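(* Let $m,n,e,X,\omega(x;z),W,\Sigma^+,\Sigma_s^+$ be as in the context, and assume $e\le1$ if $m$ is odd. Put $\langle e\rangle(z)=e(z_1+\cdots+z_n)$ and $G(z)=\prod_\alpha\frac{1+q^{\langle\alpha,z\rangle}}{1-q^{-1+\langle\alpha,z\rangle}}$, where $\alpha$ runs over $\Sigma_s^+$ if $m=2n$ and over $\Sigma^+$ if $m=2n+1$. Then for every $x\in X$ the function $q^{-\langle e\rangle(z)}G(z)\,\omega(x;z)$ is holomorphic on $\mathbb{C}^n$ and $W$-invariant; in particular it lies in $\mathbb{C}[q^{\pm z_1},\dots,q^{\pm z_n}]^W$. Moreover, for every $\sigma\in W$, the factor $\Gamma_\sigma^{(e)}(z)$ defined in the context satisfies $$\Gamma^{(e)}_\sigma(z)=\frac{q^{\langle e\rangle(z)}}{G(z)}\cdot\frac{G(\sigma(z))}{q^{\langle e\rangle(\sigma(z))}}.$$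
   Context: Let $k$ be a finite extension of $\mathbb{Q}_p$ with ring of integers $\mathcal{O}_k$, prime element $\pi$, residue field of cardinality $q$, valuation $v_\pi$ and absolute value $|\cdot|$ with $|\pi|=q^{-1}$; put $e=v_\pi(2)$. Let $k'$ be the unramified quadratic extension with ring of integers $\mathcal{O}_{k'}$ and $a^*$ the conjugate transpose of a matrix over $k'$. Let $m\ge2$, $n=\lfloor m/2\rfloor$, $j_m$ the $m\times m$ anti-diagonal matrix with entries $1$, $G=\{g\in GL_m(k'):g^*j_mg=j_m\}$, $X=\{x\in G:x^*=x,\ \det(t1_m-xj_m)=\det(t1_m-j_m)\}$ with action $g\cdot x=gxg^*$, $K=G\cap M_m(\mathcal{O}_{k'})$ with Haar measure $dk$ of mass $1$. For $y\in X$ let $d_i(y)$ ($1\le i\le n$) be the determinant of the lower right $i\times i$ block. For $x\in X$, $s\in\mathbb{C}^n$, $\omega(x;s)=\int_K\prod_i|d_i(k\cdot x)|^{s_i}dk$ (integrand $0$ if some $d_i(k\cdot x)=0$), continued to a rational function of the $q^{s_i}$; $\omega(x;z):=\omega(x;s)$ where $s_i=-z_i+z_{i+1}-1+\frac{\pi\sqrt{-1}}{\log q}$ ($1\le i<n$), $s_n=-z_n-\frac12$ ($m=2n$) or $s_n=-z_n-1+\frac{\pi\sqrt{-1}}{2\log q}$ ($m=2n+1$), with $\pi=3.14\ldots$ in exponents. $W$ is the group of signed permutations acting on $\mathbb{C}^n$ and $\mathbb{Z}^n$, generated by coordinate permutations and $\tau(z)=(z_1,\dots,z_{n-1},-z_n)$;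 $\langle\alpha,z\rangle=\sum_i\alpha_iz_i$. $\Sigma_s^+=\{e_i\pm e_j:1\le i<j\le n\}$, $\Sigma_\ell^+=\{2e_i\}$, $\Sigma^+=\Sigma_s^+\cup\Sigma_\ell^+$ ($e_i$ unit vectors). For $\sigma\in W$, $\Gamma^{(e)}_\sigma(z)=\prod_{\alpha\in\Sigma^+,\,-\sigma(\alpha)\in\Sigma^+}\gamma^{(e)}_\alpha(z)$, where $\gamma_\alpha^{(e)}(z)=\frac{1-q^{-1+\langle\alpha,z\rangle}}{q^{\langle\alpha,z\rangle}-q^{-1}}$ for $\alpha\in\Sigma_s^+$, $\gamma_\alpha^{(e)}(z)=q^{e\langle\alpha,z\rangle}$ for $\alpha\in\Sigma_\ell^+$ when $m=2n$, and $\gamma_\alpha^{(e)}(z)=\frac{q^{e\langle\alpha,z\rangle}(1-q^{-1+\langle\alpha,z\rangle})}{q^{\langle\alpha,z\rangle}-q^{-1}}$ for $\alpha\in\Sigma_\ell^+$ when $m=2n+1$. *)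

(* Defs.v *)
From HB Require Import structures.
From mathcomp Require Import all_boot all_order all_algebra all_fingroup all_field.
From mathcomp Require Import complex.
From mathcomp Require Import all_classical all_reals all_analysis.

Set Implicit Arguments.
Unset Strict Implicit.
Unset Printing Implicit Defensive.

Import Order.TTheory GRing.Theory Num.Theory.
Import numFieldNormedType.Exports.

Local Open Scope classical_set_scope.
Local Open Scope ring_scope.

(* A valuation is a map [v : F -> int] whose value at 0 is irrelevant
   ([v 0] plays the role of +oo); [vge v N] is the fractional ideal of the
   elements of valuation at least [N].  In particular [vge v 0] is the
   valuation ring and [vge v 1] its maximal ideal. *)
Definition vge (F : fieldType) (v : F -> int) (N : int) : pred F :=
  [pred x | (x == 0) || (N <= v x)].

Definition discrete_valuation (F : fieldType) (v : F -> int) : Prop :=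
  [/\ forall x y, x != 0 -> y != 0 -> v (x * y) = v x + v y,
      forall x y, x != 0 -> y != 0 -> x + y != 0 ->
        Num.min (v x) (v y) <= v (x + y)
    & exists x, x != 0 /\ v x = 1].

Definition valuation_complete (F : fieldType) (v : F -> int) : Prop :=
  forall u : nat -> F,
    (forall N : int, exists n0 : nat, forall i j : nat,
       (n0 <= i)%N -> (n0 <= j)%N -> u i - u j \in vge v N) ->
    exists l : F, forall N : int, exists n0 : nat, forall i : nat,
      (n0 <= i)%N -> u i - l \in vge v N.

(* [(F, v)] is the field Q_p: the completion of the field of rational numbers
   for the p-adic valuation. *)
Definition is_Qp (p : nat) (F : fieldType) (v : F -> int) : Prop :=
  [/\ prime p,
      discrete_valuation v,
      forall n : nat, (0 < n)%N ->
        n%:R != 0 :> F /\ v n%:R = (logn p n)%:Z,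
      forall (x : F) (N : int), exists r : rat, x - ratr r \in vge v N
    & valuation_complete v].

(* [vL] is the normalized (surjective) valuation of [L], and it lies over [vF]
   with ramification index [r]. *)
Definition valuation_over (F : fieldType) (vF : F -> int)
    (L : fieldExtType F) (vL : L -> int) (r : nat) : Prop :=
  [/\ discrete_valuation vL, (0 < r)%N
    & forall a : F, a != 0 -> vL a%:A = r%:Z * vF a].

Definition residue_card (F : fieldType) (v : F -> int) (q : nat) : Prop :=
  exists rep : 'I_q -> F,
    (forall i, rep i \in vge v 0) /\
    (forall x, x \in vge v 0 -> exists! i, x - rep i \in vge v 1).

(* Residue fields being finite, the residue extension is automatically
   separable, so unramified means that the ramification index is 1. *)
Definition unramified_quadratic (F : fieldType) (vF : F -> int)
    (L : fieldExtType F) (vL : L -> int) : Prop :=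
  \dim {: L} = 2%N /\ valuation_over vF vL 1.

(* Measurable types have to be pointed, which is not inferred for matrices over an
   abstract field. *)
Definition pointed_mx (F : fieldType) (m : nat) : Type := 'M[F]_m.
HB.instance Definition _ (F : fieldType) (m : nat) :=
  Choice.on (pointed_mx F m).
HB.instance Definition _ (F : fieldType) (m : nat) :=
  isPointed.Build (pointed_mx F m) (0 : 'M[F]_m).

Section Unitary.
Variables (k : fieldType) (k' : fieldExtType k) (conj : {lrmorphism k' -> k'}).
Variable v' : k' -> int.

Definition conj_tr (m n : nat) (a : 'M[k']_(m, n)) : 'M[k']_(n, m) :=
  (map_mx conj a)^T.

Definition antidiag (m : nat) : 'M[k']_m := \matrix_(i, j) (j == rev_ord i)%:R.

Definition unitary_group (m : nat) : set 'M[k']_m :=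
  [set g | g \in unitmx /\ conj_tr g *m antidiag m *m g = antidiag m].

Definition unitary_hermitian (m : nat) : set 'M[k']_m :=
  [set x | [/\ unitary_group x, conj_tr x = x
             & char_poly (x *m antidiag m) = char_poly (antidiag m)]].

Definition act (m : nat) (g x : 'M[k']_m) : 'M[k']_m := g *m x *m conj_tr g.

Definition unitary_integral (m : nat) : set 'M[k']_m :=
  [set g | unitary_group g /\ forall i j, g i j \in vge v' 0].

Definition adic_open (m : nat) : set (set (pointed_mx k' m)) :=
  [set U : set 'M[k']_m | forall a : 'M[k']_m, U a -> exists N : int,
     forall b : 'M[k']_m, (forall i j, b i j - a i j \in vge v' N) -> U b].

Definition borel_mx (m : nat) : measurableType (@adic_open m).-sigma :=
  @g_sigma_algebraType (pointed_mx k' m) (@adic_open m).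

(* The normalized Haar measure on K, seen as a Borel probability measure on
   M_m(k') carried by K. *)
Definition is_haar (R : realType) (m : nat) (mu : probability (borel_mx m) R)
    : Prop :=
  mu (@unitary_integral m) = 1%E /\
  forall (g : 'M[k']_m) (A : set 'M[k']_m),
    unitary_integral g -> measurable (A : set (borel_mx m)) -> A `<=` @unitary_integral m ->
    mu (mulmx g @` A) = mu A.

Fact low_ord_subproof (m : nat) (i : 'I_m./2) (a : 'I_i.+1) :
  (m - i.+1 + a < m)%N.
Proof.
have le_im : (i.+1 <= m)%N.
  by apply: leq_trans (ltn_ord i) _; rewrite -divn2 leq_div.
by rewrite -[X in (_ < X)%N](subnK le_im) ltn_add2l.
Qed.

Definition low_ord (m : nat) (i : 'I_m./2) (a : 'I_i.+1) : 'I_m :=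
  Ordinal (low_ord_subproof a).

(* Determinant of the lower right block of size [i.+1]: indices start at 0. *)
Definition dlow (m : nat) (i : 'I_m./2) (y : 'M[k']_m) : k' :=
  \det (mxsub (@low_ord m i) (@low_ord m i) y).

End Unitary.

Arguments antidiag {k k'} m.
Arguments unitary_hermitian {k k'} conj m.
Arguments unitary_integral {k k'} conj v' m.
Arguments borel_mx {k k'} v' m.

Section Exponentials.
Variable R : realType.
Local Notation C := R[i].
Variable q : nat.

(* q ^ z = exp (z log q) *)
Definition qpow (z : C) : C :=
  let r := expR (complex.Re z * ln q%:R) in
  let t := complex.Im z * ln q%:R in
  Complex (r * cos t) (r * sin t).

Definition pairing (n : nat) (alpha : 'rV[int]_n) (z : 'rV[C]_n) : C :=
  \sum_i (alpha 0 i)%:~R * z 0 i.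

(* f belongs to C[q^(+-z_1), ..., q^(+-z_n)] *)
Definition laurent (n : nat) (f : 'rV[C]_n -> C) : Prop :=
  exists s : seq (C * 'rV[int]_n),
    forall z, f z = \sum_(t <- s) t.1 * qpow (pairing t.2 z).

Definition holomorphic (n : nat) (f : 'rV[C]_n -> C) : Prop :=
  forall z, differentiable (f : 'rV[C]_n -> C^o) z.

End Exponentials.

Definition signed_perm (n : nat) : Type := ('S_n * {ffun 'I_n -> bool})%type.

Definition wact (A : pzRingType) (n : nat) (sigma : signed_perm n)
    (z : 'rV[A]_n) : 'rV[A]_n :=
  \row_i ((-1) ^+ sigma.2 i * z 0 (sigma.1 i)).

Definition short_roots (n : nat) : seq 'rV[int]_n :=
  flatten [seq [:: delta_mx 0 ij.1 + delta_mx 0 ij.2;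
                   delta_mx 0 ij.1 - delta_mx 0 ij.2]
          | ij : 'I_n * 'I_n <- enum {: 'I_n * 'I_n} & (ij.1 < ij.2)%N].

Definition long_roots (n : nat) : seq 'rV[int]_n :=
  [seq delta_mx 0 i *+ 2 | i <- enum 'I_n].

Definition pos_roots (n : nat) : seq 'rV[int]_n :=
  short_roots n ++ long_roots n.

Section Factors.
Variable R : realType.
Local Notation C := R[i].
Variables (q : nat) (e : int) (m : nat).
Local Notation n := m./2.
Local Notation "q^ z" := (qpow q z) (at level 2, z at level 2).

Definition G_roots : seq 'rV[int]_n :=
  if odd m then pos_roots n else short_roots n.

Definition Gnum (alpha : 'rV[int]_n) (z : 'rV[C]_n) : C :=
  1 + q^(pairing alpha z).

Definition Gden (alpha : 'rV[int]_n) (z : 'rV[C]_n) : C :=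
  1 - q^(- 1 + pairing alpha z).

Definition Gfun (z : 'rV[C]_n) : C :=
  \prod_(alpha <- G_roots) (Gnum alpha z / Gden alpha z).

Definition ebracket (z : 'rV[C]_n) : C := e%:~R * \sum_i z 0 i.

Definition gamma_den (alpha : 'rV[int]_n) (z : 'rV[C]_n) : C :=
  q^(pairing alpha z) - q%:R^-1.

Definition gamma (alpha : 'rV[int]_n) (z : 'rV[C]_n) : C :=
  let short := (1 - q^(- 1 + pairing alpha z)) / gamma_den alpha z in
  if alpha \in short_roots n then short
  else if odd m then q^(e%:~R * pairing alpha z) * short
  else q^(e%:~R * pairing alpha z).

Definition Gamma (sigma : signed_perm n) (z : 'rV[C]_n) : C :=
  \prod_(alpha <- pos_roots n | - wact sigma alpha \in pos_roots n)
    gamma alpha z.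

Definition svar (z : 'rV[C]_n) : 'rV[C]_n :=
  \row_i
    if (i.+1 < n)%N then
      - z 0 i + z 0 (ordS i) - 1 + Complex 0 (pi / ln q%:R)
    else if odd m then - z 0 i - 1 + Complex 0 (pi / (2 * ln q%:R))
    else - z 0 i - 2^-1.

End Factors.

Section Omega.
Variables (k : fieldType) (k' : fieldExtType k) (conj : {lrmorphism k' -> k'}).
Variables (v' : k' -> int) (R : realType) (q m : nat).
Variable mu : probability (borel_mx v' m) R.
Local Notation C := R[i].
Local Notation n := m./2.

(* For hermitian [y], [dlow i y] lies in k, where the valuation [v'] of the
   unramified extension k' restricts to that of k; hence
   |d_i(y)| = q ^ (- v' (d_i(y))). *)
Definition omega_integrand (x : 'M[k']_m) (s : 'rV[C]_n) (h : 'M[k']_m) : C :=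
  let y := act conj h x in
  if [forall i : 'I_n, dlow i y != 0] then
    \prod_i qpow q (- (v' (dlow i y))%:~R * s 0 i)
  else 0.

(* The integral over K, real and imaginary parts being integrated
   separately. *)
Definition omega_integral (x : 'M[k']_m) (s : 'rV[C]_n) : C :=
  let K := unitary_integral conj v' m in
  Complex (\int[mu]_(h in K) complex.Re (omega_integrand x s h))
          (\int[mu]_(h in K) complex.Im (omega_integrand x s h)).

(* The rational function [A / B] of the q^(s_i) is the continuation of
   omega(x; s), the integral being absolutely convergent for Re s_i >= 0. *)
Definition omega_continuation (x : 'M[k']_m) (A B : 'rV[C]_n -> C) : Prop :=
  [/\ laurent q A, laurent q B, exists s, B s != 0
    & forall s : 'rV[C]_n, (forall i, 0 <= complex.Re (s 0 i)) -> B s != 0 ->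
        omega_integral x s = A s / B s].

End Omega.

(* Main.v *)
(** Let phi(y), for y in Z^n, be the suitably normalized Haar mass of the set of h in K
    for which the valuations of the d_i(h.x) are the partial sums of y: up to a monomial,
    omega(x; z) is the generating series of phi.  Averaging over translates by the Levi
    subgroup attached to a simple root gives a rank one functional equation, which reads
    (1 - T_a / q) psi = (1 + T_a) phi with psi fixed by the reflection in a, where T_a is
    the translation by a (for a long root and even m, phi itself is fixed).  Hence the
    solution f of the equation prod_a (1 - T_a / q) f = prod_a (1 + T_a) phi, a running
    over the roots of G, is W-invariant.  As phi vanishes outside a cone, so does f, and
    invariance makes its support finite: the Laurent polynomial with coefficients f is
    q^(-<e>) G omega.  The identity with the continuation A / B only has to be tested
    at positive integers s_i. *)

Require Import Defs.
From HB Require Import structures.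
From mathcomp Require Import all_boot all_order all_algebra all_fingroup all_field.
From mathcomp Require Import complex.
From mathcomp Require Import all_classical all_reals all_analysis.
From mathcomp Require Import measurable_realfun zify ring lra.

Set Implicit Arguments.
Unset Strict Implicit.
Unset Printing Implicit Defensive.

Import Order.TTheory GRing.Theory Num.Theory.
Import numFieldNormedType.Exports.

Local Open Scope classical_set_scope.
Local Open Scope ring_scope.

Local Close Scope classical_set_scope.

(** The rank one step needs an exact mass distribution, also when 2 is not a unit. The Schur
    complement T attached to a simple root is therefore split by content: in the stratum of content
    b let M_j be the mass where the last diagonal entry of T has valuation at least b + j, or b + 2j
    for the last root. Counting which of finitely many unipotent translates raise that valuation
    gives two-term recurrences for the M_j. For short roots and for odd m they have one common
    shape, with a parameter Q equal to 1 or q, and make the weighted differences of the M_j,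
    multiplied by (1 + t) / (1 - t / q), a palindromic polynomial. For a short root T is a binary
    hermitian form of prescribed discriminant. For the last root the hypotheses on x force T J to be
    an involution whose eigenvalue -1 has multiplicity one; the form to be split is then J - T, of
    rank one, and tr((J - T) J) = 2 bounds its content by e and puts the centre of symmetry at e,
    whence the factor q^(-<e>). Integral elements are written in a basis theta, 1 with theta + conj
    theta = 1, which exists in every residue characteristic. *)

(** * One-variable recurrences and their palindromic transform *)

Section OneDim.
Variables (F : fieldType) (q Q : F) (M : nat -> F) (l : nat).
Hypotheses (q0 : q != 0) (Q0 : Q != 0) (qQ0 : q ^+ 2 * Q + 1 != 0).
Hypothesis M_zero : (q ^+ 2 * Q + 1) * M 1 = (if l == 0%N then q + 1 else 1) * M 0.
Hypothesis M_even : forall i, (0 < i)%N -> (i + i <= l)%N ->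
  q ^+ 2 * Q * M (i + i).+1 = (if (i + i == l)%N then q + 1 else 1) * M (i + i)%N.
Hypothesis M_odd : forall i, ((i + i).+1 < l)%N -> Q * M (i + i).+2 = M (i + i).+1.
Hypothesis M_end : odd l -> forall j, (l < j)%N -> M j = 0.
Hypothesis M_tail : ~~ odd l -> forall j, (l < j)%N -> q * Q * M j.+1 = M j.

(** [M j] will be the mass of the forms of content b whose last diagonal entry has valuation at
    least [b + s * j], so [jump j] is the mass at exact level j with its spectral weight. [Q] is 1
    for short roots and q for the long root in odd size; [l] is the valuation of the discriminant
    minus 2b, respectively v(2) - b. *)
Definition jump (j : nat) := (- (q * Q)) ^+ j * (M j - M j.+1).
Let u j := (- (q * Q)) ^+ j * M j.
(** For [l > 0], the renormalized masses [u j] with 0 < j <= l equal [K] at even indices and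
    [- K / q] at odd ones (see [uE]). For [l = 0] there are no such indices and the first jump
    serves instead. *)
Let K := if l == 0%N then jump 0 else - q * u 1%N.

(** Closed form of the series (1 + t) jump(t) / (1 - t / q): a polynomial of degree [l], with the
    coefficient [K] at both ends and one constant in between, which makes the symmetry j -> l - j
    visible. *)
Definition jump_sum j :=
  if (j == 0%N) || (j == l) then K else if (j < l)%N then K * (1 + (q * Q)^-1) else 0.

Let jumpE j : jump j = u j + u j.+1 / (q * Q).
Proof. by rewrite /jump /u exprS; field; rewrite q0 Q0. Qed.

Let even_step i : (0 < i)%N -> (i + i <= l)%N ->
  u (i + i).+1 = - (if (i + i == l)%N then q + 1 else 1) / q * u (i + i)%N.
Proof.
move=> i0 il; rewrite /u; have -> : M (i + i).+1 = (if (i + i == l)%N then q + 1 else 1) * M (i + i)%N / (q ^+ 2 * Q).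
  by rewrite -M_even //; field; rewrite q0 Q0.
by rewrite exprS; field; rewrite q0 Q0.
Qed.

Let odd_step i : ((i + i).+1 < l)%N -> u (i + i).+2 = - q * u (i + i).+1.
Proof. by move=> il; rewrite /u -M_odd // [in LHS]exprS; ring. Qed.

Let tail_step j : ~~ odd l -> (l < j)%N -> u j.+1 = - u j.
Proof. by move=> ol lj; rewrite /u -(M_tail ol lj) exprS; ring. Qed.

Let uE i : ((i + i < l)%N -> u (i + i).+1 = - K / q) /\ ((i + i).+1 < l -> u (i + i).+2 = K)%N.
Proof.
have base : (0 < l)%N -> u 1%N = - K / q.
  by move=> l0; rewrite /K gtn_eqF //; field.
elim: i => [|i [IH1 IH2]].
  by split=> h; [exact: base | rewrite odd_step // base; [field | exact: ltnW]].
have h1 : (i.+1 + i.+1 < l)%N -> u (i.+1 + i.+1).+1 = - K / q.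
  move=> h; rewrite even_step //; last exact: ltnW.
  rewrite ltn_eqF // (_ : (i.+1 + i.+1 = (i + i).+2)%N); last by clear; lia.
  by rewrite IH2; [field | move: h; clear; lia].
split=> // h; rewrite odd_step // h1; [field => // | exact: ltnW].
Qed.

Let jump0 : jump 0 = K.
Proof.
rewrite /K; case: eqP => // /eqP; rewrite -lt0n => l0.
have := M_zero; rewrite gtn_eqF // mul1r => e; rewrite /jump -e /u expr0 expr1; ring.
Qed.

Let jump_odd i : ((i + i).+1 < l)%N -> jump (i + i).+1 = - K / q + K / (q * Q).
Proof. by move=> h; have [h1 h2] := uE i; rewrite jumpE h1 ?h2 // ltnW. Qed.

Let jump_even i : (0 < i)%N -> (i + i < l)%N -> jump (i + i) = K - K / (q ^+ 2 * Q).
Proof.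
case: i => // i _ h; have [h1 _] := uE i.+1; have [_ h2] := uE i.
rewrite jumpE h1 //; have -> : (i.+1 + i.+1 = (i + i).+2)%N by clear; lia.
by rewrite h2; [field; rewrite q0 Q0 | move: h; clear; lia].
Qed.

Let jump_end i : l = (i + i).+1 -> jump l = - K / q.
Proof.
move=> e; have [h1 _] := uE i; rewrite jumpE {2}/u M_end ?e ?h1 ?ltnSn ?e //=; first by rewrite mulr0 mul0r addr0.
by rewrite addnn odd_double.
Qed.

Let jump_tail j : ~~ odd l -> (l < j)%N -> jump j.+1 = - jump j.
Proof.
by move=> ol lj; rewrite !jumpE (tail_step ol (leqW lj)) (tail_step ol lj); ring.
Qed.

Let jump_end_even i : (0 < i)%N -> l = (i + i)%N -> jump l = K - (q + 1) * K / (q ^+ 2 * Q).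
Proof.
case: i => // i _ e; have [_ h2] := uE i; rewrite jumpE.
have hl : u l = K by rewrite [l in u l]e (_ : (i.+1 + i.+1 = (i + i).+2)%N) ?h2 //; rewrite ?e; clear; lia.
have hl1 : u l.+1 = - (q + 1) / q * K by rewrite -hl e even_step ?e // eqxx.
by rewrite hl hl1; field; rewrite q0 Q0.
Qed.

Let jump_lt j : (0 < j)%N -> (j < l)%N ->
  jump j = if odd j then - K / q + K / (q * Q) else K - K / (q ^+ 2 * Q).
Proof.
move=> j0 jl; case: ifP => oj.
  have e : j = (j./2 + j./2).+1 by move: oj; clear; lia.
  by rewrite e jump_odd // -e.
have e : j = (j./2 + j./2)%N by move: oj; clear; lia.
by rewrite e jump_even -?e //; move: e j0; clear; lia.
Qed.

Let jump_l : (0 < l)%N -> jump l = if odd l then - K / q else K - (q + 1) * K / (q ^+ 2 * Q).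
Proof.
move=> l0; case: ifP => ol.
  by apply: (@jump_end l./2); move: ol; clear; lia.
by apply: (@jump_end_even l./2); move: ol l0; clear; lia.
Qed.

Let jump_last i : (0 < i)%N -> l = (i + i)%N -> jump l.+1 + jump l = - K / q.
Proof.
case: i => // i _ e; have ol : ~~ odd l by rewrite e addnn odd_double.
have [_ h2] := uE i; rewrite !jumpE (@tail_step l.+1) //.
have hl : u l = K by rewrite [l in u l]e (_ : (i.+1 + i.+1 = (i + i).+2)%N) ?h2 //; rewrite ?e; clear; lia.
have hl1 : u l.+1 = - (q + 1) / q * K by rewrite -hl e even_step ?e // eqxx.
by rewrite hl hl1; field; rewrite q0 Q0.
Qed.

Let jump_last0 : l = 0%N -> jump 1 + jump 0 = - K / q.
Proof.
move=> l0; have h := tail_step (j := 1); rewrite l0 /= in h.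
have := M_zero; rewrite -jump0 !jumpE h // l0 /= => z.
have -> : u 1 = - (q + 1) / q * (q ^+ 2 * Q / (q ^+ 2 * Q + 1)) * u 0%N.
  rewrite /u expr0 expr1 mul1r; apply: (mulfI qQ0).
  have -> : (q ^+ 2 * Q + 1) * (- (q * Q) * M 1) = - (q * Q) * ((q + 1) * M 0) by rewrite -z; ring.
  by field; rewrite q0 qQ0.
by field; rewrite q0 Q0 qQ0.
Qed.

Lemma jump_sum0 : jump_sum 0 = jump 0.
Proof. by rewrite /jump_sum eqxx jump0. Qed.

(** Three regimes meet here. Below [l] the jumps alternate between two constants; at [l] the
    boundary factor q + 1 enters when [l] is even; beyond [l] consecutive jumps cancel for even [l]
    and vanish for odd [l]. *)
Lemma jump_sumS j : jump_sum j.+1 - jump_sum j / q = jump j.+1 + jump j.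
Proof.
have [jl|jl|jl] := ltngtP j l; last 1 first.
- subst j; rewrite /jump_sum eqxx orbT ltnNge leqnSn /= gtn_eqF // sub0r -mulNr.
  have [ol|el] := boolP (odd l).
    have el : l = (l./2 + l./2).+1 by move: ol; clear; lia.
    by rewrite (jump_end el) /jump !M_end // subrr mulr0 add0r.
  have el' : l = (l./2 + l./2)%N by move: el; clear; lia.
  by have [h|h] := posnP l; [rewrite h jump_last0 | rewrite (jump_last _ el') //; move: h el; clear; lia].
- rewrite {2}/jump_sum; have [j0|j0] := posnP j.
    subst j; rewrite /= /jump_sum jump0 /=; have [l1|l1] := eqVneq l 1%N.
      by rewrite -[in jump _]l1 jump_l // l1 /=; ring.
    have l2 : (1 < l)%N by move: l1 jl; clear; lia.
    by rewrite l2 jump_lt //=; field; rewrite q0 Q0.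
  rewrite ?(gtn_eqF j0) ?(ltn_eqF jl) jl /jump_sum /= (jump_lt j0 jl).
  have [jl'|jl'] := eqVneq j.+1 l.
    rewrite jl' jump_l -?jl' //=; case: (odd j) => /=; field; rewrite q0 Q0 //.
  have jl2 : (j.+1 < l)%N by move: jl jl'; clear; lia.
  by rewrite jl2 (jump_lt (ltn0Sn j) jl2) /=; case: (odd j) => /=; field; rewrite q0 Q0.
rewrite /jump_sum !gtn_eqF ?ltnS ?(ltnW jl) //; last by move: jl; clear; lia.
rewrite !ltnNge (ltnW jl) (leqW (ltnW jl)) /= mul0r subrr.
have [ol|el] := boolP (odd l); last by rewrite jump_tail // addNr.
by rewrite /jump !M_end // ?ltnS ?(ltnW jl) ?leqW //; [rewrite !subrr !mulr0 addr0 | exact: ltnW].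
Qed.

Lemma jump_sum_sym j : (j <= l)%N -> jump_sum (l - j)%N = jump_sum j.
Proof.
move=> jl; rewrite /jump_sum.
have -> : ((l - j == 0) || (l - j == l))%N = ((j == 0) || (j == l))%N by move: jl; clear; lia.
by case: ifP => // h; have -> : (l - j < l)%N = (j < l)%N by move: jl h; clear; lia.
Qed.

Lemma jump_sum_out j : (l < j)%N -> jump_sum j = 0.
Proof. by move=> lj; rewrite /jump_sum; case: ifP => [|_]; [move: lj; clear; lia | rewrite ltnNge ltnW]. Qed.

End OneDim.

(* [psi] witnesses that [(1 + t) g / (1 - t / q)], [t] being the shift by [s], is symmetric
   under [V -> d - V]. *)
Definition balanced (F : fieldType) (q : F) (s : nat) (d : int) (g : int -> F) :=
  exists psi : int -> F, [/\ forall V, psi V - psi (V - s%:Z) / q = g V + g (V - s%:Z),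
    forall V, psi (d - V) = psi V & exists N, forall V, V < N -> psi V = 0].

Lemma balanced_sum (F : fieldType) (q : F) s d (L : nat) (g : 'I_L -> int -> F) :
  (forall i, balanced q s d (g i)) -> balanced q s d (fun V => \sum_i g i V).
Proof.
elim: L g => [|L IH] g hg.
  exists (fun _ => 0); split=> // [V|]; first by rewrite !big_ord0 mul0r subrr addr0.
  by exists 0.
have [psi1 [h1 h2 [N1 h3]]] := IH _ (fun i => hg (widen_ord (leqnSn L) i)).
have [psi2 [h4 h5 [N2 h6]]] := hg ord_max.
exists (fun V => psi1 V + psi2 V); split=> [V|V|].
- by rewrite !big_ord_recr /= addrACA -h1 -h4; ring.
- by rewrite h2 h5.
exists (Num.min N1 N2) => V; rewrite lt_min => /andP[v1 v2].
by rewrite h3 // h6 // addr0.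
Qed.

Lemma level_choice (b : int) (s : nat) (V : int) : (0 < s)%N ->
  (exists j : nat, V = b + (s * j)%N%:Z) \/ (forall j : nat, V != b + (s * j)%N%:Z).
Proof.
move=> s0; have [h|h] := boolP ((V - b >= 0) && (s %| `|V - b|)%N).
  case/andP: h => h /dvdnP[j e]; left; exists j; lia.
right=> j; apply: contra h => /eqP ->; rewrite addrC addKr /=.
exact: dvdn_mulr.
Qed.

Lemma level_fun (F : fieldType) (b : int) (s : nat) (f : nat -> F) : (0 < s)%N ->
  exists psi : int -> F, (forall j : nat, psi (b + (s * j)%N%:Z) = f j) /\
   (forall V, (forall j : nat, V != b + (s * j)%N%:Z) -> psi V = 0).
Proof.
move=> s0; exists (fun V => if (V - b >= 0) && (s %| `|V - b|)%N then f (`|V - b| %/ s)%N else 0).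
split=> [j|V hV]; first by rewrite addrC addKr absz_nat /= dvdn_mulr // mulKn.
case: ifP => // /andP[h /dvdnP[j e]]; have := hV j; lia.
Qed.

(** Carries the one-variable computation over to functions on Z supported on the progression b, b +
    s, b + 2s, ...; the reflection j -> l - j becomes V -> 2b + s l - V. *)
Lemma balanced_level (F : fieldType) (q Q C : F) (M : nat -> F) (l : nat) (b : int) (s : nat)
    (g : int -> F) :
  (0 < s)%N -> q != 0 -> Q != 0 -> q ^+ 2 * Q + 1 != 0 ->
  (q ^+ 2 * Q + 1) * M 1 = (if l == 0%N then q + 1 else 1) * M 0 ->
  (forall i, (0 < i)%N -> (i + i <= l)%N ->
    q ^+ 2 * Q * M (i + i).+1 = (if (i + i == l)%N then q + 1 else 1) * M (i + i)%N) ->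
  (forall i, ((i + i).+1 < l)%N -> Q * M (i + i).+2 = M (i + i).+1) ->
  (odd l -> forall j, (l < j)%N -> M j = 0) ->
  (~~ odd l -> forall j, (l < j)%N -> q * Q * M j.+1 = M j) ->
  (forall j : nat, g (b + (s * j)%N%:Z) = C * jump q Q M j) ->
  (forall V, (forall j : nat, V != b + (s * j)%N%:Z) -> g V = 0) ->
  balanced q s (b + b + (s * l)%N%:Z) g.
Proof.
move=> s0 q0 Q0 qQ0 m0 m1 m2 m3 m4 hg hg0.
have [psi [h1 h2]] := level_fun b (fun j => C * jump_sum q Q M l j) s0.
have up (j : nat) : b + (s * j.+1)%N%:Z - s%:Z = b + (s * j)%N%:Z by rewrite mulnS; lia.
have low : forall j : nat, b - s%:Z != b + (s * j)%N%:Z by move=> j; lia.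
exists psi; split.
- move=> V; case: (level_choice b V s0) => [[j ->]|hV].
    case: j => [|j].
      rewrite muln0 addr0 (h2 (b - s%:Z)) // (hg0 (b - s%:Z)) // mul0r subr0 addr0.
      have := h1 0%N; have := hg 0%N; rewrite muln0 addr0 => -> ->.
      by rewrite jump_sum0.
    by rewrite up !h1 !hg -mulrA -mulrBr -mulrDr jump_sumS.
  have hV' : forall j : nat, V - s%:Z != b + (s * j)%N%:Z.
    by move=> j; have := hV j.+1; rewrite -up; lia.
  by rewrite !h2 // !hg0 // mul0r subrr addr0.
- have key (j : nat) : psi (b + b + (s * l)%N%:Z - (b + (s * j)%N%:Z)) = psi (b + (s * j)%N%:Z).
    rewrite h1; have [jl|lj] := leqP j l.
      have -> : b + b + (s * l)%N%:Z - (b + (s * j)%N%:Z) = b + (s * (l - j))%N%:Z.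
        by rewrite mulnBr; have : (s * j <= s * l)%N; [rewrite leq_mul2l jl orbT | lia].
      by rewrite h1 jump_sum_sym.
    rewrite jump_sum_out // mulr0 h2 // => i; apply/eqP => e.
    have : (s * l < s * j)%N by rewrite ltn_pmul2l.
    lia.
  move=> V; case: (level_choice b V s0) => [[j ->]|hV]; first exact: key.
  case: (level_choice b (b + b + (s * l)%N%:Z - V) s0) => [[j e]|hV'].
    by rewrite e -key -e; congr (psi _); lia.
  by rewrite !h2.
by exists b => V hV; apply: h2 => j; lia.
Qed.

(** * Shift operators on functions on a lattice *)

Section Shift.
Variables (A : zmodType) (F : fieldType).
Implicit Types (f g : A -> F) (s : seq A).

(** Multiplication of the formal generating series of f by 1 + c t^al, written on coefficients so
    that no convergence is involved. *)
Definition op (c : F) (al : A) f := fun x => f x + c * f (x - al).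
Definition ops c s f := foldr (op c) f s.

Lemma opC c d al be f : op c al (op d be f) =1 op d be (op c al f).
Proof. by move=> x; rewrite /op [x - be - al]addrAC; ring. Qed.

Lemma op_ext c al f g : f =1 g -> op c al f =1 op c al g.
Proof. by move=> h x; rewrite /op !h. Qed.

Lemma ops_ext c s f g : f =1 g -> ops c s f =1 ops c s g.
Proof. by move=> h; elim: s => //= al s IH; apply: op_ext. Qed.

Lemma ops_op c d s al f : ops c s (op d al f) =1 op d al (ops c s f).
Proof.
elim: s => //= be s IH x; rewrite (op_ext _ _ IH) opC //.
Qed.

Lemma ops_perm c s s' f : perm_eq s s' -> ops c s f =1 ops c s' f.
Proof.
elim: s s' => [|al s IH] s'; first by move/perm_size => /esym/size0nil ->.
move=> h; have hal : al \in s' by rewrite -(perm_mem h) mem_head.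
case/splitPr: hal h => s1 s2 h.
have {}h : perm_eq s (s1 ++ s2) by rewrite -(perm_cons al) (permPl h) perm_catC /= perm_cons perm_catC.
move=> x /=; rewrite (op_ext _ _ (IH _ h)) /ops !foldr_cat /= -/(ops c s2 f) -/(ops c s1 _) -/(ops c s1 _).
by rewrite ops_op.
Qed.

Lemma ops_morph c s f (w : {additive A -> A}) :
  ops c s (f \o w) =1 ops c (map w s) f \o w.
Proof. by elim: s => //= al s IH x; rewrite (op_ext _ _ IH) /op /= raddfB. Qed.

Lemma opsB c s f g : ops c s (fun x => f x - g x) =1 (fun x => ops c s f x - ops c s g x).
Proof. by elim: s => //= al s IH x; rewrite (op_ext _ _ IH) /op; ring. Qed.

(** The series of f is bounded below along each line of direction [al]; on such functions the factor
    1 + c t^al can be cancelled. *)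
Definition line_bounded al f := forall x, exists K : nat, forall k, (K <= k)%N -> f (x - al *+ k) = 0.

Lemma line_bounded_op c al be f : line_bounded al f -> line_bounded al (op c be f).
Proof.
move=> h x; have [K1 h1] := h x; have [K2 h2] := h (x - be).
exists (maxn K1 K2) => k; rewrite geq_max => /andP[k1 k2].
by rewrite /op h1 // addrAC h2 // mulr0 addr0.
Qed.

Lemma line_bounded_ops c al s f : line_bounded al f -> line_bounded al (ops c s f).
Proof. by move=> h; elim: s => //= be s; apply: line_bounded_op. Qed.

(** Iterating f(x) = - c f(x - al) moves down the line until f vanishes. *)
Lemma op_eq0 c al f : line_bounded al f -> op c al f =1 (fun=> 0) -> f =1 (fun=> 0).
Proof.
move=> hb h x; have [K hK] := hb x.
have e k : f x = (- c) ^+ k * f (x - al *+ k).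
  elim: k => [|k IH]; first by rewrite mulr0n subr0 mul1r.
  have := h (x - al *+ k); rewrite /op -addrA -opprD -mulrSr => /(canRL (addrK _)).
  by rewrite sub0r IH => ->; rewrite exprSr; ring.
by rewrite (e K) hK // mulr0.
Qed.

Lemma ops_eq0 c s f : (forall al, al \in s -> line_bounded al f) ->
  ops c s f =1 (fun=> 0) -> f =1 (fun=> 0).
Proof.
elim: s => //= al s IH hb h; apply: IH => [be hbe|]; first by apply: hb; rewrite inE hbe orbT.
apply: (op_eq0 _ h); apply: line_bounded_ops; apply: hb; exact: mem_head.
Qed.

Lemma op_inj c al f g : line_bounded al f -> line_bounded al g ->
  op c al f =1 op c al g -> f =1 g.
Proof.
move=> hf hg h x; apply/eqP; rewrite -subr_eq0; apply/eqP.
apply: (@op_eq0 c al (fun x => f x - g x)) => y.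
  have [K1 h1] := hf y; have [K2 h2] := hg y; exists (maxn K1 K2) => k.
  by rewrite geq_max => /andP[k1 k2]; rewrite h1 // h2 // subrr.
by have := h y; rewrite /op => e; rewrite mulrBr addrACA -opprD e subrr.
Qed.

(** Since [w] permutes [s], it commutes with [ops c s] and [ops 1 s]; thus [f \o w] and [f] solve
    the same equation, and [ops_eq0] gives uniqueness. *)
Lemma ops_invariant c s f g (w : {additive A -> A}) : perm_eq (map w s) s ->
  (forall al, al \in s -> line_bounded al f) -> g \o w =1 g ->
  ops c s f =1 ops 1 s g -> f \o w =1 f.
Proof.
move=> ws hb hg h x; apply/eqP; rewrite -subr_eq0; apply/eqP.
apply: (@ops_eq0 c s (fun x => (f \o w) x - f x)) => [al hal y|y].
  have hw : w al \in s by rewrite -(perm_mem ws) map_f.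
  have [K1 h1] := hb _ hw (w y); have [K2 h2] := hb _ hal y.
  exists (maxn K1 K2) => k; rewrite geq_max => /andP[k1 k2].
  by rewrite /= raddfB raddfMn h1 // h2 // subrr.
rewrite opsB ops_morph /= (ops_perm _ _ ws) h -(ops_perm _ _ ws).
have := ops_morph 1 s g w y; rewrite /= => <-.
by rewrite (ops_ext _ _ hg) h subrr.
Qed.

(** A simple reflection preserves the set of factors except that of its own root [al]. The rank one
    witness [psi] absorbs this factor: cancelling it leaves an equation between f and [psi] whose
    roots [rest] are permuted by [w], so that [ops_invariant] applies. *)
Lemma simple_invariant c al rest s f g psi (w : {additive A -> A}) :
  perm_eq s (al :: rest) -> perm_eq (map w rest) rest ->
  (forall be, be \in s -> line_bounded be f) -> line_bounded al psi ->
  psi \o w =1 psi -> op c al psi =1 op 1 al g ->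
  ops c s f =1 ops 1 s g -> f \o w =1 f.
Proof.
move=> ps ws hb hp hw hpsi h.
have sub be : be \in rest -> be \in s by move=> hbe; rewrite (perm_mem ps) inE hbe orbT.
apply: (ops_invariant (c := c) (g := psi) ws) => // [be hbe|]; first exact/hb/sub.
apply: (op_inj (c := c) (al := al)).
- by apply: line_bounded_ops; apply: hb; rewrite (perm_mem ps) mem_head.
- exact: line_bounded_ops.
move=> x; rewrite -[LHS]/(ops c (al :: rest) f x) -(ops_perm _ _ ps) h (ops_perm _ _ ps) /=.
by rewrite -!ops_op; apply: ops_ext => y; rewrite hpsi.
Qed.

Section Solve.
Variables (J : Type) (l : J -> {additive A -> int}) (rho : {additive A -> int}).
(** The support lies in a translate of the cone where all [l j] are nonnegative. The functional
    [rho] is bounded below there, which makes geometric series finite at each point. *)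
Definition bounded_below (N : int) f := forall x, f x != 0 -> forall j, N <= l j x.

Hypothesis rho_l : forall N, exists M, forall x, (forall j, N <= l j x) -> M <= rho x.

Lemma bounded_below_line N al f : bounded_below N f -> 0 < rho al -> line_bounded al f.
Proof.
have [M hM] := rho_l N; move=> hf al0 x; exists `|(rho x - M)|%N.+1 => k hk.
apply/eqP; apply: contraT => /hf /hM; rewrite raddfB raddfMn /=.
by move: (rho x) (rho al) al0 hk => y z; rewrite -mulr_natr natz; nia.
Qed.

(** Geometric series: f = sum over k of (- c)^k times g shifted by k [al]. *)
Lemma op_inverse N c al g : bounded_below N g -> (forall j, 0 <= l j al) -> 0 < rho al ->
  exists2 f, bounded_below N f & op c al f =1 g.
Proof.
move=> hg hl al0; have [M hM] := rho_l N.
have g0 x : rho x < M -> g x = 0.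
  by move=> hx; apply/eqP; apply: contraT => /hg /hM; rewrite leNgt hx.
(* After [K x] steps along - [al] the functional [rho] has dropped below its bound [M] on the
   support of g, so the series for [f x] may be cut there. *)
pose K x := `|(rho x - M)|%N.+1.
have gK x k : (K x <= k)%N -> g (x - al *+ k) = 0.
  move=> hk; apply: g0; rewrite raddfB raddfMn /=; move: hk; rewrite /K.
  by move: (rho x) (rho al) al0 => y z; rewrite -mulr_natr natz; nia.
pose f x := \sum_(k < K x) (- c) ^+ k * g (x - al *+ k).
have fE x L : (K x <= L)%N -> f x = \sum_(k < L) (- c) ^+ k * g (x - al *+ k).
  move=> hL; rewrite /f -(subnKC hL) big_split_ord /= [X in _ + X]big1 ?addr0 // => i _.
  by rewrite gK ?mulr0 // leq_addr.
exists f => [x|x].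
  move=> fx j; rewrite leNgt; apply: contra fx => lx; rewrite /f big1 // => k _.
  suff -> : g (x - al *+ k) = 0 by rewrite mulr0.
  apply/eqP; apply: contraT => /hg /(_ j); rewrite raddfB raddfMn /= leNgt; case/negP.
  apply: le_lt_trans lx; rewrite lerBlDr lerDl; exact: mulrn_wge0.
pose L := maxn (K x) (K (x - al)).
rewrite /op (fE x L.+1) ?(fE (x - al) L) ?leq_maxr // ?leqW ?leq_maxl //.
rewrite big_ord_recl mulr0n subr0 expr0 mul1r -addrA mulr_sumr -big_split big1 /= ?addr0 // => i _.
by rewrite mulrS opprD addrA exprS; ring.
Qed.

Lemma ops_inverse N c s g : bounded_below N g ->
  (forall al, al \in s -> (forall j, 0 <= l j al) /\ 0 < rho al) ->
  exists2 f, bounded_below N f & ops c s f =1 g.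
Proof.
elim: s g => [|al s IH] g hg hs; first by exists g.
have [h1 h2] := hs al (mem_head _ _).
have [f1 b1 e1] := op_inverse c hg h1 h2.
have [|f b e] := IH f1 b1; first by move=> be hbe; apply: hs; rewrite inE hbe orbT.
by exists f => // x; rewrite /= (op_ext _ _ e).
Qed.

Lemma bounded_below_ops N c s g : bounded_below N g ->
  (forall al, al \in s -> forall j, 0 <= l j al) -> bounded_below N (ops c s g).
Proof.
move=> hg; elim: s => //= al s IH hs x; rewrite /op.
have {}IH : bounded_below N (ops c s g).
  by apply: IH => be hbe; apply: hs; rewrite inE hbe orbT.
have [->|] := eqVneq (ops c s g x) 0; last by move/IH.
rewrite add0r mulf_eq0 negb_or => /andP[_ /IH h] j; apply: le_trans (h j) _.
by rewrite raddfB /= lerBlDr lerDl hs // mem_head.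
Qed.

End Solve.
End Shift.

(** * Calculus of fractional ideals *)

Section Valuation.
Variables (F : fieldType) (v : F -> int).
Hypothesis dv : discrete_valuation v.
Local Notation P := (vge v).

Lemma vgeE N (x : F) : (x \in P N) = (x == 0) || (N <= v x).
Proof. by []. Qed.

Lemma vge0 N : 0 \in P N.
Proof. by rewrite vgeE eqxx. Qed.

Lemma vgeNz N (x : F) : x != 0 -> (x \in P N) = (N <= v x).
Proof. by rewrite vgeE => /negPf ->. Qed.

Lemma valM (x y : F) : x != 0 -> y != 0 -> v (x * y) = v x + v y.
Proof. by case: dv => + _ _; apply. Qed.

Lemma val1 : v 1 = 0.
Proof.
have e : v (1 * 1) = v 1 + v 1 := valM (oner_neq0 F) (oner_neq0 F).
by rewrite mulr1 in e; lia.
Qed.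

Lemma valN x : v (- x) = v x.
Proof.
have [->|x0] := eqVneq x 0; first by rewrite oppr0.
have nz : (-1 : F) != 0 by rewrite oppr_eq0 oner_eq0.
have e : v (-1) = 0.
  have e : v (-1 * -1) = v (-1) + v (-1) := valM nz nz.
  by rewrite mulrNN mulr1 val1 in e; lia.
by rewrite -mulN1r valM // e add0r.
Qed.

Lemma valV (x : F) : x != 0 -> v x^-1 = - v x.
Proof.
move=> x0; have := valM x0 (invr_neq0 x0); rewrite divff // val1 => e.
by apply/eqP; rewrite -addr_eq0 addrC -e.
Qed.

Lemma valX (x : F) n : x != 0 -> v (x ^+ n) = n%:Z * v x.
Proof.
move=> x0; elim: n => [|n IH]; first by rewrite expr0 val1 mul0r.
by rewrite exprS valM ?expf_neq0 // IH; lia.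
Qed.

Lemma vge1 : 1 \in P 0.
Proof. by rewrite vgeNz ?oner_eq0 // val1. Qed.

Lemma vgeD N x y : x \in P N -> y \in P N -> x + y \in P N.
Proof.
have [->|x0] := eqVneq x 0; first by rewrite add0r.
have [->|y0] := eqVneq y 0; first by rewrite addr0.
have [-> _ _|s0] := eqVneq (x + y) 0; first exact: vge0.
rewrite !vgeNz // => hx hy; case: dv => _ /(_ _ _ x0 y0 s0) h _.
by apply: le_trans h; rewrite le_min hx.
Qed.

Lemma vgeN N x : (- x \in P N) = (x \in P N).
Proof. by rewrite !vgeE oppr_eq0 valN. Qed.

Lemma vgeB N x y : x \in P N -> y \in P N -> x - y \in P N.
Proof. by move=> hx hy; apply: vgeD; rewrite ?vgeN. Qed.

Lemma vgeDr N x y : y \in P N -> (x + y \in P N) = (x \in P N).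
Proof.
move=> hy; apply/idP/idP => [h|h]; last exact: vgeD.
by rewrite -(addrK y x); apply: vgeB.
Qed.

Lemma vgeDl N x y : x \in P N -> (x + y \in P N) = (y \in P N).
Proof. by rewrite addrC; apply: vgeDr. Qed.

Lemma vgeBr N x y : y \in P N -> (x - y \in P N) = (x \in P N).
Proof. by move=> hy; rewrite vgeDr // vgeN. Qed.

Lemma vgeM N M x y : x \in P N -> y \in P M -> x * y \in P (N + M).
Proof.
have [->|x0] := eqVneq x 0; first by rewrite mul0r => *; exact: vge0.
have [->|y0] := eqVneq y 0; first by rewrite mulr0 => *; exact: vge0.
by rewrite !vgeNz ?mulf_neq0 // valM // => h1 h2; apply: lerD.
Qed.

Lemma vgeMl N x y : x \in P 0 -> y \in P N -> x * y \in P N.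
Proof. by move=> hx hy; rewrite -[N]add0r; apply: vgeM. Qed.

Lemma vgeMr N x y : x \in P N -> y \in P 0 -> x * y \in P N.
Proof. by move=> hx hy; rewrite -[N]addr0; apply: vgeM. Qed.

Lemma vge_le N M x : M <= N -> x \in P N -> x \in P M.
Proof. by move=> h; rewrite !vgeE => /orP[->//|h2]; rewrite (le_trans h h2) orbT. Qed.

Lemma vgeMz N M (x y : F) : x != 0 -> v x = M -> (x * y \in P N) = (y \in P (N - M)).
Proof.
move=> x0 <-; have [->|y0] := eqVneq y 0; first by rewrite mulr0 !vge0.
by rewrite !vgeNz ?mulf_neq0 // valM // lerBlDl.
Qed.

Lemma vgeVz N M (x y : F) : x != 0 -> v x = M -> (y / x \in P N) = (y \in P (N + M)).
Proof.
move=> x0 h; rewrite mulrC (vgeMz N y (invr_neq0 x0) (erefl _)) valV // h.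
by rewrite opprK.
Qed.

Lemma vge_sum (I : Type) (r : seq I) (Q : pred I) (f : I -> F) N :
  (forall i, Q i -> f i \in P N) -> \sum_(i <- r | Q i) f i \in P N.
Proof.
move=> h; elim/big_ind: _ => //; [exact: vge0 | exact: vgeD].
Qed.

Lemma vge_prod (I : Type) (r : seq I) (Q : pred I) (f : I -> F) :
  (forall i, Q i -> f i \in P 0) -> \prod_(i <- r | Q i) f i \in P 0.
Proof.
move=> h; elim/big_ind: _ => //; [exact: vge1 | exact: vgeMl].
Qed.

Lemma vge_nat n : n%:R \in P 0.
Proof.
elim: n => [|n IH]; first exact: vge0.
by rewrite -addn1 natrD; apply: vgeD => //; apply: vge1.
Qed.

Lemma vgeX n N x : x \in P N -> x ^+ n \in P (n%:Z * N).
Proof.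
move=> h; elim: n => [|n IH]; first by rewrite expr0 mul0r vge1.
by rewrite exprS intS mulrDl mul1r; apply: vgeM.
Qed.

Lemma vge_sqr (x : F) : x ^+ 2 \in P 1 -> x \in P 1.
Proof.
have [->|x0] := eqVneq x 0; first by rewrite vge0.
by rewrite !vgeNz ?expf_neq0 // valX //; lia.
Qed.

Lemma vge_val N (x : F) : x \in P N -> x \notin P (N + 1) -> x != 0 /\ v x = N.
Proof.
rewrite !vgeE; have [//|x0] := eqVneq x 0.
move=> h1 h2; split=> //; move: h1 h2; rewrite /= => ? ?; lia.
Qed.

Lemma vge_unbounded x : (forall N, x \in P N) -> x = 0.
Proof.
move=> h; apply/eqP/negPn/negP => x0.
by have := h (v x + 1); rewrite vgeNz // => ?; lia.
Qed.

Lemma val_eqD N (x y : F) : x != 0 -> v x = N -> y \in P (N + 1) -> x + y != 0 /\ v (x + y) = N.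
Proof.
move=> x0 h hy; apply: vge_val.
  by apply: vgeD; [rewrite vgeNz // h | apply: vge_le hy; lia].
by rewrite vgeDr // vgeNz // h; lia.
Qed.

End Valuation.

Lemma vge_ex (F : fieldType) (v : F -> int) (x : F) : exists N, x \in vge v N.
Proof. by exists (v x); rewrite vgeE lexx orbT. Qed.

Lemma eventually_forall_lt (n : nat) (Q : nat -> nat -> Prop) :
  (forall i, (i < n)%N -> exists j0, forall j, (j0 <= j)%N -> Q i j) ->
  exists j0, forall j, (j0 <= j)%N -> forall i, (i < n)%N -> Q i j.
Proof.
elim: n => [|n IH] h; first by exists 0%N.
have [j1 h1] := IH (fun i hi => h i (ltnW hi)).
have [j2 h2] := h n (ltnSn n).
exists (maxn j1 j2) => j; rewrite geq_max => /andP[k1 k2] i.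
by rewrite ltnS leq_eqVlt => /orP[/eqP ->|hi]; [exact: h2 | exact: h1].
Qed.

(** * Completeness of finite extensions *)

Section Completeness.
Variables (K : fieldType) (vK : K -> int) (L : fieldExtType K) (vL : L -> int).
Variable r : nat.
Hypothesis dK : discrete_valuation vK.
Hypothesis cK : valuation_complete vK.
Hypothesis over : valuation_over vK vL r.

Let dL : discrete_valuation vL. Proof. by case: over. Qed.

Lemma vge_alg N a : (a%:A \in vge vL (r%:Z * N)) = (a \in vge vK N).
Proof.
case: over => _ r0 h; have [->|a0] := eqVneq a 0; first by rewrite scale0r !vge0.
rewrite !vgeNz // ?h // ?ler_pM2l //.
by rewrite scaler_eq0 (negPf a0) oner_eq0.
Qed.

Lemma vge_alg_gt N : exists M, forall a, a \in vge vK M -> a%:A \in vge vL N.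
Proof.
exists `|N|%:Z => a; rewrite -vge_alg; apply: vge_le.
by case: over => _ r0 _; nia.
Qed.

Lemma vge_alg_lt N : exists M, forall a, a%:A \in vge vL M -> a \in vge vK N.
Proof. by exists (r%:Z * N) => a; rewrite vge_alg. Qed.

(** Equivalence of norms over a complete field, in the form needed for Cauchy sequences: coordinates
    with respect to independent vectors lose at most a constant [C] of valuation. The induction
    rests on the last vector being at positive distance from the span of the others. *)
Lemma indep_bound (e : nat -> L) n :
  (forall a : nat -> K, \sum_(i < n) a i *: e i = 0 ->
     forall i, (i < n)%N -> a i = 0) ->
  exists C : int, forall (a : nat -> K) N, \sum_(i < n) a i *: e i \in vge vL N ->
    forall i, (i < n)%N -> (a i)%:A \in vge vL (N - C).
Proof.
elim: n => [|n IH] ind; first by exists 0.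
have {}/IH [C hC] : forall a : nat -> K, \sum_(i < n) a i *: e i = 0 ->
     forall i, (i < n)%N -> a i = 0.
  move=> a ha i hi.
  have := ind (fun j => if (j < n)%N then a j else 0) _ i (ltnW hi).
  rewrite hi; apply; rewrite big_ord_recr /= ltnn scale0r addr0.
  by rewrite -[RHS]ha; apply: eq_bigr => j _; rewrite ltn_ord.
(* If [e n] could be approximated to every precision, the coefficients of the approximants would be
   Cauchy by the induction hypothesis and their limit would be a linear relation. *)
have [M hM] : exists M : int, forall b : nat -> K,
    e n - \sum_(i < n) b i *: e i \notin vge vL M.
  apply: contrapT => /forallNP nM.
  have {nM} : forall j : nat, exists b : nat -> K,
      e n - \sum_(i < n) b i *: e i \in vge vL j%:Z.
    move=> j; apply: contrapT => /forallNP h; apply: (nM j%:Z) => b.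
    by apply/negP; exact: h.
  case/choice=> B hB.
  have cauchy i : (i < n)%N -> exists l, forall N : int, exists n0 : nat,
      forall j, (n0 <= j)%N -> B j i - l \in vge vK N.
    move=> hi; apply: cK => N; have [M hM] := vge_alg_lt N.
    exists `|(M + C)%R|%N => j k hj hk; apply: hM.
    have -> : M = M + C - C by rewrite addrK.
    apply: (hC (fun i => B j i - B k i)) hi => //.
    have -> : \sum_(i0 < n) (B j i0 - B k i0) *: e i0 =
        (e n - \sum_(i0 < n) B k i0 *: e i0) - (e n - \sum_(i0 < n) B j i0 *: e i0).
      by under eq_bigr do rewrite scalerBl; rewrite sumrB; ring.
    by apply: vgeB => //; [apply: vge_le (hB k) | apply: vge_le (hB j)]; lia.
  have {cauchy} /choice[l hl] : forall i, exists l, (i < n)%N ->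
      forall N : int, exists n0 : nat,
      forall j, (n0 <= j)%N -> B j i - l \in vge vK N.
    move=> i; case: (ltnP i n) => [/cauchy[l hl]|_]; first by exists l.
    by exists 0.
  have lim : e n - \sum_(i < n) l i *: e i = 0.
    apply: (vge_unbounded (v := vL)) => N.
    have [j0 hj0] : exists j0, forall j, (j0 <= j)%N -> forall i, (i < n)%N ->
        (B j i - l i) *: e i \in vge vL N.
      apply: eventually_forall_lt => i hi.
      have [c hc] := vge_ex vL (e i); have [N' hN'] := vge_alg_gt (N - c).
      have [j0 hj0] := hl i hi N'; exists j0 => j hj.
      rewrite -[e i]mul1r scalerAl -(subrK c N).
      by apply: vgeM => //; apply: hN'; apply: hj0.
    have -> : e n - \sum_(i < n) l i *: e i =
      (e n - \sum_(i < n) B (maxn j0 `|N|) i *: e i) +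
      \sum_(i < n) (B (maxn j0 `|N|) i - l i) *: e i.
      rewrite -addrA; congr (_ + _); rewrite -sumrN -sumrN -big_split /=.
      by apply: eq_bigr => i _; rewrite scalerBl addKr.
    apply: vgeD => //; last by apply: vge_sum => // i _; apply: hj0; rewrite ?leq_maxl.
    by apply: vge_le (hB _); lia.
  have := ind (fun i => if (i < n)%N then - l i else 1) _ n (ltnSn n).
  rewrite ltnn => h; have /eqP : (1 : K) = 0.
    apply: h; rewrite big_ord_recr /= ltnn scale1r addrC -[RHS]lim; congr (_ + _).
    by rewrite -sumrN; apply: eq_bigr => i _; rewrite ltn_ord scaleNr.
  by rewrite oner_eq0.
have [c hc] := vge_ex vL (e n).
(* [M] is the loss on the last coordinate; the absolute value of [M - c] is what subtracting
   [a n *: e n] costs before the induction hypothesis, with its loss [C], handles the others. *)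
exists (Num.max M (C + `|M - c|)) => a N; rewrite big_ord_recr /= => hs.
have han : (a n)%:A \in vge vL (N - M).
  have [->|an0] := eqVneq (a n) 0; first by rewrite scale0r vge0.
  apply: contraT => hn.
  have an0' : (a n)%:A != 0 :> L by rewrite scaler_eq0 (negPf an0) oner_eq0.
  case/negP: (hM (fun i => - (a i / a n))).
  have -> : e n - \sum_(i < n) - (a i / a n) *: e i =
     ((a n)%:A)^-1 * (\sum_(i < n) a i *: e i + a n *: e n).
    rewrite -sumrN mulrDr addrC; congr (_ + _).
      rewrite mulr_sumr; apply: eq_bigr => i _.
      rewrite scaleNr opprK invrZ ?unitfE // ?oner_eq0 //.
      by rewrite invr1 -scalerAl mul1r scalerA mulrC.
    rewrite invrZ ?unitfE ?oner_eq0 // invr1 -scalerAl mul1r scalerA mulVf //.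
    by rewrite scale1r.
  rewrite (vgeMz dL _ _ (invr_neq0 an0') (erefl _)) valV // opprK.
  apply: vge_le hs; move: hn; rewrite vgeNz // -ltNge ltrBrDl; exact: ltW.
move=> i; rewrite ltnS leq_eqVlt => /orP[/eqP ->|hi].
  by apply: vge_le han; rewrite lerD2l lerN2 le_max lexx.
have hs' : \sum_(i < n) a i *: e i \in vge vL (N - `|M - c|).
  rewrite -(addrK (a n *: e n) (\sum_(i < n) _)); apply: vgeB => //.
    by apply: vge_le hs; lia.
  rewrite -[e n]mul1r scalerAl; apply: vge_le (vgeM dL han hc); lia.
apply: vge_le (hC _ _ hs' _ hi).
have : C + `|M - c| <= Num.max M (C + `|M - c|) by rewrite le_max lexx orbT.
lia.
Qed.

Lemma ext_complete : valuation_complete vL.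
Proof.
move=> u cu; pose X := vbasis {:L}; pose n : nat := \dim {:L}.
pose e i : L := X`_i.
have fX : free X by exact: basis_free (vbasisP _).
have uE x : x = \sum_(i < n) coord X i x *: e i.
  by apply: coord_vbasis; exact: memvf.
have [C hC] : exists C : int, forall (a : nat -> K) N,
    \sum_(i < n) a i *: e i \in vge vL N ->
    forall i, (i < n)%N -> (a i)%:A \in vge vL (N - C).
  apply: indep_bound => a ha i hi.
  have /freeP h := fX.
  by apply: (h (fun j => a j) _ (Ordinal hi)); rewrite -[RHS]ha.
have /choice[l hl] (i : 'I_n) : exists l, forall N : int, exists n0 : nat,
      forall j, (n0 <= j)%N -> coord X i (u j) - l \in vge vK N.
  apply: cK => N; have [M hM] := vge_alg_lt N; have [n0 h0] := cu (M + C).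
  exists n0 => j k hj hk; apply: hM.
  have := hC (fun i => if insub i is Some i' then coord X i' (u j - u k) else 0)
    (M + C) _ i (ltn_ord i).
  rewrite valK addrK linearB; apply.
  rewrite (eq_bigr (fun i => coord X i (u j - u k) *: e i)) -?uE ?h0 //.
  by move=> i' _; rewrite valK.
exists (\sum_(i < n) l i *: e i) => N.
have [j0 hj0] : exists j0, forall j, (j0 <= j)%N -> forall i : nat, (i < n)%N ->
    if insub i is Some i' then (coord X i' (u j) - l i') *: e i \in vge vL N else true.
  apply: eventually_forall_lt => i hi; rewrite (insubT (fun i => i < n)%N hi) /=.
  have [c hc] := vge_ex vL (e i); have [N' hN'] := vge_alg_gt (N - c).
  have [j0 hj0] := hl (Ordinal hi) N'; exists j0 => j hj.
  rewrite -[e i]mul1r scalerAl -(subrK c N).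
  by apply: vgeM => //; apply: hN'; apply: hj0.
exists j0 => j hj; rewrite {1}[u j]uE -sumrB; apply: vge_sum => // i _.
by have := hj0 j hj i (ltn_ord i); rewrite valK scalerBl.
Qed.

End Completeness.

(** * Structure of the unramified quadratic extension *)

(** What the counts use of the extension. [theta] has trace 1 and forms with 1 an integral basis
    over the fixed field, whether or not 2 is a unit, so the later arguments are uniform; [pi] is a
    uniformizer fixed by [conj], and [rep] lists the residues of the fixed ring. *)
Record inert (k : fieldType) (k' : fieldExtType k) (conj : {lrmorphism k' -> k'})
    (v : k' -> int) (q : nat) (pi theta : k') (rep : 'I_q -> k') : Prop := Inert {
  inert_dv : discrete_valuation v;
  inert_conjK : forall x, conj (conj x) = x;
  inert_vconj : forall x, v (conj x) = v x;
  inert_pi : [/\ pi != 0, v pi = 1 & conj pi = pi];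
  inert_theta : conj theta = 1 - theta;
  inert_theta_int : theta \in vge v 0;
  inert_basis : forall a b N, conj a = a -> conj b = b ->
    a * theta + b \in vge v N -> a \in vge v N /\ b \in vge v N;
  inert_rep : forall i, conj (rep i) = rep i /\ rep i \in vge v 0;
  inert_repP : forall x, conj x = x -> x \in vge v 0 ->
    exists! i, x - rep i \in vge v 1;
  inert_two : 2%:R != 0 :> k' }.

Section InertExists.
Variables (k : fieldType) (v : k -> int) (q : nat) (rep : 'I_q -> k).
Hypothesis dv : discrete_valuation v.
Hypothesis cv : valuation_complete v.
Hypothesis rep_int : forall i, rep i \in vge v 0.
Hypothesis repP : forall x, x \in vge v 0 -> exists! i, x - rep i \in vge v 1.
Hypothesis two : 2%:R != 0 :> k.
Variables (k' : fieldExtType k) (v' : k' -> int) (conj : {lrmorphism k' -> k'}).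
Hypothesis unr : unramified_quadratic v v'.
Hypothesis conj_nontriv : exists a, conj a != a.

Let over : valuation_over v v' 1. Proof. by case: unr. Qed.
Let dv' : discrete_valuation v'. Proof. by case: over. Qed.

Let algP N a : (a%:A \in vge v' N) = (a \in vge v N).
Proof. by rewrite -(vge_alg over) mul1r. Qed.

Let conjA a : conj a%:A = a%:A.
Proof. by rewrite linearZ /= rmorph1. Qed.

Let algM (a b : k) : (a * b)%:A = a%:A * b%:A :> k'.
Proof. exact: (rmorphM (in_alg k')). Qed.

Let algV (a : k) : (a^-1)%:A = (a%:A)^-1 :> k'.
Proof. exact: (fmorphV (in_alg k')). Qed.

Let algX (a : k) n : (a ^+ n)%:A = a%:A ^+ n :> k'.
Proof. exact: (rmorphXn (in_alg k')). Qed.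

Let algD (a b : k) : (a + b)%:A = a%:A + b%:A :> k'.
Proof. exact: scalerDl. Qed.

Let not_all_base : exists x : k', forall a, x <> a%:A.
Proof.
by case: conj_nontriv => x hx; exists x => a e; rewrite e conjA eqxx in hx.
Qed.

(** The residue extension is nontrivial. Otherwise, the ramification index being 1, each integral
    element of k' could be expanded digit by digit with digits in k, and completeness of k would
    place it in k. *)
Lemma residue_generator : exists t : k', t \in vge v' 0 /\
  forall a, a \in vge v 0 -> t - a%:A \notin vge v' 1.
Proof.
apply: contrapT => /forallNP nt.
have near x : x \in vge v' 0 -> exists a, a \in vge v 0 /\ x - a%:A \in vge v' 1.
  move=> hx; apply: contrapT => /forallNP h; apply: (nt x); split=> // a ha.
  by apply/negP => h2; apply: (h a).
case: (dv) => _ _ [p [p0 vp]].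
have p0' : p%:A != 0 :> k' by rewrite scaler_eq0 (negPf p0) oner_eq0.
have vp' : v' p%:A = 1 by case: over => _ _ ->; rewrite // vp.
have dense x (n : nat) : x \in vge v' 0 -> exists a, x - a%:A \in vge v' n%:Z.
  move=> hx; elim: n => [|n [a ha]]; first by exists 0; rewrite scale0r subr0.
  have vpn : v' (p%:A ^+ n) = n by rewrite valX // vp' mulr1.
  have [b [_ hb]] : exists b, b \in vge v 0 /\ (x - a%:A) / p%:A ^+ n - b%:A \in vge v' 1.
    by apply: near; rewrite (vgeVz dv' _ _ (expf_neq0 _ p0') vpn) add0r.
  exists (a + b * p ^+ n).
  have -> : x - (a + b * p ^+ n)%:A = p%:A ^+ n * ((x - a%:A) / p%:A ^+ n - b%:A).
    by rewrite mulrBr mulrCA divff ?expf_neq0 // mulr1 algD algM algX; ring.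
  rewrite (vgeMz dv' _ _ (expf_neq0 _ p0') vpn).
  by have -> : n.+1%:Z - n%:Z = 1 by lia.
have int_base x : x \in vge v' 0 -> exists a, x = a%:A.
  move=> /dense hx; have /choice[u hu] := hx.
  have [l hl] : exists l : k, forall N : int, exists n0 : nat, forall i : nat,
      (n0 <= i)%N -> u i - l \in vge v N.
    apply: cv => N; exists `|N|%N => i j hi hj; rewrite -algP.
    have -> : (u i - u j)%:A = (x - (u j)%:A) - (x - (u i)%:A).
      by rewrite scalerBl; ring.
    by apply: vgeB => //; apply: vge_le (hu _); lia.
  exists l; apply/eqP; rewrite -subr_eq0; apply/eqP.
  apply: (vge_unbounded (v := v')) => N; have [n0 hn0] := hl N.
  have -> : x - l%:A = (x - (u (maxn n0 `|N|))%:A) + (u (maxn n0 `|N|) - l)%:A.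
    by rewrite scalerBl; ring.
  apply: vgeD => //; last by rewrite algP hn0 ?leq_maxl.
  by apply: vge_le (hu _); lia.
case: not_all_base => x; have [c hc] := vge_ex v' x.
have [a ha] : exists a, x * p%:A ^+ `|c|%N = a%:A.
  apply: int_base; apply: vge_le (vgeM dv' hc (_ : p%:A ^+ `|c|%N \in vge v' `|c|%:Z)).
    by lia.
  by rewrite vgeNz ?expf_neq0 // valX // vp' mulr1.
move=> nx; apply: (nx (a / p ^+ `|c|%N)).
have pn : p%:A ^+ `|c|%N != 0 :> k' by rewrite expf_neq0.
by apply: (mulIf pn); rewrite ha algM algV algX divfK.
Qed.

(** In residue characteristic 2 squaring is injective on residues, hence surjective because they are
    finite in number. *)
Lemma residue_frobenius : 2%:R \in vge v 1 ->
  forall d, d \in vge v 0 -> exists s, s \in vge v 0 /\ d - s ^+ 2 \in vge v 1.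
Proof.
move=> h2.
have /choice[g hg] i : exists j, rep i ^+ 2 - rep j \in vge v 1.
  have [|j [hj _]] := repP (x := rep i ^+ 2); last by exists j.
  exact: (vgeX dv 2 (rep_int i)).
have ginj : injective g.
  move=> i j e; have {}e : rep i - rep j \in vge v 1.
    apply: (vge_sqr dv).
    have -> : (rep i - rep j) ^+ 2 = (rep i ^+ 2 - rep (g i)) -
       (rep j ^+ 2 - rep (g j)) + 2%:R * (rep j * (rep j - rep i)).
      by rewrite e; ring.
    apply: vgeD => //; first exact: vgeB.
    by apply: vgeMr => //; apply: vgeMl => //; apply: vgeB.
  have [i' [_ u]] := repP (rep_int i).
  by rewrite -(u i) ?subrr ?vge0 // -(u j).
move=> d hd; have [j [hj _]] := repP hd.
have [g' _ gg'] := injF_bij ginj; exists (rep (g' j)); split=> //.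
have -> : d - rep (g' j) ^+ 2 = (d - rep j) - (rep (g' j) ^+ 2 - rep (g (g' j))).
  by rewrite gg'; ring.
exact: vgeB.
Qed.

(** A generator t with t^2 = c t + d has trace c, and t + s has trace c + 2s; [theta] is t + s
    divided by its trace, once s makes this trace a unit. *)
Lemma inert_exists : exists pi theta, inert conj v' pi theta (fun i => (rep i)%:A).
Proof.
have [t [t_int t_gen]] := residue_generator.
have basis0 a b N : a%:A * t + b%:A \in vge v' N -> a \in vge v N /\ b \in vge v N.
  move=> h; suff ha : a \in vge v N.
    split=> //; move: h; rewrite vgeDl ?algP //.
    by apply: vgeMr => //; rewrite algP.
  have [->|a0] := eqVneq a 0; first by rewrite vge0.
  apply: contraT; rewrite vgeNz // -ltNge => lt.
  have a0' : a%:A != 0 :> k' by rewrite scaler_eq0 (negPf a0) oner_eq0.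
  have va : v' a%:A = v a by case: over => _ _ ->; rewrite // mul1r.
  have h2 : t - (- (b / a))%:A \in vge v' 1.
    have -> : t - (- (b / a))%:A = (a%:A * t + b%:A) / a%:A.
      by rewrite scaleNr !(algM, algV); field.
    by rewrite (vgeVz dv' _ _ a0' va); apply: vge_le h; lia.
  suff hb : - (b / a) \in vge v 0 by rewrite (negPf (t_gen _ hb)) in h2.
  rewrite -algP -[_%:A](subKr t); apply: vgeB => //.
  by apply: vge_le h2.
have t_free : free [:: t; 1].
  rewrite free_cons seq1_free oner_eq0 andbT span_seq1; apply/vlineP => -[a ta].
  have /t_gen : a \in vge v 0 by rewrite -algP -ta.
  by rewrite ta subrr vge0.
have span (x : k') : exists a b, x = a%:A * t + b%:A.
  have : x \in <<[:: t; 1%R]>>%VS.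
    suff -> : <<[:: t; 1%R]>>%VS = fullv by exact: memvf.
    apply/eqP; rewrite eqEdim subvf /=; case: unr => -> _.
    by move: t_free; rewrite /free => /eqP ->.
  rewrite span_cons span_seq1 => /memv_addP[_ /vlineP[a ->] [_ /vlineP[b ->] ->]].
  by exists a, b; rewrite -scalerAl mul1r.
have conjE a b : conj (a%:A * t + b%:A) = a%:A * conj t + b%:A.
  by rewrite rmorphD rmorphM /= !conjA.
have ct : conj t != t.
  case: conj_nontriv => x; apply: contra => /eqP e.
  by have [a [b ->]] := span x; rewrite conjE e.
have fixP (x : k') : conj x = x -> exists b, x = b%:A.
  have [a [b ->]] := span x; rewrite conjE => /addIr /eqP.
  rewrite -subr_eq0 -mulrBr mulf_eq0 subr_eq0 (negPf ct) orbF => /eqP ->.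
  by exists b; rewrite mul0r add0r.
have [c [d tt]] := span (t * t).
have [c_int d_int] : c \in vge v 0 /\ d \in vge v 0.
  by apply: basis0; rewrite -tt; apply: vgeMl.
have conj_t : conj t = c%:A - t.
  have : conj (t * t) = c%:A * conj t + d%:A by rewrite tt conjE.
  rewrite rmorphM /= => e; have /eqP : (conj t - t) * (conj t + t - c%:A) = 0.
    transitivity (conj t * conj t - t * t - c%:A * conj t + c%:A * t); first by ring.
    by rewrite e tt; ring.
  rewrite mulf_eq0 subr_eq0 (negPf ct) /= subr_eq0 => /eqP <-.
  by rewrite addrK.
have conjK (x : k') : conj (conj x) = x.
  have [a [b ->]] := span x; rewrite conjE conj_t rmorphD rmorphM rmorphB /= !conjA conj_t.
  by ring.
have vconj (x : k') N : x \in vge v' N -> conj x \in vge v' N.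
  have [a [b ->]] := span x => /basis0[ha hb]; rewrite conjE conj_t.
  apply: vgeD; rewrite ?algP //; apply: vgeMr; rewrite ?algP //.
  by apply: vgeB; rewrite ?algP.
have vconjE (x : k') : v' (conj x) = v' x.
  have [->|x0] := eqVneq x 0; first by rewrite rmorph0.
  have cx0 : conj x != 0 by rewrite fmorph_eq0.
  apply/eqP; rewrite eq_le; apply/andP; split.
    by rewrite -{2}[x]conjK -vgeNz ?fmorph_eq0 //; apply: vconj; rewrite vgeNz.
  by rewrite -vgeNz //; apply: vconj; rewrite vgeNz.
(* s = 0 works if c is a unit, and s = 1 if 2 is a unit but c is not. If neither is, t^2 is
   congruent to d and d to some square s^2, so t is congruent to s, against the choice of t. *)
have [s [s_int tau_unit]] : exists s, s \in vge v 0 /\ c + 2%:R * s \notin vge v 1.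
  have [hc|hc] := boolP (c \in vge v 1); last first.
    by exists 0; rewrite vge0 mulr0 addr0.
  have [h2|h2] := boolP (2%:R \in vge v 1); last first.
    by exists 1; rewrite vge1 // mulr1 vgeDl.
  have [s [hs hd]] := residue_frobenius h2 d_int.
  suff : t - s%:A \in vge v' 1 by rewrite (negPf (t_gen s hs)).
  apply: (vge_sqr dv').
  have -> : (t - s%:A) ^+ 2 = c%:A * t + (d - s ^+ 2)%:A - (2%:R)%:A * (s%:A * (t - s%:A)).
    rewrite scalerBl algX scaler_nat; move: tt; clear; move: c%:A d%:A s%:A => c' d' s' tt.
    have -> : (t - s') ^+ 2 = t * t - s' * t - s' * t + s' ^+ 2 by ring.
    by rewrite tt; ring.
  apply: vgeB => //; first apply: vgeD => //; rewrite ?algP //.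
    by apply: vgeMr; rewrite ?algP.
  apply: vgeMr; rewrite ?algP //; apply: vgeMl; rewrite ?algP //.
  by apply: vgeB; rewrite ?algP.
have [tau tauE] : exists tau, tau = c + 2%:R * s by exists (c + 2%:R * s).
rewrite -tauE in tau_unit.
have [tau0 vtau] : tau != 0 /\ v tau = 0.
  apply: vge_val => //; rewrite tauE; apply: vgeD => //; apply: vgeMl => //; exact: vge_nat.
have tau0' : tau%:A != 0 :> k' by rewrite scaler_eq0 (negPf tau0) oner_eq0.
have vtau' : v' tau%:A = 0 by case: over => _ _ ->; rewrite // vtau.
case: (dv) => _ _ [p [p0 vp]].
exists p%:A, ((t + s%:A) / tau%:A); split=> //.
- split; [|by case: over => _ _ ->; rewrite // vp|exact: conjA].
  by rewrite scaler_eq0 (negPf p0) oner_eq0.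
- rewrite rmorphM rmorphV ?unitfE //= rmorphD /= !conjA conj_t.
  apply: (mulIf tau0'); rewrite mulrBl mul1r !divfK // tauE scalerDl.
  by rewrite algM scaler_nat; ring.
- rewrite (vgeVz dv' _ _ tau0' vtau') addr0.
  by apply: vgeD; rewrite ?algP.
- move=> _ _ N /fixP[a ->] /fixP[b ->] h.
  have [] := basis0 (a / tau) (a * s / tau + b) N.
    have -> : (a / tau)%:A * t + (a * s / tau + b)%:A = a%:A * ((t + s%:A) / tau%:A) + b%:A.
      rewrite !(algM, algD, algV); move: tau0'.
      by move: tau%:A a%:A b%:A s%:A => *; field.
    by [].
  rewrite !(vgeVz dv _ _ tau0 vtau) !addr0 !algP => ha; rewrite vgeDl ?ha //.
  by rewrite (vgeVz dv _ _ tau0 vtau) addr0; apply: vgeMr.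
- by move=> i; rewrite conjA algP.
- move=> _ /fixP[x ->]; rewrite algP => /repP[i [hi ui]]; exists i; split.
    by rewrite -scalerBl algP.
  by move=> j; rewrite -scalerBl algP; apply: ui.
- rewrite -scaler_nat scaler_eq0 oner_eq0 orbF //.
Qed.

End InertExists.

(** * Counting residues: affine, trace and norm equations *)

Lemma card_unique (I : finType) (Q : pred I) : (exists! i, Q i) -> #|[pred i | Q i]| = 1%N.
Proof.
by case=> i [qi ui]; rewrite -(card1 i); apply: eq_card => j; rewrite !inE; apply/idP/eqP => [/ui|->].
Qed.

Lemma card_pairs (I J : finType) (Q : I -> J -> bool) c :
  (forall i, #|[pred j | Q i j]| = c) -> #|[pred ij : I * J | Q ij.1 ij.2]| = (#|I| * c)%N.
Proof.
move=> h; rewrite -sum1_card; transitivity (\sum_(i : I) \sum_(j | Q i j) 1)%N.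
  by rewrite pair_big_dep.
under eq_bigr => i _ do rewrite sum1_card (_ : #|_| = c) ?h //.
by rewrite sum_nat_const.
Qed.

Lemma card_swap (I J : finType) (Q : I -> J -> bool) :
  #|[pred ij : I * J | Q ij.1 ij.2]| = #|[pred ji : J * I | Q ji.2 ji.1]|.
Proof.
rewrite -!sum1_card; transitivity (\sum_(i : I) \sum_(j | Q i j) 1)%N.
  by rewrite pair_big_dep.
by rewrite (exchange_big_dep predT) //= pair_big_dep.
Qed.

Section InertTheory.
Variables (k : fieldType) (k' : fieldExtType k) (conj : {lrmorphism k' -> k'}).
Variables (v : k' -> int) (q : nat) (pi theta : k') (rep : 'I_q -> k').
Hypothesis I : inert conj v pi theta rep.
Local Notation P := (vge v).

Let dv := inert_dv I.
Let conjK := inert_conjK I.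

Lemma vge_conj N x : (conj x \in P N) = (x \in P N).
Proof. by rewrite !vgeE fmorph_eq0 (inert_vconj I). Qed.

Lemma conj_norm x : conj (x * conj x) = x * conj x.
Proof. by rewrite rmorphM /= conjK mulrC. Qed.

Lemma conj_trace x : conj (x + conj x) = x + conj x.
Proof. by rewrite rmorphD /= conjK addrC. Qed.

Lemma val_pi_exp n : v (pi ^+ n) = n%:Z.
Proof. by have [p0 vp _] := inert_pi I; rewrite valX // vp mulr1. Qed.

Lemma pi_exp_neq0 n : pi ^+ n != 0.
Proof. by have [p0 vp _] := inert_pi I; rewrite expf_neq0. Qed.

Lemma conj_pi_exp n : conj (pi ^+ n) = pi ^+ n.
Proof. by have [_ _ h] := inert_pi I; rewrite rmorphXn /= h. Qed.

(** A unit with [conj eta = - eta]; its multiples by fixed elements are the elements of trace 0. *)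
Definition eta : k' := theta - conj theta.

Lemma etaE : eta = 2%:R * theta - 1.
Proof. by rewrite /eta (inert_theta I); ring. Qed.

Lemma conj_eta : conj eta = - eta.
Proof. by rewrite /eta rmorphB /= conjK opprB. Qed.

Lemma eta_unit : eta != 0 /\ v eta = 0.
Proof.
apply: vge_val.
  by apply: vgeB; rewrite ?vge_conj // (inert_theta_int I).
apply/negP; rewrite etaE => /(inert_basis I); rewrite rmorphN rmorph1 rmorph_nat.
by case=> // _; rewrite vgeN // vgeNz ?oner_eq0 // val1.
Qed.

Lemma theta_decomp x : exists a b,
  [/\ conj a = a, conj b = b & x = a * theta + b].
Proof.
have [e0 _] := eta_unit; pose a := (x - conj x) / eta.
have ca : conj a = a.
  by rewrite /a rmorphM fmorphV /= conj_eta rmorphB /= conjK invrN mulrN -mulNr opprB.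
exists a, (x - a * theta); split=> //; last by ring.
rewrite rmorphB rmorphM /= ca; apply/eqP; rewrite -subr_eq0; apply/eqP.
transitivity (a * eta - (x - conj x)); first by rewrite /eta; ring.
by rewrite /a divfK // subrr.
Qed.

Definition rep2 (ij : 'I_q * 'I_q) : k' := rep ij.1 * theta + rep ij.2.

Lemma conj_rep i : conj (rep i) = rep i. Proof. by have [] := inert_rep I i. Qed.
Lemma rep_int i : rep i \in P 0. Proof. by have [] := inert_rep I i. Qed.

Lemma rep2_int ij : rep2 ij \in P 0.
Proof. by apply: vgeD => //; [apply: vgeMr => //; first exact: vge_le (rep_int _)|]; rewrite ?rep_int ?(inert_theta_int I). Qed.

Lemma rep2P x : x \in P 0 -> exists! ij, x - rep2 ij \in P 1.
Proof.
have [a [b [ca cb ->]]] := theta_decomp x => /(inert_basis I)[] // ha hb.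
have [i [hi ui]] := inert_repP I ca ha; have [j [hj uj]] := inert_repP I cb hb.
have e i' j' : a * theta + b - rep2 (i', j') = (a - rep i') * theta + (b - rep j').
  by rewrite /rep2 /=; ring.
exists (i, j); split.
  by rewrite e; apply: vgeD => //; apply: vgeMr => //; apply: inert_theta_int I.
case=> i' j'; rewrite e => /(inert_basis I)[]; rewrite ?rmorphB /= ?conj_rep ?ca ?cb //.
by move=> /ui <- /uj <-.
Qed.

Lemma residue_ex : exists r : k' -> 'I_q * 'I_q, forall x, x \in P 0 ->
  forall ij, (x - rep2 ij \in P 1) = (ij == r x).
Proof.
suff /choice[r h] : forall x, exists ij0, x \in P 0 ->
    forall ij, (x - rep2 ij \in P 1) = (ij == ij0) by exists r.
move=> x; have [hx|hx] := boolP (x \in P 0).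
  have [ij0 [h u]] := rep2P hx; exists ij0 => _ ij.
  by apply/idP/eqP => [/u|->].
have [ij0 _] := rep2P (vge0 v 0).
by exists ij0.
Qed.

Lemma rep_sep i j : rep i - rep j \in P 1 -> i = j.
Proof.
move=> h; have [l [_ u]] := inert_repP I (conj_rep i) (rep_int i).
by rewrite -(u j h) (u i) // subrr vge0.
Qed.

Lemma residue_card_gt1 : (1 < q)%N.
Proof.
have [i [hi _]] := inert_repP I (rmorph0 _) (vge0 v 0).
have [j [hj _]] := inert_repP I (rmorph1 _) (vge1 dv).
rewrite ltnNge; apply/negP => q1.
have eij : i = j by apply/val_inj => /=; have := ltn_ord i; have := ltn_ord j; lia.
have : 1 - rep j - (0 - rep i) \in P 1 by apply: vgeB.
by rewrite eij sub0r opprK subrK vgeNz ?oner_eq0 // val1.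
Qed.

Lemma card_affine x u : x \in P 0 -> u != 0 -> v u = 0 ->
  #|[pred ij | x + u * rep2 ij \in P 1]| = 1%N.
Proof.
move=> hx u0 vu; apply: card_unique.
have h : - x / u \in P 0 by rewrite (vgeVz dv _ _ u0 vu) addr0 vgeN.
have [ij [hij uij]] := rep2P h.
have e ij' : (x + u * rep2 ij' \in P 1) = (- x / u - rep2 ij' \in P 1).
  have -> : x + u * rep2 ij' = - u * (- x / u - rep2 ij') by field.
  by rewrite mulNr vgeN // (vgeMz dv _ _ u0 vu) subr0.
by exists ij; split=> [|ij']; rewrite /= e //; apply: uij.
Qed.

Lemma card_affine_fixed x u : conj x = x -> conj u = u ->
  x \in P 0 -> u != 0 -> v u = 0 ->
  #|[pred i | x + u * rep i \in P 1]| = 1%N.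
Proof.
move=> cx cu hx u0 vu; apply: card_unique.
have h : - x / u \in P 0 by rewrite (vgeVz dv _ _ u0 vu) addr0 vgeN.
have c : conj (- x / u) = - x / u by rewrite rmorphM rmorphN fmorphV /= cx cu.
have [i [hi ui]] := inert_repP I c h.
have e i' : (x + u * rep i' \in P 1) = (- x / u - rep i' \in P 1).
  have -> : x + u * rep i' = - u * (- x / u - rep i') by field.
  by rewrite mulNr vgeN // (vgeMz dv _ _ u0 vu) subr0.
by exists i; split=> [|j]; rewrite /= e //; apply: ui.
Qed.

(** The trace of u y is a linear form in the two coordinates of y, with coefficients the traces of u
    theta and of u. They are not both in the maximal ideal, because the unit u eta is an integral
    combination of them; so the form is onto and its fibres have q elements. *)
Lemma card_trace x u : conj x = x -> x \in P 0 -> u != 0 -> v u = 0 ->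
  #|[pred ij | x + (u * rep2 ij + conj (u * rep2 ij)) \in P 1]| = q.
Proof.
move=> cx hx u0 vu.
have hu : u \in P 0 by rewrite vgeNz // vu.
pose T y := y + conj y.
have iT y : y \in P 0 -> T y \in P 0 by move=> h; apply: vgeD; rewrite ?vge_conj.
have cT y : conj (T y) = T y by rewrite /T conj_trace.
have goodT y i : y \in P 0 -> conj (x + T y * rep i) = x + T y * rep i /\ x + T y * rep i \in P 0.
  move=> hy; split; first by rewrite rmorphD rmorphM /= cT conj_rep cx.
  by apply: vgeD => //; apply: vgeMl => //; [apply: iT | apply: rep_int].
have tE i j : x + (u * rep2 (i, j) + conj (u * rep2 (i, j))) =
    (x + T (u * theta) * rep i) + T u * rep j.
  by rewrite /T /rep2 /= !rmorphM rmorphD rmorphM /= !conj_rep; ring.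
have aff y w : conj y = y -> conj w = w -> y \in P 0 -> w \in P 0 -> w \notin P 1 ->
    #|[pred i | y + w * rep i \in P 1]| = 1%N.
  by move=> cy cw hy hw nw; have [] := vge_val hw nw => *; apply: card_affine_fixed.
have hut : u * theta \in P 0 by apply: vgeMl => //; apply: inert_theta_int I.
have [n1|y1] := boolP (T u \in P 1); last first.
  transitivity (#|'I_q| * 1)%N; last by rewrite card_ord muln1.
  rewrite -(card_pairs (Q := fun i j => (x + T (u * theta) * rep i) + T u * rep j \in P 1)).
    by apply: eq_card => -[i j]; rewrite !inE -tE.
  by move=> i; have [c1 c2] := goodT _ i hut; apply: aff; rewrite ?cT ?iT.
have y2 : T (u * theta) \notin P 1.
  apply/negP => n2; have [e0 ve] := eta_unit.
  have : u * eta \in P 1.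
    have -> : u * eta = T (u * theta) - conj theta * T u.
      by rewrite /T /eta rmorphM /=; ring.
    apply: vgeB => //; apply: vgeMl => //; rewrite vge_conj.
    exact: inert_theta_int I.
  by rewrite (vgeMz dv _ _ u0 vu) subr0 vgeNz // ve.
transitivity (#|'I_q| * 1)%N; last by rewrite card_ord muln1.
rewrite -(card_pairs (Q := fun j i => (x + T u * rep j) + T (u * theta) * rep i \in P 1)).
  rewrite (card_swap (fun j i => x + T u * rep j + T (u * theta) * rep i \in P 1)).
  by apply: eq_card => -[i j]; rewrite !inE tE addrAC.
by move=> j; have [c1 c2] := goodT _ j hu; apply: aff; rewrite ?cT ?iT.
Qed.

Lemma card_residue_subst (Q : pred k') x u :
  (forall y z, y \in P 0 -> z \in P 0 -> y - z \in P 1 -> Q y = Q z) ->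
  x \in P 0 -> u != 0 -> v u = 0 ->
  #|[pred ij | Q (x + u * conj (rep2 ij))]| = #|[pred ij | Q (rep2 ij)]|.
Proof.
move=> Qper hx u0 vu; have [r rP] := residue_ex.
have h ij : x + u * conj (rep2 ij) \in P 0.
  by apply: vgeD => //; rewrite (vgeMz dv _ _ u0 vu) subr0 vge_conj rep2_int.
pose f ij := r (x + u * conj (rep2 ij)).
have fP ij : x + u * conj (rep2 ij) - rep2 (f ij) \in P 1 by rewrite rP.
have finj : injective f.
  move=> i j e; have : u * conj (rep2 i - rep2 j) \in P 1.
    have -> : u * conj (rep2 i - rep2 j) = (x + u * conj (rep2 i) - rep2 (f i)) -
      (x + u * conj (rep2 j) - rep2 (f j)) by rewrite e rmorphB /=; ring.
    exact: vgeB.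
  rewrite (vgeMz dv _ _ u0 vu) subr0 vge_conj => hij.
  have [l [_ ul]] := rep2P (rep2_int i).
  by rewrite -(ul _ hij); apply/esym/ul; rewrite subrr vge0.
rewrite -!sum1_card [RHS](reindex_inj finj); apply: eq_bigl => ij /=.
by rewrite !inE; apply: Qper => //; exact: rep2_int.
Qed.

Lemma norm_periodic e y z : y \in P 0 -> z \in P 0 -> y - z \in P 1 ->
  (y * conj y - e \in P 1) = (z * conj z - e \in P 1).
Proof.
move=> hy hz hyz.
have -> : y * conj y - e = (z * conj z - e) + (y * conj (y - z) + conj z * (y - z)).
  by rewrite rmorphB /=; ring.
apply: vgeDr => //; apply: vgeD => //; apply: vgeMl => //; by rewrite vge_conj.
Qed.

Let n e := #|[pred ij | rep2 ij * conj (rep2 ij) - e \in P 1]|.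

(** Hilbert 90 in explicit form: the quotients (a + theta) / conj (a + theta), for the q residues a,
    together with 1, list the residues of norm 1. *)
Lemma card_norm_one : n 1 = q.+1.
Proof.
have [r rP] := residue_ex; have [e0 ve] := eta_unit.
pose w a := rep a + theta.
have w_unit a : w a != 0 /\ v (w a) = 0.
  apply: vge_val; rewrite /w.
    by apply: vgeD; rewrite ?rep_int ?(inert_theta_int I).
  apply/negP; rewrite addrC -[theta]mul1r add0r => /(inert_basis I) [].
  - exact: rmorph1.
  - exact: conj_rep.
  - by rewrite vgeNz ?oner_eq0 // val1.
have cw_unit a : conj (w a) != 0 /\ v (conj (w a)) = 0.
  by have [w0 vw] := w_unit a; rewrite fmorph_eq0 (inert_vconj I).
pose y o := if o is Some a then w a / conj (w a) else 1.
have y_int o : y o \in P 0.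
  case: o => [a|] /=; last exact: vge1.
  have [w0 vw] := w_unit a; have [cw0 vcw] := cw_unit a.
  by rewrite (vgeVz dv _ _ cw0 vcw) addr0 vgeNz // vw.
have y_norm o : y o * conj (y o) = 1.
  case: o => [a|] /=; last by rewrite rmorph1 mulr1.
  have [w0 vw] := w_unit a; have [cw0 vcw] := cw_unit a.
  by rewrite rmorphM fmorphV /= conjK; field; rewrite w0 cw0.
have wE a : conj (w a) = rep a + conj theta by rewrite /w rmorphD /= conj_rep.
pose f o := r (y o).
have fP o : y o - rep2 (f o) \in P 1 by rewrite rP.
have f_eq o o' : f o = f o' -> y o - y o' \in P 1.
  move=> e; have -> : y o - y o' = (y o - rep2 (f o)) - (y o' - rep2 (f o')).
    by rewrite e; ring.
  exact: vgeB.
have one_w a : 1 - y (Some a) \notin P 1.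
  have [w0 vw] := w_unit a; have [cw0 vcw] := cw_unit a.
  have -> : 1 - y (Some a) = - eta / conj (w a).
    by rewrite /= -[1](divff cw0) -mulrBl; congr (_ / _); rewrite wE /w /eta; ring.
  by rewrite (vgeVz dv _ _ cw0 vcw) addr0 vgeN // vgeNz // ve.
have f_inj : injective f.
  move=> [a|] [b|] // /f_eq; last 2 first.
  - by rewrite -vgeN // opprB (negPf (one_w a)).
  - by rewrite (negPf (one_w b)).
  rewrite -vgeN // opprB.
  have [wa vwa] := cw_unit a; have [wb vwb] := cw_unit b.
  have -> : y (Some b) - y (Some a) = (rep a - rep b) * eta / (conj (w a)) / (conj (w b)).
    transitivity ((w b * conj (w a) - w a * conj (w b)) / conj (w a) / conj (w b)).
      by rewrite /=; field; rewrite wa wb.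
    by congr (_ / _ / _); rewrite !wE /w /eta; ring.
  rewrite (vgeVz dv _ _ wb vwb) (vgeVz dv _ _ wa vwa) mulrC (vgeMz dv _ _ e0 ve).
  by rewrite subr0 !addr0 => /rep_sep ->.
rewrite -[q]card_ord -card_option -(card_codom f_inj); apply: eq_card => ij.
rewrite inE; apply/idP/codomP => [h|[w0 ->]]; last first.
  rewrite -(norm_periodic 1 (y_int w0) (rep2_int _) (fP w0)).
  by rewrite y_norm subrr vge0.
have [x1|x1] := boolP (rep2 ij - 1 \in P 1).
  by exists None; apply/eqP; rewrite -rP ?vge1 // -vgeN // opprB.
set x := rep2 ij in h x1.
have hx : x \in P 0 := rep2_int ij.
have [u0 vu] : 1 - x != 0 /\ v (1 - x) = 0.
  by apply: vge_val; [apply: vgeB => //; apply: vge1 | rewrite add0r -vgeN // opprB].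
(* Solves x = (a + theta) / conj (a + theta) as if a were fixed by [conj]; [hca] shows that it is,
   modulo the maximal ideal. *)
pose a := (x * conj theta - theta) / (1 - x).
have th := inert_theta_int I.
have ha : a \in P 0.
  by rewrite (vgeVz dv _ _ u0 vu) addr0; apply: vgeB => //; apply: vgeMl => //; rewrite vge_conj.
have hca : conj a - a \in P 1.
  have cu0 : 1 - conj x != 0 by rewrite -[1](rmorph1 conj) -rmorphB fmorph_eq0.
  have vcu : v (1 - conj x) = 0 by rewrite -[1](rmorph1 conj) -rmorphB (inert_vconj I).
  have -> : conj a - a = - (eta * (x * conj x - 1)) / (1 - x) / (1 - conj x).
    rewrite /a rmorphM fmorphV rmorphB rmorphM /= conjK rmorphB rmorph1 /eta.
    by field; rewrite u0 cu0.
  rewrite (vgeVz dv _ _ cu0 vcu) (vgeVz dv _ _ u0 vu) !addr0 vgeN //.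
  by rewrite (vgeMz dv _ _ e0 ve) subr0.
have [b [c [cb cc aE]]] := theta_decomp a.
have hb : b \in P 1.
  move: hca; have -> : conj a - a = - (eta * b).
    by rewrite aE rmorphD rmorphM /= cb cc /eta; ring.
  by rewrite vgeN // (vgeMz dv _ _ e0 ve) subr0.
have hc : c \in P 0 by move: ha; rewrite aE => /(inert_basis I)[].
have [i [hi _]] := inert_repP I cc hc.
have hai : a - rep i \in P 1.
  by rewrite aE -addrA; apply: vgeD => //; apply: vgeMr.
exists (Some i); apply/eqP; rewrite -rP // -/x.
have [wa vwa] := cw_unit i.
have -> : y (Some i) - x = - ((a - rep i) * (1 - x)) / conj (w i).
  rewrite /= -{1}[x](mulfK wa) -mulrBl; congr (_ / _).
  by rewrite wE mulrBl /a divfK // /w; ring.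
rewrite (vgeVz dv _ _ wa vwa) addr0 vgeN //; apply: vgeMr => //.
by apply: vgeB => //; apply: vge1.
Qed.

Lemma norm_unit_notin x : x \in P 0 -> (x * conj x \in P 1) = (x \in P 1).
Proof.
move=> hx; have [->|x0] := eqVneq x 0; first by rewrite mul0r.
rewrite !vgeNz ?mulf_neq0 ?fmorph_eq0 // valM // ?fmorph_eq0 // (inert_vconj I).
by move: hx; rewrite vgeNz //; lia.
Qed.

(** Each fibre of the norm over a unit residue is empty or in bijection with the fibre over 1, so it
    has at most q + 1 elements. The q - 1 fibres exhaust the q^2 - 1 unit residues, hence all these
    bounds are attained. *)
Lemma card_norm_unit_rep i : rep i \notin P 1 -> n (rep i) = q.+1.
Proof.
have n_le j : rep j \notin P 1 -> (n (rep j) <= q.+1)%N.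
  move=> hj; have [->//|] := posnP (n (rep j)).
  rewrite /n => /card_gt0P[ij]; rewrite !inE => hij.
  set y := rep2 ij in hij; have hy : y \in P 0 := rep2_int ij.
  have yn : y \notin P 1.
    by rewrite -norm_unit_notin // -(subrK (rep j) (y * conj y)) vgeDl.
  have [y0 vy] := vge_val hy yn.
  rewrite -(card_residue_subst (x := 0) (u := y) (@norm_periodic (rep j))) ?vge0 //.
  have cy0 : conj y != 0 by rewrite fmorph_eq0.
  have vyy : v (y * conj y) = 0 by rewrite valM // (inert_vconj I) vy.
  rewrite -card_norm_one; apply/eq_leq/eq_card => l; rewrite [LHS]inE [RHS]inE add0r.
  have -> : y * conj (rep2 l) * conj (y * conj (rep2 l)) - rep j =
      y * conj y * (rep2 l * conj (rep2 l) - 1) + (y * conj y - rep j).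
    by rewrite rmorphM /= conjK; ring.
  by rewrite vgeDr // (vgeMz dv _ _ (mulf_neq0 y0 cy0) vyy) subr0.
have sum_n : (\sum_(j | rep j \notin P 1) n (rep j) = \sum_(j < q | rep j \notin P 1) q.+1)%N.
  have c1 : #|[pred j | rep j \in P 1]| = 1%N.
    rewrite -(card_affine_fixed (x := 0) (u := 1)) ?rmorph0 ?rmorph1 ?vge0 ?oner_eq0 ?val1 //.
    by apply: eq_card => j; rewrite !inE add0r mul1r.
  have c2 : #|[pred ij | rep2 ij \in P 1]| = 1%N.
    rewrite -(card_affine (x := 0) (u := 1)) ?vge0 ?oner_eq0 ?val1 //.
    by apply: eq_card => j; rewrite !inE add0r mul1r.
  rewrite sum_nat_const.
  have e1 : #|[pred j | rep j \notin P 1]| = q.-1.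
    have e := cardC [pred j | rep j \in P 1]; rewrite c1 card_ord add1n in e.
    exact: (congr1 predn e).
  have e2 : #|[pred ij | rep2 ij \notin P 1]| = (q * q).-1.
    have e := cardC [pred ij | rep2 ij \in P 1]; rewrite c2 card_prod card_ord add1n in e.
    exact: (congr1 predn e).
  rewrite (_ : #|_| = q.-1) //; have := residue_card_gt1 => q1.
  transitivity (q * q).-1; last by nia.
  rewrite -e2 -sum1_card /n.
  under eq_bigr do rewrite -sum1_card.
  rewrite (exchange_big_dep (fun ij => rep2 ij \notin P 1)) /=; last first.
    move=> j ij hj; rewrite inE => h; rewrite -norm_unit_notin ?rep2_int //.
    by rewrite -(subrK (rep j) (_ * _)) vgeDl.
  apply: eq_bigr => ij hij; rewrite sum1_card.
  have [j [hj uj]] : exists! j, rep2 ij * conj (rep2 ij) - rep j \in P 1.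
    apply: (inert_repP I (conj_norm _)).
    by apply: vgeMl => //; rewrite ?vge_conj rep2_int.
  rewrite -(card1 j); apply: eq_card => l; rewrite !inE.
  apply/andP/eqP => [[_ /uj//]|->]; split=> //.
  apply: contra hij => h; rewrite -norm_unit_notin ?rep2_int //.
  by rewrite -(subrK (rep j) (_ * _)) vgeDl.
move=> hi.
have /leqif_sum [_] : forall j : 'I_q, rep j \notin P 1 ->
    (n (rep j) <= q.+1 ?= iff (n (rep j) == q.+1))%N by move=> j /n_le; exact: leqif_eq.
by rewrite sum_n eqxx => /esym/forallP /(_ i); rewrite hi => /eqP.
Qed.

Lemma card_norm x u e : conj e = e -> e \in P 0 -> e \notin P 1 ->
  x \in P 0 -> u != 0 -> v u = 0 ->
  #|[pred ij | (x + u * conj (rep2 ij)) * conj (x + u * conj (rep2 ij)) - e \in P 1]| = q.+1.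
Proof.
move=> ce he ne hx u0 vu.
rewrite (card_residue_subst (@norm_periodic e)) //.
have [i [hi _]] := inert_repP I ce he.
rewrite -(@card_norm_unit_rep i); last first.
  by apply: contra ne => h; rewrite -(subrK (rep i) e); apply: vgeD.
apply: eq_card => ij; rewrite [LHS]inE [RHS]inE.
have -> : rep2 ij * conj (rep2 ij) - e = (rep2 ij * conj (rep2 ij) - rep i) - (e - rep i).
  by ring.
exact: vgeBr.
Qed.

End InertTheory.

(** * Schur complements and block elements of the unitary group *)

Lemma det_schur (F : fieldType) (t r : nat) (A : 'M[F]_t) (B : 'M[F]_(t, r)) (C : 'M[F]_(r, t))
    (D : 'M[F]_r) : D \in unitmx ->
  \det (block_mx A B C D) = \det D * \det (A - B *m invmx D *m C).
Proof.
move=> uD; have -> : block_mx A B C D =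
    block_mx 1%:M (B *m invmx D) 0 1%:M *m block_mx (A - B *m invmx D *m C) 0 C D.
  by rewrite mulmx_block !mul1mx !mul0mx !add0r mulmxKV // subrK.
by rewrite det_mulmx det_ublock det_lblock !det1 !mul1r mulrC.
Qed.

Section Blocks.
Variables (k : fieldType) (k' : fieldExtType k) (conj : {lrmorphism k' -> k'}).
Hypothesis conjK : forall x, conj (conj x) = x.
Local Notation ct := (conj_tr conj).
Local Notation J := (@antidiag k k').
Local Notation uact := (Defs.act conj).

Lemma ctM m n p (a : 'M[k']_(m, n)) (b : 'M[k']_(n, p)) : ct (a *m b) = ct b *m ct a.
Proof. by rewrite /conj_tr map_mxM trmx_mul. Qed.

Lemma ctK m n (a : 'M[k']_(m, n)) : ct (ct a) = a.
Proof. by apply/matrixP => i j; rewrite !mxE conjK. Qed.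

Lemma ctD m n (a b : 'M[k']_(m, n)) : ct (a + b) = ct a + ct b.
Proof. by apply/matrixP => i j; rewrite !mxE rmorphD. Qed.

Lemma ctB m n (a b : 'M[k']_(m, n)) : ct (a - b) = ct a - ct b.
Proof. by apply/matrixP => i j; rewrite !mxE rmorphB. Qed.

Lemma ct1 m : ct (1%:M : 'M[k']_m) = 1%:M.
Proof. by apply/matrixP => i j; rewrite !mxE rmorph_nat eq_sym. Qed.

Lemma ct_det m (a : 'M[k']_m) : \det (ct a) = conj (\det a).
Proof. by rewrite /conj_tr det_tr det_map_mx. Qed.

Lemma ct_inv m (a : 'M[k']_m) : ct (invmx a) = invmx (ct a).
Proof. by rewrite /conj_tr map_invmx trmx_inv. Qed.

Lemma ctJ m : ct (J m) = J m.
Proof.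
by apply/matrixP => i j; rewrite !mxE rmorph_nat eq_sym (can2_eq (@rev_ordK m) (@rev_ordK m)).
Qed.

Lemma mulJJ m : J m *m J m = 1%:M.
Proof.
apply/matrixP => i j; rewrite !mxE (bigD1 (rev_ord i)) //= !mxE eqxx mul1r.
rewrite rev_ordK eq_sym big1 ?addr0 // => l /negPf h.
by rewrite !mxE h mul0r.
Qed.

Section Block.
Variable m : nat.

Definition blk (t s : nat) : 'M[k']_(t, m) := \matrix_(a, j) (j == (s + a)%N :> nat)%:R.

Lemma blk_ord_subproof t s (H : (s + t <= m)%N) (a : 'I_t) : (s + a < m)%N.
Proof. by apply: leq_trans H; rewrite ltn_add2l. Qed.

Definition blk_ord t s (H : (s + t <= m)%N) (a : 'I_t) : 'I_m :=
  Ordinal (blk_ord_subproof H a).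

Lemma blkE t s (H : (s + t <= m)%N) : blk t s = rowsub (blk_ord H) 1%:M.
Proof. by apply/matrixP => a j; rewrite !mxE -val_eqE /= eq_sym. Qed.

Lemma blk_mul t s (H : (s + t <= m)%N) n (M : 'M[k']_(m, n)) :
  blk t s *m M = rowsub (blk_ord H) M.
Proof. by rewrite blkE mul_rowsub_mx mul1mx. Qed.

Lemma ct_blk t s : ct (blk t s) = (blk t s)^T.
Proof. by apply/matrixP => i j; rewrite !mxE rmorph_nat. Qed.

Lemma mul_blk t s (H : (s + t <= m)%N) n (M : 'M[k']_(n, m)) :
  M *m (blk t s)^T = colsub (blk_ord H) M.
Proof. by rewrite -[M *m _]trmxK trmx_mul trmxK blk_mul; apply/matrixP => i j; rewrite !mxE. Qed.

Lemma blk_disjoint t s t' s' : (s + t <= m)%N -> (s' + t' <= m)%N ->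
  (s + t <= s')%N || (s' + t' <= s)%N -> blk t s *m (blk t' s')^T = 0.
Proof.
move=> H H' d; rewrite (blk_mul H); apply/matrixP => a b.
rewrite !mxE /=; case: eqP => // e; have := ltn_ord a; have := ltn_ord b; lia.
Qed.

Lemma blk_orth t s : (s + t <= m)%N -> blk t s *m (blk t s)^T = 1%:M.
Proof.
move=> H; rewrite (blk_mul H); apply/matrixP => a b.
by rewrite !mxE /= eqn_add2l.
Qed.

Lemma blk_col t s r : blk (t + r) s = col_mx (blk t s) (blk r (s + t)).
Proof.
apply/matrixP => a j; rewrite !mxE; case: splitP => b hb; rewrite mxE hb //.
by rewrite addnA.
Qed.

Lemma blkJ t s : (s + t <= m)%N -> blk t s *m J m = J t *m blk t (m - s - t).
Proof.
move=> H; rewrite (blk_mul H); apply/matrixP => a j.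
rewrite !mxE (bigD1 (rev_ord a)) //= !mxE eqxx mul1r big1 ?addr0 => [|i hi]; last first.
  by rewrite !mxE (negPf hi) mul0r.
rewrite -val_eqE /=; congr (_ %:R); congr nat_of_bool.
have := ltn_ord a; have := ltn_ord j => lj la.
by apply/eqP/eqP; lia.
Qed.

(* The last [r] rows of the identity. *)
Definition low r := blk r (m - r).

Definition lowdet r (y : 'M[k']_m) := \det (low r *m y *m ct (low r)).

Lemma lowdet0 y : lowdet 0 y = 1.
Proof. exact: det_mx00. Qed.

Lemma dlowE (i : 'I_m./2) y : dlow i y = lowdet i.+1 y.
Proof.
have le_im : (i.+1 <= m)%N.
  by apply: leq_trans (ltn_ord i) _; rewrite -divn2 leq_div.
have H : (m - i.+1 + i.+1 <= m)%N by rewrite subnK.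
rewrite /lowdet /dlow /low ct_blk (blk_mul H) (mul_blk H); congr (\det _).
by apply/matrixP => a b; rewrite !mxE; congr (y _ _); apply: val_inj.
Qed.

(** Schur complement of the lower right block of size r inside that of size t + r: the hermitian
    form that remains on the t rows above the last r ones. *)
Definition sch t r (y : 'M[k']_m) : 'M[k']_t :=
  let E := low r in let Q := blk t (m - r - t) in
  Q *m y *m ct Q - Q *m y *m ct E *m invmx (E *m y *m ct E) *m (E *m y *m ct Q).

Lemma lowdet_sch t r y : (t + r <= m)%N -> lowdet r y != 0 ->
  lowdet (t + r) y = lowdet r y * \det (sch t r y).
Proof.
move=> H d0; rewrite /sch -det_schur ?unitmxE ?unitfE //.
rewrite /lowdet /low (_ : m - (t + r) = m - r - t)%N; last lia.
rewrite blk_col (_ : m - r - t + t = m - r)%N; last lia.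
congr (\det _); rewrite [ct (col_mx _ _)]/conj_tr map_col_mx tr_col_mx.
by rewrite mul_col_mx mul_col_row -!/(conj_tr conj _).
Qed.

Lemma sch_ct t r (y : 'M[k']_m) : ct y = y -> ct (sch t r y) = sch t r y.
Proof.
by move=> hy; rewrite /sch ctB !ctM !ctK ct_inv !ctM !ctK hy !mulmxA.
Qed.

Lemma act_ct (g y : 'M[k']_m) : ct y = y -> ct (uact g y) = uact g y.
Proof. by move=> hy; rewrite /Defs.act !ctM ctK hy mulmxA. Qed.

Lemma act_comp (g h y : 'M[k']_m) : uact g (uact h y) = uact (g *m h) y.
Proof. by rewrite /Defs.act ctM !mulmxA. Qed.

Lemma lowdet_act r (g : 'M[k']_m) U y : low r *m g = U *m low r ->
  lowdet r (uact g y) = \det U * lowdet r y * conj (\det U).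
Proof.
move=> h; rewrite /lowdet /Defs.act -ct_det -!det_mulmx; congr (\det _).
have h' : ct g *m ct (low r) = ct (low r) *m ct U by rewrite -!ctM h.
by rewrite !mulmxA h -!mulmxA h'.
Qed.

(** Reduces the action of block elements on the large matrix to the usual change of basis by h on a
    form of size t. *)
Lemma sch_act t r (g : 'M[k']_m) h y : low r *m g = low r ->
  blk t (m - r - t) *m g = h *m blk t (m - r - t) ->
  sch t r (uact g y) = h *m sch t r y *m ct h.
Proof.
move=> hE hP; rewrite /sch /Defs.act.
set E := low r in hE *; set Q := blk t _ in hP *.
have hE' : ct g *m ct E = ct E by rewrite -ctM hE.
have hP' : ct g *m ct Q = ct Q *m ct h by rewrite -!ctM hP.
have a n p (A : 'M[k']_(n, m)) A' (B : 'M[k']_(m, p)) B' : A *m g = A' -> ct g *m B = B' ->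
    A *m (g *m y *m ct g) *m B = A' *m y *m B'.
  by move=> <- <-; rewrite !mulmxA.
rewrite (a _ _ _ _ _ _ hP hP') (a _ _ _ _ _ _ hP hE') (a _ _ _ _ _ _ hE hE').
by rewrite (a _ _ _ _ _ _ hE hP') mulmxBr mulmxBl !mulmxA.
Qed.

(** When [m = t + r + r] these are the t middle rows, and the element is unitary as soon as h is
    unitary for [J t]. *)
Definition emb t r (h : 'M[k']_t) : 'M[k']_m :=
  1%:M + (blk t (m - r - t))^T *m (h - 1%:M) *m blk t (m - r - t).

Lemma emb_mid t r h : (t + r <= m)%N ->
  blk t (m - r - t) *m emb r h = h *m blk t (m - r - t).
Proof.
move=> H; rewrite /emb mulmxDr mulmx1 !mulmxA blk_orth; last lia.
by rewrite mul1mx mulmxBl mul1mx subrKC.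
Qed.

Lemma emb_low t r (h : 'M[k']_t) j : (t + r <= m)%N -> (j <= r)%N -> low j *m emb r h = low j.
Proof.
move=> H jr; rewrite /emb mulmxDr mulmx1 !mulmxA blk_disjoint ?mul0mx ?addr0 //; lia.
Qed.

Lemma emb_unitary t r h : m = (t + r + r)%N -> ct h *m J t *m h = J t ->
  ct (emb r h) *m J m *m emb r h = J m.
Proof.
move=> em uh; rewrite /emb; set Q := blk t _.
have e1 : (m - r - t = r)%N by lia.
have QQ : Q *m Q^T = 1%:M by apply: blk_orth; lia.
have QJ : Q *m J m = J t *m Q by rewrite blkJ; [congr (_ *m blk _ _); lia | lia].
have JQ : J m *m Q^T = Q^T *m J t.
  apply: (can_inj (@ctK _ _)); rewrite !ctM !ctJ -ct_blk ctK; exact: QJ.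
have cQ : ct Q = Q^T := ct_blk _ _.
have cQT : ct Q^T = Q by rewrite -cQ ctK.
have -> : ct (1%:M + Q^T *m (h - 1%:M) *m Q) = 1%:M + Q^T *m (ct h - 1%:M) *m Q.
  by rewrite ctD ct1 !ctM ctB ct1 cQ cQT mulmxA.
have [A eA] : exists A, A = ct h - 1%:M by exists (ct h - 1%:M).
have [B eB] : exists B, B = h - 1%:M by exists (h - 1%:M).
rewrite -eA -eB.
have -> : (1%:M + Q^T *m A *m Q) *m J m = J m + Q^T *m (A *m J t) *m Q.
  by rewrite mulmxDl mul1mx -(mulmxA _ Q) QJ !mulmxA.
rewrite mulmxDl !mulmxDr !mulmx1 !mulmxA JQ -!mulmxA (mulmxA Q) QQ mul1mx.
rewrite -addrA -[RHS]addr0; congr (_ + _).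
rewrite !mulmxA -!mulmxDl -!(mulmxA Q^T) -!mulmxDr.
suff -> : J t *m B + (A *m J t + A *m J t *m B) = 0 by rewrite mulmx0 mul0mx.
rewrite eA eB !(mulmxBl, mulmxBr) !mul1mx !mulmx1 uh.
by apply/matrixP => a b; rewrite !mxE; ring.
Qed.

(* The element of the Siegel-type Levi subgroup acting by [h] on the rows
   [m - r - t, m - r) and by [h' = (ct h)^-1] on the dual rows. *)
Definition levi t r (h h' : 'M[k']_t) : 'M[k']_m :=
  1%:M + (blk t (m - r - t))^T *m (h - 1%:M) *m blk t (m - r - t)
  + J m *m (blk t (m - r - t))^T *m (h' - 1%:M) *m (blk t (m - r - t) *m J m).

Section Levi.
Variables (t r : nat).
Hypothesis Hm : ((t + r).*2 <= m)%N.
Let Q := blk t (m - r - t).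

Let QQ : Q *m Q^T = 1%:M. Proof. by apply: blk_orth; lia. Qed.

Let blkJQ (t' s' : nat) : (s' + t' <= m)%N -> (r + t <= s')%N ->
  blk t' s' *m (Q *m J m)^T = 0.
Proof.
move=> H1 H2; rewrite /Q blkJ; last lia.
rewrite trmx_mul mulmxA blk_disjoint ?mul0mx //; lia.
Qed.

Let JT : (J m)^T = J m.
Proof. by rewrite -[RHS]ctJ; apply/matrixP => i j; rewrite !mxE rmorph_nat. Qed.

Let QJQ : Q *m J m *m Q^T = 0.
Proof.
have H : Q *m (Q *m J m)^T = 0 by apply: blkJQ; lia.
by rewrite -[LHS]trmxK trmx_mul trmxK H trmx0.
Qed.

Lemma levi_mid h h' : Q *m levi r h h' = h *m Q.
Proof.
have [A eA] : exists A, A = h - 1%:M by exists (h - 1%:M).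
have [B eB] : exists B, B = h' - 1%:M by exists (h' - 1%:M).
rewrite /levi -/Q -eA -eB !mulmxDr mulmx1 !mulmxA QQ mul1mx QJQ !mul0mx addr0.
by rewrite eA mulmxBl mul1mx subrKC.
Qed.

Lemma levi_low (h h' : 'M[k']_t) j : (j <= r)%N -> low j *m levi r h h' = low j.
Proof.
have [A eA] : exists A, A = h - 1%:M by exists (h - 1%:M).
have [B eB] : exists B, B = h' - 1%:M by exists (h' - 1%:M).
move=> jr; rewrite /levi -/Q -eA -eB !mulmxDr mulmx1 !mulmxA.
rewrite (_ : low j *m Q^T = 0); last by rewrite blk_disjoint //; lia.
rewrite (_ : low j *m J m *m Q^T = 0); first by rewrite !mul0mx !addr0.
by rewrite -mulmxA -[J m]JT -trmx_mul blkJQ //; lia.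
Qed.

(** Since 2j <= m, the last j rows avoid the dual rows altered by h'; since j >= t + r, they contain
    the rows on which h acts. So their span is stable. *)
Lemma levi_high (h h' : 'M[k']_t) j : (t + r <= j)%N -> (j.*2 <= m)%N ->
  exists U, low j *m levi r h h' = U *m low j.
Proof.
move=> H1 H2.
have [W QW] : exists W, Q = W *m low j.
  exists (\matrix_(a, b) (m - r - t + a == m - j + b)%N%:R).
  apply/matrixP => a i; rewrite !mxE.
  have la := ltn_ord a; have lj : (a + j - r - t < j)%N by lia.
  rewrite (bigD1 (Ordinal lj)) //= big1 => [|b hb]; last first.
    rewrite !mxE; case: eqP => e; last by rewrite mul0r.
    by case/eqP: hb; apply: val_inj => /=; lia.
  rewrite !mxE /= addr0.
  have -> : (m - r - t + a == m - j + (a + j - r - t))%N = true by apply/eqP; lia.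
  rewrite mul1r.
  by congr (_ %:R); congr nat_of_bool; apply/eqP/eqP; lia.
exists (1%:M + low j *m Q^T *m (h - 1%:M) *m W).
have [A eA] : exists A, A = h - 1%:M by exists (h - 1%:M).
have [B eB] : exists B, B = h' - 1%:M by exists (h' - 1%:M).
rewrite /levi -/Q -eA -eB !mulmxDr mulmx1 mulmxDl mul1mx !mulmxA.
rewrite (_ : low j *m J m *m Q^T = 0); last first.
  by rewrite -mulmxA -[J m]JT -trmx_mul blkJQ //; lia.
by rewrite !mul0mx addr0 -[RHS]/(_ + _) -!mulmxA -QW.
Qed.

Lemma levi_unitary (h h' : 'M[k']_t) : ct h *m h' = 1%:M -> ct (levi r h h') *m J m *m levi r h h' = J m.
Proof.
move=> hh'; have h'h : ct h' *m h = 1%:M by rewrite -[h]ctK -ctM hh' ct1.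
rewrite /levi -/Q.
have [A eA] : exists A, A = h - 1%:M by exists (h - 1%:M).
have [B eB] : exists B, B = h' - 1%:M by exists (h' - 1%:M).
have [A' eA'] : exists A', A' = ct h - 1%:M by exists (ct h - 1%:M).
have [B' eB'] : exists B', B' = ct h' - 1%:M by exists (ct h' - 1%:M).
have [c ec] : exists c, c = Q *m J m by exists (Q *m J m).
have [d ed] : exists d, d = J m *m Q^T by exists (J m *m Q^T).
have cQ : ct Q = Q^T := ct_blk _ _.
have cQT : ct Q^T = Q by rewrite -cQ ctK.
have cc : ct c = d by rewrite ec ed ctM ctJ cQ.
have cd : ct d = c by rewrite -cc ctK.
rewrite -eA -eB -ec -ed.
have -> : ct (1%:M + Q^T *m A *m Q + d *m B *m c) = 1%:M + Q^T *m A' *m Q + d *m B' *m c.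
  by rewrite !ctD ct1 !ctM cQ cQT cc cd eA eB !ctB ct1 -eA' -eB' !mulmxA.
have -> : (1%:M + Q^T *m A' *m Q + d *m B' *m c) *m J m = J m + Q^T *m A' *m c + d *m B' *m Q.
  have cJ : c *m J m = Q by rewrite ec -mulmxA mulJJ mulmx1.
  by rewrite !mulmxDl mul1mx -!mulmxA -ec cJ.
have JQ : J m *m Q^T = d by [].
have Jd : J m *m d = Q^T by rewrite ed mulmxA mulJJ mul1mx.
have cQ0 n (X : 'M[k']_(t, n)) : c *m (Q^T *m X) = 0 by rewrite mulmxA ec QJQ mul0mx.
have cd1 n (X : 'M[k']_(t, n)) : c *m (d *m X) = X.
  by rewrite ec ed mulmxA (mulmxA (Q *m J m)) -(mulmxA Q) mulJJ mulmx1 QQ mul1mx.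
have Qd n (X : 'M[k']_(t, n)) : Q *m (d *m X) = 0 by rewrite ed !mulmxA QJQ !mul0mx.
have QQ1 n (X : 'M[k']_(t, n)) : Q *m (Q^T *m X) = X by rewrite mulmxA QQ mul1mx.
rewrite !mulmxDl !mulmxDr !mulmx1 !(mulmxA (J m)) JQ Jd -!mulmxA.
rewrite !(cQ0, cd1, Qd, QQ1) !mulmx0 !addr0.
(* In terms of the differences from the identity, the relation [ct h *m h' = 1] reads B + A' + A' B
   = 0. *)
have e1 : Q^T *m (B *m c) + Q^T *m (A' *m c) + Q^T *m (A' *m (B *m c)) = 0.
  have z : B + A' + A' *m B = 0.
    rewrite eB eA' !(mulmxBl, mulmxBr) !mul1mx !mulmx1 hh'.
    by apply/matrixP => i j; rewrite !mxE; ring.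
  by rewrite (mulmxA A') -!mulmxDr -!mulmxDl z mul0mx mulmx0.
have e2 : d *m (A *m Q) + d *m (B' *m Q) + d *m (B' *m (A *m Q)) = 0.
  have z : A + B' + B' *m A = 0.
    rewrite eA eB' !(mulmxBl, mulmxBr) !mul1mx !mulmx1 h'h.
    by apply/matrixP => i j; rewrite !mxE; ring.
  by rewrite (mulmxA B') -!mulmxDr -!mulmxDl z mul0mx mulmx0.
have ac (V : zmodType) (x1 x2 x3 x4 x5 x6 x7 : V) :
    x1 + x5 + x2 + (x3 + x4) + (x6 + x7) = x1 + (x2 + x3 + x4) + (x5 + x6 + x7).
  by rewrite !addrA [LHS](ACl (1*3*4*5*2*6*7)).
by rewrite ac e1 e2 !addr0.
Qed.

End Levi.

End Block.
End Blocks.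

(** * Schur complements of unitary hermitian matrices *)

Lemma mulmx1C_cast (F : fieldType) (n m : nat) (A : 'M[F]_(n, m)) (B : 'M[F]_(m, n)) :
  n = m -> A *m B = 1%:M -> B *m A = 1%:M.
Proof. by move=> e; case: _ / e A B; exact: mulmx1C. Qed.

Lemma mxtrace_antidiag (k : fieldType) (k' : fieldExtType k) m :
  \tr (antidiag m : 'M[k']_m) = (odd m)%:R.
Proof.
rewrite /mxtrace; have [om|em] := boolP (odd m); last first.
  rewrite big1 // => i _; rewrite mxE -val_eqE /=.
  by case: eqP => // e; have := ltn_ord i; move: em; lia.
have lt : (m./2 < m)%N by move: om; lia.
rewrite (bigD1 (Ordinal lt)) //= big1 ?addr0 => [|i hi]; rewrite !mxE -val_eqE /=.
  by case: eqP => // e; exfalso; move: om e; lia.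
case: eqP => // e; case/eqP: hi; apply: val_inj => /=.
by have := ltn_ord i; move: om e; lia.
Qed.

Section UnitaryBlocks.
Variables (k : fieldType) (k' : fieldExtType k) (conj : {lrmorphism k' -> k'}).
Hypothesis conjK : forall x, conj (conj x) = x.
Local Notation ct := (conj_tr conj).
Local Notation J := (@antidiag k k').

Lemma ct_inj n p : injective (fun a : 'M[k']_(n, p) => ct a).
Proof. exact: can_inj (@ctK _ _ _ conjK n p). Qed.

Lemma ct0 n p : ct (0 : 'M[k']_(n, p)) = 0.
Proof. by rewrite /conj_tr map_mx0 trmx0. Qed.

Section Schur.
Variables (m t r : nat).
Hypothesis em : m = (t + r + r)%N.
Variable y : 'M[k']_m.
Hypothesis cy : ct y = y.
Hypothesis yJy : y *m J m *m y = J m.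
Hypothesis d0 : lowdet conj r y != 0.

Let E : 'M[k']_(r, m) := low k' m r.
Let Q : 'M[k']_(t, m) := blk k' m t (m - r - t).
Let D := E *m y *m ct E.
(** The rows Q made y-orthogonal to E. As E is J-isotropic and J-orthogonal to Q, correcting Q by
    multiples of E leaves its J-Gram matrix unchanged. *)
Let Ph := Q - Q *m y *m ct E *m invmx D *m E.

Let uD : D \in unitmx. Proof. by rewrite unitmxE unitfE. Qed.
Let cD : ct D = D. Proof. by rewrite /D !ctM ctK // cy !mulmxA. Qed.
Let cDi : ct (invmx D) = invmx D. Proof. by rewrite ct_inv cD. Qed.

Let EJE : E *m J m *m ct E = 0.
Proof.
rewrite /E /low blkJ ?ct_blk; last lia.
by rewrite -mulmxA blk_disjoint ?mulmx0 //; lia.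
Qed.

Let EJQ : E *m J m *m ct Q = 0.
Proof.
rewrite /E /low blkJ ?ct_blk; last lia.
by rewrite -mulmxA blk_disjoint ?mulmx0 //; lia.
Qed.

Let QJE : Q *m J m *m ct E = 0.
Proof. by apply: ct_inj; rewrite !ctM ctK // ctJ mulmxA EJQ ct0. Qed.

Let QJQ : Q *m J m *m ct Q = J t.
Proof.
rewrite /Q blkJ ?ct_blk; last lia.
rewrite (_ : m - (m - r - t) - t = m - r - t)%N; last lia.
by rewrite -mulmxA blk_orth ?mulmx1 //; lia.
Qed.

Let PyE : Ph *m y *m ct E = 0.
Proof. by rewrite /Ph !mulmxBl -!(mulmxA _ E) -!(mulmxA _ (E *m y)) mulmxKV // subrr. Qed.

Let PJE : Ph *m J m *m ct E = 0.
Proof. by rewrite /Ph !mulmxBl QJE -!(mulmxA _ E) -!(mulmxA _ (E *m J m)) EJE mulmx0 subr0. Qed.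

Let cPh : ct Ph = ct Q - ct E *m invmx D *m (E *m y *m ct Q).
Proof. by rewrite /Ph ctB !ctM ctK // cDi cy !mulmxA. Qed.

Let PJP : Ph *m J m *m ct Ph = J t.
Proof.
rewrite cPh mulmxBr !mulmxA PJE !mul0mx subr0 /Ph !mulmxBl QJQ.
by rewrite -!(mulmxA _ E) -!(mulmxA _ (E *m J m)) EJQ mulmx0 subr0.
Qed.

Let PyP : Ph *m y *m ct Ph = sch conj t r y.
Proof.
rewrite cPh mulmxBr !mulmxA PyE !mul0mx subr0 /Ph !mulmxBl.
by rewrite /sch -/E -/Q -/D !mulmxA.
Qed.

Let projected (P : 'M[k']_(t, m)) := [/\ P *m y *m ct E = 0, P *m J m *m ct E = 0,
  P *m J m *m ct P = J t & P *m y *m ct P = sch conj t r y].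

Let projected_ex : exists P, projected P. Proof. by exists Ph; split. Qed.

(* [P] spans the common orthogonal of [E] for the forms [y] and [J], and
   [E], [E y J] span its [J]-orthogonal. *)
Let resolution P : projected P -> J m *m ct P *m J t *m P + (y *m ct E *m invmx D *m E +
   J m *m ct E *m invmx D *m (E *m y *m J m)) = 1%:M.
Proof.
case=> hPyE hPJE hPJP _.
have EJP : E *m J m *m ct P = 0.
  by apply: ct_inj; rewrite !ctM ctK // ctJ mulmxA hPJE ct0.
have EyP : E *m y *m ct P = 0.
  by apply: ct_inj; rewrite !ctM ctK // cy mulmxA hPyE ct0.
(* The second matrix is checked to be a right inverse of the square matrix with rows P, E, E y J;
   being also a left inverse, it gives the claimed decomposition of the identity. *)
have H := @mulmx1C_cast _ (t + (r + r)) m (col_mx P (col_mx E (E *m y *m J m)))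
  (row_mx (J m *m ct P *m J t) (row_mx (y *m ct E *m invmx D) (J m *m ct E *m invmx D))).
rewrite -H ?mul_row_col ?mulmxA //; first lia.
have JJ n (X : 'M[k']_(n, m)) : X *m J m *m J m = X by rewrite -mulmxA mulJJ mulmx1.
have yJyE n (X : 'M[k']_(n, m)) : X *m y *m J m *m y = X *m J m.
  by rewrite -!mulmxA (mulmxA y) yJy.
rewrite mul_col_mx mul_col_mx !mul_mx_row !mulmxA !JJ !yJyE.
rewrite hPJP hPyE hPJE EJP EJE EyP !mul0mx -/D mulJJ mulmxV //.
rewrite row_mx0 -[X in col_mx _ X]/(block_mx _ _ _ _) block_mxEh col_mx0.
by rewrite -[X in row_mx 0 X]/(block_mx _ _ _ _) -scalar_mx_block -/(block_mx _ _ _ _) -scalar_mx_block.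
Qed.

Lemma sch_unitary : sch conj t r y *m J t *m sch conj t r y = J t.
Proof.
have [P hP] := projected_ex; have res := resolution hP; case: hP => hPyE hPJE hPJP hPyP.
have e : ct P *m J t *m P = J m - J m *m (y *m ct E *m invmx D *m E +
   J m *m ct E *m invmx D *m (E *m y *m J m)).
  apply: (can_inj (mulKmx (_ : J m \in unitmx))).
    by case/mulmx1_unit: (mulJJ k' m).
  rewrite mulmxBr (mulmxA (J m) (J m)) mulJJ mul1mx -res !mulmxA.
  by rewrite addrK.
rewrite -{1}hPyP -hPyP -!mulmxA (mulmxA (ct P)) (mulmxA (ct P *m J t)) e.
rewrite !mulmxA mulmxBr mulmxDr !mulmxA.
have JJ n (X : 'M[k']_(n, m)) : X *m J m *m J m = X by rewrite -mulmxA mulJJ mulmx1.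
have yJyE n (X : 'M[k']_(n, m)) : X *m y *m J m *m y = X *m J m.
  by rewrite -!mulmxA (mulmxA y) yJy.
rewrite mulmxBl mulmxDr mulmxDl !mulmxA !JJ !yJyE hPJE hPyE !mul0mx addr0 subr0.
exact: hPJP.
Qed.

(** Inserting the decomposition of the identity splits tr(y J) into the trace on the middle part and
    terms that cyclic invariance turns into multiples of E J [ct E], which is 0. *)
Lemma sch_trace : \tr (sch conj t r y *m J t) = \tr (y *m J m).
Proof.
have [P hP] := projected_ex; have res := resolution hP; case: hP => hPyE hPJE hPJP hPyP.
rewrite -[y *m J m]mulmx1 -res !mulmxDr !mxtraceD !mulmxA.
have JJ n (X : 'M[k']_(n, m)) : X *m J m *m J m = X by rewrite -mulmxA mulJJ mulmx1.
have yJyE : y *m J m *m y = J m by [].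
have e1 : \tr (y *m ct P *m J t *m P) = \tr (sch conj t r y *m J t).
  by rewrite mxtrace_mulC -hPyP !mulmxA.
have e2 : \tr (J m *m ct E *m invmx D *m E) = 0.
  by rewrite mxtrace_mulC !mulmxA EJE !mul0mx mxtrace0.
have e3 : \tr (y *m ct E *m invmx D *m E *m y *m J m) = 0.
  transitivity (\tr (y *m ct E *m invmx D *m (E *m y *m J m))); first by rewrite !mulmxA.
  have EyJy : E *m y *m J m *m y = E *m J m by rewrite -!mulmxA (mulmxA y) yJyE.
  by rewrite mxtrace_mulC !mulmxA EyJy EJE !mul0mx mxtrace0.
by rewrite !JJ yJyE e1 e2 e3 !addr0.
Qed.

End Schur.

(** The trace is the coefficient of the characteristic polynomial next to the leading one, up to
    sign; later it forces the eigenvalue -1 of the middle block to have multiplicity one. *)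
Lemma unitary_hermitian_facts m x : unitary_hermitian conj m x ->
  [/\ ct x = x, x *m J m *m x = J m & \tr (x *m J m) = (odd m)%:R].
Proof.
case=> -[_ xx] cx e; split=> //; first by rewrite -{1}cx.
rewrite -(mxtrace_antidiag k' m); case: m x xx cx e => [|m] x xx cx e.
  by rewrite /mxtrace !big_ord0.
by apply: oppr_inj; rewrite -!char_poly_trace // e.
Qed.

Lemma unitary_unit m g : ct g *m J m *m g = J m -> g \in unitmx /\ invmx g = J m *m ct g *m J m.
Proof.
move=> h; have h2 : (J m *m ct g *m J m) *m g = 1%:M by rewrite -!mulmxA (mulmxA (ct g)) h mulJJ.
have [_ u] := mulmx1_unit h2; split=> //.
by rewrite -[LHS]mul1mx -h2 mulmxK.
Qed.

Lemma unitary_ct m g : ct g *m J m *m g = J m -> g *m J m *m ct g = J m.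
Proof.
move=> h; have [u e] := unitary_unit h.
have : g *m (J m *m ct g *m J m) = 1%:M by rewrite -e mulmxV.
move/(congr1 (fun a => a *m J m)); rewrite mul1mx => {2}<-.
by rewrite -!mulmxA mulJJ mulmx1.
Qed.

Lemma act_unitary m g x : ct g *m J m *m g = J m -> x *m J m *m x = J m ->
  Defs.act conj g x *m J m *m Defs.act conj g x = J m.
Proof.
move=> hg hx; rewrite /Defs.act -!mulmxA (mulmxA (ct g)) (mulmxA (ct g *m J m)) hg.
by rewrite (mulmxA x) (mulmxA (x *m J m)) hx mulmxA unitary_ct.
Qed.

Lemma act_trace m g x : ct g *m J m *m g = J m ->
  \tr (Defs.act conj g x *m J m) = \tr (x *m J m).
Proof.
move=> hg; rewrite /Defs.act -!mulmxA mxtrace_mulC -!mulmxA; congr (\tr (x *m _)).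
by rewrite mulmxA.
Qed.

End UnitaryBlocks.

(** * Integral unitary elements *)

Section Integral.
Variables (k : fieldType) (k' : fieldExtType k) (conj : {lrmorphism k' -> k'}).
Variables (v : k' -> int) (q : nat) (pi theta : k') (rep : 'I_q -> k').
Hypothesis I : inert conj v pi theta rep.
Local Notation P := (vge v).
Local Notation ct := (conj_tr conj).
Local Notation J := (@antidiag k k').
Let dv := inert_dv I.
Let conjK := inert_conjK I.

Definition mxge (N : int) m n (A : 'M[k']_(m, n)) := forall i j, A i j \in P N.

Lemma mxgeD N m n (A B : 'M[k']_(m, n)) : mxge N A -> mxge N B -> mxge N (A + B).
Proof. by move=> hA hB i j; rewrite mxE; apply: vgeD. Qed.

Lemma mxgeB N m n (A B : 'M[k']_(m, n)) : mxge N A -> mxge N B -> mxge N (A - B).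
Proof. by move=> hA hB i j; rewrite !mxE; apply: vgeB. Qed.

Lemma mxgeM N M m n p (A : 'M[k']_(m, n)) (B : 'M[k']_(n, p)) :
  mxge N A -> mxge M B -> mxge (N + M) (A *m B).
Proof. by move=> hA hB i j; rewrite mxE; apply: vge_sum => // l _; apply: vgeM. Qed.

Lemma mxgeMl N m n p (A : 'M[k']_(m, n)) (B : 'M[k']_(n, p)) :
  mxge 0 A -> mxge N B -> mxge N (A *m B).
Proof. by move=> hA hB; rewrite -[N]add0r; apply: mxgeM. Qed.

Lemma mxgeMr N m n p (A : 'M[k']_(m, n)) (B : 'M[k']_(n, p)) :
  mxge N A -> mxge 0 B -> mxge N (A *m B).
Proof. by move=> hA hB; rewrite -[N]addr0; apply: mxgeM. Qed.

Lemma mxge_ct N m n (A : 'M[k']_(m, n)) : mxge N A -> mxge N (ct A).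
Proof. by move=> hA i j; rewrite !mxE (vge_conj I). Qed.

Lemma mxge_tr N m n (A : 'M[k']_(m, n)) : mxge N A -> mxge N A^T.
Proof. by move=> hA i j; rewrite mxE. Qed.

Lemma mxge1 m : mxge 0 (1%:M : 'M[k']_m).
Proof. by move=> i j; rewrite mxE; apply: vge_nat. Qed.

Lemma mxgeJ m : mxge 0 (J m).
Proof. by move=> i j; rewrite mxE; apply: vge_nat. Qed.

Lemma mxge_blk m t s : mxge 0 (blk k' m t s).
Proof. by move=> i j; rewrite mxE; apply: vge_nat. Qed.

Lemma mxge_le N M m n (A : 'M[k']_(m, n)) : M <= N -> mxge N A -> mxge M A.
Proof. by move=> h hA i j; apply: vge_le (hA i j). Qed.

Lemma vge_det m (A : 'M[k']_m) : mxge 0 A -> \det A \in P 0.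
Proof.
move=> hA; apply: vge_sum => // s _; apply: vgeMl => //; last by apply: vge_prod.
by rewrite -signr_odd; case: (odd _); rewrite ?expr1 ?vgeN // vge1.
Qed.

Lemma mxge_ex m n (A : 'M[k']_(m, n)) : exists N : nat, mxge (- N%:Z) A.
Proof.
have h i j : exists N : nat, A i j \in P (- N%:Z).
  have [N hN] := vge_ex v (A i j); exists `|N|%N; apply: vge_le hN; lia.
have /choice[f hf] : forall ij, exists N : nat, A ij.1 ij.2 \in P (- N%:Z) by move=> ij; exact: h.
exists (\max_ij f ij)%N => i j; apply: vge_le (hf (i, j)).
by rewrite lerN2 lez_nat; apply: leq_bigmax.
Qed.

Section Group.
Variable m : nat.
Local Notation K := (unitary_integral conj v m).

Lemma unitary_integralP (g : 'M[k']_m) : ct g *m J m *m g = J m -> mxge 0 g -> K g.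
Proof. by move=> h hg; split=> //; split=> //; case: (unitary_unit h). Qed.

Lemma K_unitary g : K g -> ct g *m J m *m g = J m. Proof. by case=> -[]. Qed.
Lemma K_int g : K g -> mxge 0 g. Proof. by case. Qed.

Lemma K_inv g : K g -> [/\ K (J m *m ct g *m J m), g *m (J m *m ct g *m J m) = 1%:M
  & J m *m ct g *m J m *m g = 1%:M].
Proof.
move=> Kg; have hg := K_unitary Kg; have [u e] := unitary_unit hg; rewrite -e.
split; [|by rewrite mulmxV|by rewrite mulVmx].
apply: unitary_integralP.
  rewrite e !ctM !ctJ ctK // !mulmxA -(mulmxA (J m *m g)) mulJJ mulmx1.
  rewrite -!mulmxA (mulmxA g) (mulmxA (g *m J m)) (unitary_ct hg).
  by rewrite mulJJ mulmx1.
rewrite e; apply: mxgeMr; last exact: mxgeJ.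
by apply: mxgeMl; [exact: mxgeJ | apply/mxge_ct/K_int].
Qed.

Lemma K_mul g h : K g -> K h -> K (g *m h).
Proof.
move=> Kg Kh; apply: unitary_integralP; last by apply: mxgeMl; apply: K_int.
by rewrite ctM -!mulmxA (mulmxA (ct g)) (mulmxA (ct g *m _)) (K_unitary Kg) mulmxA K_unitary.
Qed.

Lemma emb_K t r (h : 'M[k']_t) : m = (t + r + r)%N -> ct h *m J t *m h = J t ->
  mxge 0 h -> K (emb m r h).
Proof.
move=> em hu hi; apply: unitary_integralP; first exact: emb_unitary.
apply: mxgeD; first exact: mxge1.
apply: mxgeMl; last exact: mxge_blk.
apply: mxgeMl; first exact/mxge_tr/mxge_blk.
by apply: mxgeB => //; exact: mxge1.
Qed.

Lemma levi_K t r (h h' : 'M[k']_t) : ((t + r).*2 <= m)%N -> ct h *m h' = 1%:M ->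
  mxge 0 h -> mxge 0 h' -> K (levi m r h h').
Proof.
move=> em hu hi hi'; apply: unitary_integralP; first exact: levi_unitary.
have B : mxge 0 (blk k' m t (m - r - t)) by exact: mxge_blk.
have O : mxge 0 (1%:M : 'M[k']_t) by exact: mxge1.
apply: mxgeD; first apply: mxgeD; first exact: mxge1.
  by do ![apply: mxgeMl | apply: mxge_tr | apply: mxgeB].
by do ![apply: mxgeMl | apply: mxge_tr | apply: mxgeB | apply: mxgeJ].
Qed.

(** g acts on the span of the last j rows by an integral matrix U, and the inverse of g provides an
    integral inverse of U; so det U is a unit and d_j changes by its norm. *)
Lemma lowdet_act_val (g x : 'M[k']_m) j U : K g -> (j <= m)%N ->
  low k' m j *m g = U *m low k' m j ->
  (lowdet conj j (Defs.act conj g x) != 0) = (lowdet conj j x != 0) /\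
  v (lowdet conj j (Defs.act conj g x)) = v (lowdet conj j x).
Proof.
move=> Kg jm hU.
have [g' [Kg' gg']] : exists g', K g' /\ g *m g' = 1%:M by have [h1 h2 _] := K_inv Kg; exists (J m *m ct g *m J m).
set E := low k' m j in hU.
have EE : E *m E^T = 1%:M by apply: blk_orth; lia.
have UE : U = E *m g *m E^T by rewrite hU -mulmxA EE mulmx1.
have iE : mxge 0 E by exact: mxge_blk.
have iU : mxge 0 U.
  by rewrite UE; apply: mxgeMl; [apply: mxgeMl => //; exact: K_int | exact: mxge_tr].
have uU : U *m (E *m g' *m E^T) = 1%:M by rewrite !mulmxA -hU -(mulmxA E g) gg' mulmx1.
have iU' : mxge 0 (E *m g' *m E^T).
  by apply: mxgeMl; [apply: mxgeMl => //; exact: K_int | exact: mxge_tr].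
have [d0 vd] : \det U != 0 /\ v (\det U) = 0.
  have e : \det U * \det (E *m g' *m E^T) = 1 by rewrite -det_mulmx uU det1.
  have d0 : \det U != 0 by apply: contra_eq_neq e => ->; rewrite mul0r eq_sym oner_eq0.
  split=> //; have d0' : \det (E *m g' *m E^T) != 0.
    by apply: contra_eq_neq e => ->; rewrite mulr0 eq_sym oner_eq0.
  have := vge_det iU; have := vge_det iU'; rewrite !vgeNz //.
  by have := congr1 v e; rewrite valM // val1 //; lia.
have cd0 : conj (\det U) != 0 by rewrite fmorph_eq0.
rewrite (lowdet_act _ _ hU) !mulf_eq0 (negPf d0) (negPf cd0) orbF; split=> //.
have [->|l0] := eqVneq (lowdet conj j x) 0; first by rewrite mulr0 mul0r.
by rewrite !valM ?mulf_neq0 // (inert_vconj I) vd addr0 add0r.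
Qed.

End Group.
End Integral.

(** * Continuity of minors and Schur complements *)

Section AdicContinuity.
Variables (k : fieldType) (k' : fieldExtType k) (conj : {lrmorphism k' -> k'}).
Variables (v : k' -> int) (q : nat) (pi theta : k') (rep : 'I_q -> k').
Hypothesis I : inert conj v pi theta rep.
Local Notation P := (vge v).
Local Notation ct := (conj_tr conj).
Let dv := inert_dv I.
Variable m : nat.
Variable a : 'M[k']_m.

Definition acont (f : 'M[k']_m -> k') := forall N, exists M,
  forall b, mxge v M (b - a) -> f b - f a \in P N.

Lemma acont_cst c : acont (fun=> c).
Proof. by move=> N; exists 0 => b _; rewrite subrr vge0. Qed.

Lemma acont_coord i j : acont (fun b => b i j).
Proof. by move=> N; exists N => b /(_ i j); rewrite !mxE. Qed.

Lemma acont_conj f : acont f -> acont (fun b => conj (f b)).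
Proof.
move=> h N; have [M hM] := h N; exists M => b hb.
by rewrite -rmorphB /= (vge_conj I); apply: hM.
Qed.

Lemma acontD f g : acont f -> acont g -> acont (fun b => f b + g b).
Proof.
move=> hf hg N; have [M hM] := hf N; have [M' hM'] := hg N.
exists (Num.max M M') => b hb.
have -> : f b + g b - (f a + g a) = (f b - f a) + (g b - g a) by ring.
apply: vgeD => //; [apply: hM | apply: hM']; apply: mxge_le hb.
  by rewrite le_max lexx.
by rewrite le_max lexx orbT.
Qed.

Lemma acontM f g : acont f -> acont g -> acont (fun b => f b * g b).
Proof.
move=> hf hg N; have [c hc] := vge_ex v (f a); have [d hd] := vge_ex v (g a).
have [M hM] := hf (Num.max c (N - d)); have [M' hM'] := hg (N - c).
exists (Num.max M M') => b hb.
have -> : f b * g b - f a * g a = f b * (g b - g a) + (f b - f a) * g a by ring.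
have h1 : f b - f a \in P (Num.max c (N - d)).
  by apply: hM; apply: mxge_le hb; rewrite le_max lexx.
have h2 : g b - g a \in P (N - c).
  by apply: hM'; apply: mxge_le hb; rewrite le_max lexx orbT.
apply: vgeD => //.
  rewrite -(subrKC c N); apply: vgeM => //.
  rewrite -(subrK (f a) (f b)); apply: vgeD => //; apply: vge_le h1.
  by rewrite le_max lexx.
by rewrite -(subrK d N); apply: vgeM => //; apply: vge_le h1; rewrite le_max lexx orbT.
Qed.

Lemma acontN f : acont f -> acont (fun b => - f b).
Proof.
move=> h N; have [M hM] := h N; exists M => b hb.
by rewrite -opprD vgeN // -[- f a]opprK opprK; apply: hM.
Qed.

Lemma acont_sum (T : Type) (r : seq T) (Q : pred T) (F : T -> 'M[k']_m -> k') :
  (forall i, Q i -> acont (F i)) -> acont (fun b => \sum_(i <- r | Q i) F i b).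
Proof.
move=> h; elim: r => [|i r IH].
  by move=> N; exists 0 => b _; rewrite !big_nil subrr vge0.
have [Qi|Qi] := boolP (Q i); move=> N.
  have [M hM] := acontD (h i Qi) IH N.
  by exists M => b /hM; rewrite !big_cons Qi.
by have [M hM] := IH N; exists M => b /hM; rewrite !big_cons (negPf Qi).
Qed.

Lemma acont_prod (T : Type) (r : seq T) (F : T -> 'M[k']_m -> k') :
  (forall i, acont (F i)) -> acont (fun b => \prod_(i <- r) F i b).
Proof.
move=> h; elim: r => [|i r IH].
  by move=> N; exists 0 => b _; rewrite !big_nil subrr vge0.
move=> N; have [M hM] := acontM (h i) IH N.
by exists M => b /hM; rewrite !big_cons.
Qed.

Lemma acontV f : f a != 0 -> acont f -> acont (fun b => (f b)^-1).
Proof.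
move=> f0 hf N; pose c := v (f a).
have [M hM] := hf (Num.max (c + 1) (N + c + c)).
exists M => b /hM h.
have h1 : f b - f a \in P (c + 1) by apply: vge_le h; rewrite le_max lexx.
have h2 : f b - f a \in P (N + c + c) by apply: vge_le h; rewrite le_max lexx orbT.
have [fb0 vfb] : f b != 0 /\ v (f b) = c.
  by rewrite -(subrKC (f a) (f b)); apply: val_eqD.
have -> : (f b)^-1 - (f a)^-1 = - (f b - f a) / f a / f b.
  by field; rewrite f0 fb0.
by rewrite (vgeVz dv _ _ fb0 vfb) (vgeVz dv _ _ f0 (erefl c)) vgeN.
Qed.

Definition macont n p (F : 'M[k']_m -> 'M[k']_(n, p)) := forall i j, acont (fun b => F b i j).

Lemma eq_acont f g : f =1 g -> acont f -> acont g.
Proof. by move=> e h N; have [M hM] := h N; exists M => b /hM; rewrite !e. Qed.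

Lemma macont_cst n p (A : 'M[k']_(n, p)) : macont (fun=> A).
Proof. by move=> i j; apply: acont_cst. Qed.

Lemma macont_id : macont (fun b => b).
Proof. by move=> i j; apply: acont_coord. Qed.

Lemma macont_ct n p (F : 'M[k']_m -> 'M[k']_(n, p)) : macont F -> macont (fun b => ct (F b)).
Proof.
move=> h i j; apply: (@eq_acont (fun b => conj (F b j i))).
  by move=> b; rewrite !mxE.
by apply: acont_conj.
Qed.

Lemma macontM n p l (F : 'M[k']_m -> 'M[k']_(n, p)) (G : 'M[k']_m -> 'M[k']_(p, l)) :
  macont F -> macont G -> macont (fun b => F b *m G b).
Proof.
move=> hF hG i j; apply: (@eq_acont (fun b => \sum_u F b i u * G b u j)).
  by move=> b; rewrite !mxE.
by apply: acont_sum => u _; apply: acontM.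
Qed.

Lemma macontB n p (F G : 'M[k']_m -> 'M[k']_(n, p)) :
  macont F -> macont G -> macont (fun b => F b - G b).
Proof.
move=> hF hG i j; apply: (@eq_acont (fun b => F b i j - G b i j)).
  by move=> b; rewrite !mxE.
by apply: acontD => //; apply: acontN.
Qed.

Lemma acont_det n (F : 'M[k']_m -> 'M[k']_n) : macont F -> acont (fun b => \det (F b)).
Proof.
move=> h; apply: acont_sum => s _; apply: acontM; first exact: acont_cst.
by apply: acont_prod => i.
Qed.

Lemma macont_adj n (F : 'M[k']_m -> 'M[k']_n) : macont F -> macont (fun b => \adj (F b)).
Proof.
move=> h i j; apply: (@eq_acont (fun b => cofactor (F b) j i)).
  by move=> b; rewrite mxE.
apply: acontM; first exact: acont_cst.
apply: acont_det => x y.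
apply: (@eq_acont (fun b => F b (lift j x) (lift i y))) => // b.
by rewrite !mxE.
Qed.

Lemma macont_inv n (F : 'M[k']_m -> 'M[k']_n) : \det (F a) != 0 -> macont F ->
  macont (fun b => invmx (F b)).
Proof.
move=> d0 h i j N.
have [M hM] := acontM (acontV d0 (acont_det h)) (macont_adj h i j) N.
have [M' hM'] := acont_det h (v (\det (F a)) + 1).
exists (Num.max M M') => b hb.
have nz : \det (F b) != 0.
  rewrite -(subrKC (\det (F a)) (\det (F b))).
  have [] // := @val_eqD _ _ dv _ _ (\det (F b) - \det (F a)) d0 (erefl _).
  by apply: hM'; apply: mxge_le hb; rewrite le_max lexx orbT.
rewrite /invmx !unitmxE !unitfE d0 nz !mxE -!/(cofactor _ _ _).
have := hM b; rewrite !mxE; apply.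
by apply: mxge_le hb; rewrite le_max lexx.
Qed.

Lemma acont_lowdet r x : acont (fun h => lowdet conj r (Defs.act conj h x)).
Proof.
apply: acont_det; apply: macontM; last exact: macont_cst.
apply: macontM; first exact: macont_cst.
apply: macontM; last by apply: macont_ct; apply: macont_id.
by apply: macontM; [apply: macont_id | apply: macont_cst].
Qed.

Lemma macont_sch t r x : lowdet conj r (Defs.act conj a x) != 0 ->
  macont (fun h => sch conj t r (Defs.act conj h x)).
Proof.
have A : macont (fun h => Defs.act conj h x).
  apply: macontM; last by apply: macont_ct; apply: macont_id.
  by apply: macontM; [apply: macont_id | apply: macont_cst].
have C n p (B : 'M[k']_(n, m)) (D : 'M[k']_(m, p)) : macont (fun h => B *m Defs.act conj h x *m D).
  by apply: macontM; [apply: macontM => //; apply: macont_cst | apply: macont_cst].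
move=> d0; apply: macontB; first exact: C.
apply: macontM; last exact: C.
apply: macontM; first exact: C.
by apply: macont_inv; first exact: d0; exact: C.
Qed.

End AdicContinuity.

Local Open Scope classical_set_scope.

(** * Averaging over translates for the Haar measure *)

Section HaarStep.
Variables (k : fieldType) (k' : fieldExtType k) (conj : {lrmorphism k' -> k'}).
Variables (v : k' -> int) (q : nat) (pi theta : k') (rep : 'I_q -> k').
Hypothesis I : inert conj v pi theta rep.
Variables (R : realType) (m : nat) (mu : probability (borel_mx v m) R).
Hypothesis Hmu : is_haar conj mu.
Local Notation P := (vge v).
Local Notation ct := (conj_tr conj).
Local Notation J := (@antidiag k k').
Local Notation K := (unitary_integral conj v m).
Let dv := inert_dv I.
Let conjK := inert_conjK I.

Lemma open_measurable_mx (U : set 'M[k']_m) :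
  (forall a, U a -> exists N, forall b, mxge v N (b - a) -> U b) ->
  measurable (U : set (borel_mx v m)).
Proof.
move=> h; apply: sub_sigma_algebra => a /h[N hN]; exists N => b hb.
by apply: hN => i j; rewrite !mxE.
Qed.

(** The complement is open: a matrix that is not integral stays so under integral changes, and a
    failure of the unitary relation persists nearby by continuity. *)
Lemma measurable_K : measurable (K : set (borel_mx v m)).
Proof.
rewrite -[K]setCK; apply: measurableC; apply: open_measurable_mx => a Ka.
have [ui|ui] := pselect (mxge v 0 a); last first.
  exists 0 => b hb Kb; apply: ui; rewrite -(subKr b a).
  by apply: (mxgeB I) => //; case: Kb.
have [i [j hij]] : exists i j, (ct a *m J m *m a) i j - J m i j != 0.
  apply: contrapT => h; apply: Ka; apply: unitary_integralP => //.
  apply/matrixP => i j; apply/eqP; rewrite -subr_eq0; apply/negPn/negP => h2.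
  by apply: h; exists i, j.
have C : macont v a (fun b => ct b *m J m *m b).
  apply: (macontM I); last exact: macont_id.
  by apply: (macontM I); [apply: (macont_ct I); apply: macont_id | apply: macont_cst].
have [M hM] := C i j (v ((ct a *m J m *m a) i j - J m i j) + 1).
exists M => b /hM h Kb.
have [] := val_eqD dv hij (erefl _) h.
by rewrite (K_unitary Kb) addrC subrKA subrr eqxx.
Qed.

Lemma mulmx_measurable (g : 'M[k']_m) : mxge v 0 g ->
  measurable_fun setT (fun h : borel_mx v m => g *m h : borel_mx v m).
Proof.
move=> ig; have H := @measurability _ _ (borel_mx v m) (borel_mx v m) setT (fun h : borel_mx v m => g *m h : borel_mx v m) (@adic_open _ _ v m) (erefl _).
apply: H => //.
move=> _ [U oU <-]; rewrite setTI; apply: open_measurable_mx => a /oU[N hN].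
exists N => b hb; apply: hN => i j.
by have := mxgeMl I ig hb i j; rewrite mulmxBr !mxE.
Qed.

Lemma haar_translate (g : 'M[k']_m) (B : set (borel_mx v m)) :
  K g -> measurable B -> B `<=` K ->
  measurable ([set h | B (g *m h)] : set (borel_mx v m)) /\
  mu [set h | B (g *m h)] = mu B.
Proof.
move=> Kg mB BK; have [Kg' gg' g'g] := K_inv I Kg.
have [g' eg'] : exists g', g' = J m *m ct g *m J m by exists (J m *m ct g *m J m).
rewrite -eg' in Kg' gg' g'g.
have mE : measurable ([set h | B (g *m h)] : set (borel_mx v m)).
  by rewrite -[X in measurable X]setTI; apply: mulmx_measurable => //; case: Kg.
split=> //; case: Hmu => _ /(_ g' B Kg' mB BK) <-; congr (mu _).
apply/seteqP; split=> h /= => [Bh|[b Bb <-]]; last by rewrite mulmxA gg' mul1mx.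
by exists (g *m h) => //; rewrite mulmxA g'g mul1mx.
Qed.

Definition mass (A : set 'M[k']_m) : R := fine (mu A).

Lemma mass_fin (A : set (borel_mx v m)) : measurable A -> mu A \is a fin_num.
Proof. by move=> mA; apply: fin_num_measure. Qed.

(** Double counting: the number of s with g_s h in B is integrated over K. Invariance of the measure
    gives #|S| mu(B), the hypothesis gives c mu(A). *)
Lemma haar_step (S : finType) (g : S -> 'M[k']_m) (c : nat) (A B : set (borel_mx v m)) :
  (forall s, K (g s)) -> measurable A -> measurable B -> A `<=` K -> B `<=` K ->
  (forall h, K h -> #|[pred s | `[< B (g s *m h) >] ]| = (if `[< A h >] then c else 0)%N) ->
  #|S|%:R * mass B = c%:R * mass A.
Proof.
move=> Kg mA mB AK BK hc.
have tr s := haar_translate (Kg s) mB BK.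
have e : (\sum_(s : S) mu [set h | B (g s *m h)] = c%:R%:E * mu A)%E.
  transitivity (\int[mu]_(h in K) \sum_(s : S) ((\1_[set h | B (g s *m h)] h)%:E))%E.
    rewrite ge0_integral_sum //; last 2 first.
    - exact: measurable_K.
    - move=> s; apply/measurable_EFinP; apply: measurable_indic; by have [] := tr s.
    apply: eq_bigr => s _; rewrite integral_indic //; last by have [] := tr s.
    - congr (mu _); apply/seteqP; split=> h /= => [Bh|[]//]; split=> //.
      have [Kg' gg' g'g] := K_inv I (Kg s); rewrite -[h]mul1mx -g'g -(mulmxA _ (g s)).
      by apply: (K_mul I) => //; apply: BK.
    - exact: measurable_K.
  transitivity (\int[mu]_(h in K) (c%:R%:E * (\1_A h)%:E))%E.
    apply: eq_integral => h; rewrite inE => Kh; have := hc h Kh.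
    rewrite -sum1_card => e; rewrite sumEFin -EFinM; congr EFin.
    have asE (C : set (borel_mx v m)) : (h \in C) = `[< C h >].
      by apply/idP/asboolP; rewrite inE.
    transitivity ((if `[< A h >] then c else 0%N)%:R : R); last first.
      by rewrite indicE asE; case: asboolP; rewrite ?mulr1 ?mulr0.
    rewrite -e natr_sum [RHS]big_mkcond /=; apply: eq_bigr => s _.
    by rewrite indicE asE inE; case: ifP.
  have mK := measurable_K.
  rewrite ge0_integralZl_EFin //.
    by rewrite integral_indic // (setIidl AK).
  by apply/measurable_EFinP; apply: measurable_indic.
rewrite /mass; have f1 := mass_fin mA; have f2 := mass_fin mB.
have e2 : (#|S|%:R%:E * mu B = c%:R%:E * mu A)%E.
  rewrite -e; under [RHS]eq_bigr do rewrite (tr _).2.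
  by rewrite -[mu B]fineK // sumEFin -EFinM; congr EFin; rewrite sumr_const mulr_natl.
by apply: EFin_inj; rewrite !EFinM !fineK.
Qed.

End HaarStep.

Local Close Scope classical_set_scope.

(** * Counting zeros of hermitian forms modulo the maximal ideal *)

Section ScalarCounts.
Variables (k : fieldType) (k' : fieldExtType k) (conj : {lrmorphism k' -> k'}).
Variables (v : k' -> int) (q : nat) (pi theta : k') (rep : 'I_q -> k').
Hypothesis I : inert conj v pi theta rep.
Local Notation P := (vge v).
Let dv := inert_dv I.
Let conjK := inert_conjK I.
Local Notation eta := (eta conj theta).
Local Notation rep2 := (rep2 theta rep).

Lemma card_pairs_cond (S S' : finType) (Q1 : pred S) (Q2 : S -> pred S') c :
  (forall i, Q1 i -> #|[pred j | Q2 i j]| = c) ->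
  #|[pred ij : S * S' | Q1 ij.1 && Q2 ij.1 ij.2]| = (#|[pred i | Q1 i]| * c)%N.
Proof.
move=> h; rewrite -sum1_card; transitivity (\sum_(i | Q1 i) \sum_(j | Q2 i j) 1)%N.
  by rewrite pair_big_dep.
under eq_bigr => i Qi do rewrite sum1_card (_ : #|_| = c) ?(h i Qi) //.
by rewrite sum_nat_const; congr (_ * _)%N; apply: eq_card.
Qed.

Lemma fixed_val (b : int) : exists w, [/\ w != 0, v w = b & conj w = w].
Proof.
case: b => n.
  exists (pi ^+ n); split; [exact: (pi_exp_neq0 I)|exact: (val_pi_exp I)|].
  exact: (conj_pi_exp I).
exists (pi ^+ n.+1)^-1; split; first by rewrite invr_eq0 (pi_exp_neq0 I).
  by rewrite valV ?(pi_exp_neq0 I) // (val_pi_exp I) NegzE.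
by rewrite fmorphV /= (conj_pi_exp I).
Qed.

Lemma norm_vge N x : (x * conj x \in P (N + N)) = (x \in P N).
Proof.
have [->|x0] := eqVneq x 0; first by rewrite mul0r !vge0.
rewrite !vgeNz ?mulf_neq0 ?fmorph_eq0 // valM ?fmorph_eq0 // (inert_vconj I).
by apply/idP/idP; lia.
Qed.

Lemma norm_vge1 N x : (x * conj x \in P (N + N + 1)) = (x \in P (N + 1)).
Proof.
have [->|x0] := eqVneq x 0; first by rewrite mul0r !vge0.
rewrite !vgeNz ?mulf_neq0 ?fmorph_eq0 // valM ?fmorph_eq0 // (inert_vconj I).
by apply/idP/idP; lia.
Qed.

Lemma norm_vgeB1 N x : (x * conj x \in P (N + N - 1)) = (x \in P N).
Proof.
have [->|x0] := eqVneq x 0; first by rewrite mul0r !vge0.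
rewrite !vgeNz ?mulf_neq0 ?fmorph_eq0 // valM ?fmorph_eq0 // (inert_vconj I).
by apply/idP/idP; lia.
Qed.

Lemma val_norm x : x != 0 -> v (x * conj x) = v x + v x.
Proof. by move=> x0; rewrite valM ?fmorph_eq0 // (inert_vconj I). Qed.

(** The second coordinate of y in the basis theta, eta, the first one being its trace; both are
    fixed by [conj], and y lies in an ideal exactly when both do ([vge_trace_zpart]). *)
Definition zpart y := (y - (y + conj y) * theta) / eta.

Lemma zpartE y : y = (y + conj y) * theta + zpart y * eta.
Proof. by have [e0 _] := eta_unit I; rewrite /zpart divfK // subrKC. Qed.

Lemma conj_zpart y : conj (zpart y) = zpart y.
Proof.
have [e0 _] := eta_unit I.
rewrite /zpart rmorphM fmorphV rmorphB rmorphM rmorphD /= conjK (conj_eta I) (inert_theta I).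
by rewrite invrN mulrN -mulNr; congr (_ / _); ring.
Qed.

Lemma vge_trace_zpart N y : (y \in P N) = (y + conj y \in P N) && (zpart y \in P N).
Proof.
have [e0 ve] := eta_unit I.
apply/idP/andP => [hy|[h1 h2]]; last first.
  rewrite [y]zpartE; apply: vgeD => //; apply: vgeMr => //.
    exact: inert_theta_int I.
  by rewrite vgeNz // ve.
have hT : y + conj y \in P N by apply: vgeD => //; rewrite (vge_conj I).
split=> //; rewrite (vgeVz dv _ _ e0 ve) addr0; apply: vgeB => //.
by apply: vgeMr => //; apply: inert_theta_int I.
Qed.

Lemma zpartD y z : zpart (y + z) = zpart y + zpart z.
Proof. by rewrite /zpart -mulrDl; congr (_ / _); rewrite rmorphD /=; ring. Qed.

Lemma zpart_eta x : conj x = x -> zpart (x * eta) = x.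
Proof.
have [e0 ve] := eta_unit I.
move=> cx; rewrite /zpart rmorphM /= (conj_eta I) cx mulrN subrr mul0r subr0 mulfK //.
Qed.

Lemma card_shift_fixed x N u : conj x = x -> conj u = u -> u != 0 -> v u = N ->
  x \in P N -> #|[pred i | x + u * rep i \in P (N + 1)]| = 1%N.
Proof.
move=> cx cu u0 vu hx.
have h : x / u \in P 0 by rewrite (vgeVz dv _ _ u0 vu) add0r.
rewrite -(card_affine_fixed I (x := x / u) (u := 1)) ?rmorph1 ?oner_eq0 ?val1 //.
  apply: eq_card => i; rewrite [LHS]inE [RHS]inE.
  have -> : x + u * rep i = u * (x / u + 1 * rep i) by field.
  by rewrite (vgeMz dv _ _ u0 vu) addrAC subrr add0r.
by rewrite rmorphM fmorphV /= cx cu.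
Qed.

Lemma card_shift x N u : u != 0 -> v u = N -> x \in P N ->
  #|[pred ij | x + u * rep2 ij \in P (N + 1)]| = 1%N.
Proof.
move=> u0 vu hx.
have h : x / u \in P 0 by rewrite (vgeVz dv _ _ u0 vu) add0r.
rewrite -(card_affine I (x := x / u) (u := 1)) ?oner_eq0 ?val1 //.
apply: eq_card => ij; rewrite [LHS]inE [RHS]inE; move: (rep2 ij) => y.
have -> : x + u * y = u * (x / u + 1 * y) by field.
by rewrite (vgeMz dv _ _ u0 vu) addrAC subrr add0r.
Qed.

Lemma card_shift_conj x N u : u != 0 -> v u = N -> x \in P N ->
  #|[pred ij | x + u * conj (rep2 ij) \in P (N + 1)]| = 1%N.
Proof.
move=> u0 vu hx.
rewrite -(card_shift (x := conj x) (N := N) (u := conj u)) ?fmorph_eq0 ?(vge_conj I) //.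
  by apply: eq_card => ij; rewrite [LHS]inE [RHS]inE -[LHS](vge_conj I); move: (rep2 ij) => y; rewrite rmorphD rmorphM /= conjK.
by rewrite (inert_vconj I).
Qed.

Lemma card_norm_shift x N u e : u != 0 -> v u = N -> x \in P N ->
  conj e = e -> e != 0 -> v e = N + N ->
  #|[pred ij | (x + u * conj (rep2 ij)) * conj (x + u * conj (rep2 ij)) - e
      \in P (N + N + 1)]| = q.+1.
Proof.
move=> u0 vu hx ce e0 ve.
have h : x / u \in P 0 by rewrite (vgeVz dv _ _ u0 vu) add0r.
have cu0 : conj u != 0 by rewrite fmorph_eq0.
have uu0 : u * conj u != 0 by rewrite mulf_neq0.
have vuu : v (u * conj u) = N + N by rewrite val_norm // vu.
rewrite -(card_norm I (x := x / u) (u := 1) (e := e / (u * conj u))) ?oner_eq0 ?val1 //.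
- apply: eq_card => ij; rewrite [LHS]inE [RHS]inE; move: (rep2 ij) => y.
  have -> : (x + u * conj y) * conj (x + u * conj y) - e =
     u * conj u * ((x / u + 1 * conj y) * conj (x / u + 1 * conj y) -
       e / (u * conj u)).
    by rewrite !rmorphD !rmorphM !fmorphV /= rmorph1 !conjK; field; rewrite u0 cu0.
  by rewrite (vgeMz dv _ _ uu0 vuu) addrAC subrr add0r.
- by rewrite rmorphM fmorphV /= (conj_norm I) ce.
- by rewrite (vgeVz dv _ _ uu0 vuu) vgeNz // ve add0r.
- by rewrite (vgeVz dv _ _ uu0 vuu) vgeNz // ve -ltNge; lia.
Qed.

Lemma card_trace_shift x N u : u != 0 -> v u = N -> x \in P N -> conj x = x ->
  #|[pred ij | x + (u * rep2 ij + conj (u * rep2 ij)) \in P (N + 1)]| = q.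
Proof.
move=> u0 vu hx cx; have [w [w0 vw cw]] := fixed_val N.
rewrite -[RHS](card_trace I (x := x / w) (u := u / w)) ?mulf_neq0 ?invr_eq0 //.
- apply: eq_card => ij; rewrite [LHS]inE [RHS]inE; move: (rep2 ij) => y.
  have -> : x + (u * y + conj (u * y)) =
      w * (x / w + (u / w * y + conj (u / w * y))).
    by rewrite !rmorphM !fmorphV /= cw; field.
  by rewrite (vgeMz dv _ _ w0 vw) addrAC subrr add0r.
- by rewrite rmorphM fmorphV /= cx cw.
- by rewrite (vgeVz dv _ _ w0 vw) add0r.
- by rewrite valM ?invr_eq0 // valV // vu vw subrr.
Qed.

Lemma card_option_pred (S : finType) (Q : pred (option S)) :
  #|Q| = (#|[pred i | Q (Some i)]| + Q None)%N.
Proof.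
rewrite -!sum1_card (bigID (pred1 None)) /= addnC; congr (_ + _)%N.
  rewrite (reindex_omap Some id) => [|[i //|]]; last by rewrite andbF.
  by apply: eq_bigl => i; rewrite [RHS]inE /= eqxx !andbT.
rewrite (eq_bigl (fun i => (i == None) && Q i)) => [|i]; last by rewrite andbC.
by rewrite big_mkcondr /= big_pred1_eq; case: (Q None).
Qed.

Section HermitianPlane.
Variables (al ga be : k').
Hypotheses (cal : conj al = al) (cga : conj ga = ga).
Let D := al * ga - be * conj be.
(** Value of a binary hermitian form with diagonal [al], [ga] and off-diagonal entry [be]: the last
    diagonal entry after translation by the unipotent element of parameter c ([low2_act]). *)
Definition herm2 (al ga be c : k') := ga + (c * be + conj (c * be)) + al * (c * conj c).
Local Notation E := (herm2 al ga be).

(** Completing the square, which turns zeros of the form into elements of norm - D. *)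
Lemma herm2_norm c : al * E c = (be + al * conj c) * conj (be + al * conj c) + D.
Proof. by rewrite /herm2 /D !rmorphD !rmorphM /= conjK cal; ring. Qed.

Lemma herm2_stable b w d N c : be \in P w -> al \in P b -> c \in P d -> ga \in P N ->
  N <= w + d -> N <= b + (d + d) -> E c \in P N.
Proof.
move=> hb ha hc hg h1 h2.
have hcb : c * be \in P N.
  by apply: (vge_le h1); rewrite addrC; apply: vgeM.
apply: vgeD => //; first apply: vgeD => //.
  by apply: vgeD => //; rewrite (vge_conj I).
by apply: (vge_le h2); do 2?apply: vgeM => //; rewrite (vge_conj I).
Qed.

(** By [herm2_norm] the condition says that the norm of be + u conj(y) is congruent to - D. There is
    one solution if D vanishes to higher order; otherwise the solutions fill a norm fibre with q + 1
    elements. *)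
Lemma card_herm2_even b (i : nat) : al != 0 -> v al = b ->
  D \in P (b + b + (i + i)%:Z) -> ga \in P (b + (i + i)%:Z) ->
  #|[pred ij | E (pi ^+ i * rep2 ij) \in P (b + (i + i)%:Z + 1)]|
    = if D \in P (b + b + (i + i)%:Z + 1) then 1%N else q.+1.
Proof.
move=> al0 val_al hD hga.
have hbe : be \in P (b + i%:Z).
  rewrite -norm_vge (_ : b + i%:Z + (b + i%:Z) = b + b + (i + i)%:Z); last lia.
  have -> : be * conj be = al * ga - D by rewrite /D; ring.
  apply: vgeB => //; rewrite (vgeMz dv _ _ al0 val_al).
  by rewrite (_ : b + b + _ - b = b + (i + i)%:Z) //; lia.
pose u := al * pi ^+ i.
have u0 : u != 0 by rewrite mulf_neq0 ?(pi_exp_neq0 I).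
have vu : v u = b + i%:Z by rewrite valM ?(pi_exp_neq0 I) // (val_pi_exp I) val_al.
have e ij : (E (pi ^+ i * rep2 ij) \in P (b + (i + i)%:Z + 1)) =
   ((be + u * conj (rep2 ij)) * conj (be + u * conj (rep2 ij)) + D
      \in P (b + i%:Z + (b + i%:Z) + 1)).
  rewrite (_ : b + (i + i)%:Z + 1 = b + i%:Z + (b + i%:Z) + 1 - b); last lia.
  rewrite -(vgeMz dv _ _ al0 val_al) herm2_norm.
  by rewrite rmorphM /= (conj_pi_exp I) /u mulrA.
rewrite (_ : b + b + (i + i)%:Z + 1 = b + i%:Z + (b + i%:Z) + 1); last lia.
case: ifPn => hD1.
  rewrite -(card_shift_conj u0 vu hbe); apply: eq_card => ij.
  by rewrite [LHS]inE [RHS]inE e (vgeDr dv _ hD1) norm_vge1.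
have [D0 vD] : D != 0 /\ v D = b + i%:Z + (b + i%:Z).
  by apply: vge_val => //; apply: vge_le hD; lia.
rewrite -(card_norm_shift (e := - D) u0 vu hbe) ?oppr_eq0 ?valN //.
  by apply: eq_card => ij; rewrite [LHS]inE [RHS]inE e opprK.
by rewrite rmorphN rmorphB rmorphM /= (conj_norm I) cal cga.
Qed.

(** The term quadratic in c has higher order here, so that a trace equation is left. *)
Lemma card_herm2_tail b w (d : nat) N : be != 0 -> v be = w -> al \in P b ->
  ga \in P N -> N = w + d%:Z -> N < b + (d + d)%:Z ->
  #|[pred ij | E (pi ^+ d * rep2 ij) \in P (N + 1)]| = q.
Proof.
move=> be0 vbe hal hga eN lN.
have u0 : pi ^+ d * be != 0 by rewrite mulf_neq0 ?(pi_exp_neq0 I).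
have vu : v (pi ^+ d * be) = N.
  by rewrite valM ?(pi_exp_neq0 I) // (val_pi_exp I) vbe eN addrC.
rewrite -[RHS](card_trace_shift u0 vu hga cga).
apply: eq_card => ij; rewrite [LHS]inE [RHS]inE /herm2.
have hp : pi ^+ d * rep2 ij \in P d%:Z.
  apply: vgeMr => //; last exact: (rep2_int I).
  by rewrite vgeNz ?(pi_exp_neq0 I) // (val_pi_exp I).
have hc : conj (pi ^+ d * rep2 ij) \in P d%:Z by rewrite (vge_conj I).
have hs : al * (pi ^+ d * rep2 ij * conj (pi ^+ d * rep2 ij)) \in P (N + 1).
  by apply: vge_le (vgeM dv hal (vgeM dv hp hc)); lia.
by rewrite (vgeDr dv _ hs) mulrAC.
Qed.

Lemma herm2_alpha_unit b : [&& al \in P b, ga \in P b & be \in P b] ->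
  ~~ [&& al \in P (b + 1), ga \in P (b + 1) & be \in P (b + 1)] ->
  D \in P (b + b + 1) -> ga \in P (b + 1) -> al != 0 /\ v al = b.
Proof.
case/and3P=> h1 h2 h3 h4 hD hga; apply: vge_val => //; apply: contra h4 => hal.
rewrite hal hga -norm_vge1 /=.
have -> : be * conj be = al * ga - D by rewrite /D; ring.
apply: vgeB => //; have := vgeM dv hal hga; apply: vge_le; lia.
Qed.

(** Isotropic points of a nonzero form on the projective line over the residue field of k', the
    point at infinity being [None]: one if the form is degenerate, q + 1 otherwise. *)
Lemma card_herm2_lines b : [&& al \in P b, ga \in P b & be \in P b] ->
  ~~ [&& al \in P (b + 1), ga \in P (b + 1) & be \in P (b + 1)] ->
  #|[pred s : option ('I_q * 'I_q) |
      (if s is Some ij then E (rep2 ij) else al) \in P (b + 1)]|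
    = if D \in P (b + b + 1) then 1%N else q.+1.
Proof.
case/and3P=> h1 h2 h3 h4.
rewrite card_option_pred /=.
have [hal|hal] := boolP (al \in P (b + 1)); last first.
  have [al0 val_al] := vge_val h1 hal.
  have hD : D \in P (b + b) by apply: vgeB => //; rewrite ?norm_vge //; apply: vgeM.
  have := @card_herm2_even b 0 al0 val_al; rewrite !addr0 => /(_ hD h2) <-; rewrite addn0.
  by apply: eq_card => ij; rewrite [LHS]inE [RHS]inE expr0 mul1r.
have hEb ij : (E (rep2 ij) \in P (b + 1)) =
    (ga + (be * rep2 ij + conj (be * rep2 ij)) \in P (b + 1)).
  have hs : al * (rep2 ij * conj (rep2 ij)) \in P (b + 1).
    by apply: vgeMr => //; apply: vgeMl => //; rewrite ?(vge_conj I) (rep2_int I).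
  by rewrite /herm2 (vgeDr dv _ hs) [be * _]mulrC.
have hD : (D \in P (b + b + 1)) = (be \in P (b + 1)).
  have hs : al * ga \in P (b + b + 1) by apply: vge_le (vgeM dv hal h2); lia.
  by rewrite /D (vgeDl dv _ hs) vgeN // norm_vge1.
rewrite hD; case: ifPn => hbe.
  rewrite (_ : #|_| = 0%N) //; apply/eq_card0 => ij; rewrite [LHS]inE hEb.
  apply: contraNF h4 => hs; rewrite hal hbe andbT /=.
  have ht : be * rep2 ij + conj (be * rep2 ij) \in P (b + 1).
    by apply: vgeD => //; rewrite ?(vge_conj I) //; apply: vgeMr => //; exact: (rep2_int I).
  by rewrite -(vgeDr dv _ ht).
have [be0 vbe] := vge_val h3 hbe.
rewrite addn1 -[in RHS](card_trace_shift be0 vbe h2 cga); congr _.+1.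
by apply: eq_card => ij; rewrite [LHS]inE [RHS]inE hEb.
Qed.

End HermitianPlane.

(** Parameters of a Heisenberg group: c runs over P^d modulo P^(d+1), and a has the trace - c
    conj(c) that unitarity requires, its free part of trace 0 being a multiple of [eta]. *)
Definition heis_c (d : nat) (ij : 'I_q * 'I_q) := pi ^+ d * rep2 ij.
Definition heis_a (d j : nat) (ij : 'I_q * 'I_q) (l : 'I_q) :=
  - (heis_c d ij * conj (heis_c d ij)) * theta + pi ^+ j * rep l * eta.

Lemma vge_pi_exp d : pi ^+ d \in P d%:Z.
Proof. by rewrite vgeNz ?(pi_exp_neq0 I) // (val_pi_exp I). Qed.

Lemma vge_heis_c d ij : heis_c d ij \in P d%:Z.
Proof. by apply: vgeMr => //; [exact: vge_pi_exp | exact: (rep2_int I)]. Qed.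

Lemma heis_a_trace d j ij l :
  heis_a d j ij l + conj (heis_a d j ij l) = - (heis_c d ij * conj (heis_c d ij)).
Proof.
rewrite /heis_a; move: (heis_c d ij) => c.
rewrite rmorphD !rmorphM rmorphN /= (conj_norm I) (inert_theta I) (conj_pi_exp I).
by rewrite (conj_rep I) (conj_eta I); ring.
Qed.

Lemma vge_heis_norm d ij : heis_c d ij * conj (heis_c d ij) \in P (d + d)%:Z.
Proof. by rewrite PoszD; apply: vgeM => //; rewrite ?(vge_conj I) vge_heis_c. Qed.

Lemma vge_heis_a N d j ij l : N <= (d + d)%:Z -> N <= j%:Z -> heis_a d j ij l \in P N.
Proof.
have [e0 ve] := eta_unit I.
move=> h1 h2; apply: vgeD => //; apply: vgeMr => //; last by rewrite vgeNz // ve.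
- by rewrite vgeN //; apply: vge_le (vge_heis_norm d ij).
- exact: (inert_theta_int I).
- by apply: vgeMr => //; [apply: vge_le (vge_pi_exp j) | exact: (rep_int I)].
Qed.

Lemma card_axis_step y (j : nat) : y \in P j%:Z -> y + conj y \in P (j%:Z + 1) ->
  #|[pred l | y + pi ^+ j * rep l * eta \in P (j%:Z + 1)]| = 1%N.
Proof.
rewrite vge_trace_zpart => /andP[_ hz] hT.
rewrite -(card_shift_fixed (conj_zpart y) (conj_pi_exp I j) (pi_exp_neq0 I j)
  (val_pi_exp I j) hz).
apply: eq_card => l; rewrite [LHS]inE [RHS]inE vge_trace_zpart.
have c : conj (pi ^+ j * rep l) = pi ^+ j * rep l.
  by rewrite rmorphM /= (conj_pi_exp I) (conj_rep I).
rewrite zpartD zpart_eta //; set z := (X in _ && X).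
suff -> : y + pi ^+ j * rep l * eta + conj (y + pi ^+ j * rep l * eta) = y + conj y.
  by rewrite hT.
by rewrite rmorphD rmorphM /= c (conj_eta I); ring.
Qed.

(** The parameter l moves only the eta coordinate and has one good value once the trace is right.
    The trace condition is a norm equation in c with right-hand side rho. *)
Lemma card_heis_even y1 y2 rho (i : nat) : y2 + conj y2 + y1 * conj y1 = rho ->
  y2 \in P (i + i)%:Z -> rho \in P (i + i)%:Z ->
  #|[pred s : ('I_q * 'I_q) * 'I_q |
     y2 + heis_a i (i + i) s.1 s.2 + heis_c i s.1 * y1 \in P ((i + i)%:Z + 1)]|
  = if rho \in P ((i + i)%:Z + 1) then 1%N else q.+1.
Proof.
move=> erho hy2 hrho.
have crho : conj rho = rho.
  by rewrite -erho !rmorphD rmorphM /= !conjK; ring.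
have hy1 : y1 \in P i%:Z.
  rewrite -norm_vge (_ : y1 * conj y1 = rho - (y2 + conj y2)); last by rewrite -erho; ring.
  by apply: vgeB => //; apply: vgeD => //; rewrite (vge_conj I).
have u0 : - pi ^+ i != 0 by rewrite oppr_eq0 (pi_exp_neq0 I).
have vu : v (- pi ^+ i) = i%:Z by rewrite valN // (val_pi_exp I).
pose Q1 ij := (y1 + - pi ^+ i * conj (rep2 ij)) * conj (y1 + - pi ^+ i * conj (rep2 ij)) - rho
   \in P (i%:Z + i%:Z + 1).
have c1 : #|[pred ij | Q1 ij]| = if rho \in P ((i + i)%:Z + 1) then 1%N else q.+1.
  rewrite PoszD; case: ifPn => hr; rewrite /Q1.
    rewrite -(card_shift_conj u0 vu hy1); apply: eq_card => ij.
    by rewrite [LHS]inE [RHS]inE (vgeBr dv _ hr) norm_vge1.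
  have [r0 vr] := vge_val hrho hr.
  by apply: card_norm_shift.
pose base ij := y2 + - (heis_c i ij * conj (heis_c i ij)) * theta + heis_c i ij * y1.
have baseT ij : base ij + conj (base ij) =
   - ((y1 + - pi ^+ i * conj (rep2 ij)) * conj (y1 + - pi ^+ i * conj (rep2 ij)) - rho).
  rewrite /base /heis_c; move: (rep2 ij) => c.
  rewrite !rmorphD !rmorphM !rmorphN !rmorphM /= !conjK (conj_pi_exp I) (inert_theta I).
  by rewrite -erho; ring.
have baseP ij : base ij \in P (i + i)%:Z.
  apply: vgeD => //; first apply: vgeD => //.
    apply: vgeMr => //; last exact: (inert_theta_int I).
    by rewrite vgeN // vge_heis_norm.
  by rewrite PoszD; apply: vgeM => //; exact: vge_heis_c.
rewrite -c1 -[RHS]muln1.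
rewrite -(card_pairs_cond (Q1 := Q1)
  (Q2 := fun ij l => base ij + pi ^+ (i + i) * rep l * eta \in P ((i + i)%:Z + 1))).
  apply: eq_card => -[ij l]; rewrite [LHS]inE [RHS]inE /=.
  have -> : y2 + heis_a i (i + i) ij l + heis_c i ij * y1 =
      base ij + pi ^+ (i + i) * rep l * eta by rewrite /base /heis_a; ring.
  apply/idP/andP => [h|[]//]; split=> //.
  move: h; rewrite vge_trace_zpart => /andP[h _]; move: h.
  have c : conj (pi ^+ (i + i) * rep l) = pi ^+ (i + i) * rep l.
    by rewrite rmorphM /= (conj_pi_exp I) (conj_rep I).
  have -> : base ij + pi ^+ (i + i) * rep l * eta +
      conj (base ij + pi ^+ (i + i) * rep l * eta) = base ij + conj (base ij).
    by rewrite rmorphD rmorphM /= c (conj_eta I); ring.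
  by rewrite baseT vgeN // PoszD.
move=> ij Qij; apply: card_axis_step => //.
by rewrite baseT vgeN // PoszD.
Qed.

Lemma card_heis_tail x u w N M (d : nat) : x \in P N -> u != 0 -> v u + d%:Z = N ->
  w \in P M -> N < M + (d + d)%:Z ->
  #|[pred ij | x - (heis_c d ij * conj (heis_c d ij)) * theta * w + heis_c d ij * u
       \in P (N + 1)]| = 1%N.
Proof.
move=> hx u0 vu hw hN.
have u0' : pi ^+ d * u != 0 by rewrite mulf_neq0 ?(pi_exp_neq0 I).
have vu' : v (pi ^+ d * u) = N by rewrite valM ?(pi_exp_neq0 I) // (val_pi_exp I) addrC.
rewrite -(card_shift u0' vu' hx); apply: eq_card => ij; rewrite [LHS]inE [RHS]inE.
have hs : (heis_c d ij * conj (heis_c d ij)) * theta * w \in P (N + 1).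
  apply: (@vge_le _ _ ((d + d)%:Z + M)); first by lia.
  apply: vgeM => //; apply: vgeMr => //; last exact: (inert_theta_int I).
  exact: vge_heis_norm.
by rewrite addrAC (vgeBr dv _ hs) /heis_c mulrAC.
Qed.

End ScalarCounts.

Lemma vge_det_gen (k : fieldType) (v : k -> int) (dv : discrete_valuation v) n (A : 'M[k]_n) N :
  (forall i j, A i j \in vge v N) -> \det A \in vge v (n%:Z * N).
Proof.
move=> hA; apply: vge_sum => // s _; apply: vgeMl => //.
  by rewrite -signr_odd; case: (odd _); rewrite ?expr1 ?vgeN // vge1.
have h (r : seq 'I_n) : \prod_(i <- r) A i (s i) \in vge v ((size r)%:Z * N).
  elim: r => [|i r IH]; first by rewrite big_nil mul0r vge1.
  by rewrite big_cons /= intS mulrDl mul1r; apply: vgeM.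
by have := h (enum 'I_n); rewrite size_enum_ord big_enum.
Qed.

Local Open Scope classical_set_scope.

(** * Fibres where all minors but one are frozen *)

Section Fiber.
Variables (k : fieldType) (k' : fieldExtType k) (conj : {lrmorphism k' -> k'}).
Variables (v : k' -> int) (q : nat) (pi theta : k') (rep : 'I_q -> k').
Hypothesis I : inert conj v pi theta rep.
Variables (R : realType) (m : nat) (mu : probability (borel_mx v m) R).
Hypothesis Hmu : is_haar conj mu.
Local Notation P := (vge v).
Local Notation ct := (conj_tr conj).
Local Notation J := (@antidiag k k').
Local Notation K := (unitary_integral conj v m).
Local Notation uact := (Defs.act conj).
Let dv := inert_dv I.
Let conjK := inert_conjK I.

Variables (x : 'M[k']_m) (t r : nat) (a : nat -> int).
Local Notation n := m./2.

(** d_(r+1) is the only minor left free; the rank one computation varies it alone. *)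
Definition fiber_base (h : 'M[k']_m) := forall j, (0 < j)%N -> (j <= n)%N -> j <> r.+1 ->
  lowdet conj j (uact h x) != 0 /\ v (lowdet conj j (uact h x)) = a j.

Definition fiber (Q : 'M[k']_t -> Prop) : set (borel_mx v m) :=
  [set h | K h /\ fiber_base h /\ Q (sch conj t r (uact h x))].

Definition mx_open (Q : 'M[k']_t -> Prop) := forall T, Q T ->
  exists N, forall T', mxge v N (T' - T) -> Q T'.

Hypothesis rn : (r < n)%N.

Lemma fiber_base_low h : fiber_base h -> lowdet conj r (uact h x) != 0.
Proof.
move=> hb; have [->|r0] := posnP r; first by rewrite lowdet0 oner_eq0.
by have [] := hb r r0 (ltnW rn) (n_Sn r).
Qed.

Lemma fiber_measurable Q : mx_open Q -> measurable (fiber Q).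
Proof.
move=> oQ.
have -> : fiber Q = K `&` [set h | fiber_base h /\ Q (sch conj t r (uact h x))].
  by apply/seteqP; split.
apply: measurableI; first exact: measurable_K I _.
apply: open_measurable_mx => b [hb Qb].
have evt (C : nat -> 'M[k']_m -> Prop) l :
    (forall j, (j < l)%N -> exists M, forall h, mxge v M (h - b) -> C j h) ->
    exists M, forall h, mxge v M (h - b) -> forall j, (j < l)%N -> C j h.
  elim: l => [|l IH] h; first by exists 0.
  have [M1 h1] := IH (fun j hj => h j (ltnW hj)); have [M2 h2] := h l (ltnSn l).
  exists (Num.max M1 M2) => g hg j; rewrite ltnS leq_eqVlt => /orP[/eqP ->|].
    by apply: h2; apply: mxge_le hg; rewrite le_max lexx orbT.
  by apply: h1; apply: mxge_le hg; rewrite le_max lexx.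
have [M1 h1] : exists M, forall h, mxge v M (h - b) -> fiber_base h.
  have [|M hM] := evt (fun j h => (0 < j)%N -> (j <= n)%N -> j <> r.+1 ->
    lowdet conj j (uact h x) != 0 /\ v (lowdet conj j (uact h x)) = a j) n.+1; last first.
    by exists M => h /hM hh j j0 jn; apply: hh.
  move=> j jn; have [j0|] := boolP (0 < j)%N; last by exists 0 => ? _ /negP.
  have [jr|jr] := eqVneq j r.+1; first by exists 0 => ? _ _ _ /(_ jr).
  have [d0 vd] := hb j j0 jn (elimN eqP jr).
  have [M hM] := acont_lowdet I b j x (v (lowdet conj j (uact b x)) + 1).
  exists M => h /hM hh _ _ _; rewrite -(subrKC (lowdet conj j (uact b x)) (lowdet conj j (uact h x))).
  by rewrite -vd; apply: val_eqD.
have [N hN] := oQ _ Qb.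
have [M2 h2] : exists M, forall h, mxge v M (h - b) ->
    mxge v N (sch conj t r (uact h x) - sch conj t r (uact b x)).
  have C : macont v b (fun h => sch conj t r (uact h x)).
    by apply: (macont_sch I); exact: fiber_base_low hb.
  have [M hM] : exists M, forall h, mxge v M (h - b) -> forall i, (i < t)%N ->
      forall j : 'I_t, if insub i is Some i' then
       (sch conj t r (uact h x) - sch conj t r (uact b x)) i' j \in P N else true.
    apply: (evt _ _) => i hi.
    have [|M hM] := evt (fun j h => if insub j is Some j' then
       (sch conj t r (uact h x) - sch conj t r (uact b x)) (Ordinal hi) j' \in P N else true) t; last first.
      exists M => h /hM hh j; rewrite insubT /=.
      by have := hh j (ltn_ord j); rewrite valK.
    move=> j hj; have [M hM] := C (Ordinal hi) (Ordinal hj) N.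
    by exists M => h /hM; rewrite insubT /= !mxE.
  by exists M => h /hM hh i j; have := hh i (ltn_ord i) j; rewrite valK.
exists (Num.max M1 M2) => h hh; split.
  by apply: h1; apply: mxge_le hh; rewrite le_max lexx.
by apply: hN; apply: h2; apply: mxge_le hh; rewrite le_max lexx orbT.
Qed.

Definition liftable (h0 : 'M[k']_t) := exists g : 'M[k']_m, [/\ K g,
  forall j, (0 < j)%N -> (j <= n)%N -> j <> r.+1 -> exists U, low k' m j *m g = U *m low k' m j,
  low k' m r *m g = low k' m r &
  blk k' m t (m - r - t) *m g = h0 *m blk k' m t (m - r - t)].

Lemma fiber_step (S : finType) (h0 : S -> 'M[k']_t) (c : nat) (Q Q' : 'M[k']_t -> Prop) :
  (forall s, liftable (h0 s)) -> mx_open Q -> mx_open Q' ->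
  (forall h, K h -> fiber_base h -> let T := sch conj t r (uact h x) in
    #|[pred s | `[< Q' (h0 s *m T *m ct (h0 s)) >] ]| = (if `[< Q T >] then c else 0)%N) ->
  #|S|%:R * mass mu (fiber Q') = c%:R * mass mu (fiber Q).
Proof.
move=> /choice[g hg] oQ oQ' hc.
apply: (haar_step I Hmu (g := g)); try exact: fiber_measurable.
- by move=> s; have [] := hg s.
- by move=> h [].
- by move=> h [].
have base_g s h : K h -> fiber_base (g s *m h) <-> fiber_base h.
  move=> Kh; have [Kg st lr _] := hg s; split=> hb j j0 jn jr.
    have [U hU] := st j j0 jn jr; have jm : (j <= m)%N by lia.
    have [e1 e2] := lowdet_act_val I (uact h x) Kg jm hU.
    by rewrite -e1 -e2 act_comp; apply: hb.
  have [U hU] := st j j0 jn jr; have jm : (j <= m)%N by lia.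
  have [e1 e2] := lowdet_act_val I (uact h x) Kg jm hU.
  by rewrite -act_comp e1 e2; apply: hb.
move=> h Kh; have [hb|hb] := pselect (fiber_base h); last first.
  rewrite (asboolF (P := fiber Q h)); last by case=> _ [].
  apply/eq_card0 => s; rewrite inE; apply/asboolP; case=> _ [/base_g hb' _]; apply: hb; exact: hb'.
have -> : `[< fiber Q h >] = `[< Q (sch conj t r (uact h x)) >].
  by apply/asboolP/asboolP => [[_ []]|].
rewrite -(hc h Kh hb); apply: eq_card => s; rewrite !inE.
have [Kg _ lr lt] := hg s.
rewrite -(sch_act _ _ lr lt) act_comp; apply/asboolP/asboolP => [[_ []]//|hQ].
split; first exact: (K_mul I).
by split=> //; apply/base_g.
Qed.

End Fiber.

(** * Stratification by content *)

Section Content.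
Variables (k : fieldType) (k' : fieldExtType k) (conj : {lrmorphism k' -> k'}).
Variables (v : k' -> int) (q : nat) (pi theta : k') (rep : 'I_q -> k').
Hypothesis I : inert conj v pi theta rep.
Variables (R : realType) (m : nat) (mu : probability (borel_mx v m) R).
Local Notation P := (vge v).
Local Notation ct := (conj_tr conj).
Local Notation J := (@antidiag k k').
Local Notation K := (unitary_integral conj v m).
Local Notation uact := (Defs.act conj).
Let dv := inert_dv I.

Lemma massU (A B : set (borel_mx v m)) : measurable A -> measurable B ->
  A `&` B = set0 -> mass mu (A `|` B) = mass mu A + mass mu B.
Proof.
move=> mA mB AB; rewrite /mass measureU // fineD //; exact: mass_fin.
Qed.

Lemma mass0 : mass mu (set0 : set (borel_mx v m)) = 0.
Proof. by rewrite /mass measure0. Qed.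

Lemma mass_ge0 (A : set (borel_mx v m)) : 0 <= mass mu A.
Proof. by rewrite /mass fine_ge0. Qed.

Variables (x : 'M[k']_m) (t r : nat) (a : nat -> int).
Hypothesis rn : (r < m./2)%N.
Hypothesis H : (t.+1 + r <= m)%N.
Variable tau : 'M[k']_t.+1 -> 'M[k']_t.+1.
Hypothesis tauB : forall N A B, mxge v N (A - B) -> mxge v N (tau A - tau B).
Hypothesis tau_low : exists N, forall A M, M <= N -> mxge v M A -> mxge v M (tau A).

Local Notation fib := (fiber conj (v := v) x r a).
Local Notation base h := (fiber_base conj v x r a h).
Local Notation S h := (sch conj t.+1 r (uact h x)).

(** [tau] is the identity for a short root and A -> J - A for the last root, where the rank one
    matrix J - A is the form whose content matters. *)
Definition content b y (A : 'M[k']_t.+1) :=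
  [/\ mxge v b (tau A), ~ mxge v (b + 1) (tau A) & tau A ord_max ord_max \in P y].
Definition wide b y (A : 'M[k']_t.+1) := mxge v b (tau A) /\ tau A ord_max ord_max \in P y.
Definition atleast y (A : 'M[k']_t.+1) := tau A ord_max ord_max \in P y.
Definition exactly y (A : 'M[k']_t.+1) := tau A ord_max ord_max != 0 /\ v (tau A ord_max ord_max) = y.

Lemma vge_near N (z w : k') : z - w \in P N -> (z \in P N) = (w \in P N).
Proof. by move=> h; rewrite -(subrK w z) vgeDl. Qed.

Lemma mxge_near N m1 n1 (A B : 'M[k']_(m1, n1)) : mxge v N (A - B) -> mxge v N A <-> mxge v N B.
Proof.
move=> h; split=> h2 i j.
  by rewrite -(vge_near (z := A i j)) //; have := h i j; rewrite !mxE.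
by rewrite (vge_near (w := B i j)) //; have := h i j; rewrite !mxE.
Qed.

Lemma wide_open b y : mx_open v (wide b y).
Proof.
move=> A [h1 h2]; exists (Num.max b y) => B /tauB hB.
have hb : mxge v b (tau B - tau A) by apply: mxge_le hB; rewrite le_max lexx.
have hy : mxge v y (tau B - tau A) by apply: mxge_le hB; rewrite le_max lexx orbT.
split; first exact/(mxge_near hb).
by rewrite (vge_near (w := tau A ord_max ord_max)) //; have := hy ord_max ord_max; rewrite !mxE.
Qed.

Lemma content_open b y : mx_open v (content b y).
Proof.
move=> A [h1 h2 h3]; have hw : wide b y A by split.
have [N hN] := wide_open hw.
exists (Num.max N (b + 1)) => B hB.
have [h4 h5] : wide b y B by apply: hN; apply: mxge_le hB; rewrite le_max lexx.
split=> // h6; apply: h2.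
have hb : mxge v (b + 1) (tau B - tau A).
  by apply: tauB; apply: mxge_le hB; rewrite le_max lexx orbT.
exact/(mxge_near hb).
Qed.

Lemma atleast_open y : mx_open v (atleast y).
Proof.
move=> A h; exists y => B /tauB hB.
by rewrite /atleast (vge_near (w := tau A ord_max ord_max)) //; have := hB ord_max ord_max; rewrite !mxE.
Qed.

Lemma exactly_open y : mx_open v (exactly y).
Proof.
move=> A [h1 h2]; exists (y + 1) => B /tauB hB.
have := hB ord_max ord_max; rewrite !mxE => h.
by rewrite /exactly -(subrKC (tau A ord_max ord_max) (tau B _ _)); apply: val_eqD.
Qed.

Definition cmass b y := mass mu (fib (content b y)).

Lemma mass_wide b y :
  mass mu (fib (wide b y)) = cmass b y + mass mu (fib (wide (b + 1) y)).
Proof.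
rewrite -massU.
- congr (mass _ _); apply/seteqP; split=> h [].
    move=> Kh [hb [h1 h2]]; have [h3|h3] := pselect (mxge v (b + 1) (tau (S h))).
      by right.
    by left.
  by case=> Kh [hb [h1 h2 h3]].
  by case=> Kh [hb [h1 h2]]; split=> //; split=> //; split=> //; apply: mxge_le h1; lia.
- by apply: (fiber_measurable I) => //; apply: content_open.
- by apply: (fiber_measurable I) => //; apply: wide_open.
- by apply/seteqP; split=> // h [[_ [_ [_ h1 _]]] [_ [_ [h2 _]]]].
Qed.

Lemma mass_atleast y :
  mass mu (fib (atleast y)) = mass mu (fib (exactly y)) + mass mu (fib (atleast (y + 1))).
Proof.
rewrite -massU.
- congr (mass _ _); apply/seteqP; split=> h [].
    move=> Kh [hb h1]; have [h3|h3] := boolP (tau (S h) ord_max ord_max \in P (y + 1)).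
      by right.
    by left; split=> //; split=> //; apply: vge_val.
  by case=> Kh [hb [h1 h2]]; split=> //; split=> //; rewrite /atleast vgeNz // h2.
  by case=> Kh [hb h1]; split=> //; split=> //; apply: vge_le h1; lia.
- by apply: (fiber_measurable I) => //; apply: exactly_open.
- by apply: (fiber_measurable I) => //; apply: atleast_open.
- apply/seteqP; split=> // h [[_ [_ [h1 h2]]] [_ [_ h3]]].
  by move: h3; rewrite /atleast vgeNz // h2; lia.
Qed.

Lemma sch_bounded_below : exists N, forall h, K h -> base h -> mxge v N (tau (S h)).
Proof.
have [N0 hN0] := tau_low; have [c hc] := mxge_ex v x.
(* For r = 0 the minor is the empty one, d_0 = 1. *)
pose d : int := if (r == 0)%N then 0 else a r.
pose N1 : int := - (r.+2 * c)%N%:Z - `|d|.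
exists (- `|N0| + N1) => h Kh hb.
have ih : mxge v 0 h by case: Kh.
apply: hN0; first by rewrite /N1; lia.
have hy : mxge v (- c%:Z) (uact h x).
  apply: (mxgeMr I); last exact: (mxge_ct I).
  by apply: (mxgeMl I).
have d0 := fiber_base_low rn hb.
have vd : v (lowdet conj r (uact h x)) = d.
  rewrite /d; case: posnP => r0; last by have [] := hb r r0 (ltnW rn) (n_Sn _).
  by rewrite -[v _](congr1 (fun r => v (lowdet conj r (uact h x))) (esym r0)) lowdet0 val1.
have hB p (B : 'M[k']_(p, m)) : mxge v 0 B -> forall p' (B' : 'M[k']_(p', m)), mxge v 0 B' ->
    mxge v (- c%:Z) (B *m uact h x *m ct B').
  move=> iB p' B' iB'; apply: (mxgeMr I); last exact: (mxge_ct I).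
  by apply: (mxgeMl I).
have iE : mxge v 0 (low k' m r) by exact: (mxge_blk I).
have iQ : mxge v 0 (blk k' m t.+1 (m - r - t.+1)) by exact: (mxge_blk I).
have hinv : mxge v (- (r * c)%N%:Z - `|d|) (invmx (low k' m r *m uact h x *m ct (low k' m r))).
  move=> i j; rewrite /invmx unitmxE unitfE d0 mxE.
  apply: (@vge_le _ _ (- d + (r.-1)%:Z * - c%:Z)).
    by case: (r) => [|r'] /=; nia.
  apply: vgeM => //; first by rewrite vgeNz ?invr_eq0 // valV // vd.
  rewrite mxE; apply: vgeMl => //.
    by rewrite -signr_odd; case: (odd _); rewrite ?expr1 ?vgeN // vge1.
  by apply: (vge_det_gen dv) => i' j'; rewrite 2!mxE; apply: hB.
have h2 : mxge v N1 (S h).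
  apply: (mxgeB I).
    by apply: mxge_le (hB _ _ iQ _ _ iQ); rewrite /N1; nia.
  apply: mxge_le (mxgeM I (mxgeM I (hB _ _ iQ _ _ iE) hinv) (hB _ _ iE _ _ iQ)).
  by rewrite /N1; nia.
by apply: mxge_le h2; lia.
Qed.

(** On the fibre the content is bounded below by integrality and above by [B0], so the strata are
    finite in number; telescoping [mass_wide] over them gives the sum. *)
Lemma mass_exactly (B0 : int) :
  (forall h, K h -> base h -> ~ mxge v B0 (tau (S h))) ->
  exists N0 (L : nat), (forall y, mass mu (fib (exactly y)) =
    \sum_(i < L) (cmass (N0 + i%:Z) y - cmass (N0 + i%:Z) (y + 1))) /\
    forall i : 'I_L, N0 + i%:Z < B0.
Proof.
move=> hB0; have [N0 hN0] := sch_bounded_below.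
have wide_lo y : mass mu (fib (atleast y)) = mass mu (fib (wide N0 y)).
  congr (mass _ _); apply/seteqP; split=> h [Kh [hb h1]]; split=> //; split=> //.
    by split=> //; apply: hN0.
  by case: h1.
have wide_hi b y : B0 <= b -> mass mu (fib (wide b y)) = 0.
  move=> hb0; rewrite -mass0; congr (mass _ _); apply/seteqP; split=> // h [Kh [hb [h1 _]]].
  by apply: (hB0 h Kh hb); apply: mxge_le h1.
have sum_wide y (L : nat) : mass mu (fib (wide N0 y)) =
    \sum_(i < L) cmass (N0 + i%:Z) y + mass mu (fib (wide (N0 + L%:Z) y)).
  elim: L => [|L IH]; first by rewrite big_ord0 add0r addr0.
  have -> : N0 + L.+1%:Z = N0 + L%:Z + 1 by lia.
  by rewrite big_ord_recr /= -addrA -mass_wide.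
have [L [hL1 hL2]] : exists L : nat, B0 <= N0 + L%:Z /\ forall i, (i < L)%N -> N0 + i%:Z < B0.
  have [h|h] := leP N0 B0; last by exists 0%N; split=> //; lia.
  by exists `|(B0 - N0)%R|%N; split=> [|i hi]; lia.
have e y : mass mu (fib (atleast y)) = \sum_(i < L) cmass (N0 + i%:Z) y.
  by rewrite wide_lo (sum_wide y L) (wide_hi (N0 + L%:Z)) ?addr0.
exists N0, L; split=> [y|i].
  rewrite sumrB -!e mass_atleast; ring.
exact: hL2.
Qed.

Lemma cmass_low b y : y <= b -> cmass b y = cmass b b.
Proof.
move=> yb; congr (mass _ _); apply/seteqP; split=> h [Kh [hb [h1 h2 h3]]];
  split=> //; split=> //; split=> //.
by apply: vge_le h3.
Qed.

End Content.

(** * Elementary translates of small forms *)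

Section Lines.
Variables (k : fieldType) (k' : fieldExtType k) (conj : {lrmorphism k' -> k'}).
Variables (v : k' -> int) (q : nat) (pi theta : k') (rep : 'I_q -> k').
Hypothesis I : inert conj v pi theta rep.
Variables (R : realType) (m : nat) (mu : probability (borel_mx v m) R).
Hypothesis Hmu : is_haar conj mu.
Local Notation P := (vge v).
Local Notation ct := (conj_tr conj).
Local Notation J := (@antidiag k k').
Local Notation K := (unitary_integral conj v m).
Local Notation uact := (Defs.act conj).
Local Notation rep2 := (rep2 theta rep).
Let dv := inert_dv I.
Let conjK := inert_conjK I.

Section ContentStep.
Variables (x : 'M[k']_m) (t r : nat) (a : nat -> int).
Hypothesis rn : (r < m./2)%N.
Variable tau : 'M[k']_t.+1 -> 'M[k']_t.+1.
Hypothesis tauB : forall N A B, mxge v N (A - B) -> mxge v N (tau A - tau B).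

(** An integral h with an integral inverse h'; changing basis by h then preserves the content of a
    form. *)
Definition integral_pair (h h' : 'M[k']_t.+1) :=
  [/\ mxge v 0 h, mxge v 0 h' & h' *m h = 1%:M].

Lemma mxge_conj_pair N h h' T : integral_pair h h' ->
  mxge v N (h *m T *m ct h) <-> mxge v N T.
Proof.
case=> i1 i2 hh; split=> hT; last first.
  by apply: (mxgeMr I); [apply: (mxgeMl I) | apply: (mxge_ct I)].
have -> : T = h' *m (h *m T *m ct h) *m ct h'.
  by rewrite !mulmxA hh mul1mx -mulmxA -ctM hh ct1 mulmx1.
by apply: (mxgeMr I); [apply: (mxgeMl I) | apply: (mxge_ct I)].
Qed.

(* One averaging step: among the translates by [h0 s], exactly [c] raise the
   valuation of the last diagonal entry from [y] to [y']. *)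
Lemma content_step (S : finType) (h0 h0' : S -> 'M[k']_t.+1) (c : nat) b y y' :
  (forall s, @liftable _ _ conj v m t.+1 r (h0 s)) ->
  (forall s, integral_pair (h0 s) (h0' s)) ->
  (forall s T, tau (h0 s *m T *m ct (h0 s)) = h0 s *m tau T *m ct (h0 s)) ->
  (forall h, K h -> fiber_base conj v x r a h ->
     let T := tau (sch conj t.+1 r (uact h x)) in
     mxge v b T -> ~ mxge v (b + 1) T ->
     let Q s := (h0 s *m T *m ct (h0 s)) ord_max ord_max \in P y' in
     (forall s, Q s -> T ord_max ord_max \in P y) /\
     (T ord_max ord_max \in P y -> #|[pred s | Q s]| = c)) ->
  #|S|%:R * cmass conj mu x r a tau b y' = c%:R * cmass conj mu x r a tau b y.
Proof.
move=> hl hp ht hc; apply: (fiber_step I Hmu rn (h0 := h0)) => //.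
- exact: (content_open I tauB).
- exact: (content_open I tauB).
move=> h Kh hb T; have := hc h Kh hb; rewrite -/T /= => hc'.
have e s : `[< content v tau b y' (h0 s *m T *m ct (h0 s)) >] =
    `[< mxge v b (tau T) /\ ~ mxge v (b + 1) (tau T) >] &&
    ((h0 s *m tau T *m ct (h0 s)) ord_max ord_max \in P y').
  rewrite /content ht; apply/asboolP/andP.
    case=> /(mxge_conj_pair _ _ (hp s)) h1 h2 h3; split=> //; apply/asboolP; split=> // h4.
    by apply: h2; apply/(mxge_conj_pair _ _ (hp s)).
  case=> /asboolP[h1 h2] h3; split=> //; first exact/(mxge_conj_pair _ _ (hp s)).
  by move/(mxge_conj_pair _ _ (hp s)).
have [hT|hT] := pselect (mxge v b (tau T) /\ ~ mxge v (b + 1) (tau T)); last first.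
  rewrite asboolF; last by case=> h1 h2 _; apply: hT.
  by apply/eq_card0 => s; rewrite inE e asboolF.
have [h1 h2] := hc' hT.1 hT.2.
have -> : `[< content v tau b y T >] = (tau T ord_max ord_max \in P y).
  by apply/asboolP/idP => [[]|h3]; [|split=> //; case: hT].
case: ifP => hy; first by rewrite -h2 //; apply: eq_card => s; rewrite [LHS]inE [RHS]inE e asboolT.
apply/eq_card0 => s; rewrite [LHS]inE e asboolT //=.
by apply/negbTE/negP => /h1; rewrite hy.
Qed.

Lemma cmass_eq b y y' :
  (forall h, K h -> fiber_base conj v x r a h ->
     let T := tau (sch conj t.+1 r (uact h x)) in
     mxge v b T -> ~ mxge v (b + 1) T -> (T ord_max ord_max \in P y') = (T ord_max ord_max \in P y)) ->
  cmass conj mu x r a tau b y' = cmass conj mu x r a tau b y.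
Proof.
move=> hc; congr (mass _ _); apply/seteqP; split=> h [Kh [hb [h1 h2 h3]]]; split=> //; split=> //.
  by split=> //; rewrite -(hc h).
by split=> //; rewrite (hc h).
Qed.

Lemma cmass_eq0 b y :
  (forall h, K h -> fiber_base conj v x r a h ->
     let T := tau (sch conj t.+1 r (uact h x)) in
     mxge v b T -> ~ mxge v (b + 1) T -> T ord_max ord_max \in P y -> False) ->
  cmass conj mu x r a tau b y = 0.
Proof.
move=> hc; rewrite -(mass0 mu); congr (mass _ _); apply/seteqP; split=> // h [Kh [hb [h1 h2 h3]]].
exact: (hc h).
Qed.

End ContentStep.

Lemma sum2 (f : 'I_2 -> k') : \sum_i f i = f ord0 + f ord_max.
Proof. by rewrite !big_ord_recr big_ord0 /= add0r; congr (f _ + f _); apply: val_inj. Qed.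

Lemma ord2P (i : 'I_2) : i = ord0 \/ i = ord_max.
Proof. by case: i => [[|[|//]] hi]; [left | right]; apply: val_inj. Qed.

(** With parameters running over the residues, these matrices and [J 2] represent the points of the
    projective line over the residue field. *)
Definition low2 (c : k') : 'M[k']_2 :=
  \matrix_(i, j) (if i == j then 1 else if i == ord_max then c else 0).

Lemma low2E c : [/\ low2 c ord0 ord0 = 1, low2 c ord0 ord_max = 0,
  low2 c ord_max ord0 = c & low2 c ord_max ord_max = 1].
Proof. by split; rewrite mxE. Qed.

Lemma mul_low2 c d : low2 c *m low2 d = low2 (c + d).
Proof.
have [c1 c2 c3 c4] := low2E c; have [d1 d2 d3 d4] := low2E d.
have [e1 e2 e3 e4] := low2E (c + d).
apply/matrixP => i j; rewrite mxE sum2.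
by case: (ord2P i) => ->; case: (ord2P j) => ->;
  rewrite ?c1 ?c2 ?c3 ?c4 ?d1 ?d2 ?d3 ?d4 ?e1 ?e2 ?e3 ?e4; ring.
Qed.

Lemma low2_0 : low2 0 = 1%:M.
Proof. by apply/matrixP => i j; rewrite !mxE; case: eqP => // _; case: ifP. Qed.

Lemma mxge_low2 c : c \in P 0 -> mxge v 0 (low2 c).
Proof. by move=> hc i j; rewrite mxE; case: ifP => _; [apply: vge1|case: ifP => _ //; apply: vge0]. Qed.

Lemma low2_pair c : c \in P 0 -> integral_pair (low2 c) (low2 (- c)).
Proof.
move=> hc; split; [exact: mxge_low2|by apply: mxge_low2; rewrite vgeN|].
by rewrite mul_low2 addNr low2_0.
Qed.

Lemma anti_pair t : integral_pair (J t.+1) (J t.+1).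
Proof. by split; [exact: (mxgeJ I)|exact: (mxgeJ I)|exact: mulJJ]. Qed.

Lemma low2_act c T : ct T = T -> (low2 c *m T *m ct (low2 c)) ord_max ord_max =
  herm2 conj (T ord0 ord0) (T ord_max ord_max) (T ord0 ord_max) c.
Proof.
move=> cT; have [c1 c2 c3 c4] := low2E c.
have h i j : T j i = conj (T i j) by rewrite -{1}cT !mxE.
rewrite !mxE !sum2 !mxE !sum2 /= !mxE /= !rmorph1 !mulr1 !mul1r.
rewrite (h ord0 ord_max) /herm2 rmorphM /=; ring.
Qed.

Lemma anti_act t T : (J t.+1 *m T *m ct (J t.+1)) ord_max ord_max = T ord0 ord0.
Proof.
have e (j : 'I_t.+1) : (j == rev_ord ord_max) = (j == ord0).
  by rewrite -!val_eqE /= subnn.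
rewrite !mxE (bigD1 ord0) //= big1 ?addr0 => [|j hj]; rewrite !mxE e ?eqxx ?rmorph1.
  rewrite mulr1 (bigD1 ord0) //= big1 ?addr0 => [|i hi]; rewrite !mxE e ?eqxx ?mul1r //.
  by rewrite (negPf hi) mul0r.
by rewrite (negPf hj) rmorph0 mulr0.
Qed.

End Lines.

(** * Short roots: binary hermitian forms of given discriminant *)

Section CaseA.
Variables (k : fieldType) (k' : fieldExtType k) (conj : {lrmorphism k' -> k'}).
Variables (v : k' -> int) (q : nat) (pi theta : k') (rep : 'I_q -> k').
Hypothesis I : inert conj v pi theta rep.
Variables (R : realType) (m : nat) (mu : probability (borel_mx v m) R).
Hypothesis Hmu : is_haar conj mu.
Local Notation P := (vge v).
Local Notation ct := (conj_tr conj).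
Local Notation J := (@antidiag k k').
Local Notation K := (unitary_integral conj v m).
Local Notation uact := (Defs.act conj).
Local Notation rep2 := (rep2 theta rep).
Let dv := inert_dv I.
Let conjK := inert_conjK I.

Lemma herm2_back al ga be c : conj al = al ->
  herm2 conj al (herm2 conj al ga be c) (be + al * conj c) (- c) = ga.
Proof.
move=> cal; rewrite /herm2 !(rmorphD, rmorphM, rmorphN) /= cal conjK; ring.
Qed.

Section Scalars.
Variables (al ga be : k') (b : int) (l : nat).
Hypotheses (cal : conj al = al) (cga : conj ga = ga).
Let D := al * ga - be * conj be.
Hypotheses (D0 : D != 0) (vD : v D = b + b + l%:Z).
Hypothesis hb : [&& al \in P b, ga \in P b & be \in P b].
Hypothesis hb1 : ~~ [&& al \in P (b + 1), ga \in P (b + 1) & be \in P (b + 1)].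
Local Notation E := (herm2 conj al ga be).

Let hD (N : int) : N <= l%:Z -> D \in P (b + b + N).
Proof. by move=> h; rewrite vgeNz // vD; lia. Qed.

(** The translated form has off-diagonal entry be + al conj(c), of norm al E(c) - D, which bounds
    its valuation; translating back by - c then bounds ga. *)
Lemma herm2_back_step (N : int) (i d : nat) c : c \in P d%:Z -> (i + i <= l)%N ->
  (i + i)%:Z <= N -> N <= (i + d)%:Z -> N <= (d + d)%:Z ->
  E c \in P (b + N) -> ga \in P (b + N).
Proof.
move=> hc h1 h2 h3 h4 hE; have /and3P[hal _ _] := hb.
rewrite -(herm2_back ga be c cal).
have g1 : b + N <= b + i%:Z + d%:Z by clear -h3; lia.
have g2 : b + N <= b + (d%:Z + d%:Z) by clear -h4; lia.
apply: (herm2_stable I (b := b) (w := b + i%:Z) (d := d%:Z)) => //.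
  rewrite -(norm_vge I).
  have -> : (be + al * conj c) * conj (be + al * conj c) = al * E c - D.
    by rewrite (herm2_norm I ga be cal) /D; ring.
  have -> : b + i%:Z + (b + i%:Z) = b + b + (i + i)%:Z by lia.
  apply: vgeB => //; last by apply: hD; lia.
  by apply: (@vge_le _ _ (b + (b + N))); [lia | apply: vgeM].
by rewrite vgeN.
Qed.

(** Vanishing of ga to positive order forces al to have valuation b, and [card_herm2_even] applies;
    q + 1 occurs exactly when the level equals l = v(D) - 2b. *)
Lemma herm2_even (i : nat) : (0 < i)%N -> (i + i <= l)%N ->
  ga \in P (b + (i + i)%:Z) ->
  #|[pred ij | E (pi ^+ i * rep2 ij) \in P (b + (i + i)%:Z + 1)]|
    = if (i + i == l)%N then q.+1 else 1%N.
Proof.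
move=> i0 il hga.
have [al0 val] : al != 0 /\ v al = b.
  apply: (herm2_alpha_unit I (be := be) hb hb1); first by apply: hD; lia.
  by apply: vge_le hga; lia.
rewrite (card_herm2_even I cal cga al0 val) //; last by apply: hD; lia.
rewrite -/D vgeNz // vD; case: eqP => e; first by rewrite ifF //; lia.
by rewrite ifT //; lia.
Qed.

(** The norm of be has even valuation, so at an odd level it lies one step higher than the bound on
    al ga - D shows; then al ga lies there exactly when D does. *)
Lemma herm2_odd (i : nat) : (i + i < l)%N -> ga \in P (b + (i + i).+1%:Z) ->
  (ga \in P (b + (i + i).+2%:Z)) = ((i + i).+1 < l)%N.
Proof.
move=> il hga; have /and3P[hal _ _] := hb.
have [al0 val] : al != 0 /\ v al = b.
  apply: (herm2_alpha_unit I (be := be) hb hb1); first by apply: hD; lia.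
  by apply: vge_le hga; lia.
have hN : be * conj be \in P (b + b + (i + i).+2%:Z).
  rewrite (_ : b + b + (i + i).+2%:Z = b + i.+1%:Z + (b + i.+1%:Z)); last by lia.
  rewrite (norm_vge I) -(norm_vgeB1 I).
  rewrite (_ : be * conj be = al * ga - D); last by rewrite /D; ring.
  rewrite (_ : _ - 1 = b + b + (i + i).+1%:Z); last by clear; lia.
  apply: vgeB => //; last by apply: hD; clear -il; lia.
  by apply: (@vge_le _ _ (b + (b + (i + i).+1%:Z))); [clear; lia | apply: vgeM].
have : (al * ga \in P (b + b + (i + i).+2%:Z)) = ((i + i).+1 < l)%N.
  by rewrite -(vgeBr dv _ hN) -/D vgeNz // vD; clear; lia.
by rewrite (vgeMz dv _ _ al0 val) => <-; congr (_ \in P _); clear; lia.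
Qed.

(** Beyond the discriminant al ga no longer contributes to the leading part of D, so be has
    valuation exactly b + l / 2 and the count is a trace equation. *)
Lemma herm2_tail (i j : nat) : l = (i + i)%N -> (l < j)%N -> ga \in P (b + j%:Z) ->
  #|[pred ij | E (pi ^+ (j - i) * rep2 ij) \in P (b + j%:Z + 1)]| = q.
Proof.
move=> el lj hga; have /and3P[hal _ _] := hb.
have hag : al * ga \in P (b + b + l%:Z + 1).
  by apply: (@vge_le _ _ (b + (b + j%:Z))); [clear -lj; lia | apply: vgeM].
have ell : b + i%:Z + (b + i%:Z) = b + b + l%:Z by rewrite el; clear; lia.
have hN : be * conj be \in P (b + i%:Z + (b + i%:Z)).
  rewrite (_ : be * conj be = al * ga - D); last by rewrite /D; ring.
  rewrite ell; apply: vgeB => //; last exact: hD.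
  by apply: vge_le hag; clear; lia.
have [be0 vbe] : be != 0 /\ v be = b + i%:Z.
  apply: vge_val => //; first by rewrite -(norm_vge I).
  rewrite -(norm_vge1 I) ell; apply/negP => h.
  have : D \in P (b + b + l%:Z + 1) by apply: vgeB.
  by rewrite vgeNz // vD; clear; lia.
have g1 : b + j%:Z = b + i%:Z + (j - i)%N%:Z by clear -el lj; lia.
have g2 : b + j%:Z < b + ((j - i) + (j - i))%N%:Z by clear -el lj; lia.
exact: (card_herm2_tail I cga be0 vbe hal hga g1 g2).
Qed.

End Scalars.

Variables (x : 'M[k']_m) (r : nat) (a : nat -> int).
Hypothesis cx : ct x = x.
Hypothesis rn : (r.+2 <= m./2)%N.
Hypothesis a0 : a 0 = 0.
Local Notation base := (fiber_base conj v x r a).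
Local Notation sch2 h := (sch conj 2 r (uact h x)).
Local Notation cm := (cmass conj (t := 1) mu x r a id).

Let rn' : (r < m./2)%N. Proof. exact: ltnW. Qed.

Let tauB : forall N (A B : 'M[k']_2), mxge v N (A - B) -> mxge v N (id A - id B).
Proof. by []. Qed.

Lemma det2 (T : 'M[k']_2) : \det T = T ord0 ord0 * T ord_max ord_max - T ord0 ord_max * T ord_max ord0.
Proof.
rewrite (expand_det_row _ ord0) sum2 /cofactor !det_mx11 !mxE /= expr0 expr1.
have -> : lift ord0 0 = ord_max :> 'I_2 by apply: val_inj.
have -> : lift ord_max 0 = ord0 :> 'I_2 by apply: val_inj.
ring.
Qed.

Lemma caseA_facts h : K h -> base h ->
  let T := sch2 h in let D := T ord0 ord0 * T ord_max ord_max - T ord0 ord_max * conj (T ord0 ord_max) in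
  [/\ ct T = T, conj (T ord0 ord0) = T ord0 ord0, conj (T ord_max ord_max) = T ord_max ord_max,
   D != 0 & v D = a r.+2 - a r].
Proof.
move=> Kh hb T D.
have cT : ct T = T by apply: sch_ct => //; apply: act_ct.
have hc i j : conj (T i j) = T j i by rewrite -{2}cT !mxE.
have eD : D = \det T.
  by rewrite det2 /D hc.
have [d0 vd] : lowdet conj (2 + r) (uact h x) != 0 /\ v (lowdet conj (2 + r) (uact h x)) = a (r.+2).
  by apply: hb; lia.
have d1 := fiber_base_low rn' hb.
have vd1 : v (lowdet conj r (uact h x)) = a r.
  have [r0|r0] := posnP r; last by have [] := hb r r0 (ltnW rn') (n_Sn _).
  by rewrite [v _](congr1 (fun r => v (lowdet conj r (uact h x))) r0) lowdet0 val1 // r0 a0.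
have e : lowdet conj (2 + r) (uact h x) = lowdet conj r (uact h x) * \det T.
  by apply: lowdet_sch => //; lia.
have dT : \det T != 0 by move: d0; rewrite e mulf_eq0 negb_or => /andP[].
split=> //; rewrite eD //.
by move: vd; rewrite e valM // vd1; lia.
Qed.

Lemma mxge2P N (T : 'M[k']_2) : ct T = T -> mxge v N T <->
  [&& T ord0 ord0 \in P N, T ord_max ord_max \in P N & T ord0 ord_max \in P N].
Proof.
move=> cT; split=> [h|/and3P[h1 h2 h3] i j]; first by rewrite !h.
have hc : conj (T ord0 ord_max) = T ord_max ord0 by rewrite -{2}cT !mxE.
by case: (ord2P i) => ->; case: (ord2P j) => -> //; rewrite -hc (vge_conj I).
Qed.

(** The Levi element acts by h on two rows and by its conjugate-transpose inverse on the dual rows.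
    The last j rows have a stable span for j <= r and for j >= r + 2, so only d_(r+1) moves. *)
Lemma liftA h h' : integral_pair v h h' -> @liftable _ _ conj v m 2 r h.
Proof.
case=> i1 i2 hh; exists (levi m r h (ct h')).
have Hm : ((2 + r).*2 <= m)%N by lia.
have u : ct h *m ct h' = 1%:M by rewrite -ctM hh ct1.
split.
- by apply: (levi_K I) => //; apply: (mxge_ct I).
- move=> j j0 jn jr; have [jr'|jr'] := leqP j r.
    by exists 1%:M; rewrite mul1mx levi_low.
  by apply: levi_high => //; lia.
- exact: levi_low.
- exact: levi_mid.
Qed.

Section Relations.
Variables (b : int) (l : nat).
Hypothesis el : a r.+2 - a r = b + b + l%:Z.
Local Notation M j := (cm b (b + j%:Z)).

Lemma caseA_state h : K h -> base h -> mxge v b (sch2 h) -> ~ mxge v (b + 1) (sch2 h) ->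
  let T := sch2 h in
  [/\ conj (T ord0 ord0) = T ord0 ord0, conj (T ord_max ord_max) = T ord_max ord_max,
   T ord0 ord0 * T ord_max ord_max - T ord0 ord_max * conj (T ord0 ord_max) != 0,
   v (T ord0 ord0 * T ord_max ord_max - T ord0 ord_max * conj (T ord0 ord_max)) = b + b + l%:Z &
  [&& T ord0 ord0 \in P b, T ord_max ord_max \in P b & T ord0 ord_max \in P b] /\
  ~~ [&& T ord0 ord0 \in P (b + 1), T ord_max ord_max \in P (b + 1) & T ord0 ord_max \in P (b + 1)]].
Proof.
move=> Kh hb h1 h2 T; have [cT c1 c2 D0 vD] := caseA_facts Kh hb.
split=> //; first by rewrite vD.
split; first exact/(mxge2P _ cT).
by apply/negP => /(mxge2P _ cT).
Qed.

(** The q^2 + 1 translates run over the projective line over the residue field; l = 0 is the case of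
    a form that is nondegenerate after division by pi^b. *)
Lemma massA_zero : (q ^ 2 + 1)%:R * M 1%N = (if l == 0%N then q.+1 else 1%N)%:R * M 0%N.
Proof.
pose h0 (s : option ('I_q * 'I_q)) : 'M[k']_2 := if s is Some ij then low2 (rep2 ij) else J 2.
pose h0' (s : option ('I_q * 'I_q)) : 'M[k']_2 := if s is Some ij then low2 (- rep2 ij) else J 2.
have hp s : integral_pair v (h0 s) (h0' s).
  by case: s => [ij|]; [apply: (low2_pair I); apply: (rep2_int I)|apply: (anti_pair I)].
rewrite (_ : q ^ 2 + 1 = #|{: option ('I_q * 'I_q)}|)%N; last first.
  by rewrite card_option card_prod card_ord addn1 expnS expn1.
apply: (content_step I Hmu rn' tauB (h0 := h0) (h0' := h0')) => //.
  by move=> s; apply: (liftA (hp s)).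
move=> h Kh hb T hT1 hT2 Q; have [c1 c2 D0 vD [h1 h2]] := caseA_state Kh hb hT1 hT2.
have [cT _ _ _ _] := caseA_facts Kh hb.
rewrite addr0; split=> [s _|_]; first exact: hT1.
have := card_herm2_lines I c1 c2 h1 h2.
rewrite vgeNz // vD => e; rewrite (_ : (l == 0%N) = ~~ (b + b + 1 <= b + b + l%:Z)); last by clear; lia.
rewrite if_neg -e; apply: eq_card => s; rewrite [LHS]inE [RHS]inE /Q; case: s => [ij|].
  by rewrite /h0 low2_act.
by rewrite /h0 anti_act.
Qed.

(** The q^2 translates have parameters in P^d modulo P^(d+1), with d to be chosen so that level j is
    stable under them. *)
Let step (d c j : nat) :
  (forall h, K h -> base h -> mxge v b (sch2 h) -> ~ mxge v (b + 1) (sch2 h) ->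
     let T := sch2 h in let E z := herm2 conj (T ord0 ord0) (T ord_max ord_max) (T ord0 ord_max) z in
     (forall z, z \in P d%:Z -> E z \in P (b + j.+1%:Z) -> T ord_max ord_max \in P (b + j%:Z)) /\
     (T ord_max ord_max \in P (b + j%:Z) ->
       #|[pred ij | E (pi ^+ d * rep2 ij) \in P (b + j%:Z + 1)]| = c)) ->
  (q ^ 2)%:R * M j.+1 = c%:R * M j.
Proof.
move=> hc; pose h0 (s : 'I_q * 'I_q) : 'M[k']_2 := low2 (pi ^+ d * rep2 s).
pose h0' (s : 'I_q * 'I_q) : 'M[k']_2 := low2 (- (pi ^+ d * rep2 s)).
have ci s : pi ^+ d * rep2 s \in P d%:Z.
  by apply: vgeMr => //; [rewrite vgeNz ?(pi_exp_neq0 I) // (val_pi_exp I) | apply: (rep2_int I)].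
have hp s : integral_pair v (h0 s) (h0' s).
  by apply: (low2_pair I); apply: vge_le (ci s).
rewrite (_ : q ^ 2 = #|{: 'I_q * 'I_q}|)%N; last by rewrite card_prod card_ord expnS expn1.
apply: (content_step I Hmu rn' tauB (h0 := h0) (h0' := h0')) => //.
  by move=> s; apply: (liftA (hp s)).
move=> h Kh hb T hT1 hT2 Q; have [cT _ _ _ _] := caseA_facts Kh hb.
have [H1 H2] := hc h Kh hb hT1 hT2; split=> [s|hy].
  by rewrite /Q /h0 low2_act // => hQ; apply: (H1 _ (ci s)).
rewrite -(H2 hy); apply: eq_card => s; rewrite [LHS]inE [RHS]inE /Q /h0 low2_act //.
by rewrite -addrA -[in RHS]PoszD addn1.
Qed.

Lemma massA_even (i : nat) : (0 < i)%N -> (i + i <= l)%N ->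
  (q ^ 2)%:R * M (i + i).+1 = (if (i + i == l)%N then q.+1 else 1%N)%:R * M (i + i)%N.
Proof.
move=> i0 il; apply: (step (d := i)) => h Kh hb hT1 hT2 T E.
have [c1 c2 D0 vD [h1 h2]] := caseA_state Kh hb hT1 hT2; split; last exact: herm2_even.
move=> z hz hE; apply: (herm2_back_step c1 D0 vD h1 h2 (i := i) hz) => //.
by apply: vge_le hE; clear; lia.
Qed.

(** No averaging occurs: by parity, a last entry of valuation at least b + 2i + 1 lies one level
    higher either always or never. *)
Lemma massA_odd (i : nat) : (i + i < l)%N ->
  M (i + i).+2 = if ((i + i).+1 < l)%N then M (i + i).+1 else 0.
Proof.
move=> il; case: ifP => e; [apply: cmass_eq | apply: cmass_eq0] => h Kh hb T hT1 hT2;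
  have [c1 c2 D0 vD [h1 h2]] := caseA_state Kh hb hT1 hT2.
  apply/idP/idP => hy; first by apply: vge_le hy; clear; lia.
  by rewrite (herm2_odd D0 vD h1 h2).
move=> hy; move: e; rewrite -(herm2_odd D0 vD h1 h2 il) ?hy //.
by apply: vge_le hy; clear; lia.
Qed.

Lemma massA_tail (i j : nat) : l = (i + i)%N -> (l < j)%N ->
  (q ^ 2)%:R * M j.+1 = q%:R * M j.
Proof.
move=> el' lj; apply: (step (d := (j - i)%N)) => h Kh hb hT1 hT2 T E.
have [c1 c2 D0 vD [h1 h2]] := caseA_state Kh hb hT1 hT2.
split; last by move=> hy; apply: (herm2_tail c2 D0 vD h1 h2 el' lj hy).
move=> z hz hE; apply: (herm2_back_step c1 D0 vD h1 h2 (i := i) hz); try by (move: el' lj; clear; lia).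
by apply: vge_le hE; clear; lia.
Qed.

End Relations.

Lemma massA_content (b y : int) : a r.+2 - a r < b + b -> cm b y = 0.
Proof.
move=> hlt; apply: cmass_eq0 => h Kh hb T hT1 hT2 hy; have [cT c1 c2 D0 vD] := caseA_facts Kh hb.
have : T ord0 ord0 * T ord_max ord_max - T ord0 ord_max * conj (T ord0 ord_max) \in P (b + b).
  by apply: vgeB => //; apply: vgeM => //; rewrite ?(vge_conj I).
by rewrite vgeNz // vD; move: hlt; clear; lia.
Qed.

End CaseA.

(** * Idempotents of trace one and hermitian matrices of rank one *)

(** In a full-rank factorization A = C L idempotency gives L C = 1, whose size is the rank. *)
Lemma idem_trace_rank (F : fieldType) n (A : 'M[F]_n) : A *m A = A -> \tr A = (\rank A)%:R.
Proof.
move=> AA; rewrite -{1}(mulmx_base A) mxtrace_mulC.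
have := col_base_full A; have := row_base_free A.
move: (col_base A) (row_base A) (mulmx_base A) => C L e fL fC.
suff -> : L *m C = 1%:M by rewrite mxtrace1.
apply: (row_full_inj fC); apply: (row_free_inj fL) => /=.
by rewrite mulmx1 e mulmxA e -mulmxA e.
Qed.

(** The trace determines the rank only modulo the characteristic; with n <= 3 and 2 nonzero the
    ranks 0, 2 and 3 are excluded. *)
Lemma idem_rank1 (F : fieldType) n (A : 'M[F]_n) : (n <= 3)%N -> 2%:R != 0 :> F ->
  A *m A = A -> \tr A = 1 -> forall i j i' j', A i j * A i' j' = A i j' * A i' j.
Proof.
move=> n3 h2 AA tA; have r1 : \rank A = 1%N.
  have := idem_trace_rank AA; rewrite tA; have := leq_trans (rank_leq_row A) n3.
  case: (\rank A) => [|[|[|[|]]]] // _ /eqP; first by rewrite oner_eq0.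
    by rewrite -subr_eq0 mulrS opprD addrA subrr sub0r oppr_eq0 oner_eq0.
  by rewrite -subr_eq0 mulrS opprD addrA subrr sub0r oppr_eq0 (negPf h2).
move=> i j i' j'; have [c [d h]] : exists c d : 'I_n -> F, forall a b, A a b = c a * d b.
  have := mulmx_base A; move: (col_base A) (row_base A); rewrite r1 => C L <-.
  by exists (fun a => C a 0), (fun b => L 0 b) => u w; rewrite mxE big_ord1.
by rewrite !h; ring.
Qed.

Definition minors0 (F : fieldType) m n (A : 'M[F]_(m, n)) :=
  forall i j i' j', A i j * A i' j' = A i j' * A i' j.

Lemma minor_mull (F : fieldType) m n p (B : 'M[F]_(p, m)) (A : 'M[F]_(m, n)) :
  minors0 A -> minors0 (B *m A).
Proof.
move=> hA i j i' j'; rewrite !mxE !mulr_suml; apply: eq_bigr => c _.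
rewrite !mulr_sumr; apply: eq_bigr => d _.
by rewrite mulrACA hA mulrACA.
Qed.

Lemma minor_mulr (F : fieldType) m n p (A : 'M[F]_(m, n)) (B : 'M[F]_(n, p)) :
  minors0 A -> minors0 (A *m B).
Proof.
move=> hA i j i' j'; rewrite !mxE !mulr_suml.
under eq_bigr do rewrite mulr_sumr; under [RHS]eq_bigr do rewrite mulr_sumr.
rewrite [RHS]exchange_big; apply: eq_bigr => c _; apply: eq_bigr => d _.
by rewrite mulrACA hA; ring.
Qed.

Section RankOne.
Variables (k : fieldType) (k' : fieldExtType k) (conj : {lrmorphism k' -> k'}).
Variables (v : k' -> int) (q : nat) (pi theta : k') (rep : 'I_q -> k').
Hypothesis I : inert conj v pi theta rep.
Local Notation P := (vge v).
Local Notation ct := (conj_tr conj).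
Local Notation J := (@antidiag k k').
Local Notation rep2 := (rep2 theta rep).
Let dv := inert_dv I.
Let conjK := inert_conjK I.

Record rank1_form t (b : int) (T : 'M[k']_t) : Prop := {
  r1_ct : ct T = T;
  r1_minor : forall i j i' j', T i j * T i' j' = T i j' * T i' j;
  r1_trace : \tr (T *m J t) = 2%:R;
  r1_ge : mxge v b T;
  r1_nge : ~ mxge v (b + 1) T }.

(** S J is an involution of trace t - 2, so (1 - S J) / 2 is an idempotent of trace 1, to which
    [idem_rank1] applies. *)
Lemma rank1_form_sch t (S : 'M[k']_t) b : (t <= 3)%N -> ct S = S -> S *m J t *m S = J t ->
  \tr (S *m J t) + 2%:R = t%:R -> mxge v b (J t - S) -> ~ mxge v (b + 1) (J t - S) ->
  rank1_form b (J t - S).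
Proof.
move=> t3 cS SJS tS h1 h2; have n2 := inert_two I.
have tT : \tr ((J t - S) *m J t) = 2%:R.
  by rewrite mulmxBl mulJJ raddfB /= mxtrace1 -tS addrC addKr.
split=> //; first by rewrite ctB ctJ cS.
have [A eA] : exists A, A = 2%:R^-1 *: ((J t - S) *m J t) by eexists.
have eT : J t - S = 2%:R *: (A *m J t).
  by rewrite eA -scalemxAl scalerA mulfV // scale1r -mulmxA mulJJ mulmx1.
have hTT : (J t - S) *m J t *m (J t - S) = 2%:R *: (J t - S).
  rewrite !(mulmxBl, mulmxBr) mulJJ !mul1mx SJS -mulmxA mulJJ mulmx1.
  by rewrite scaler_nat mulr2n opprB addrA.
have hA : forall i j i' j', A i j * A i' j' = A i j' * A i' j.
  apply: idem_rank1 => //.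
    rewrite eA -scalemxAl -scalemxAr scalerA mulmxA hTT -scalemxAl scalerA.
    by rewrite -mulrA mulVf // mulr1.
  by rewrite eA mxtraceZ tT mulVf.
move=> i j i' j'; rewrite eT.
have hJ a c : (A *m J t) a c = A a (rev_ord c).
  rewrite mxE (bigD1 (rev_ord c)) //= big1 ?addr0 => [|d hd]; rewrite !mxE.
    by rewrite rev_ordK eqxx mulr1.
  rewrite (_ : c == rev_ord d = false) ?mulr0 //; apply: contraNF hd => /eqP ->; by rewrite rev_ordK.
have hJ2 a c : (2%:R *: (A *m J t)) a c = 2%:R * A a (rev_ord c) by rewrite -hJ [LHS]mxE.
by rewrite !hJ2 mulrACA hA mulrACA.
Qed.

Section Form.
Variables (t : nat) (b : int) (T : 'M[k']_t.+1).
Hypothesis rT : rank1_form b T.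

Lemma r1_conj i j : conj (T i j) = T j i.
Proof. by rewrite -{2}(r1_ct rT) !mxE. Qed.

Lemma r1_diag i j : T i i * T j j = T i j * conj (T i j).
Proof. by rewrite r1_conj (r1_minor rT). Qed.

Lemma r1_act (h : 'M[k']_t.+1) i l :
  T i i * (h *m T *m ct h) l l = (h *m T) l i * conj ((h *m T) l i).
Proof.
have hu c : T i i * (h *m T) l c = (h *m T) l i * T i c.
  rewrite !mxE mulr_sumr mulr_suml; apply: eq_bigr => d _.
  by rewrite mulrCA (r1_minor rT) [T i c * _]mulrC mulrA.
rewrite mxE mulr_sumr.
under eq_bigr do rewrite mulrA hu -mulrA; rewrite -mulr_sumr; congr (_ * _).
rewrite [(h *m T) l i]mxE rmorph_sum /=; apply: eq_bigr => c _.
by rewrite rmorphM /= r1_conj !mxE mulrC.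
Qed.

(** If every diagonal entry were in P^(b+1), so would be every entry, because its norm is the
    product of two diagonal ones. *)
Lemma r1_unit : exists2 i, T i i != 0 & v (T i i) = b.
Proof.
have [[i hi]|hn] := pselect (exists i, T i i \notin P (b + 1)).
  have [|h1 h2] := vge_val (r1_ge rT i i); last by exists i.
  exact: hi.
case: (r1_nge rT) => i j; rewrite -(norm_vge I) -r1_diag.
by apply: vgeM => //; apply/negPn/negP => h; apply: hn; eexists; exact: h.
Qed.

(** A product of two diagonal entries is a norm, hence of even valuation or zero; as one diagonal
    entry has valuation b, all the nonzero ones have the parity of b. *)
Lemma r1_parity j l : T l l \in P (b + (j + j)%:Z + 1) -> T l l \in P (b + (j.+1 + j.+1)%:Z).
Proof.
have [i i0 vi] := r1_unit => h.
have : T i i * T l l \in P (b + j%:Z + (b + j%:Z) + 1).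
  rewrite (vgeMz dv _ _ i0 vi); apply: vge_le h; lia.
rewrite r1_diag (norm_vge1 I) -(norm_vge I) -r1_diag (vgeMz dv _ _ i0 vi).
by apply: vge_le; lia.
Qed.

Lemma r1_conj_pair h h' : integral_pair v h h' -> ct h *m J t.+1 *m h = J t.+1 ->
  rank1_form b (h *m T *m ct h).
Proof.
move=> hp hu; split.
- by rewrite !ctM ctK // (r1_ct rT) mulmxA.
- by apply: minor_mulr; apply: minor_mull; exact: (r1_minor rT).
- rewrite -!mulmxA mxtrace_mulC -!mulmxA; rewrite (mulmxA (ct h)) hu; exact: (r1_trace rT).
- by apply/(mxge_conj_pair I); [exact: hp | exact: (r1_ge rT)].
- by move/(mxge_conj_pair I _ _ hp); exact: (r1_nge rT).
Qed.

End Form.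
End RankOne.

(** * The last root: reduction to matrices of rank one *)

Section MidStep.
Variables (k : fieldType) (k' : fieldExtType k) (conj : {lrmorphism k' -> k'}).
Variables (v : k' -> int) (q : nat) (pi theta : k') (rep : 'I_q -> k').
Hypothesis I : inert conj v pi theta rep.
Variables (R : realType) (m : nat) (mu : probability (borel_mx v m) R).
Hypothesis Hmu : is_haar conj mu.
Local Notation P := (vge v).
Local Notation ct := (conj_tr conj).
Local Notation J := (@antidiag k k').
Local Notation K := (unitary_integral conj v m).
Local Notation uact := (Defs.act conj).
Local Notation rep2 := (rep2 theta rep).
Let dv := inert_dv I.
Let conjK := inert_conjK I.
Variables (x : 'M[k']_m) (t r : nat) (a : nat -> int).
Hypothesis hx : unitary_hermitian conj m x.
Hypothesis em : m = (t.+1 + r + r)%N.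
Hypothesis rn : r.+1 = m./2.
Local Notation base := (fiber_base conj v x r a).
Local Notation tau := (fun A : 'M[k']_t.+1 => J t.+1 - A).
Local Notation S h := (sch conj t.+1 r (uact h x)).
Local Notation cm := (cmass conj (t := t) mu x r a tau).

Let rn' : (r < m./2)%N. Proof. by rewrite -rn. Qed.

Lemma tau_near N A B : mxge v N (A - B) -> mxge v N (tau A - tau B).
Proof.
move=> h i j; have := h i j; rewrite !mxE -(vgeN dv).
by congr (_ \in P N); ring.
Qed.

Lemma tau_low : exists N, forall A M, M <= N -> mxge v M A -> mxge v M (tau A).
Proof.
exists 0 => A M M0 hA; apply: (mxgeB I) => //.
by apply: mxge_le M0 _; apply: (mxgeJ I).
Qed.

Lemma mid_form h b : K h -> base h -> mxge v b (tau (S h)) -> ~ mxge v (b + 1) (tau (S h)) ->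
  rank1_form conj v b (tau (S h)).
Proof.
move=> Kh hb hT1 hT2; have [cx xJx tx] := unitary_hermitian_facts hx.
have cy : ct (uact h x) = uact h x by apply: act_ct.
have yJy : uact h x *m J m *m uact h x = J m.
  by apply: act_unitary => //; apply: (K_unitary Kh).
have d0 := fiber_base_low rn' hb.
apply: (rank1_form_sch I); first by lia.
- exact: sch_ct.
- exact: sch_unitary.
- rewrite sch_trace // act_trace ?tx; last exact: K_unitary Kh.
  by rewrite -natrD; congr (_%:R); lia.
- exact: hT1.
- exact: hT2.
Qed.

(** The trace of (J - S) J is 2, so the content of J - S is at most v(2). *)
Lemma mid_content b : v 2%:R < b -> forall h, K h -> base h -> ~ mxge v b (tau (S h)).
Proof.
move=> hlt h Kh hb hT.
have [cx xJx tx] := unitary_hermitian_facts hx.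
have yJy : uact h x *m J m *m uact h x = J m.
  by apply: act_unitary => //; apply: (K_unitary Kh).
have d0 := fiber_base_low rn' hb.
have : 2%:R \in P b.
  have -> : 2%:R = \tr (tau (S h) *m J t.+1).
    rewrite mulmxBl mulJJ raddfB /= mxtrace1 sch_trace //; last by apply: act_ct.
    rewrite act_trace ?tx; last exact: K_unitary Kh.
    have -> : t.+1 = (odd m + 2)%N by lia.
    by rewrite natrD [_ + 2%:R]addrC addrK.
  rewrite /mxtrace; apply: vge_sum => // i _; apply: (mxgeMr I hT); exact: (mxgeJ I).
by rewrite vgeNz ?(inert_two I) // leNgt hlt.
Qed.

Lemma mid_lift h h' : integral_pair v h h' -> ct h *m J t.+1 *m h = J t.+1 ->
  @liftable _ _ conj v m t.+1 r h.
Proof.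
case=> i1 i2 hh u; exists (emb m r h); split.
- exact: (emb_K I).
- move=> j j0 jn jr; exists 1%:M; rewrite mul1mx emb_low //; lia.
- by rewrite emb_low //; lia.
- by rewrite emb_mid //; lia.
Qed.

(** Translating by elements unitary for J commutes with S -> J - S, so the counts may be made on
    matrices of rank one. *)
Lemma mid_step (F : finType) (h0 h0' : F -> 'M[k']_t.+1) c b y y' :
  (forall s, integral_pair v (h0 s) (h0' s)) ->
  (forall s, ct (h0 s) *m J t.+1 *m h0 s = J t.+1) ->
  (forall T, rank1_form conj v b T ->
    let Q s := (h0 s *m T *m ct (h0 s)) ord_max ord_max \in P y' in
     (forall s, Q s -> T ord_max ord_max \in P y) /\
     (T ord_max ord_max \in P y -> #|[pred s | Q s]| = c)) ->
  #|F|%:R * cm b y' = c%:R * cm b y.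
Proof.
move=> hp hu hc; apply: (content_step I Hmu rn' tau_near (h0 := h0) (h0' := h0')) => //.
- by move=> s; apply: mid_lift (hp s) (hu s).
- by move=> s T; rewrite mulmxBr mulmxBl (unitary_ct (hu s)).
move=> h Kh hb T hT1 hT2 Q; apply: hc; exact: mid_form.
Qed.

(* Levels [b + 2 j] suffice since all diagonal valuations have the parity of [b]. *)
Lemma mid_level (F : finType) (h0 h0' : F -> 'M[k']_t.+1) c b (j : nat) :
  (forall s, integral_pair v (h0 s) (h0' s)) ->
  (forall s, ct (h0 s) *m J t.+1 *m h0 s = J t.+1) ->
  (forall T, rank1_form conj v b T -> (0 < j)%N -> forall s,
    T ord_max ord_max \in P (b + (j + j)%:Z) ->
    (h0' s *m T *m ct (h0' s)) ord_max ord_max \in P (b + (j + j)%:Z)) ->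
  (forall T, rank1_form conj v b T -> T ord_max ord_max \in P (b + (j + j)%:Z) ->
    #|[pred s | (h0 s *m T *m ct (h0 s)) ord_max ord_max \in P (b + (j + j)%:Z + 1)]| = c) ->
  #|F|%:R * cm b (b + (j.+1 + j.+1)%:Z) = c%:R * cm b (b + (j + j)%:Z).
Proof.
move=> hp hu hs hc; apply: (mid_step hp hu) => T rT Q.
have rT' s : rank1_form conj v b (h0 s *m T *m ct (h0 s)) by exact: (r1_conj_pair I rT (hp s) (hu s)).
have eQ s : Q s = ((h0 s *m T *m ct (h0 s)) ord_max ord_max \in P (b + (j + j)%:Z + 1)).
  apply/idP/idP => [|h]; last exact: (r1_parity I (rT' s)).
  by apply: vge_le; clear; lia.
split=> [s|hy]; last by rewrite -(hc T rT hy); apply: eq_card => s; rewrite [LHS]inE [RHS]inE eQ.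
rewrite eQ => hQ; have [j0|j0] := posnP j; first by rewrite j0 addr0; exact: (r1_ge rT).
have := hs _ (rT' s) j0 s; have [_ _ e] := hp s.
have -> : h0' s *m (h0 s *m T *m ct (h0 s)) *m ct (h0' s) = T.
  by rewrite !mulmxA e mul1mx -mulmxA -ctM e ct1 mulmx1.
apply.
by apply: vge_le hQ; clear; lia.
Qed.

Lemma mid_parity b (j : nat) : cm b (b + (j + j)%:Z + 1) = cm b (b + (j.+1 + j.+1)%:Z).
Proof.
apply: cmass_eq => h Kh hb T hT1 hT2; have rT := mid_form Kh hb hT1 hT2.
apply/idP/idP => [h1|]; first exact: (r1_parity I rT).
by apply: vge_le; clear; lia.
Qed.

Lemma mid_cmass0 b y : (forall T : 'M[k']_t.+1, rank1_form conj v b T -> T ord_max ord_max \in P y -> False) ->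
  cm b y = 0.
Proof.
move=> hc; apply: cmass_eq0 => h Kh hb T hT1 hT2; exact/hc/mid_form.
Qed.

End MidStep.

(** * The last root in even size *)

Section CaseB.
Variables (k : fieldType) (k' : fieldExtType k) (conj : {lrmorphism k' -> k'}).
Variables (v : k' -> int) (q : nat) (pi theta : k') (rep : 'I_q -> k').
Hypothesis I : inert conj v pi theta rep.
Local Notation P := (vge v).
Local Notation ct := (conj_tr conj).
Local Notation J := (@antidiag k k').
Local Notation eta := (eta conj theta).
Let dv := inert_dv I.
Let conjK := inert_conjK I.

(** Elements of trace 0 in P^j modulo P^(j+1), the parameters for which [low2] is unitary. *)
Definition imag (j : nat) (l : 'I_q) := pi ^+ j * rep l * eta.

Lemma imag_conj j l : conj (imag j l) = - imag j l.
Proof. by rewrite /imag !rmorphM /= (conj_pi_exp I) (conj_rep I) (conj_eta I) mulrN. Qed.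

Lemma vge_imag j l : imag j l \in P j%:Z.
Proof.
have [e0 ve] := eta_unit I.
apply: vgeMr => //; last by rewrite vgeNz // ve.
by apply: vgeMr => //; [exact: (vge_pi_exp I) | exact: (rep_int I)].
Qed.

Lemma low2_unitary c : conj c = - c -> ct (low2 c) *m J 2 *m low2 c = J 2.
Proof.
move=> hc; apply/matrixP => i j; rewrite !mxE !sum2 !mxE !sum2 !mxE /= !rmorph1.
by case: (ord2P i) => ->; case: (ord2P j) => ->; rewrite /= ?rmorph1 ?rmorph0 ?hc; ring.
Qed.

Section Form.
Variables (T : 'M[k']_2) (b : int) (r : nat).
Hypothesis rT : rank1_form conj v b T.
Hypothesis v2 : v 2%:R = b + r%:Z.

Let al := T ord0 ord0.
Let ga := T ord_max ord_max.
Let be := T ord_max ord0.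

Lemma B_trace : be + conj be = 2%:R.
Proof.
rewrite -(r1_trace rT) /mxtrace sum2 !mxE !sum2 !mxE /= (r1_conj rT).
by rewrite !mulr0 !mulr1 addr0 add0r addrC.
Qed.

Lemma B_norm : al * ga = be * conj be.
Proof. by rewrite mulrC (r1_diag rT). Qed.

Lemma B_act c : al * (low2 c *m T *m ct (low2 c)) ord_max ord_max =
  (be + c * al) * conj (be + c * al).
Proof.
rewrite (r1_act rT); congr (_ * conj _); rewrite !mxE sum2 !mxE /=;
by rewrite mul1r addrC.
Qed.

Lemma B_al : ga \in P (b + 1) -> al != 0 /\ v al = b.
Proof.
move=> h; have [i i0 vi] := r1_unit I rT.
case: (ord2P i) => ei; subst i; first by [].
by move: h; rewrite /ga vgeNz // vi; lia.
Qed.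

Lemma B_be (j : nat) : ga \in P (b + (j + j)%:Z) -> be \in P (b + j%:Z).
Proof.
move=> h; rewrite -(norm_vge I) -B_norm; apply: (@vge_le _ _ (b + (b + (j + j)%:Z))); first by clear; lia.
by apply: vgeM => //; exact: (r1_ge rT).
Qed.

Lemma B_be1 (j : nat) : ga \in P (b + (j + j)%:Z + 1) -> be \in P (b + j%:Z + 1).
Proof.
move=> h; rewrite -(norm_vge1 I) -B_norm; apply: (@vge_le _ _ (b + (b + (j + j)%:Z + 1))); first by clear; lia.
by apply: vgeM => //; exact: (r1_ge rT).
Qed.

(** The relation be + conj(be) = 2 with v(2) = b + r bounds the valuation of be, hence that of ga
    through al ga = be conj(be). *)
Lemma B_end : ga \in P (b + (r + r)%:Z + 1) -> False.
Proof.
move/B_be1 => h; have : 2%:R \in P (b + r%:Z + 1).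
  by rewrite -B_trace; apply: vgeD; rewrite ?(vge_conj I).
by rewrite vgeNz ?(inert_two I) // v2; lia.
Qed.

Lemma B_stable (j : nat) c : (0 < j)%N -> c \in P j%:Z -> ga \in P (b + (j + j)%:Z) ->
  (low2 c *m T *m ct (low2 c)) ord_max ord_max \in P (b + (j + j)%:Z).
Proof.
move=> j0 hc hg; have [al0 val] : al != 0 /\ v al = b.
  by apply: B_al; apply: vge_le hg; lia.
rewrite (_ : b + _ = b + j%:Z + (b + j%:Z) - b); last by clear; lia.
rewrite -(vgeMz dv _ _ al0 val) B_act (norm_vge I); apply: vgeD => //; first exact: B_be.
by rewrite addrC; apply: vgeM => //; exact: (r1_ge rT).
Qed.

(** After division by al the condition is be / al + c in P^(j+1). The trace of be / al is 2 / al, of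
    valuation r > j, so only the coordinate of trace 0 has to be corrected, and exactly one
    parameter does it. *)
Lemma B_count (j : nat) : al != 0 -> v al = b -> ga \in P (b + (j + j)%:Z) -> (j < r)%N ->
  #|[pred l | (low2 (imag j l) *m T *m ct (low2 (imag j l))) ord_max ord_max
      \in P (b + (j + j)%:Z + 1)]| = 1%N.
Proof.
move=> al0 val hg jr.
have hy : be / al \in P j%:Z by rewrite (vgeVz dv _ _ al0 val) addrC; exact: B_be.
have cal : conj al = al by rewrite (r1_conj rT).
have ht : be / al + conj (be / al) \in P (j%:Z + 1).
  rewrite rmorphM fmorphV /= cal -mulrDl B_trace (vgeVz dv _ _ al0 val).
  by rewrite vgeNz ?(inert_two I) // v2; move: jr; clear; lia.
rewrite -[RHS](card_axis_step I hy ht); apply: eq_card => l; rewrite [LHS]inE [RHS]inE -/(imag j l).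
have -> : be / al + imag j l = (be + imag j l * al) / al by rewrite mulrDl mulfK.
rewrite (vgeVz dv _ _ al0 val) (_ : j%:Z + 1 + b = b + j%:Z + 1); last by clear; lia.
rewrite -[RHS](norm_vge1 I) -B_act (vgeMz dv _ _ al0 val); congr (_ \in P _).
by clear; lia.
Qed.

(** Modulo the maximal ideal T is a unit times y times its conjugate transpose, and r > 0 makes y
    isotropic; among the q + 1 isotropic lines only its own is orthogonal to it. It is reached by
    [J 2] if al lies in P^(b+1), and by one [low2] otherwise. *)
Lemma B_count0 : (0 < r)%N ->
  #|[pred s : option 'I_q | ((if s is Some l then low2 (imag 0 l) else J 2) *m T *m
      ct (if s is Some l then low2 (imag 0 l) else J 2)) ord_max ord_max \in P (b + 1)]| = 1%N.
Proof.
move=> r0; rewrite card_option_pred /= anti_act.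
have [hal|hal] := boolP (al \in P (b + 1)); last first.
  have [al0 val] := vge_val (r1_ge rT ord0 ord0) hal.
  rewrite addn0 -[RHS](@B_count 0 al0 val) //; last by rewrite addr0; exact: (r1_ge rT).
  by apply: eq_card => l; rewrite [LHS]inE [RHS]inE /= addr0.
rewrite eq_card0 // => l; rewrite [LHS]inE /= low2_act ?(r1_ct rT) //.
have hbe : T ord0 ord_max \in P (b + 1).
  rewrite -(norm_vge1 I) -(r1_diag rT) (_ : b + b + 1 = b + 1 + b); last by clear; lia.
  by apply: vgeM => //; exact: (r1_ge rT).
have hc : imag 0 l \in P 0 := vge_imag 0 l.
have hcb : imag 0 l * T ord0 ord_max \in P (b + 1) by apply: vgeMl.
rewrite /herm2 (vgeDr dv) ?(vgeDr dv) ?(vgeD dv) ?(vge_conj I) //; last first.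
  by apply: vgeMr => //; apply: vgeMl => //; rewrite (vge_conj I).
have [i i0 vi] := r1_unit I rT; case: (ord2P i) => ei; subst i.
  by move: hal; rewrite /al vgeNz // vi; lia.
by rewrite [RHS]inE vgeNz // vi; apply: negbTE; lia.
Qed.

End Form.

Variables (R : realType) (m : nat) (mu : probability (borel_mx v m) R).
Hypothesis Hmu : is_haar conj mu.
Variables (x : 'M[k']_m) (r : nat) (a : nat -> int).
Hypothesis hx : unitary_hermitian conj m x.
Hypothesis em : m = (2 + r + r)%N.
Hypothesis rn : r.+1 = m./2.
Local Notation cm := (cmass conj (t := 1) mu x r a (fun A : 'M[k']_2 => J 2 - A)).
Variables (b : int) (s : nat).
Hypothesis v2 : v 2%:R = b + s%:Z.
Local Notation M j := (cm b (b + (j + j)%N%:Z)).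

Lemma massB_zero : (0 < s)%N -> q.+1%:R * M 1%N = M 0%N.
Proof.
move=> s0; pose h0 (l : option 'I_q) : 'M[k']_2 := if l is Some l then low2 (imag 0 l) else J 2.
pose h0' (l : option 'I_q) : 'M[k']_2 := if l is Some l then low2 (- imag 0 l) else J 2.
rewrite (_ : q.+1 = #|{: option 'I_q}|)%N; last by rewrite card_option card_ord.
rewrite -[RHS]mul1r; apply: (mid_level I Hmu a hx em rn (h0 := h0) (h0' := h0') (c := 1) (j := 0)) => //.
- by case=> [l|]; [apply: (low2_pair I); apply: vge_imag | apply: (anti_pair I)].
- case=> [l|]; first by apply: low2_unitary; apply: imag_conj.
  by rewrite ctJ mulJJ mul1mx.
- by move=> T rT _; rewrite addr0; exact: B_count0 rT v2 s0.
Qed.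

Lemma massB_step (j : nat) : (0 < j)%N -> (j < s)%N -> q%:R * M j.+1 = M j.
Proof.
move=> j0 js; rewrite -[in q%:R](card_ord q) -[RHS]mul1r.
apply: (mid_level I Hmu a hx em rn (h0 := fun l => low2 (imag j l)) (h0' := fun l => low2 (- imag j l)) (c := 1)).
- by move=> l; apply: (low2_pair I); apply: vge_le (vge_imag j l).
- by move=> l; apply: low2_unitary; apply: imag_conj.
- move=> T rT _ l hl; apply: (B_stable rT v2) => //; by rewrite (vgeN dv); apply: vge_imag.
move=> T rT hg; have [al0 val] : T ord0 ord0 != 0 /\ v (T ord0 ord0) = b.
  by apply: (B_al rT v2); apply: vge_le hg; move: j0; clear; lia.
exact: (B_count rT v2).
Qed.

Lemma massB_end : M s.+1 = 0.
Proof.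
rewrite -(mid_parity I mu a hx em rn); apply: (mid_cmass0 I mu a hx em rn) => T rT; exact: (B_end rT v2).
Qed.

End CaseB.

(** * The last root in odd size: Heisenberg translates *)

Section CaseC.
Variables (k : fieldType) (k' : fieldExtType k) (conj : {lrmorphism k' -> k'}).
Variables (v : k' -> int) (q : nat) (pi theta : k') (rep : 'I_q -> k').
Hypothesis I : inert conj v pi theta rep.
Local Notation P := (vge v).
Local Notation ct := (conj_tr conj).
Local Notation J := (@antidiag k k').
Local Notation eta := (eta conj theta).
Local Notation heis_c := (heis_c pi theta rep).
Local Notation heis_a := (heis_a conj pi theta rep).
Let dv := inert_dv I.
Let conjK := inert_conjK I.

Let o0 : 'I_3 := ord0.
Let o1 : 'I_3 := lift ord0 ord0.
Let o2 : 'I_3 := ord_max.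

Lemma sum3 (f : 'I_3 -> k') : \sum_i f i = f o0 + f o1 + f o2.
Proof.
by rewrite !big_ord_recr big_ord0 /= add0r; congr (f _ + f _ + f _); apply: val_inj.
Qed.

Lemma ord3P (i : 'I_3) : [\/ i = o0, i = o1 | i = o2].
Proof.
by case: i => [[|[|[|//]]] hi]; [constructor 1 | constructor 2 | constructor 3]; apply: val_inj.
Qed.

(** Lower unipotent elements in three variables: c is free, and a + conj(a) = - c conj(c) is the
    condition for unitarity. *)
Definition heis (c a : k') : 'M[k']_3 := \matrix_(i, j)
  (if i == j then 1 else if (i < j)%N then 0 else
   if j == 1%N :> nat then c else if i == 1%N :> nat then - conj c else a).

Lemma heisE c a : [/\ [/\ heis c a o0 o0 = 1, heis c a o0 o1 = 0 & heis c a o0 o2 = 0],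
  [/\ heis c a o1 o0 = - conj c, heis c a o1 o1 = 1 & heis c a o1 o2 = 0] &
  [/\ heis c a o2 o0 = a, heis c a o2 o1 = c & heis c a o2 o2 = 1]].
Proof. by split; split; rewrite mxE. Qed.

Lemma heis_mul c a d b : heis c a *m heis d b = heis (c + d) (a - c * conj d + b).
Proof.
have [[c1 c2 c3] [c4 c5 c6] [c7 c8 c9]] := heisE c a.
have [[d1 d2 d3] [d4 d5 d6] [d7 d8 d9]] := heisE d b.
have [[e1 e2 e3] [e4 e5 e6] [e7 e8 e9]] := heisE (c + d) (a - c * conj d + b).
apply/matrixP => i j; rewrite mxE sum3.
by case: (ord3P i) => ->; case: (ord3P j) => ->;
  rewrite ?c1 ?c2 ?c3 ?c4 ?c5 ?c6 ?c7 ?c8 ?c9 ?d1 ?d2 ?d3 ?d4 ?d5 ?d6 ?d7 ?d8 ?d9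
   ?e1 ?e2 ?e3 ?e4 ?e5 ?e6 ?e7 ?e8 ?e9 ?rmorphD /=; ring.
Qed.

Lemma heis0 : heis 0 0 = 1%:M.
Proof.
apply/matrixP => i j; rewrite !mxE rmorph0 oppr0; case: eqP => // _.
by rewrite !if_same.
Qed.

Lemma mxge_heis c a : c \in P 0 -> a \in P 0 -> mxge v 0 (heis c a).
Proof.
move=> hc ha i j; rewrite mxE.
by do 4?case: ifP => _ //; rewrite ?vge1 ?vge0 ?vgeN ?(vge_conj I).
Qed.

Lemma heis_pair c a : c \in P 0 -> a \in P 0 -> a + conj a = - (c * conj c) ->
  integral_pair v (heis c a) (heis (- c) (conj a)).
Proof.
move=> hc ha e; split; first exact: mxge_heis.
  by apply: mxge_heis; rewrite ?vgeN ?(vge_conj I).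
rewrite heis_mul addNr mulNr opprK -heis0; congr (heis _ _).
by rewrite addrAC [conj a + a]addrC e addNr.
Qed.

Lemma heis_unitary c a : a + conj a = - (c * conj c) ->
  ct (heis c a) *m J 3 *m heis c a = J 3.
Proof.
move=> e; have ea : conj a = - (c * conj c) - a by rewrite -e; ring.
have [[c1 c2 c3] [c4 c5 c6] [c7 c8 c9]] := heisE c a.
have hct i j : ct (heis c a) i j = conj (heis c a j i) by rewrite !mxE.
have [j1 j2 j3] : [/\ J 3 o0 o0 = 0, J 3 o0 o1 = 0 & J 3 o0 o2 = 1] by split; rewrite mxE.
have [j4 j5 j6] : [/\ J 3 o1 o0 = 0, J 3 o1 o1 = 1 & J 3 o1 o2 = 0] by split; rewrite mxE.
have [j7 j8 j9] : [/\ J 3 o2 o0 = 1, J 3 o2 o1 = 0 & J 3 o2 o2 = 0] by split; rewrite mxE.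
apply/matrixP => i j; rewrite mxE !sum3 ![(ct _ *m _) _ _]mxE !sum3 !hct.
by case: (ord3P i) => ->; case: (ord3P j) => ->;
  rewrite ?c1 ?c2 ?c3 ?c4 ?c5 ?c6 ?c7 ?c8 ?c9 ?j1 ?j2 ?j3 ?j4 ?j5 ?j6 ?j7 ?j8 ?j9
   ?rmorphN ?rmorph1 ?rmorph0 /= ?conjK ?ea; ring.
Qed.

Section Form.
Variables (T : 'M[k']_3) (b : int) (r : nat).
Hypothesis rT : rank1_form conj v b T.
Hypothesis v2 : v 2%:R = b + r%:Z.

Let hT := r1_ge rT.

Lemma C_trace : T o2 o0 + conj (T o2 o0) + T o1 o1 = 2%:R.
Proof.
rewrite -(r1_trace rT) /mxtrace sum3 !mxE !sum3 !mxE /= (r1_conj rT).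
by rewrite !mulr0 !mulr1 !addr0 !add0r; ring.
Qed.

Lemma C_trace0 : T o0 o0 * (T o2 o0 + conj (T o2 o0)) + T o1 o0 * conj (T o1 o0) = 2%:R * T o0 o0.
Proof. by rewrite -C_trace -(r1_diag rT); ring. Qed.

Lemma C_act i c a : T i i * (heis c a *m T *m ct (heis c a)) o2 o2 =
  (T o2 i + a * T o0 i + c * T o1 i) * conj (T o2 i + a * T o0 i + c * T o1 i).
Proof.
have [_ _ [c7 c8 c9]] := heisE c a.
rewrite (r1_act rT); suff -> : (heis c a *m T) o2 i = T o2 i + a * T o0 i + c * T o1 i by [].
by rewrite mxE sum3 c7 c8 c9; ring.
Qed.

Lemma C_off i j : T j j \in P (b + 1) -> T i j \in P (b + 1).
Proof.
move=> h; rewrite -(norm_vge1 I) -(r1_diag rT) (_ : b + b + 1 = b + (b + 1)); last by clear; lia.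
exact: vgeM.
Qed.

Lemma C_off' i j : T j j \in P (b + 1) -> T j i \in P (b + 1).
Proof. by move=> h; rewrite -(r1_conj rT) (vge_conj I) C_off. Qed.

Lemma C_mid : (0 < r)%N -> T o2 o0 \in P (b + 1) -> T o1 o1 \in P (b + 1).
Proof.
move=> r0 h; rewrite (_ : T o1 o1 = 2%:R - (T o2 o0 + conj (T o2 o0))); last by rewrite -C_trace; ring.
apply: vgeB => //; first by rewrite vgeNz ?(inert_two I) // v2; move: r0; clear; lia.
by apply: vgeD; rewrite ?(vge_conj I).
Qed.

(** T_22 in P^(b+1) forces the same for T_20, then for T_11 by the trace relation and r > 0; the
    diagonal entry of valuation b can only be T_00. *)
Lemma C_al : (0 < r)%N -> T o2 o2 \in P (b + 1) -> T o0 o0 != 0 /\ v (T o0 o0) = b.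
Proof.
move=> r0 h; have h1 := C_mid r0 (C_off' o0 h).
have [i i0 vi] := r1_unit I rT; case: (ord3P i) => ei; subst i; first by [].
  by move: h1; rewrite vgeNz // vi; lia.
by move: h; rewrite vgeNz // vi; lia.
Qed.

Lemma C_T20 (j : nat) : T o2 o2 \in P (b + (j + j)%:Z) -> T o2 o0 \in P (b + j%:Z).
Proof.
move=> h; rewrite -(norm_vge I) -(r1_diag rT).
apply: (@vge_le _ _ (b + (j + j)%:Z + b)); first by clear; lia.
exact: vgeM.
Qed.

Section Chart0.
Hypotheses (al0 : T o0 o0 != 0) (val : v (T o0 o0) = b).
Let y1 := T o1 o0 / T o0 o0.
Let y2 := T o2 o0 / T o0 o0.
Let rho := 2%:R / T o0 o0.

Let cal : conj (T o0 o0) = T o0 o0.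
Proof. exact: (r1_conj rT). Qed.

(** With T_00 as pivot, T is T_00 times y times its conjugate transpose for y = (1, y1, y2), and
    tr(T J) = 2 becomes the equation of an affine hermitian curve with right-hand side rho = 2 /
    T_00, of valuation r. *)
Lemma C_chart : y2 + conj y2 + y1 * conj y1 = rho.
Proof.
rewrite /y2 /y1 /rho !rmorphM !fmorphV /= !cal.
have -> : 2%:R / T o0 o0 = (2%:R * T o0 o0) / (T o0 o0 * T o0 o0) by field.
by rewrite -C_trace0; field.
Qed.

Lemma C_rho (N : int) : (rho \in P N) = (N <= r%:Z).
Proof.
rewrite (vgeVz dv _ _ al0 val) vgeNz ?(inert_two I) // v2; apply/idP/idP; clear; lia.
Qed.

Lemma C_y2 (j : nat) : T o2 o2 \in P (b + (j + j)%:Z) -> y2 \in P j%:Z.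
Proof. by move=> /C_T20 h; rewrite (vgeVz dv _ _ al0 val) addrC. Qed.

Lemma C_chart_act (j : nat) c a :
  ((heis c a *m T *m ct (heis c a)) o2 o2 \in P (b + (j + j)%:Z + 1)) =
  (y2 + a + c * y1 \in P (j%:Z + 1)).
Proof.
have -> : y2 + a + c * y1 = (T o2 o0 + a * T o0 o0 + c * T o1 o0) / T o0 o0 by rewrite /y1 /y2; field.
rewrite (vgeVz dv _ _ al0 val) (_ : j%:Z + 1 + b = b + j%:Z + 1); last by clear; lia.
rewrite -[RHS](norm_vge1 I) -C_act (vgeMz dv _ _ al0 val); congr (_ \in P _).
by clear; lia.
Qed.

(** The alternatives for c are the two families in use: central translates, and full Heisenberg
    translates of order i with 2i <= r, for which the equation of the curve bounds y1. *)
Lemma C_chart_stable (i j : nat) c a : (i <= j)%N -> (j <= i + i)%N ->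
  (c = 0 \/ (i + i <= r)%N) ->
  c \in P i%:Z -> a \in P j%:Z -> T o2 o2 \in P (b + (j + j)%:Z) ->
  (heis c a *m T *m ct (heis c a)) o2 o2 \in P (b + (j + j)%:Z).
Proof.
move=> ij ji hci hc ha hg; have hy2 := C_y2 hg.
have -> : b + (j + j)%:Z = b + j%:Z + (b + j%:Z) - b by clear; lia.
rewrite -(vgeMz dv _ _ al0 val) C_act (norm_vge I).
have -> : T o2 o0 + a * T o0 o0 + c * T o1 o0 = T o0 o0 * (y2 + a + c * y1) by rewrite /y1 /y2; field.
rewrite (vgeMz dv _ _ al0 val) (_ : b + j%:Z - b = j%:Z); last by clear; lia.
apply: vgeD => //; first exact: vgeD.
case: hci => [->|ir]; first by rewrite mul0r vge0.
have hy1 : y1 \in P (j - i)%N%:Z.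
  rewrite -(norm_vge I) (_ : y1 * conj y1 = rho - (y2 + conj y2)); last by rewrite -C_chart; ring.
  apply: vgeB => //; first by rewrite C_rho; move: ij ji ir; clear; lia.
  by apply: (@vge_le _ _ j%:Z); [move: ij ji; clear; lia | apply: vgeD; rewrite ?(vge_conj I)].
by apply: (@vge_le _ _ (i%:Z + (j - i)%N%:Z)); [move: ij; clear; lia | apply: vgeM].
Qed.

(** In the chart the condition is y2 + a + c y1 in P^(2i+1), which [card_heis_even] counts; rho has
    valuation r, whence q + 1 exactly for 2i = r. *)
Lemma C_even (i : nat) : (i + i <= r)%N -> T o2 o2 \in P (b + ((i + i) + (i + i))%:Z) ->
  #|[pred s : ('I_q * 'I_q) * 'I_q |
     (heis (heis_c i s.1) (heis_a i (i + i) s.1 s.2) *m T *m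
        ct (heis (heis_c i s.1) (heis_a i (i + i) s.1 s.2))) o2 o2
      \in P (b + ((i + i) + (i + i))%:Z + 1)]| = if (i + i < r)%N then 1%N else q.+1.
Proof.
move=> ir hg; rewrite -(_ : (rho \in P ((i + i)%:Z + 1)) = (i + i < r)%N); last first.
  by rewrite C_rho; move: ir; clear; lia.
rewrite -(card_heis_even I C_chart (C_y2 hg)); last by rewrite C_rho; move: ir; clear; lia.
by apply: eq_card => s; rewrite [LHS]inE [RHS]inE C_chart_act.
Qed.

(** At an odd level central translates suffice: y1 conj(y1) has even valuation, so the trace of y2
    already lies one step higher and only its eta coordinate has to be corrected. *)
Lemma C_odd (i : nat) : ((i + i).+1 < r)%N -> T o2 o2 \in P (b + ((i + i).+1 + (i + i).+1)%:Z) ->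
  #|[pred l | (heis 0 (pi ^+ (i + i).+1 * rep l * eta) *m T *m
        ct (heis 0 (pi ^+ (i + i).+1 * rep l * eta))) o2 o2
      \in P (b + ((i + i).+1 + (i + i).+1)%:Z + 1)]| = 1%N.
Proof.
move=> ir hg; have hy2 := C_y2 hg.
rewrite -[RHS](card_axis_step I hy2).
  by apply: eq_card => l; rewrite [LHS]inE [RHS]inE C_chart_act mul0r addr0.
have hr : rho \in P ((i + i).+1%:Z + 1) by rewrite C_rho; move: ir; clear; lia.
rewrite (_ : y2 + conj y2 = rho - y1 * conj y1); last by rewrite -C_chart; ring.
apply: vgeB => //; have e1 : (i + i).+1%:Z + 1 = i.+1%:Z + i.+1%:Z by clear; lia.
rewrite e1 (norm_vge I) -(norm_vgeB1 I) (_ : i.+1%:Z + i.+1%:Z - 1 = (i + i).+1%:Z); last by clear; lia.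
rewrite (_ : y1 * conj y1 = rho - (y2 + conj y2)); last by rewrite -C_chart; ring.
apply: vgeB => //; first by apply: vge_le hr; clear; lia.
by apply: vgeD; rewrite ?(vge_conj I).
Qed.

(** Past level r, y2 and then, by parity, y1 conj(y1) would lie in P^(r+1), and so would rho,
    against v(rho) = r. *)
Lemma C_odd_end (i : nat) : r = (i + i).+1 -> T o2 o2 \in P (b + (r + r)%:Z + 1) -> False.
Proof.
move=> er hg; have hy2 : y2 \in P (r%:Z + 1).
  rewrite (vgeVz dv _ _ al0 val) -(norm_vge I) -(r1_diag rT).
  apply: (@vge_le _ _ (b + (r.+1 + r.+1)%:Z + b)); first by clear; lia.
  by apply: vgeM => //; apply: (r1_parity I rT).
have hs : y2 + conj y2 \in P (r%:Z + 1) by apply: vgeD; rewrite ?(vge_conj I).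
have : rho \in P (r%:Z + 1).
  rewrite -C_chart; apply: vgeD => //; rewrite er (_ : _ + 1 = i.+1%:Z + i.+1%:Z); last by clear; lia.
  rewrite (norm_vge I) -(norm_vgeB1 I) (_ : y1 * conj y1 = rho - (y2 + conj y2)); last by rewrite -C_chart; ring.
  apply: vgeB => //; first by rewrite C_rho er; clear; lia.
  by apply: vge_le hs; rewrite er; clear; lia.
by rewrite C_rho; clear; lia.
Qed.

End Chart0.

Section Chart1.
Variables (i j : nat).
Hypotheses (er : r = (i + i)%N) (rj : (r < j)%N) (hg : T o2 o2 \in P (b + (j + j)%:Z)).

(** Past level r the entry T_20 is too small for the trace relation, so T_11 carries the valuation
    of 2. It replaces T_00 as pivot. *)
Lemma C_T11 : T o1 o1 != 0 /\ v (T o1 o1) = b + r%:Z.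
Proof.
have h : T o2 o0 \in P (b + r%:Z + 1) by apply: vge_le (C_T20 hg); move: rj; clear; lia.
have h2 : T o2 o0 + conj (T o2 o0) \in P (b + r%:Z + 1) by apply: vgeD; rewrite ?(vge_conj I).
have e : T o1 o1 = 2%:R - (T o2 o0 + conj (T o2 o0)) by rewrite -C_trace; ring.
rewrite e -v2; apply: val_eqD; rewrite ?(inert_two I) //.
by rewrite vgeN // v2.
Qed.

Lemma C_T01 : T o0 o1 \in P (b + i%:Z).
Proof.
have [h1 h2] := C_T11; rewrite -(norm_vge I) -(r1_diag rT).
rewrite (_ : b + i%:Z + (b + i%:Z) = b + (b + r%:Z)); last by rewrite er; clear; lia.
by apply: vgeM => //; rewrite vgeNz // h2.
Qed.

Lemma C_T21 : T o2 o1 \in P (b + (i + j)%N%:Z).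
Proof.
have [h1 h2] := C_T11; rewrite -(norm_vge I) -(r1_diag rT).
rewrite (_ : _ + _ = b + (j + j)%:Z + (b + r%:Z)); last by rewrite er; clear; lia.
by apply: vgeM => //; rewrite vgeNz // h2.
Qed.

Lemma C_chart1_act (N : int) (c a : k') :
  ((heis c a *m T *m ct (heis c a)) o2 o2 \in P (N + N - (b + r%:Z))) =
  (T o2 o1 + a * T o0 o1 + c * T o1 o1 \in P N).
Proof.
by have [h1 h2] := C_T11; rewrite -[RHS](norm_vge I) -C_act (vgeMz dv _ _ h1 h2).
Qed.

Lemma C_tail_stable c a : c \in P (j - i)%N%:Z -> a \in P ((j - i) + (j - i))%N%:Z ->
  (heis c a *m T *m ct (heis c a)) o2 o2 \in P (b + (j + j)%:Z).
Proof.
move=> hc ha; have [h1 h2] := C_T11.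
rewrite (_ : b + (j + j)%:Z = b + (i + j)%N%:Z + (b + (i + j)%N%:Z) - (b + r%:Z)); last by rewrite er; clear; lia.
rewrite C_chart1_act; apply: vgeD => //; first (apply: vgeD => //; first exact: C_T21).
  apply: (@vge_le _ _ (((j - i) + (j - i))%N%:Z + (b + i%:Z))); first by move: er rj; clear; lia.
  by apply: vgeM => //; exact: C_T01.
apply: (@vge_le _ _ ((j - i)%N%:Z + (b + r%:Z))); first by move: er rj; clear; lia.
by apply: vgeM => //; rewrite vgeNz // h2.
Qed.

(** With pivot T_11 of valuation b + 2i, parameters c of order j - i act linearly at level j, while
    the contribution of a has higher order. *)
Lemma C_tail : #|[pred ij |
   (heis (heis_c (j - i) ij) (- (heis_c (j - i) ij * conj (heis_c (j - i) ij)) * theta) *m T *m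
     ct (heis (heis_c (j - i) ij) (- (heis_c (j - i) ij * conj (heis_c (j - i) ij)) * theta))) o2 o2
     \in P (b + (j + j)%:Z + 1)]| = 1%N.
Proof.
have [h1 h2] := C_T11.
have g1 : v (T o1 o1) + (j - i)%N%:Z = b + (i + j)%N%:Z.
  by rewrite h2; move: er rj; clear; lia.
have g2 : b + (i + j)%N%:Z < b + i%:Z + ((j - i) + (j - i))%N%:Z by move: er rj; clear; lia.
rewrite -[RHS](card_heis_tail I C_T21 h1 g1 C_T01 g2); apply: eq_card => ij.
rewrite [LHS]inE [RHS]inE (_ : b + (j + j)%:Z + 1 = b + (i + j)%N%:Z + (b + (i + j)%N%:Z) + 1 - (b + r%:Z)); last first.
  by rewrite er; clear; lia.
rewrite -(vgeMz dv _ _ h1 h2) C_act (norm_vge1 I); congr (_ \in P _); ring.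
Qed.

End Chart1.

(** Modulo the maximal ideal the translates run over the q^3 + 1 isotropic lines, and the condition
    selects those orthogonal to y, where T is a unit times y times its conjugate transpose. By tr(T
    J) = 2 the vector y is isotropic for r > 0, leaving its own line, and anisotropic for r = 0,
    leaving q + 1 lines. *)
Lemma C_zero :
  #|[pred s : option (('I_q * 'I_q) * 'I_q) |
     ((if s is Some u then heis (heis_c 0 u.1) (heis_a 0 0 u.1 u.2) else J 3) *m T *m
      ct (if s is Some u then heis (heis_c 0 u.1) (heis_a 0 0 u.1 u.2) else J 3)) o2 o2 \in P (b + 1)]|
  = if (0 < r)%N then 1%N else q.+1.
Proof.
rewrite card_option_pred /= anti_act.
have [hal|hal] := boolP (T o0 o0 \in P (b + 1)); last first.
  have [al0 val] := vge_val (hT o0 o0) hal.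
  rewrite addn0 -[RHS](@C_even al0 val 0) //; last by rewrite addr0; exact: hT.
  by apply: eq_card => s; rewrite [LHS]inE [RHS]inE /= addr0.
have h10 i : T i o0 \in P (b + 1) := C_off i hal.
have h01 i : T o0 i \in P (b + 1) := C_off' i hal.
have hc ij : heis_c 0 ij \in P 0 := vge_heis_c I 0 ij.
have ha ij l : heis_a 0 0 ij l \in P 0 by apply: (vge_heis_a I).
have hg c a : a \in P 0 -> (T o2 o1 + a * T o0 o1 + c * T o1 o1 \in P (b + 1)) =
    (T o2 o1 + c * T o1 o1 \in P (b + 1)).
  by move=> ha0; rewrite addrAC (vgeDr dv) //; apply: vgeMl.
have [r0|r0] := posnP r; last first.
  have h11 := C_mid r0 (h10 o2).
  have h22 : T o2 o2 \notin P (b + 1).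
    have [i i0 vi] := r1_unit I rT; have : T i i \notin P (b + 1) by rewrite vgeNz // vi; lia.
    by case: (ord3P i) => -> //; rewrite ?hal ?h11.
  rewrite eq_card0 // => -[ij l]; rewrite [LHS]inE [RHS]inE /=.
  have [_ _ [c7 c8 c9]] := heisE (heis_c 0 ij) (heis_a 0 0 ij l).
  set h := heis _ _ in c7 c8 c9 *.
  have hr i : (h *m T) o2 i = heis_a 0 0 ij l * T o0 i + heis_c 0 ij * T o1 i + T o2 i.
    by rewrite mxE sum3 c7 c8 c9 mul1r.
  have h2 i : T i i \in P (b + 1) -> (h *m T) o2 i \in P (b + 1).
    move=> hi; rewrite hr; apply: vgeD => //; last exact: C_off.
    by apply: vgeD => //; apply: vgeMl => //; exact: C_off.
  have hct i : ct h i o2 = conj (h o2 i) by rewrite !mxE.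
  rewrite mxE sum3 !hct c7 c8 c9 rmorph1 mulr1 (vgeDl dv); last first.
    by apply: vgeD => //; apply: vgeMr => //; rewrite ?(vge_conj I) // h2.
  by rewrite hr (vgeDl dv) ?(negPf h22) //; apply: vgeD => //; apply: vgeMl => //; apply: C_off'.
have [t0 vt] : T o1 o1 != 0 /\ v (T o1 o1) = b.
  have e : T o1 o1 = 2%:R - (T o2 o0 + conj (T o2 o0)) by rewrite -C_trace; ring.
  have v2' : v 2%:R = b by rewrite v2 r0 addr0.
  rewrite e -v2'; apply: val_eqD; rewrite ?(inert_two I) // v2'.
  by rewrite vgeN // vgeD ?(vge_conj I).
rewrite addn1; congr _.+1.
have c1 : #|[pred ij | T o2 o1 + heis_c 0 ij * T o1 o1 \in P (b + 1)]| = 1%N.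
  rewrite -[RHS](card_shift I t0 vt (hT o2 o1)); apply: eq_card => ij.
  by rewrite [LHS]inE [RHS]inE /heis_c expr0 mul1r [T o1 o1 * _]mulrC.
have c2 : #|[pred ijl : ('I_q * 'I_q) * 'I_q | (T o2 o1 + heis_c 0 ijl.1 * T o1 o1 \in P (b + 1)) && true]| = q.
  rewrite -[RHS]mul1n -[in RHS]c1.
  apply: (@card_pairs_cond _ _ (fun ij => T o2 o1 + heis_c 0 ij * T o1 o1 \in P (b + 1)) (fun _ _ => true)) => ij _.
  by rewrite -[RHS]card_ord; apply: eq_card => l.
rewrite -[RHS]c2; apply: eq_card => -[ij l]; rewrite [LHS]inE [RHS]inE /= andbT -(hg _ _ (ha ij l)).
rewrite (_ : b + 1 = b + b + 1 - b); last by clear; lia.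
rewrite -(vgeMz dv _ _ t0 vt) C_act (norm_vge1 I) (_ : b + b + 1 - b = b + 1) //; clear; lia.
Qed.

End Form.

Variables (R : realType) (m : nat) (mu : probability (borel_mx v m) R).
Hypothesis Hmu : is_haar conj mu.
Variables (x : 'M[k']_m) (r : nat) (a : nat -> int).
Hypothesis hx : unitary_hermitian conj m x.
Hypothesis em : m = (3 + r + r)%N.
Hypothesis rn : r.+1 = m./2.
Local Notation cm := (cmass conj (t := 2) mu x r a (fun A : 'M[k']_3 => J 3 - A)).
Variables (b : int) (s : nat).
Hypothesis v2 : v 2%:R = b + s%:Z.
Local Notation M j := (cm b (b + (j + j)%N%:Z)).

Let two_pos (j : nat) : (0 < j)%N -> b + 1 <= b + (j + j)%N%:Z.
Proof. clear; lia. Qed.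

Lemma massC_zero : (q ^ 3 + 1)%:R * M 1%N = (if (0 < s)%N then 1%N else q.+1)%:R * M 0%N.
Proof.
pose par (u : ('I_q * 'I_q) * 'I_q) := (heis_c 0 u.1, heis_a 0 0 u.1 u.2).
pose h0 u : 'M[k']_3 := if u is Some u then heis (heis_c 0 u.1) (heis_a 0 0 u.1 u.2) else J 3.
pose h0' u : 'M[k']_3 := if u is Some u then heis (- heis_c 0 u.1) (conj (heis_a 0 0 u.1 u.2)) else J 3.
rewrite (_ : q ^ 3 + 1 = #|{: option (('I_q * 'I_q) * 'I_q)}|)%N; last first.
  by rewrite card_option !card_prod card_ord addn1 !expnSr expn0 mul1n.
apply: (mid_level I Hmu a hx em rn (h0 := h0) (h0' := h0') (j := 0)) => //.
- case=> [u|]; last exact: (anti_pair I).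
  by apply: heis_pair; [exact: (vge_heis_c I)|exact: (vge_heis_a I)|exact: (heis_a_trace I)].
- case=> [u|]; first by apply: heis_unitary; apply: (heis_a_trace I).
  by rewrite ctJ mulJJ mul1mx.
by move=> T rT _; rewrite addr0; exact: (C_zero rT v2).
Qed.

Lemma massC_even (i : nat) : (0 < i)%N -> (i + i <= s)%N ->
  (q ^ 3)%:R * M (i + i).+1 = (if (i + i < s)%N then 1%N else q.+1)%:R * M (i + i)%N.
Proof.
move=> i0 il; have s0 : (0 < s)%N by move: i0 il; clear; lia.
rewrite (_ : q ^ 3 = #|{: ('I_q * 'I_q) * 'I_q}|)%N; last first.
  by rewrite !card_prod card_ord !expnSr expn0 mul1n.
apply: (mid_level I Hmu a hx em rn
  (h0 := fun u => heis (heis_c i u.1) (heis_a i (i + i) u.1 u.2))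
  (h0' := fun u => heis (- heis_c i u.1) (conj (heis_a i (i + i) u.1 u.2)))).
- move=> u; apply: heis_pair; last exact: (heis_a_trace I).
    exact: vge_le (vge_heis_c I i u.1).
  exact: (vge_heis_a I).
- by move=> u; apply: heis_unitary; apply: (heis_a_trace I).
- move=> T rT j0 u hg; have [al0 val] := C_al rT v2 s0 (vge_le (two_pos j0) hg).
  apply: (C_chart_stable rT v2 al0 val (i := i)) => //; first exact: leq_addr.
  + by right.
  + by rewrite vgeN //; apply: (vge_heis_c I).
  + by rewrite (vge_conj I); apply: (vge_heis_a I).
move=> T rT hg; have i2 : (0 < i + i)%N by move: i0; clear; lia.
have [al0 val] := C_al rT v2 s0 (vge_le (two_pos i2) hg).
exact: C_even.
Qed.

Lemma massC_odd (i : nat) : ((i + i).+1 < s)%N -> q%:R * M (i + i).+2 = M (i + i).+1.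
Proof.
move=> il; have s0 : (0 < s)%N by move: il; clear; lia.
have [e0 ve] := eta_unit I.
have hp l : pi ^+ (i + i).+1 * rep l * eta \in P (i + i).+1%:Z := vge_imag I _ l.
have cp l : conj (pi ^+ (i + i).+1 * rep l * eta) = - (pi ^+ (i + i).+1 * rep l * eta) := imag_conj I _ l.
have tp l : pi ^+ (i + i).+1 * rep l * eta + conj (pi ^+ (i + i).+1 * rep l * eta) = - (0 * conj 0).
  by rewrite cp subrr mul0r oppr0.
rewrite -[in q%:R](card_ord q) -[RHS]mul1r.
apply: (mid_level I Hmu a hx em rn (c := 1)
  (h0 := fun l => heis 0 (pi ^+ (i + i).+1 * rep l * eta))
  (h0' := fun l => heis (- 0) (conj (pi ^+ (i + i).+1 * rep l * eta)))).
- by move=> l; apply: heis_pair => //; [exact: vge0 | apply: vge_le (hp l)].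
- by move=> l; apply: heis_unitary.
- move=> T rT j0 l hg; have [al0 val] := C_al rT v2 s0 (vge_le (two_pos j0) hg).
  rewrite oppr0; apply: (C_chart_stable rT v2 al0 val (i := (i + i).+1)) => //.
  + exact: leq_addr.
  + by left.
  + exact: vge0.
  + by rewrite (vge_conj I).
move=> T rT hg; have [al0 val] := C_al rT v2 s0 (vge_le (two_pos (ltn0Sn _)) hg).
exact: (C_odd rT v2 al0 val il hg).
Qed.

Lemma massC_odd_end (i : nat) : s = (i + i).+1 -> M s.+1 = 0.
Proof.
move=> es; have s0 : (0 < s)%N by rewrite es.
rewrite -(mid_parity I mu a hx em rn); apply: (mid_cmass0 I mu a hx em rn) => T rT hg.
have h1 : b + 1 <= b + (s + s)%:Z + 1 by clear; lia.
have [al0 val] := C_al rT v2 s0 (vge_le h1 hg).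
exact: (C_odd_end rT v2 al0 val es hg).
Qed.

Lemma massC_tail (i j : nat) : s = (i + i)%N -> (s < j)%N -> (q ^ 2)%:R * M j.+1 = M j.
Proof.
move=> es sj; pose c u := heis_c (j - i) u; pose f u := - (c u * conj (c u)) * theta.
have hc u : c u \in P (j - i)%N%:Z by exact: (vge_heis_c I).
have hf u : f u \in P ((j - i) + (j - i))%N%:Z.
  apply: vgeMr => //; last exact: (inert_theta_int I).
  by rewrite vgeN //; exact: (vge_heis_norm I).
have tf u : f u + conj (f u) = - (c u * conj (c u)).
  rewrite /f; move: (c u) => z; rewrite !(rmorphM, rmorphN) /= conjK (inert_theta I); ring.
rewrite (_ : q ^ 2 = #|{: 'I_q * 'I_q}|)%N; last by rewrite card_prod card_ord expnS expn1.
rewrite -[RHS]mul1r; apply: (mid_level I Hmu a hx em rn (c := 1)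
  (h0 := fun u => heis (c u) (f u)) (h0' := fun u => heis (- c u) (conj (f u)))).
- by move=> u; apply: heis_pair => //; [exact: vge_le (hc u) | exact: vge_le (hf u)].
- by move=> u; apply: heis_unitary.
- move=> T rT j0 u hg; apply: (C_tail_stable rT v2 es sj hg); first by rewrite vgeN.
  by rewrite (vge_conj I).
by move=> T rT hg; exact: (C_tail rT v2 es sj hg).
Qed.

End CaseC.

(** * Masses of level sets and the rank one functional equations *)

Section FiberMass.
Variables (k : fieldType) (k' : fieldExtType k) (conj : {lrmorphism k' -> k'}).
Variables (v : k' -> int) (q : nat) (pi theta : k') (rep : 'I_q -> k').
Hypothesis I : inert conj v pi theta rep.
Variables (R : realType) (m : nat) (mu : probability (borel_mx v m) R).
Hypothesis Hmu : is_haar conj mu.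
Local Notation P := (vge v).
Local Notation ct := (conj_tr conj).
Local Notation J := (@antidiag k k').
Local Notation K := (unitary_integral conj v m).
Local Notation uact := (Defs.act conj).
Local Notation n := m./2.
Local Notation C := R[i].
Let dv := inert_dv I.
Let conjK := inert_conjK I.

Variable x : 'M[k']_m.
Hypothesis hx : unitary_hermitian conj m x.

Definition level_set (a : nat -> int) : set (borel_mx v m) :=
  [set h | K h /\ forall j, (0 < j)%N -> (j <= n)%N ->
    lowdet conj j (uact h x) != 0 /\ v (lowdet conj j (uact h x)) = a j].

Definition level_mass a : C := (mass mu (level_set a))%:C%C.

Definition upd (a : nat -> int) (r : nat) (y : int) j := if j == r then y else a j.

Lemma sch_last t r (y : 'M[k']_m) : (t.+1 + r <= m)%N -> sch conj 1 r y 0 0 = sch conj t.+1 r y ord_max ord_max.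
Proof.
move=> H; have [U [hU hV]] : exists U : 'M[k']_(1, t.+1), blk k' m 1 (m - r - 1) = U *m blk k' m t.+1 (m - r - t.+1) /\
   forall A : 'M[k']_t.+1, (U *m A *m ct U) 0 0 = A ord_max ord_max.
  exists (delta_mx 0 ord_max); split.
    apply/rowP => j; rewrite -rowE !mxE; congr (_ == _)%:R; move: H; clear=> /= H; lia.
  move=> A; rewrite -rowE mxE (bigD1 ord_max) //= big1 ?addr0 => [|i hi]; rewrite !mxE.
    by rewrite !eqxx rmorph1 mulr1.
  by rewrite (negPf hi) andbF rmorph0 mulr0.
rewrite -hV; congr (fun_of_matrix _ 0 0); rewrite /sch hU ctM.
set Q := blk k' m t.+1 _; set E := low k' m r; set X := invmx _; clearbody X Q E.
by rewrite mulmxBr mulmxBl !mulmxA.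
Qed.

Lemma lowdet_last t r (y : 'M[k']_m) : (t.+1 + r <= m)%N -> lowdet conj r y != 0 ->
  lowdet conj r.+1 y = lowdet conj r y * sch conj t.+1 r y ord_max ord_max.
Proof.
move=> H y0; rewrite -sch_last // -[r.+1]add1n lowdet_sch //; last by move: H; clear; lia.
by rewrite det_mx11.
Qed.

Section Fiber.
Variables (t r : nat) (a : nat -> int).
Hypothesis rn : (r < n)%N.
Hypothesis H : (t.+1 + r <= m)%N.
Hypothesis a0 : a 0 = 0.
Variable tau : 'M[k']_t.+1 -> 'M[k']_t.+1.
Hypothesis tau_last : forall A, tau A ord_max ord_max = A ord_max ord_max \/
  tau A ord_max ord_max = - A ord_max ord_max.

(** d_(r+1) is d_r times the last diagonal entry of the Schur complement, and [tau] changes this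
    entry at most by a sign. *)
Lemma exactly_level y :
  fiber conj (v := v) x r a (exactly v tau y) = level_set (upd a r.+1 (a r + y)).
Proof.
have key h : fiber_base conj v x r a h ->
  exactly v tau y (sch conj t.+1 r (uact h x)) <->
  (lowdet conj r.+1 (uact h x) != 0 /\ v (lowdet conj r.+1 (uact h x)) = a r + y).
  move=> hb; have d0 := fiber_base_low rn hb.
  have vd : v (lowdet conj r (uact h x)) = a r.
    have [r0|r0] := posnP r; last by have [] := hb r r0 (ltnW rn) (n_Sn _).
    by rewrite [v _](congr1 (fun r => v (lowdet conj r (uact h x))) r0) lowdet0 val1 // r0 a0.
  rewrite (lowdet_last H d0) /exactly.
  have -> : (tau (sch conj t.+1 r (uact h x)) ord_max ord_max != 0) =
     (sch conj t.+1 r (uact h x) ord_max ord_max != 0).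
    by case: (tau_last (sch conj t.+1 r (uact h x))) => ->; rewrite ?oppr_eq0.
  have -> : v (tau (sch conj t.+1 r (uact h x)) ord_max ord_max) =
     v (sch conj t.+1 r (uact h x) ord_max ord_max).
    by case: (tau_last (sch conj t.+1 r (uact h x))) => ->; rewrite ?valN.
  rewrite mulf_eq0 (negPf d0) /=; split=> -[h1 h2]; split=> //.
    by rewrite valM // vd h2.
  by move: h2; rewrite valM // vd => /addrI.
apply/seteqP; split=> h [Kh].
  case=> hb hy; split=> // j j0 jn; rewrite /upd.
  have [ej|jr] := eqVneq j r.+1; first by rewrite ej; apply: (key h hb).1.
  exact/hb/eqP.
move=> hl; have hb : fiber_base conj v x r a h.
  by move=> j j0 jn jr; have := hl j j0 jn; rewrite /upd (introF eqP jr).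
split=> //; split=> //; apply/(key h hb).
by have := hl r.+1 isT rn; rewrite /upd eqxx.
Qed.

Lemma cmass_ge0 b y : 0 <= cmass conj mu x r a tau b y.
Proof. exact: mass_ge0. Qed.

Lemma cmass0_le (b y y' : int) : (forall N A B, mxge v N (A - B) -> mxge v N (tau A - tau B)) ->
  y <= y' -> cmass conj mu x r a tau b y = 0 -> cmass conj mu x r a tau b y' = 0.
Proof.
move=> tb yy e; apply/eqP; rewrite eq_le cmass_ge0 andbT -e /cmass /mass.
have me z : measurable (fiber conj (v := v) x r a (content v tau b z)).
  by apply: (fiber_measurable I) => //; apply: (content_open I tb).
apply: fine_le; [exact: mass_fin | exact: mass_fin | apply: le_measure]; rewrite ?inE //.
move=> h [Kh [hb [h1 h2 h3]]]; split=> //; split=> //; split=> //.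
exact: vge_le h3.
Qed.

End Fiber.
Local Notation "x %:CC" := (real_complex R x) (at level 2, format "x %:CC").

(** [bal] stands for the property aimed at, [balanced] or a plain symmetry. Additivity lets it pass
    from the strata of given content to the whole level mass. *)
Lemma level_balanced t r a (tau : 'M[k']_t.+1 -> 'M[k']_t.+1) (c : C) (B0 : int)
    (bal : (int -> C) -> Prop) : (r < n)%N -> (t.+1 + r <= m)%N -> a 0 = 0 ->
  (forall L (g : 'I_L -> int -> C), (forall i, bal (g i)) -> bal (fun V => \sum_i g i V)) ->
  (forall A, tau A ord_max ord_max = A ord_max ord_max \/
     tau A ord_max ord_max = - A ord_max ord_max) ->
  (forall N A B, mxge v N (A - B) -> mxge v N (tau A - tau B)) ->
  (exists N, forall A M, M <= N -> mxge v M A -> mxge v M (tau A)) ->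
  (forall h, K h -> fiber_base conj v x r a h -> ~ mxge v B0 (tau (sch conj t.+1 r (uact h x)))) ->
  (forall b : int, b < B0 -> bal (fun V => c ^ V *
    (cmass conj mu x r a tau b V - cmass conj mu x r a tau b (V + 1))%:CC)) ->
  bal (fun V => c ^ V * level_mass (upd a r.+1 (a r + V))).
Proof.
move=> rn H a0 hsum tl tb tlow hB hb.
have [N0 [L [e hL]]] := mass_exactly I mu rn H tb tlow hB.
have -> : (fun V => c ^ V * level_mass (upd a r.+1 (a r + V))) =
  (fun V => \sum_(i < L) c ^ V * (cmass conj mu x r a tau (N0 + i%:Z) V - cmass conj mu x r a tau (N0 + i%:Z) (V + 1))%:CC).
  apply/funext => V; rewrite /level_mass -(exactly_level rn H a0 tl) e.
  by rewrite -mulr_sumr [(\sum_(_ < _) _)%:CC]rmorph_sum.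
apply: hsum => i; exact: hb.
Qed.

Lemma balanced0 (d : int) (s : nat) (g : int -> C) : (forall V, g V = 0) -> balanced q%:R s d g.
Proof.
move=> h; exists (fun _ => 0); split=> [V|//|]; last by exists 0.
by rewrite !h mul0r subrr addr0.
Qed.

Let qn0 : q%:R != 0 :> C.
Proof. by rewrite pnatr_eq0 -lt0n; apply: ltnW; apply: (residue_card_gt1 I). Qed.

Lemma real_complex_rel (N1 N2 : nat) (x1 x2 : R) : N1%:R * x1 = N2%:R * x2 ->
  N1%:R * x1%:CC = N2%:R * x2%:CC.
Proof. by move/(congr1 (real_complex R)); rewrite !rmorphM !rmorph_nat. Qed.

(** V -> d - V exchanges the successive differences of v(d_r), v(d_(r+1)), v(d_(r+2)), whose sum d
    is frozen: this is the reflection in a root of the form e_i - e_(i+1). *)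
Lemma balanced_short r a : (r.+2 <= n)%N -> a 0 = 0 ->
  balanced q%:R 1 (a r.+2 - a r) (fun V => (- q%:R) ^ V * level_mass (upd a r.+1 (a r + V))).
Proof.
move=> rn a0; have [cx _ _] := unitary_hermitian_facts hx.
have H : (2 + r <= m)%N by move: rn; clear; lia.
pose d := a r.+2 - a r.
have c0 : - q%:R != 0 :> C by rewrite oppr_eq0.
apply: (@level_balanced 1 r a id (- q%:R) (`|d| + 1) (balanced q%:R 1 d)) => //.
- exact: ltnW.
- by move=> L g; apply: balanced_sum.
- by move=> A; left.
- by exists 0.
(* A larger content would put the determinant, of valuation d, into the ideal of exponent 2 |d| +
   2. *)
- move=> h Kh hb hT; have [cT c1 c2 D0 vD] := caseA_facts I cx rn a0 Kh hb.
  move: (sch conj 2 r (uact h x)) hT cT c1 c2 D0 vD => T hT cT c1 c2 D0 vD.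
  have : T ord0 ord0 * T ord_max ord_max - T ord0 ord_max * conj (T ord0 ord_max) \in P (`|d| + 1 + (`|d| + 1)).
    by apply: vgeB => //; apply: vgeM => //; rewrite ?(vge_conj I).
  by rewrite vgeNz // vD -/d; clear; lia.
(* Twice the content is at most the valuation d of the determinant; [l] is the excess. *)
move=> b _; have [bd|db] := ltP d (b + b).
  apply: balanced0 => V; rewrite !(massA_content I mu cx rn a0) // subrr rmorph0 mulr0 //.
pose l := `|(d - (b + b))%R|%N; have el : a r.+2 - a r = b + b + l%:Z.
  by rewrite -/d /l; move: db; clear; lia.
pose M j := (cmass conj mu x r a (t := 1) id b (b + j%:Z))%:CC.
have -> : d = b + b + (1 * l)%N%:Z by rewrite mul1n -el.
have rn' : (r < n)%N by exact: ltnW.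
have tb N (A B : 'M[k']_2) : mxge v N (A - B) -> mxge v N (id A - id B) by [].
have natE (N : nat) (z : C) : N.+1%:R * z = (N%:R + 1) * z by rewrite -natr1.
apply: (@balanced_level _ q%:R 1 ((- q%:R) ^ b) M l b 1) => //.
- have := real_complex_rel (massA_zero I Hmu cx rn a0 el).
  by rewrite mulr1 natrD natrX /M; case: ifP; rewrite ?natE ?mul1r.
- move=> i i0 il; have := real_complex_rel (massA_even I Hmu cx rn a0 el i0 il).
  by rewrite mulr1 natrX /M; case: ifP; rewrite ?natE ?mul1r.
- move=> i il; rewrite mul1r /M (massA_odd I mu cx rn a0 el); last by move: il; clear; lia.
  by rewrite il.
- move=> ol j lj; rewrite /M; apply/eqP; rewrite fmorph_eq0; apply/eqP.
  have h : (l./2 + l./2 < l)%N by move: ol; clear; lia.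
  have := massA_odd I mu cx rn a0 el h; rewrite (_ : (l./2 + l./2).+1 = l); last by move: ol; clear; lia.
  rewrite ltnn => e; apply: (cmass0_le rn' tb _ e); move: lj h; clear; lia.
- move=> el' j lj; rewrite mulr1; have hl : l = (l./2 + l./2)%N by move: el'; clear; lia.
  have := real_complex_rel (massA_tail I Hmu cx rn a0 el hl lj); rewrite natrX expr2 -mulrA.
  by move/(mulfI qn0).
- move=> j; rewrite mul1n /jump mulr1 /M exprzDr // -exprnP mulrA; congr (_ * _).
  by rewrite rmorphB -addrA; congr (_ - (cmass _ _ _ _ _ _ _ (b + _))%:CC); lia.
move=> V hV; have Vb : V + 1 <= b.
  by have := hV `|(V - b)%R|%N; clear; lia.
have Vb' : V <= b by move: Vb; clear; lia.
by rewrite (cmass_low _ _ _ _ _ _ Vb') (cmass_low _ _ _ _ _ _ Vb) subrr rmorph0 mulr0.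
Qed.

Section Middle.
Variables (t r : nat) (a : nat -> int).
Hypothesis em : m = (t.+1 + r + r)%N.
Hypothesis rn : r.+1 = n.
Hypothesis a0 : a 0 = 0.
Hypothesis t0 : (0 < t)%N.
Local Notation tau := (fun A : 'M[k']_t.+1 => J t.+1 - A).
Local Notation cm := (cmass conj (t := t) mu x r a tau).

Let rn' : (r < n)%N. Proof. by rewrite -rn. Qed.

Lemma middle_even (b : int) (j : nat) : cm b (b + (2 * j)%N%:Z + 1) = cm b (b + (j.+1 + j.+1)%N%:Z).
Proof. by rewrite mul2n -addnn (mid_parity I mu a hx em rn). Qed.

(** No mass has exact valuation V off the progression: below b because the entry lies in P^b, and at
    odd distance from b by parity. *)
Lemma middle_gap (b : int) V : (forall j : nat, V != b + (2 * j)%N%:Z) -> cm b V - cm b (V + 1) = 0.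
Proof.
move=> hV; have [Vb|bV] := ltP V b.
  have Vb' : V <= b by exact: ltW.
  have Vb1 : V + 1 <= b by move: Vb; clear; lia.
  by rewrite (cmass_low _ _ _ _ _ _ Vb') (cmass_low _ _ _ _ _ _ Vb1) subrr.
have [j e] : exists j : nat, V = b + (2 * j)%N%:Z + 1.
  have := hV `|(V - b)%R|./2; exists `|(V - b)%R|./2; move: bV H; clear; lia.
rewrite e middle_even (_ : b + (2 * j)%N%:Z + 1 + 1 = b + (j.+1 + j.+1)%N%:Z) ?subrr //.
by clear; lia.
Qed.

Lemma middle_sum (c : C) (bal : (int -> C) -> Prop) :
  (forall L (g : 'I_L -> int -> C), (forall i, bal (g i)) -> bal (fun V => \sum_i g i V)) ->
  (forall (b : int) (s : nat), v 2%:R = b + s%:Z ->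
     bal (fun V => c ^ V * (cm b V - cm b (V + 1))%:CC)) ->
  bal (fun V => c ^ V * level_mass (upd a n (a r + V))).
Proof.
move=> hs hb; rewrite -rn; apply: (@level_balanced t r a tau c (v 2%:R + 1)) => //.
- by rewrite em; clear; lia.
- move=> A; right; rewrite !mxE (_ : (_ == _) = false) ?sub0r //.
  by rewrite -val_eqE /= subnn; move: t0; clear; lia.
- exact: (tau_near I).
- exact: (tau_low I).
- by apply: (mid_content I hx em rn); clear; lia.
move=> b hlt; apply: (hb b `|(v 2%:R - b)%R|%N); move: hlt; clear; lia.
Qed.

End Middle.

(** One step in the progression multiplies the weight by c^2 = - q^2, which is the factor - q Q of
    [jump] for Q = q. *)
Lemma balanced_odd r a (c : C) : m = (3 + r + r)%N -> r.+1 = n -> a 0 = 0 ->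
  c ^+ 2 = - q%:R ^+ 2 ->
  balanced q%:R 2 (v 2%:R + v 2%:R) (fun V => c ^ V * level_mass (upd a n (a r + V))).
Proof.
move=> em rn a0 c2; have c0 : c != 0.
  by rewrite -sqrf_eq0 c2 oppr_eq0 sqrf_eq0.
apply: (middle_sum em rn a0) => [//|L g|b s v2]; first exact: balanced_sum.
pose M j := (cmass conj mu x r a (t := 2) (fun A => J 3 - A) b (b + (j + j)%N%:Z))%:CC.
have -> : v 2%:R + v 2%:R = b + b + (2 * s)%N%:Z by rewrite v2; clear; lia.
have natE (N : nat) (z : C) : N.+1%:R * z = (N%:R + 1) * z by rewrite -natr1.
have rn' : (r < n)%N by rewrite -rn.
apply: (@balanced_level _ q%:R q%:R (c ^ b) M s b 2) => //.
- have := real_complex_rel (massC_zero I Hmu a hx em rn v2).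
  by rewrite -exprSr natrD natrX /M; case: (s) => [|s'] /=; rewrite ?natE ?mul1r.
- move=> i i0 il; have := real_complex_rel (massC_even I Hmu a hx em rn v2 i0 il).
  rewrite -exprSr natrX /M ltn_neqAle il andbT.
  by case: eqP => /=; rewrite ?natE ?mul1r.
- move=> i il; have := massC_odd I Hmu a hx em rn v2 il.
  by rewrite -[RHS]mul1r => /(@real_complex_rel _ 1); rewrite mul1r.
- move=> ol j lj; rewrite /M; apply/eqP; rewrite fmorph_eq0; apply/eqP.
  have h : s = (s./2 + s./2).+1 by move: ol; clear; lia.
  have e := massC_odd_end I mu a hx em rn v2 h.
  apply: (cmass0_le rn' _ _ e); first exact: (tau_near I).
  by move: lj; clear; lia.
- move=> es j lj; have h : s = (s./2 + s./2)%N by move: es; clear; lia.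
  have := massC_tail I Hmu a hx em rn v2 h lj.
  by rewrite -[RHS]mul1r => /(@real_complex_rel _ 1); rewrite mul1r natrX expr2.
- move=> j; rewrite (middle_even a em rn) exprzDr // -mulrA /jump /M; congr (_ * _).
  rewrite rmorphB -exprnP exprM c2 expr2; congr (_ * (_ - _)).
  by rewrite mul2n -addnn.
by move=> V hV; rewrite (middle_gap a em rn) // rmorph0 mulr0.
Qed.

(** No denominator appears: for s > 0 the weighted masses [g] are themselves palindromic, with q M_1
    at both ends and (q - 1) M_1 in between. *)
Lemma balanced_even r a (c : C) : m = (2 + r + r)%N -> r.+1 = n -> a 0 = 0 -> c ^+ 2 = q%:R ->
  forall V, c ^ (v 2%:R + v 2%:R - V) * level_mass (upd a n (a r + (v 2%:R + v 2%:R - V))) =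
    c ^ V * level_mass (upd a n (a r + V)).
Proof.
move=> em rn a0 c2; have c0 : c != 0 by rewrite -sqrf_eq0 c2.
pose bal (g : int -> C) := forall V, g (v 2%:R + v 2%:R - V) = g V.
apply: (middle_sum em rn a0 _ (bal := bal)) => [//|L g hg V|b s v2].
  by apply: eq_bigr => i _; apply: hg.
pose M j := (cmass conj mu x r a (t := 1) (fun A => J 2 - A) b (b + (j + j)%N%:Z))%:CC.
have rn' : (r < n)%N by rewrite -rn.
have Mend j : (s < j)%N -> M j = 0.
  move=> sj; rewrite /M; apply/eqP; rewrite fmorph_eq0; apply/eqP.
  apply: (cmass0_le rn' _ _ (massB_end I mu a hx em rn v2)); first exact: (tau_near I).
  by move: sj; clear; lia.
have Mstep j : (0 < j)%N -> (j <= s)%N -> q%:R ^+ j * M j = q%:R * M 1%N.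
  elim: j => // j IH _ js; have [->|j0] := posnP j; first by rewrite expr1.
  rewrite -IH //; last exact: ltnW.
  have := massB_step I Hmu a hx em rn v2 j0 js.
  by rewrite -[RHS]mul1r => /(@real_complex_rel _ 1); rewrite mul1r exprSr -mulrA => ->.
have M0 : (0 < s)%N -> M 0%N = (q%:R + 1) * M 1%N.
  move=> s0; have := massB_zero I Hmu a hx em rn v2 s0.
  by rewrite -[RHS]mul1r => /(@real_complex_rel _ 1); rewrite mul1r natr1 => ->.
pose g j : C := q%:R ^+ j * (M j - M j.+1).
have gsym j : (j <= s)%N -> g (s - j)%N = g j.
  have ends : (0 < s)%N -> g s = g 0%N.
    by move=> s0; rewrite /g (Mend s.+1) // subr0 Mstep // expr0 mul1r M0 //; ring.
  have mid i : (0 < i)%N -> (i < s)%N -> g i = q%:R * M 1%N - M 1%N.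
    move=> i0 js; rewrite /g mulrBr Mstep ?(ltnW js) //; congr (_ - _).
    by apply: (mulfI qn0); rewrite mulrA -exprS Mstep.
  move=> js; have [s0|s0] := posnP s; first by congr g; move: js s0; clear; lia.
  have [->|j0] := posnP j; first by rewrite subn0 ends.
  have [->|jn] := eqVneq j s; first by rewrite subnn ends.
  by rewrite !mid //; move: js j0 jn; clear; lia.
have gE j : c ^ (b + (2 * j)%N%:Z) * (cmass conj mu x r a (fun A => J 2 - A) b (b + (2 * j)%N%:Z) -
    cmass conj mu x r a (fun A => J 2 - A) b (b + (2 * j)%N%:Z + 1))%:CC = c ^ b * g j.
  rewrite (middle_even a em rn) exprzDr // -mulrA /g /M; congr (_ * _).
  by rewrite rmorphB -exprnP exprM c2; congr (_ * (_ - _)); rewrite mul2n -addnn.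
have key (j : nat) V : V = b + (2 * j)%N%:Z -> c ^ (v 2%:R + v 2%:R - V) *
   (cmass conj mu x r a (fun A => J 2 - A) b (v 2%:R + v 2%:R - V) -
    cmass conj mu x r a (fun A => J 2 - A) b (v 2%:R + v 2%:R - V + 1))%:CC = c ^ V *
   (cmass conj mu x r a (fun A => J 2 - A) b V - cmass conj mu x r a (fun A => J 2 - A) b (V + 1))%:CC.
  move=> ->; have [js|sj] := leqP j s.
    have -> : v 2%:R + v 2%:R - (b + (2 * j)%N%:Z) = b + (2 * (s - j))%N%:Z.
      by rewrite v2; move: js; clear; lia.
    by rewrite !gE gsym.
  rewrite gE /g !Mend ?subrr ?mulr0 //; last exact: leqW.
  rewrite (middle_gap a em rn) ?rmorph0 ?mulr0 // => i; rewrite v2; move: sj; clear; lia.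
move=> V; case: (level_choice b V (ltn0Sn 1)) => [[j e]|hV]; first exact: (key j).
rewrite [RHS](_ : _ = 0); last by rewrite (middle_gap a em rn) // rmorph0 mulr0.
case: (level_choice b (v 2%:R + v 2%:R - V) (ltn0Sn 1)) => [[j e]|hV'].
  by rewrite -(key j _ e) opprD addrA subrr sub0r opprK (middle_gap a em rn) // rmorph0 mulr0.
by rewrite (middle_gap a em rn) // rmorph0 mulr0.
Qed.

End FiberMass.

Local Close Scope classical_set_scope.

(** * Roots and signed permutations *)

Section Roots.
Variable n : nat.
Local Notation V := 'rV[int]_n.
Local Notation "''e' i" := (delta_mx 0 i : 'rV[int]_n) (at level 8, i at level 2).

(** Partial sums are nonnegative on positive roots and will, up to a shift, be the valuations of the
    d_j; their sum [rho] is positive on positive roots. *)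
Definition cum (j : nat) (x : V) : int := \sum_(i < n | (i < j)%N) x 0 i.

Lemma cum_is_zmod_morphism j : zmod_morphism (cum j).
Proof. by move=> x y; rewrite /cum -sumrB; apply: eq_bigr => i _; rewrite !mxE. Qed.
HB.instance Definition _ j := GRing.isZmodMorphism.Build V int (cum j) (cum_is_zmod_morphism j).

Definition rho (x : V) : int := \sum_(j < n) cum j.+1 x.

Lemma rho_is_zmod_morphism : zmod_morphism rho.
Proof. by move=> x y; rewrite /rho -sumrB; apply: eq_bigr => i _; rewrite raddfB. Qed.
HB.instance Definition _ := GRing.isZmodMorphism.Build V int rho rho_is_zmod_morphism.

Lemma wact_is_zmod_morphism (A : pzRingType) (s : signed_perm n) : zmod_morphism (@wact A n s).
Proof. by move=> x y; apply/rowP => i; rewrite !mxE mulrBr. Qed.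
HB.instance Definition _ (A : pzRingType) (s : signed_perm n) :=
  GRing.isZmodMorphism.Build 'rV[A]_n 'rV[A]_n (wact s) (@wact_is_zmod_morphism A s).

Lemma cum0 x : cum 0 x = 0.
Proof. by rewrite /cum big_pred0. Qed.

Lemma cumS (i : 'I_n) x : cum i.+1 x = cum i x + x 0 i.
Proof.
rewrite /cum (bigD1 i) //= addrC; congr (_ + _); apply: eq_bigl => j.
by rewrite ltnS -val_eqE /= ltn_neqAle andbC.
Qed.

Lemma cum_delta j i : cum j 'e i = (i < j)%N%:R.
Proof.
rewrite /cum; have [ij|ij] := boolP (i < j)%N.
  by rewrite (bigD1 i) //= big1 ?addr0 => [|l /andP[_ hl]]; rewrite !mxE ?eqxx // (negPf hl) andbF.
by rewrite big1 // => l lj; rewrite !mxE eqxx /=; case: eqP => // e; rewrite e (negPf ij) in lj.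
Qed.

Lemma wact_delta (s : signed_perm n) i :
  wact s 'e i = if s.2 (s.1^-1 i)%g then - 'e ((s.1^-1)%g i) else 'e ((s.1^-1)%g i).
Proof.
apply/rowP => j; rewrite !mxE.
have -> : (s.1 j == i) = (j == (s.1^-1)%g i).
  by apply/eqP/eqP => [<-|->]; rewrite ?permK ?permKV.
rewrite eqxx /=; have [->|ne] := eqVneq j ((s.1^-1)%g i).
  by case: (s.2 _); rewrite !mxE !eqxx ?mulr1 ?expr0 ?expr1.
by rewrite mulr0; case: (s.2 _); rewrite !mxE (negPf ne) andbF ?oppr0.
Qed.

Definition short_root (ij : 'I_n * 'I_n) (b : bool) : V :=
  if b then 'e ij.1 + 'e ij.2 else 'e ij.1 - 'e ij.2.

Lemma short_rootsE : short_roots n =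
  [seq short_root ij b | ij <- [seq ij : 'I_n * 'I_n <- enum {: 'I_n * 'I_n} | (ij.1 < ij.2)%N], b <- [:: true; false]].
Proof. by []. Qed.

Lemma short_rootP x : reflect (exists (i j : 'I_n) (b : bool), (i < j)%N /\ x = short_root (i, j) b) (x \in short_roots n).
Proof.
rewrite short_rootsE; apply: (iffP allpairsP) => [[[[i j] b] [/=]]|[i [j [b [ij ->]]]]].
  by rewrite mem_filter => /andP[ij _] _ ->; exists i, j, b.
exists ((i, j), b); split=> //=; last by case: (b).
by rewrite mem_filter ij mem_enum.
Qed.

Lemma long_rootP x : reflect (exists i, x = 'e i *+ 2) (x \in long_roots n).
Proof.
apply: (iffP mapP) => [[i _ ->]|[i ->]]; first by exists i.
by exists i => //; rewrite mem_enum.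
Qed.

Lemma short_root_inj (ij : 'I_n * 'I_n) b (ij' : 'I_n * 'I_n) b' : (ij.1 < ij.2)%N -> (ij'.1 < ij'.2)%N ->
  short_root ij b = short_root ij' b' -> (ij, b) = (ij', b').
Proof.
case: ij ij' => i j [i' j'] /= h h' e.
have E l := congr1 (fun x : V => x 0 l) e.
have ev l (a c : 'I_n) d : short_root (a, c) d 0 l = (l == a :> nat)%:Z + (if d then (l == c :> nat)%:Z else - (l == c :> nat)%:Z).
  by case: d; rewrite /short_root /= !mxE !eqxx /= -!val_eqE /= ?natz.
have e1 : i = i' :> nat.
  move: h h' (E i) (E i'); rewrite !ev; clear.
  move: (i : nat) (j : nat) (i' : nat) (j' : nat) => {}i {}j {}i' {}j'.
  by rewrite !eqxx [i' == i]eq_sym; case: (i =P i') => // ne; case: b; case: b' => /=;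
    case: eqP => e; case: eqP => e' *; lia.
have [e2 e3] : j = j' :> nat /\ b = b'.
  move: h h' (E j) (E j'); rewrite !ev e1; clear.
  move: (j : nat) (i' : nat) (j' : nat) => {}j {}i' {}j' h h'.
  rewrite !eqxx (gtn_eqF h) (gtn_eqF h') [j' == j]eq_sym.
  by case: (j =P j') => [->|ne]; case: b; case: b'.
by rewrite e3; congr ((_, _), _); apply: val_inj.
Qed.

Lemma short_roots_uniq : uniq (short_roots n).
Proof.
rewrite short_rootsE; apply: allpairs_uniq => //; first by rewrite filter_uniq // enum_uniq.
have hp (u : ('I_n * 'I_n) * bool) : u \in [seq (ij, b) | ij <- [seq ij : 'I_n * 'I_n <- enum {: 'I_n * 'I_n} | (ij.1 < ij.2)%N],
    b <- [:: true; false]] -> (u.1.1 < u.1.2)%N.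
  by case/allpairsP => -[p c] /= [hp _ ->]; move: hp; rewrite mem_filter => /andP[].
by move=> [ij b] [ij' b'] /hp h /hp h' e; apply: short_root_inj.
Qed.

Lemma pos_roots_uniq : uniq (pos_roots n).
Proof.
rewrite cat_uniq short_roots_uniq /=; apply/andP; split.
  apply/hasPn => x /long_rootP[a ->]; apply/negP => /short_rootP[i [j [b [ij]]]].
  move/(congr1 (fun x : V => x 0 a)); case: b; rewrite /short_root /= !mxE !eqxx /= -!val_eqE /=; lia.
rewrite map_inj_in_uniq ?enum_uniq // => i j _ _ /(congr1 (fun x : V => x 0 i)).
by rewrite !mxE !eqxx /=; case: eqP.
Qed.

Lemma pos_root_cum x : x \in pos_roots n -> (forall j, 0 <= cum j x) /\ 0 < rho x.
Proof.
move=> hx; have [h1 [a h2]] : (forall j, 0 <= cum j x) /\ exists a : 'I_n, 0 < cum a.+1 x.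
  move: hx; rewrite mem_cat => /orP[/short_rootP[i [j [b [ij ->]]]]|/long_rootP[i ->]]; last first.
    by split=> [l|]; [|exists i]; rewrite raddfMn /= cum_delta; [case: (_ < _)%N|rewrite ltnSn].
  have cs l : cum l (short_root (i, j) b) = (i < l)%N%:Z + (if b then (j < l)%N%:Z else - (j < l)%N%:Z).
    by case: b; rewrite /short_root ?raddfB ?raddfD /= !cum_delta !natz.
  split=> [l|]; [|exists i]; rewrite cs.
    by have [il|li] := ltnP i l; have [jl|lj] := ltnP j l; case: b {cs} => //; have := leq_ltn_trans li (ltn_trans ij jl); rewrite ltnn.
  by rewrite ltnSn ltnS leqNgt ij; case: (b).
split=> //; rewrite /rho (bigD1 a) //=; apply: ltr_wpDr => //.
by apply: sumr_ge0 => j _; apply: h1.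
Qed.

Lemma pos_rootN x : x \in pos_roots n -> - x \notin pos_roots n.
Proof.
move=> /pos_root_cum[_ h1]; apply/negP => /pos_root_cum[_].
by rewrite raddfN /= oppr_gt0 ltNge ltW.
Qed.

Lemma wact_short s x : x \in short_roots n -> (wact s x \in short_roots n) || (- wact s x \in short_roots n).
Proof.
move=> /short_rootP[i [j [b [ij ->]]]].
pose i' := (s.1^-1)%g i; pose j' := (s.1^-1)%g j.
have ne : (i' != j' :> nat) by rewrite val_eqE (inj_eq perm_inj) -val_eqE neq_ltn ij.
have key (c d : bool) : let y : V := (if c then - 'e i' else 'e i') + (if d then - 'e j' else 'e j') in
   (y \in short_roots n) || (- y \in short_roots n).
  wlog lt : (i') (j') ne c d / (i' < j')%N => [hw|].
    move: ne; rewrite neq_ltn => /orP[lt|lt]; first by apply: hw => //; rewrite neq_ltn lt.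
    by rewrite /= addrC; apply: hw => //; rewrite neq_ltn lt.
  move=> y; case: c @y => y; [apply/orP; right | apply/orP; left]; apply/short_rootP; exists i', j'.
    by exists d; split=> //; rewrite /y /short_root /= opprD opprK; case: (d); rewrite ?opprK.
  by exists (~~ d); split=> //; rewrite /y /short_root; case: (d).
case: b; rewrite /short_root ?(raddfB (wact s)) ?(raddfD (wact s)) /= !wact_delta -/i' -/j'; first exact: (key (s.2 i') (s.2 j')).
have := key (s.2 i') (~~ s.2 j'); by case: (s.2 j'); rewrite /= ?opprK.
Qed.

Lemma wact_long s x : x \in long_roots n -> (wact s x \in long_roots n) || (- wact s x \in long_roots n).
Proof.
move=> /long_rootP[i ->]; rewrite raddfMn /= wact_delta.
by case: (s.2 _); [rewrite mulNrn opprK; apply/orP; right | apply/orP; left];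
  apply/long_rootP; eexists.
Qed.

Lemma perm_involution (T : eqType) (w : T -> T) (s : seq T) : uniq s -> involutive w ->
  {in s, forall x, w x \in s} -> perm_eq (map w s) s.
Proof.
move=> us ww h; apply: uniq_perm => //; first by rewrite (map_inj_uniq (inv_inj ww)).
move=> x; apply/mapP/idP => [[y ys ->]|xs]; first exact: h.
by exists (w x); [exact: h | rewrite ww].
Qed.

Definition swap (i j : 'I_n) : signed_perm n := (tperm i j, [ffun=> false]).
Definition flip (l : 'I_n) : signed_perm n := (1%g, [ffun j => j == l]).

Lemma wact_swapE (A : pzRingType) i j (x : 'rV[A]_n) a : wact (swap i j) x 0 a = x 0 (tperm i j a).
Proof. by rewrite mxE ffunE expr0 mul1r. Qed.

Lemma wact_flipE (A : pzRingType) l (x : 'rV[A]_n) a :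
  wact (flip l) x 0 a = if a == l then - x 0 a else x 0 a.
Proof. by rewrite mxE ffunE perm1; case: eqP => _; rewrite ?expr1 ?expr0 ?mulN1r ?mul1r. Qed.

Lemma wact_swapK (A : pzRingType) i j : involutive (@wact A n (swap i j)).
Proof. by move=> x; apply/rowP => a; rewrite !wact_swapE tpermK. Qed.

Lemma wact_flipK (A : pzRingType) l : involutive (@wact A n (flip l)).
Proof. by move=> x; apply/rowP => a; rewrite !wact_flipE; case: eqP => // _; rewrite opprK. Qed.

Lemma swap_delta i j a : wact (swap i j) 'e a = 'e (tperm i j a).
Proof. by rewrite wact_delta ffunE /= tpermV. Qed.

Lemma flip_delta l a : wact (flip l) 'e a = if a == l then - 'e a else 'e a.
Proof. by rewrite wact_delta ffunE /= invg1 perm1. Qed.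

(** The pair (i, i + 1) is the only one whose order is reversed; this is why the swap permutes the
    positive roots other than its own. *)
Lemma adjacent_tperm (i i' a b : 'I_n) : i' = i.+1 :> nat -> (a < b)%N ->
  (tperm i i' a < tperm i i' b)%N \/ (a = i /\ b = i').
Proof.
move=> ei ab; have val_neq (x y : 'I_n) : x <> y -> x <> y :> nat by move=> h /val_inj.
case: tpermP => [ea|ea|/val_neq ea /val_neq ea']; case: tpermP => [eb|eb|/val_neq eb /val_neq eb'];
  subst; try (by right); left; move: ab ei; clear -ea ea' eb eb' || idtac; lia.
Qed.

Section SwapRoots.
Variables (i i' : 'I_n).
Hypothesis ei : i' = i.+1 :> nat.
Let al := short_root (i, i') false.
Let w := wact (A := int) (swap i i').

Let w_short x : x \in short_roots n -> x != al -> w x \in short_roots n.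
Proof.
move=> /short_rootP[a [b [c [ab ->]]]] ne.
have -> : w (short_root (a, b) c) = short_root (tperm i i' a, tperm i i' b) c.
  by case: c {ne}; rewrite /w /short_root ?(raddfB (wact _)) ?(raddfD (wact _)) /= !swap_delta.
have [lt|[ea eb]] := adjacent_tperm ei ab; apply/short_rootP.
  by exists (tperm i i' a), (tperm i i' b), c.
exists i, i', true; split; first by rewrite ei.
case: c ne => [_|]; last by rewrite ea eb eqxx.
by rewrite /short_root ea eb /= tpermL tpermR addrC.
Qed.

Let al_short : al \in short_roots n.
Proof. by apply/short_rootP; exists i, i', false; rewrite ei. Qed.

Let w_al : w al = - al.
Proof. by rewrite /w /al /short_root (raddfB (wact _)) /= !swap_delta tpermL tpermR opprB. Qed.

(** If w x were [al] for a positive x, then x = w [al] = - [al] would be positive. *)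
Let w_rest (s : seq V) : uniq s -> {subset short_roots n <= s} -> {subset s <= pos_roots n} ->
  (forall x, x \in s -> x != al -> w x \in s) ->
  perm_eq s (al :: rem al s) /\ perm_eq (map w (rem al s)) (rem al s).
Proof.
move=> us h1 h2 h3; split; first by apply: perm_to_rem; apply: h1.
apply: perm_involution; [exact: rem_uniq | exact: wact_swapK | move=> x].
rewrite !mem_rem_uniq // => /andP[/= xa xs]; rewrite inE h3 // andbT /=.
apply: contraL (pos_rootN (h2 _ (h1 _ al_short))) => /eqP e.
by rewrite negbK -w_al -e /w wact_swapK h2.
Qed.

Lemma swap_short_roots : perm_eq (short_roots n) (al :: rem al (short_roots n)) /\
  perm_eq (map w (rem al (short_roots n))) (rem al (short_roots n)).
Proof.
apply: w_rest => //; first exact: short_roots_uniq.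
by move=> x xs; rewrite mem_cat xs.
Qed.

Lemma swap_pos_roots : perm_eq (pos_roots n) (al :: rem al (pos_roots n)) /\
  perm_eq (map w (rem al (pos_roots n))) (rem al (pos_roots n)).
Proof.
apply: w_rest => //; first exact: pos_roots_uniq.
  by move=> x xs; rewrite mem_cat xs.
move=> x; rewrite !mem_cat => /orP[/w_short h /h -> //|/long_rootP[a ->] _].
apply/orP; right; apply/long_rootP; exists (tperm i i' a).
by rewrite /w raddfMn /= swap_delta.
Qed.

End SwapRoots.

Section FlipRoots.
Variable l : 'I_n.
Hypothesis el : l.+1 = n.
Let al := 'e l *+ 2.
Let w := wact (A := int) (flip l).

Let w_short x : x \in short_roots n -> w x \in short_roots n.
Proof.
move=> /short_rootP[a [b [c [ab ->]]]].
have al' : (a == l) = false by rewrite -val_eqE /=; have := ltn_ord b; lia.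
apply/short_rootP; exists a, b, (if b == l then ~~ c else c); split=> //.
by case: c; rewrite /w /short_root ?(raddfB (wact _)) ?(raddfD (wact _)) /= !flip_delta al'; case: (b == l); rewrite /= ?opprK.
Qed.

Lemma flip_short_roots : perm_eq (map w (short_roots n)) (short_roots n).
Proof. by apply: perm_involution; [exact: short_roots_uniq | exact: wact_flipK |]. Qed.

Lemma flip_pos_roots : perm_eq (pos_roots n) (al :: rem al (pos_roots n)) /\
  perm_eq (map w (rem al (pos_roots n))) (rem al (pos_roots n)).
Proof.
have hal : al \in pos_roots n by rewrite mem_cat; apply/orP; right; apply/long_rootP; exists l.
have w_al : w al = - al by rewrite /w /al raddfMn /= flip_delta eqxx mulNrn.
split; first exact: perm_to_rem.
apply: perm_involution; [exact/rem_uniq/pos_roots_uniq | exact: wact_flipK | move=> x].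
rewrite !mem_rem_uniq ?pos_roots_uniq // => /andP[/= xa xs]; rewrite inE; apply/andP; split=> /=.
  apply: contraL (pos_rootN hal) => /eqP e.
  by rewrite negbK -w_al -e /w wact_flipK.
move: xs; rewrite !mem_cat => /orP[/w_short -> //|/long_rootP[a ea]].
apply/orP; right; apply/long_rootP; exists a; move: xa; rewrite ea /w raddfMn /= flip_delta /al.
by case: (eqVneq a l) => [->|//]; rewrite eqxx.
Qed.

End FlipRoots.

(** Conjugation by adjacent transpositions reaches every transposition, and conjugation by
    transpositions takes the last flip to every flip; a signed permutation is then built up one sign
    at a time. *)
Lemma simple_generate (T : Type) (f : V -> T) :
  (forall i i' : 'I_n, i' = i.+1 :> nat -> f \o wact (swap i i') =1 f) ->
  (forall l : 'I_n, l.+1 = n -> f \o wact (flip l) =1 f) ->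
  forall s, f \o wact s =1 f.
Proof.
move=> hs hf; pose P (p : 'S_n) := forall x : V, f (\row_i x 0 (p i)) = f x.
have P1 : P 1%g by move=> x; congr f; apply/rowP => i; rewrite mxE perm1.
have PM p p' : P p -> P p' -> P (p * p')%g.
  move=> h h' x; rewrite -[RHS]h' -[RHS]h; congr f; apply/rowP => i; by rewrite !mxE permM.
have Padj (i i' : 'I_n) : i' = i.+1 :> nat -> P (tperm i i').
  move=> e x; rewrite -(hs _ _ e x) /=; congr f; apply/rowP => a.
  by rewrite wact_swapE mxE.
have Pt (i j : 'I_n) : (i < j)%N -> P (tperm i j).
  have [d hd] : exists d, (j - i = d.+1)%N \/ (j - i = 0)%N by exists (j - i).-1; lia.
  elim: d j hd => [|d IH] j hd ij; first by apply: Padj; lia.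
  have hj : (j.-1 < n)%N by apply: leq_ltn_trans (ltn_ord j); exact: leq_pred.
  pose j' := Ordinal hj; have jj' : j = j'.+1 :> nat by rewrite /=; lia.
  have ij' : (i < j')%N by rewrite /=; lia.
  have -> : tperm i j = (tperm i j' ^ tperm j' j)%g.
    rewrite tpermJ tpermL tpermD // -val_eqE /=; lia.
  rewrite /conjg tpermV; apply: (PM _ _ _ (PM _ _ _ _)); [exact: Padj | | exact: Padj].
  by apply: IH => //; left; rewrite /=; lia.
have Pall p : P p.
  case: (prod_tpermP p) => ts -> _; elim: ts => [|t ts IH]; first by rewrite big_nil.
  rewrite big_cons; apply: PM => //; case: (ltngtP t.1 t.2) => [h|h|/val_inj ->].
  - exact: Pt.
  - by rewrite tpermC; apply: Pt.
  by rewrite tperm1.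
have hflip (a : 'I_n) x : f (wact (flip a) x) = f x.
  have hl : (n.-1 < n)%N by have := ltn_ord a; lia.
  pose l := Ordinal hl; have el : l.+1 = n by rewrite /=; have := ltn_ord a; lia.
  rewrite -(Pall (tperm a l)) -[RHS](Pall (tperm a l)) -[RHS](hf l el) /=; congr f.
  apply/rowP => b; rewrite mxE !wact_flipE !mxE; congr (if _ then _ else _).
  by rewrite -{2}(tpermR a l) (inj_eq perm_inj).
(* [y k] carries the signs of s on its first k coordinates only. *)
move=> s x /=; pose y k : V := \row_i (if s.2 i && (i < k)%N then - x 0 (s.1 i) else x 0 (s.1 i)).
have -> : wact s x = y n.
  by apply/rowP => i; rewrite !mxE ltn_ord andbT; case: (s.2 i); rewrite ?expr1 ?expr0 ?mulN1r ?mul1r.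
have y0 : f (y 0%N) = f x by rewrite -[RHS](Pall s.1); congr f; apply/rowP => i; rewrite !mxE andbF.
have : (n <= n)%N by []; elim: {1 3}n => [|k IH] kn //.
rewrite -(IH (ltnW kn)); pose a := Ordinal kn.
have [sa|sa] := boolP (s.2 a); last first.
  congr f; apply/rowP => i; rewrite !mxE ltnS leq_eqVlt; case: eqP => //= e.
  by rewrite (_ : i = a) ?(negPf sa) //; apply: val_inj.
rewrite -[RHS](hflip a); congr f; apply/rowP => i; rewrite wact_flipE !mxE ltnS leq_eqVlt.
rewrite -val_eqE /=; case: eqP => [e|//].
by rewrite (_ : i = a) ?sa ?ltnn //; apply: val_inj.
Qed.

End Roots.

(** * The formal functional equation *)

Section Formal.
Variables (n : nat) (F : fieldType) (qF : F).
Local Notation V := 'rV[int]_n.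
Variables (fm : (nat -> int) -> F) (c : 'I_n -> F) (e : int).
Hypothesis c0 : forall j, c j != 0.

(** The shift by e in each coordinate accounts for q^(-<e>): it moves the centre of the last
    reflection, V -> 2e - V, to the origin. Beyond n the value is set to 0, so that the function
    [lev x] is determined by the valuations of the n minors. *)
Definition lev (x : V) (j : nat) : int := if (j <= n)%N then cum j (x + const_mx e) else 0.
Definition wt (x : V) : F := \prod_j c j ^ lev x j.+1.
(** Coefficient of the generating series: the mass of a level set times the constants [c j], which
    will be the contributions q^(-kappa_j) of the constant terms of s. *)
Definition phi (x : V) : F := wt x * fm (lev x).
Definition set_lev (a : nat -> int) (r : nat) (y : int) j := if j == r then y else a j.

Lemma levS (r : 'I_n) x : lev x r.+1 = lev x r + (x 0 r + e).
Proof. by rewrite /lev ltn_ord (ltnW (ltn_ord r)) cumS !mxE. Qed.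

(** Along [al] only the partial sum of index r + 1 varies, and [w] fixes the others, so one-variable
    witnesses can be glued. [key x], with the moving level erased, records the other levels, and
    [coef x] collects the part of the weight that they determine. *)
Lemma line_psi (r : 'I_n) (s : nat) (al : V) (w : V -> V) (d : (nat -> int) -> int) :
  (0 < s)%N ->
  (forall j, (j <= n)%N -> cum j al = if j == r.+1 then s%:Z else 0) ->
  (forall x j, j != r.+1 -> lev (w x) j = lev x j) ->
  (forall x, w x 0 r + e = d (lev x) - (x 0 r + e)) ->
  (forall a y, d (set_lev a r.+1 y) = d a) ->
  (forall a, a 0%N = 0 -> balanced qF s (d a) (fun y => c r ^ y * fm (set_lev a r.+1 (a r + y)))) ->
  exists psi, [/\ op (- qF^-1) al psi =1 op 1 al phi, psi \o w =1 psi & line_bounded al psi].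
Proof.
move=> s0 hal hw hw2 hd hbal.
have [psi hpsi] : exists psi : (nat -> int) -> int -> F, forall a, a 0%N = 0 ->
  let g y := c r ^ y * fm (set_lev a r.+1 (a r + y)) in
  [/\ forall y, psi a y - psi a (y - s%:Z) / qF = g y + g (y - s%:Z),
    forall y, psi a (d a - y) = psi a y & exists N, forall y, y < N -> psi a y = 0].
  have /choice[psi h] : forall a, exists psi : int -> F, a 0%N = 0 ->
    let g y := c r ^ y * fm (set_lev a r.+1 (a r + y)) in
    [/\ forall y, psi y - psi (y - s%:Z) / qF = g y + g (y - s%:Z),
      forall y, psi (d a - y) = psi y & exists N, forall y, y < N -> psi y = 0].
    move=> a; have [a0|a0] := eqVneq (a 0%N) 0; last by exists (fun=> 0) => h; rewrite h eqxx in a0.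
    by have [psi h] := hbal a a0; exists psi.
  by exists psi.
pose key x := set_lev (lev x) r.+1 0.
pose coef x := (\prod_(j | j != r) c j ^ lev x j.+1) * c r ^ lev x r.
have key0 x : key x 0%N = 0 by rewrite /key /set_lev /= /lev /= cum0.
have keyr x : key x r = lev x r by rewrite /key /set_lev ltn_eqF.
have same x y : (forall j, j != r.+1 -> lev y j = lev x j) -> key y = key x /\ coef y = coef x.
  move=> h; split.
    by apply/funext => j; rewrite /key /set_lev; case: ifPn => // /h.
  rewrite /coef h ?ltn_eqF //; congr (_ * _); apply: eq_bigr => j hj.
  by rewrite h // eqSS.
have phiE x : phi x = coef x * (c r ^ (x 0 r + e) * fm (set_lev (key x) r.+1 (key x r + (x 0 r + e)))).
  rewrite /phi /wt (bigD1 r) //= levS expfzDr // /coef keyr.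
  have -> : set_lev (key x) r.+1 (lev x r + (x 0 r + e)) = lev x.
    by apply/funext => j; rewrite /set_lev /key /set_lev; case: eqP => // ->; rewrite levS.
  set A := c r ^ _; set B := c r ^ _; set X := fm _; set P := \prod_(_ | _) _.
  by rewrite [P * A]mulrC -!mulrA; congr (A * _); rewrite mulrCA.
have levB x k j : lev (x - al *+ k) j = if j == r.+1 then lev x j - (s * k)%N%:Z else lev x j.
  rewrite /lev; case: leqP => [jn|nj]; last by rewrite gtn_eqF // (leq_ltn_trans (ltn_ord r) nj).
  rewrite addrAC raddfB raddfMn /= hal //; case: ifP => _; last by rewrite mul0rn subr0.
  by rewrite -mulr_natr natz PoszM.
have xB x k : (x - al *+ k) 0 r = x 0 r - (s * k)%N%:Z.
  have := levS r (x - al *+ k); rewrite !levB eqxx ltn_eqF // levS.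
  by move: (lev x r) (x 0 r) ((x - al *+ k) 0 r) => A B D; clear; lia.
have sameB x k : key (x - al *+ k) = key x /\ coef (x - al *+ k) = coef x.
  by apply: same => j hj; rewrite levB (negPf hj).
exists (fun x => coef x * psi (key x) (x 0 r + e)); split=> x.
- have [k1 k2] := sameB x 1%N; have xx := xB x 1%N; rewrite mulr1n muln1 in k1 k2 xx.
  rewrite /op !phiE k1 k2 xx mul1r -mulrDr.
  have [h _ _] := hpsi _ (key0 x); rewrite addrAC -h; ring.
- have [k1 k2] := same x (w x) (hw x); rewrite /= k1 k2 hw2.
  have [_ h _] := hpsi _ (key0 x); rewrite -[RHS]/(coef x * _) -[in RHS]h.
  by rewrite /key hd.
have [_ _ [N hN]] := hpsi _ (key0 x).
exists `|(x 0 r + e - N)%R|%N.+1 => k hk; have [-> ->] := sameB x k.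
by rewrite xB hN ?mulr0 //; move: hk s0; clear; nia.
Qed.

Lemma lev_swap (i i' : 'I_n) x j : i' = i.+1 :> nat -> j != i.+1 ->
  lev (wact (swap i i') x) j = lev x j.
Proof.
move=> ei ji; rewrite /lev; case: leqP => // _.
have -> : wact (swap i i') x + const_mx e = wact (swap i i') (x + const_mx e).
  by apply/rowP => a; rewrite mxE wact_swapE [const_mx _ _ _]mxE wact_swapE !mxE.
move: (x + const_mx e) => y; rewrite /cum (reindex_inj (@perm_inj _ (tperm i i'))) /=.
apply: eq_big => [a|a _]; last by rewrite wact_swapE tpermK.
by case: tpermP => [->|->|//]; move: ji; rewrite ei; clear; lia.
Qed.

Lemma lev_flip (l : 'I_n) x j : l.+1 = n -> j != l.+1 -> lev (wact (flip l) x) j = lev x j.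
Proof.
move=> el; rewrite el => jn; rewrite /lev; case: leqP => // jn'.
have {jn jn'}jn : (j < n)%N by rewrite ltn_neqAle jn.
rewrite /cum; apply: eq_bigr => a aj; rewrite !mxE ffunE perm1.
by case: eqP => [ea|_]; [move: aj jn; rewrite ea; lia | rewrite expr0 mul1r].
Qed.

Definition roots_of (b : bool) := if b then pos_roots n else short_roots n.

Lemma roots_of_pos b : {subset roots_of b <= pos_roots n}.
Proof. by case: b => x //; rewrite mem_cat => ->. Qed.

Definition lc (j : 'I_n) : {additive V -> int} := cum j.+1 : V -> int.
Definition lrho : {additive V -> int} := @rho n.

Lemma lrho_ge N : exists M, forall x, (forall j, N <= lc j x) -> M <= lrho x.
Proof.
exists (\sum_(j < n) N) => x h; apply: ler_sum => j _; exact: h.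
Qed.

Lemma formal_solution (b : bool) (N : int) :
  bounded_below lc N phi ->
  (forall i i' : 'I_n, i' = i.+1 :> nat -> exists psi,
    [/\ op (- qF^-1) (short_root (i, i') false) psi =1 op 1 (short_root (i, i') false) phi,
     psi \o wact (swap i i') =1 psi & line_bounded (short_root (i, i') false) psi]) ->
  (forall l : 'I_n, l.+1 = n -> if b then exists psi,
      [/\ op (- qF^-1) (delta_mx 0 l *+ 2) psi =1 op 1 (delta_mx 0 l *+ 2) phi,
       psi \o wact (flip l) =1 psi & line_bounded (delta_mx 0 l *+ 2) psi]
    else phi \o wact (flip l) =1 phi) ->
  exists f, [/\ ops (- qF^-1) (roots_of b) f =1 ops 1 (roots_of b) phi,
    forall s, f \o wact s =1 f, bounded_below lc N f
    & forall x, f x != 0 -> forall j : 'I_n, `|cum j.+1 x| <= `|N|].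
Proof.
move=> hb hs hf.
have hpos be : be \in roots_of b -> (forall j, 0 <= lc j be) /\ 0 < lrho be.
  by move=> /roots_of_pos /pos_root_cum[h1 h2]; split=> // j; apply: h1.
have [f bf ef] := ops_inverse lrho_ge (- qF^-1)
   (bounded_below_ops (c := 1) hb (fun be hbe => (hpos be hbe).1)) hpos.
have lb be : be \in roots_of b -> line_bounded be f.
  by move=> hbe; apply: (bounded_below_line lrho_ge bf); case: (hpos be hbe).
have inv s : f \o wact s =1 f.
  apply: simple_generate => [i i' ei|l el].
    have [psi [h1 h2 h3]] := hs i i' ei.
    have [p1 p2] : perm_eq (roots_of b) (short_root (i, i') false :: rem (short_root (i, i') false) (roots_of b)) /\
      perm_eq (map (wact (swap i i')) (rem (short_root (i, i') false) (roots_of b))) (rem (short_root (i, i') false) (roots_of b)).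
      by rewrite /roots_of; case: (b); [apply: swap_pos_roots | apply: swap_short_roots].
    exact: (simple_invariant (w := wact (swap i i')) p1 p2 lb h3 h2 h1 ef).
  have := hf l el; rewrite /roots_of in ef lb *; case: (b) ef lb => ef' lb'.
    case=> psi [h1 h2 h3]; have [p1 p2] := flip_pos_roots el.
    exact: (simple_invariant (w := wact (flip l)) p1 p2 lb' h3 h2 h1 ef').
  move=> h; exact: (ops_invariant (w := wact (flip l)) (flip_short_roots el) lb' h ef').
exists f; split=> // x fx j.
(* The element -1 of W turns the lower bound on the partial sums into an upper bound. *)
pose s : signed_perm n := (1%g, [ffun=> true]).
have sx : wact s x = - x by apply/rowP => i; rewrite !mxE ffunE perm1 mulN1r.
have fx' : f (- x) != 0 by rewrite -sx; have /= -> := inv s x.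
have := bf x fx j; have := bf _ fx' j; rewrite /lc /= raddfN /=.
lia.
Qed.

End Formal.

Local Open Scope classical_set_scope.

(** * The formal equation for the level masses *)

Section FormalZeta.
Variables (k : fieldType) (k' : fieldExtType k) (conj : {lrmorphism k' -> k'}).
Variables (v : k' -> int) (q : nat) (pi theta : k') (rep : 'I_q -> k').
Hypothesis I : inert conj v pi theta rep.
Variables (R : realType) (m : nat) (mu : probability (borel_mx v m) R).
Hypothesis Hmu : is_haar conj mu.
Local Notation K := (unitary_integral conj v m).
Local Notation uact := (Defs.act conj).
Local Notation n := m./2.
Local Notation C := R[i].
Let dv := inert_dv I.

Variable x : 'M[k']_m.
Hypothesis hx : unitary_hermitian conj m x.
Local Notation fm := (level_mass conj mu x).
Local Notation e := (v 2%:R).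
Variable c : 'I_n -> C.
Hypothesis c_short : forall j : 'I_n, (j.+1 < n)%N -> c j = - q%:R.
Hypothesis c_long : forall j : 'I_n, j.+1 = n -> c j ^+ 2 = if odd m then - q%:R ^+ 2 else q%:R.

Lemma level_bound : exists N : nat, forall a j, @level_set _ _ conj v m x a !=set0 -> (0 < j)%N -> (j <= n)%N ->
  - N%:Z <= a j.
Proof.
have [b hb] := mxge_ex v x; exists (n * b)%N => a j [h [Kh hl]] j0 jn.
have [d0 vd] := hl j j0 jn; rewrite -vd.
have ih : mxge v 0 h by case: Kh.
have hy : mxge v (- b%:Z) (uact h x).
  apply: (mxgeMr I); last exact: (mxge_ct I).
  by apply: (mxgeMl I).
have iE : mxge v 0 (low k' m j) by exact: (mxge_blk I).
have : lowdet conj j (uact h x) \in vge v (j%:Z * - b%:Z).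
  apply: (vge_det_gen dv); apply: (mxgeMr I); last exact: (mxge_ct I).
  by apply: (mxgeMl I).
by rewrite vgeNz // => h1; apply: le_trans h1; move: jn; clear; nia.
Qed.

Lemma phi_bounded : exists N, bounded_below (@lc n) N (phi fm c e).
Proof.
have [N hN] := level_bound; exists (- N%:Z - `|e| * n%:Z) => y hy j.
have ne : @level_set _ _ conj v m x (lev e y) !=set0.
  apply/set0P; apply: contraNneq hy => h; rewrite /phi /level_mass h mass0 mulr0 //.
have := hN _ _ ne (ltn0Sn j) (ltn_ord j); rewrite /lev ltn_ord raddfD /= /lc /=.
have : cum j.+1 (const_mx e : 'rV[int]_n) <= `|e| * n%:Z.
  rewrite /cum; apply: (@le_trans _ _ (\sum_(i < n) `|e|)).
    rewrite [leRHS](bigID (fun i : 'I_n => (i < j.+1)%N)) /=; apply: ler_wpDr; first exact: sumr_ge0.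
    by apply: ler_sum => i _; rewrite mxE ler_norm.
  by rewrite sumr_const card_ord pmulrn mulrzz.
move: (cum _ y) (cum _ _) => A B; move: (`|e| * _) => D; clear; lia.
Qed.

Lemma formal_zeta : exists f, [/\
  ops (- q%:R^-1) (G_roots m) f =1 ops 1 (G_roots m) (phi fm c e),
  forall s, f \o wact s =1 f
  & exists N : nat, forall y, f y != 0 -> forall j : 'I_n, `|cum j.+1 y| <= N%:Z].
Proof.
have q0 : q%:R != 0 :> C by rewrite pnatr_eq0 -lt0n; apply: ltnW; apply: (residue_card_gt1 I).
have c0 j : c j != 0.
  have [h|h] := boolP (j.+1 < n)%N; first by rewrite c_short // oppr_eq0.
  have {}h : j.+1 = n by have := ltn_ord j; move: h; clear; lia.
  by rewrite -sqrf_eq0 c_long //; case: ifP => _; rewrite ?oppr_eq0 ?sqrf_eq0.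
have [N hN] := phi_bounded.
have swapS (i i' : 'I_n) : i' = i.+1 :> nat -> exists psi,
    [/\ op (- q%:R^-1) (short_root (i, i') false) psi =1 op 1 (short_root (i, i') false) (phi fm c e),
     psi \o wact (swap i i') =1 psi & line_bounded (short_root (i, i') false) psi].
  move=> ei; have i1 : (i.+1 < n)%N by rewrite -ei.
  apply: (line_psi (qF := q%:R) (fm := fm) (e := e) c0 (w := wact (swap i i')) (r := i) (s := 1) (d := fun a => a i.+2 - a i)) => //.
  - move=> j _; rewrite /short_root raddfB /= !cum_delta ei !natz; clear.
    by case: (ltngtP j i.+1) => h; rewrite /= ?subr0; lia.
  - by move=> y j; apply: lev_swap.
  - move=> y; rewrite wact_swapE tpermL -ei !levS; rewrite ei in i1 *.
    rewrite (levS e i); move: (lev e y i) (y 0 i) (y 0 i') => A B D; clear; lia.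
  - by move=> a z; rewrite /set_lev gtn_eqF // ltn_eqF.
  - move=> a a0; rewrite (c_short i1).
    exact: (balanced_short I Hmu hx i1 a0).
have flipS (l : 'I_n) : l.+1 = n -> if odd m then exists psi,
      [/\ op (- q%:R^-1) (delta_mx 0 l *+ 2) psi =1 op 1 (delta_mx 0 l *+ 2) (phi fm c e),
       psi \o wact (flip l) =1 psi & line_bounded (delta_mx 0 l *+ 2) psi]
    else phi fm c e \o wact (flip l) =1 phi fm c e.
  move=> el; have updE a : upd a n = set_lev a l.+1 by rewrite /upd /set_lev el.
  case: ifP => om.
    apply: (line_psi (qF := q%:R) (fm := fm) (e := e) c0 (w := wact (flip l)) (r := l) (s := 2) (d := fun=> e + e)) => //.
    - move=> j jn; rewrite raddfMn /= cum_delta; have -> : (l < j)%N = (j == l.+1).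
        by apply/idP/eqP; move: jn el; move: (l : nat) => L; clear; lia.
      by case: ifP.
    - by move=> y j; apply: lev_flip.
    - by move=> y; rewrite wact_flipE eqxx; move: (y 0 l) => A; clear; lia.
    move=> a a0; have em : m = (3 + l + l)%N by move: el om; clear; lia.
    by have := balanced_odd I Hmu hx em el a0 (etrans (c_long el) (ifT _ _ om)); rewrite updE.
  move=> y; have em : m = (2 + l + l)%N by move: el om; clear; lia.
  have c2 : c l ^+ 2 = q%:R by rewrite c_long // om.
  have lev0 : lev e y 0 = 0 by rewrite /lev /= cum0.
  have := balanced_even I Hmu hx em el lev0 c2 (y 0 l + e); rewrite updE => h.
  have ly : lev e y = set_lev (lev e y) l.+1 (lev e y l + (y 0 l + e)).
    by apply/funext => j; rewrite /set_lev; case: eqP => // ->; rewrite levS.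
  have lw : lev e (wact (flip l) y) = set_lev (lev e y) l.+1 (lev e y l + (e + e - (y 0 l + e))).
    apply/funext => j; rewrite /set_lev; case: eqP => [->|/eqP jl]; last exact: lev_flip.
    rewrite levS lev_flip ?ltn_eqF // wact_flipE eqxx; move: (lev e y l) (y 0 l) => A B; clear; lia.
  have wtE z a V : lev e z = set_lev a l.+1 (a l + V) ->
      wt c e z = (\prod_(j | j != l) c j ^ a j.+1) * c l ^ a l * c l ^ V.
    move=> hz; rewrite /wt hz (bigD1 l) //= /set_lev eqxx expfzDr // -mulrA mulrC; congr (_ * _).
    by apply: eq_bigr => j jl; rewrite eqSS (_ : (j == l :> nat) = false) //; apply/negbTE; rewrite val_eqE.
  have fy := congr1 fm ly; have fw := congr1 fm lw.
  by rewrite /= /phi (wtE _ _ _ lw) (wtE _ _ _ ly) fy fw -!mulrA h.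
have [f [h1 h2 h3 h4]] := formal_solution hN swapS flipS.
exists f; split=> //; exists `|N|%N => y fy j; exact: h4.
Qed.

End FormalZeta.

(** * Evaluating formal series at a character *)

Section Evaluation.
Variables (R : realType) (n q : nat).
Hypothesis q1 : (1 < q)%N.
Local Notation C := R[i].
Local Notation V := 'rV[int]_n.

Lemma cum_inj (x y : V) : (forall j : 'I_n, cum j.+1 x = cum j.+1 y) -> x = y.
Proof.
move=> h; have h' (j : nat) : (j <= n)%N -> cum j x = cum j y.
  by case: j => [|j] jn; [rewrite !cum0 | exact: (h (Ordinal jn))].
apply/rowP => j; have := h j; rewrite !cumS h' ?(ltnW (ltn_ord j)) //.
exact: addrI.
Qed.

Lemma cum_surj (a : nat -> int) : a 0%N = 0 -> exists x : V, forall j, (j <= n)%N -> cum j x = a j.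
Proof.
move=> a0; exists (\row_i (a i.+1 - a i)); elim=> [|j IH] jn; first by rewrite cum0.
by rewrite (cumS (Ordinal jn)) /= IH ?(ltnW jn) // mxE /= subrKC.
Qed.

Lemma box_ex (L : nat) : exists s : seq V, uniq s /\
  forall x, (x \in s) = [forall j : 'I_n, `|cum j.+1 x| <= L%:Z].
Proof.
have /choice[g hg] : forall f : {ffun 'I_n -> 'I_(L + L).+1}, exists x : V,
    forall j : 'I_n, cum j.+1 x = (f j)%:Z - L%:Z.
  move=> f; have [|x hx] := @cum_surj (fun j => if j is j'.+1 then
      (if insub j' is Some i then (f i : nat)%:Z else 0) - L%:Z else 0) => //.
  by exists x => j; rewrite hx ?ltn_ord // valK.
exists (map g (enum {: {ffun 'I_n -> 'I_(L + L).+1}})); split.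
  rewrite map_inj_uniq ?enum_uniq // => f f' e; apply/ffunP => j; apply: val_inj.
  have := hg f j; rewrite e hg => /addIr [] //.
move=> x; apply/mapP/forallP => [[f _ ->] j|h].
  by rewrite hg; have := ltn_ord (f j); move: (nat_of_ord (f j)) => A; clear; lia.
have hb (j : 'I_n) : (`|(cum j.+1 x + L%:Z)%R|%N < (L + L).+1)%N.
  by have := h j; move: (cum _ x) => A; clear; lia.
exists [ffun j => Ordinal (hb j)]; first by rewrite mem_enum.
apply: cum_inj => j; rewrite hg ffunE /=; have := h j; move: (cum _ x) => A; clear; lia.
Qed.

Variable T : V -> C.
Hypothesis TD : forall x y, T (x + y) = T x * T y.

(** Convergence at rate q^(-L) of the sums over any finite set containing the box of size L.
    Allowing all such sets makes the notion stable under translation of the index set, up to a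
    constant loss in L. *)
Definition near_sum (f : V -> C) (l : C) := exists (D : C) (L0 : nat), forall (L : nat) (s : seq V), (L0 <= L)%N ->
  uniq s -> (forall x, (forall j : 'I_n, `|cum j.+1 x| <= L%:Z) -> x \in s) ->
  `|\sum_(x <- s) f x * T x - l| <= D * q%:R^-1 ^+ L.

Let q0 : q%:R != 0 :> C. Proof. by rewrite pnatr_eq0 -lt0n ltnW. Qed.

(** The shifted half is a sum over the translate of s by - [al], which contains the box of size L -
    k when s contains that of size L. *)
Lemma near_sum_op c al f l : near_sum f l -> near_sum (op c al f) ((1 + c * T al) * l).
Proof.
move=> [D [L0 h]]; have [k hk] : exists k : nat, forall j : 'I_n, `|cum j.+1 al| <= k%:Z.
  exists (\max_(j < n) `|cum j.+1 al|%N)%N => j.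
  by rewrite -abszE lez_nat; apply: (leq_bigmax_cond (F := fun j : 'I_n => `|cum j.+1 al|%N)).
exists (D + `|c * T al| * D * q%:R ^+ k), (L0 + k)%N => L s hL us hs.
have e : \sum_(x <- s) op c al f x * T x - (1 + c * T al) * l =
   (\sum_(x <- s) f x * T x - l) + c * T al * (\sum_(x <- map (fun x => x - al) s) f x * T x - l).
  rewrite big_map mulrBr mulrDl mul1r opprD addrACA; congr (_ + _).
  rewrite mulr_sumr -big_split /=; apply: eq_bigr => x _.
  by rewrite /op mulrDl; congr (_ + _); rewrite -{2}(subrK al x) TD; ring.
rewrite e; apply: le_trans (ler_normD _ _) _; rewrite mulrDl; apply: lerD.
  by apply: h => //; move: hL; clear; lia.
rewrite normrM -!mulrA; apply: ler_wpM2l => //.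
have -> : q%:R ^+ k * q%:R^-1 ^+ L = q%:R^-1 ^+ (L - k) :> C.
  have kL : (k <= L)%N by move: hL; clear; lia.
  by rewrite -{1}(subnK kL) exprD mulrCA -exprMn mulfV // expr1n mulr1.
apply: h; first by move: hL; clear; lia.
  by rewrite map_inj_uniq // => x y /addIr.
move=> x hx; apply/mapP; exists (x + al); last by rewrite addrK.
apply: hs => j; rewrite raddfD /=; have := hx j; have := hk j; move: hL.
move: (cum _ x) (cum _ al) => A B; clear; lia.
Qed.

Lemma near_sum_ops c s f l : near_sum f l -> near_sum (ops c s f) (\prod_(al <- s) (1 + c * T al) * l).
Proof.
move=> h; elim: s => [|al s IH]; first by rewrite big_nil mul1r.
by rewrite big_cons -mulrA; apply: near_sum_op.
Qed.

Lemma near_sum_finite (f : V -> C) (N : nat) (s : seq V) : uniq s ->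
  (forall x, (x \in s) = [forall j : 'I_n, `|cum j.+1 x| <= N%:Z]) ->
  (forall x, f x != 0 -> forall j : 'I_n, `|cum j.+1 x| <= N%:Z) ->
  near_sum f (\sum_(x <- s) f x * T x).
Proof.
move=> us hs hf; exists 0, N => L s' NL us' hs'.
have -> : \sum_(x <- s') f x * T x = \sum_(x <- s) f x * T x; last by rewrite subrr normr0 mul0r.
rewrite (bigID (mem s)) /= [X in _ + X]big1 ?addr0 => [|x]; last first.
  rewrite hs => /forallPn[j hj]; suff -> : f x = 0 by rewrite mul0r.
  by apply/eqP; apply: contraNT hj => /hf.
rewrite -big_filter; apply: perm_big; apply: uniq_perm; [exact: filter_uniq | by [] |].
move=> x; rewrite mem_filter; apply: andb_idr => /=; rewrite hs => /forallP h.
by apply: hs' => j; apply: le_trans (h j) _; rewrite lez_nat.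
Qed.

Lemma near_sum_ext f g l : f =1 g -> near_sum f l -> near_sum g l.
Proof.
move=> e [D [L0 h]]; exists D, L0 => L s h1 h2 h3; rewrite -(eq_bigr _ (fun x _ => congr1 ( *%R^~ (T x)) (e x))).
exact: h.
Qed.

Lemma near_sum_unique f l l' : near_sum f l -> near_sum f l' -> l = l'.
Proof.
move=> [D [L0 h]] [D' [L0' h']]; apply/eqP; rewrite -subr_eq0 -normr_eq0.
have key L : (L0 + L0' <= L)%N -> `|l - l'| <= (D + D') * q%:R^-1 ^+ L.
  move=> hL; have [s [us hs]] := box_ex L.
  have hs' x : (forall j : 'I_n, `|cum j.+1 x| <= L%:Z) -> x \in s by move=> hx; rewrite hs; apply/forallP.
  rewrite mulrDl; have -> : l - l' = (\sum_(x <- s) f x * T x - l') - (\sum_(x <- s) f x * T x - l) by ring.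
  rewrite [leRHS]addrC; apply: le_trans (ler_normB _ _) _; apply: lerD.
    by apply: h' => //; move: hL; clear; lia.
  by apply: h => //; move: hL; clear; lia.
have q1R : 1 < q%:R :> R by rewrite ltr1n.
have [r er] : exists r : R, `|l - l'| = r%:C%C by rewrite normc_def; eexists.
have r_ge0 : 0 <= r by rewrite -lecR -er normr_ge0.
(* The inequality L <= q^L replaces the exponential rate by a linear one, enough for an Archimedean
   contradiction. *)
have key2 L : (L0 + L0' <= L)%N -> r * L%:R <= complex.Re (D + D').
  move=> hL; have := key L hL; rewrite exprVn ler_pdivlMr ?exprn_gt0 ?ltr0n ?(ltnW q1) // => hle.
  have : `|l - l'| * L%:R <= D + D'.
    apply: le_trans hle; apply: ler_wpM2l => //; rewrite -natrX ler_nat.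
    exact/ltnW/ltn_expl.
  by rewrite er -(rmorph_nat (real_complex R)) -rmorphM lecE => /andP[_].
suff r_le0 : r <= 0 by rewrite er (_ : r = 0) ?rmorph0 //; apply/eqP; rewrite eq_le r_le0.
rewrite leNgt; apply/negP => r0.
pose L := (L0 + L0' + (Num.trunc (complex.Re (D + D')%R / r)%R).+1)%N.
have := key2 L (leq_addr _ _); rewrite leNgt => /negP; apply.
rewrite mulrC -ltr_pdivrMr //; apply: lt_le_trans (truncnS_gt _) _.
by rewrite ler_nat leq_addl.
Qed.

End Evaluation.

Lemma cumD n j (x y : 'rV[int]_n) : cum j (x + y) = cum j x + cum j y.
Proof.
have h := cum_is_zmod_morphism j; have hN z : cum j (- z) = - cum j z.
  by rewrite -[in LHS](sub0r z) h (_ : cum j 0 = 0) ?sub0r // /cum big1 // => i _; rewrite mxE.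
by rewrite -[in LHS](opprK y) h hN opprK.
Qed.

Lemma levE n e (x : 'rV[int]_n) j : (j <= n)%N -> lev e x j = cum j x + cum j (const_mx e : 'rV[int]_n).
Proof. by move=> jn; rewrite /lev jn cumD. Qed.

(** * The integral as a limit of sums over level sets *)

Section ZetaIntegral.
Variables (k : fieldType) (k' : fieldExtType k) (conj : {lrmorphism k' -> k'}).
Variables (v : k' -> int) (q : nat) (pi theta : k') (rep : 'I_q -> k').
Hypothesis I : inert conj v pi theta rep.
Variables (R : realType) (m : nat) (mu : probability (borel_mx v m) R).
Hypothesis Hmu : is_haar conj mu.
Local Notation K := (unitary_integral conj v m).
Local Notation uact := (Defs.act conj).
Local Notation n := m./2.
Let dv := inert_dv I.

Variable x : 'M[k']_m.
Variable e : int.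
Variable N : 'I_n -> nat.
Hypothesis N0 : forall i, (0 < N i)%N.
Local Notation E y := (@level_set _ _ conj v m x (lev e y)).
Local Notation d j h := (lowdet conj j (uact h x)).

(** The integrand at s = (N_1, ..., N_n) with positive integers N_i, where it is real, nonnegative
    and bounded on K. *)
Definition weight (h : 'M[k']_m) : R :=
  if [forall i : 'I_n, d i.+1 h != 0] then \prod_(i < n) q%:R ^ (- (v (d i.+1 h) * (N i)%:Z)) else 0.
Definition lweight (y : 'rV[int]_n) : R := \prod_(i < n) q%:R ^ (- (lev e y i.+1 * (N i)%:Z)).

Let q1 : 1 < q%:R :> R. Proof. by rewrite ltr1n (residue_card_gt1 I). Qed.
Let q0 : 0 < q%:R :> R. Proof. exact: lt_trans q1. Qed.
Let mK : measurable (K : set (borel_mx v m)). Proof. exact: (measurable_K I). Qed.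

Lemma lowdet_measurable (Q : (nat -> k') -> Prop) :
  (forall f, Q f -> exists M, forall g, (forall j, (0 < j)%N -> (j <= n)%N -> g j - f j \in vge v M) -> Q g) ->
  measurable ([set h | Q (fun j => d j h)] : set (borel_mx v m)).
Proof.
move=> hQ; apply: open_measurable_mx => a /hQ[M hM].
have [L hL] : exists L, forall h, mxge v L (h - a) -> forall j, (j < n.+1)%N -> d j h - d j a \in vge v M.
  elim: n.+1 => [|l [L IH]]; first by exists 0.
  have [L' h'] := acont_lowdet I a l x M; exists (Num.max L L') => h hh j.
  rewrite ltnS leq_eqVlt => /orP[/eqP ->|].
    by apply: h'; apply: mxge_le hh; rewrite le_max lexx orbT.
  by apply: IH; apply: mxge_le hh; rewrite le_max lexx.
by exists L => h hh; apply: hM => j _ jn; apply: hL.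
Qed.

Lemma near_vals (f : nat -> k') : (forall i : 'I_n, f i.+1 != 0) ->
  exists M, forall g, (forall j, (0 < j)%N -> (j <= n)%N -> g j - f j \in vge v M) ->
    forall i : 'I_n, g i.+1 != 0 /\ v (g i.+1) = v (f i.+1).
Proof.
move=> hf; exists (\sum_(i < n) `|v (f i.+1)| + 1) => g hg i.
rewrite -(subrKC (f i.+1) (g i.+1)); apply: val_eqD => //.
apply: vge_le (hg _ _ _) => //; rewrite (bigD1 i) //=.
have : 0 <= \sum_(j < n | j != i) `|v (f j.+1)| by apply: sumr_ge0.
move: (\sum_(_ < _ | _) _) (v _) => A B; clear; lia.
Qed.

Lemma level_measurable (y : 'rV[int]_n) : measurable (E y : set (borel_mx v m)).
Proof.
rewrite /level_set; apply: measurableI => //.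
apply: (@lowdet_measurable (fun f => forall j, (0 < j)%N -> (j <= n)%N -> f j != 0 /\ v (f j) = lev e y j)) => f hf.
have [|M hM] := @near_vals f; first by move=> i; have [] := hf i.+1 isT (ltn_ord i).
exists M => g hg [|j] // _ jn; have [h1 h2] := hM g hg (Ordinal jn).
by split=> //; rewrite h2; have [] := hf j.+1 isT jn.
Qed.

Lemma weight_measurable : measurable_fun (K : set (borel_mx v m)) weight.
Proof.
move=> _ Y mY; apply: measurableI => //.
pose Q (f : nat -> k') := (forall i : 'I_n, f i.+1 != 0) /\
  Y (\prod_(i < n) q%:R ^ (- (v (f i.+1) * (N i)%:Z))).
have m1 : measurable ([set h | Q (fun j => d j h)] : set (borel_mx v m)).
  apply: lowdet_measurable => f [f0 fY]; have [M hM] := near_vals f0; exists M => g hg.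
  have h := hM g hg; split; first by move=> i; have [] := h i.
  by rewrite (eq_bigr (fun i : 'I_n => q%:R ^ (- (v (f i.+1) * (N i)%:Z)))) // => i _; have [_ ->] := h i.
have m2 : measurable ([set h | forall i : 'I_n, d i.+1 h != 0] : set (borel_mx v m)).
  apply: (@lowdet_measurable (fun f => forall i : 'I_n, f i.+1 != 0)) => f f0; have [M hM] := near_vals f0.
  by exists M => g /hM h i; have [] := h i.
have [Y0|Y0] := pselect (Y 0).
  have -> : weight @^-1` Y = [set h | Q (fun j => d j h)] `|` ~` [set h | forall i : 'I_n, d i.+1 h != 0].
    apply/seteqP; split=> h /=; rewrite /weight; case: forallP => h0.
    - by left.
    - by right.
    - by case=> [[]|].
    by move=> _.
  by apply: measurableU => //; apply: measurableC.
have -> : weight @^-1` Y = [set h | Q (fun j => d j h)]; last by [].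
by apply/seteqP; split=> h /=; rewrite /weight /Q; case: forallP => h0 //; [case | case].
Qed.

Lemma weight_ge0 h : 0 <= weight h.
Proof.
rewrite /weight; case: ifP => // _; apply: prodr_ge0 => i _; apply: exprz_ge0; exact: ltW.
Qed.

(** Valuations of the minors are bounded below on K, so outside the box of size L some v(d_j) is at
    least L up to a constant. As N_j > 0, the factor of d_j is then of order q^(-L), while the
    others stay bounded. *)
Lemma weight_bound : exists (D : R) (B : nat), forall h, K h -> weight h <= D /\
  forall L (y : 'rV[int]_n) (j : 'I_n), (B <= L)%N -> E y h -> L%:Z < `|cum j.+1 y| -> weight h <= D * q%:R^-1 ^+ L.
Proof.
have [b hb] := level_bound I x.
pose B := (b + `|e| * n)%N.
pose D0 : R := \prod_(i < n) q%:R ^+ (b * N i).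
have D01 : 1 <= D0.
  apply: (@big_ind _ (fun z : R => 1 <= z)) => // [z w hz hw|i _]; first by apply: mulr_ege1.
  by apply: exprn_ege1; exact: ltW.
have qle (s t : int) : s <= t -> (q%:R : R) ^ s <= q%:R ^ t by move=> st; rewrite ler_eXz2l.
have fac (a : int) i : - b%:Z <= a -> (q%:R : R) ^ (- (a * (N i)%:Z)) <= q%:R ^+ (b * N i).
  by move=> ha; rewrite exprnP; apply: qle; move: ha; move: (N i) => s; clear; nia.
exists (D0 * q%:R ^+ B), B => h Kh.
have [h0|h0] := boolP [forall i : 'I_n, d i.+1 h != 0]; last first.
  by rewrite /weight (negPf h0); split=> [|L y j _ _ _]; rewrite ?mulr_ge0 ?exprn_ge0 ?invr_ge0 ?(ltW q0) // (le_trans _ D01).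
have hlev : @level_set _ _ conj v m x (fun j => v (d j h)) h.
  split=> // j j0 jn; split=> //; have jn' : (j.-1 < n)%N by rewrite prednK.
  by have := forallP h0 (Ordinal jn'); rewrite /= prednK.
have hlow (i : 'I_n) : - b%:Z <= v (d i.+1 h).
  by apply: (hb (fun j => v (d j h))) => //; exists h.
rewrite /weight h0; split.
  apply: (@le_trans _ _ D0); last by rewrite ler_peMr ?(le_trans _ D01) // exprn_ege1 // ltW.
  by apply: ler_prod => i _; rewrite exprz_ge0 ?(ltW q0) //= fac.
move=> L y j BL [_ hE] hj.
have hcum (l : nat) : (l <= n)%N -> `|cum l (const_mx e : 'rV[int]_n)| <= (`|e| * n)%N%:Z.
  move=> ln; rewrite /cum; apply: le_trans (ler_norm_sum _ _ _) _; apply: (@le_trans _ _ (\sum_(i < n) `|e|)).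
    rewrite [leRHS](bigID (fun i : 'I_n => (i < l)%N)) /=; apply: ler_wpDr; first exact: sumr_ge0.
    by apply: ler_sum => i _; rewrite mxE.
  by rewrite sumr_const card_ord pmulrn mulrzz PoszM abszE.
have aj : L%:Z - (`|e| * n)%N%:Z <= v (d j.+1 h).
  have [_ ->] := hE j.+1 isT (ltn_ord j).
  have := hcum j.+1 (ltn_ord j); have := hlow j; have [_ ->] := hE j.+1 isT (ltn_ord j).
  rewrite levE //; move: hj BL; rewrite /B.
  move: (cum j.+1 y) (cum j.+1 (const_mx e)) (`|e| * n)%N => s t w; clear; lia.
have -> : D0 * q%:R ^+ B * q%:R^-1 ^+ L = D0 * q%:R ^ (B%:Z - L%:Z).
  by rewrite -mulrA; congr (_ * _); rewrite expfzDr ?gt_eqF // exprVn -exprnP exprnN.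
have -> : D0 * q%:R ^ (B%:Z - L%:Z) = q%:R ^+ (b * N j) * q%:R ^ (B%:Z - L%:Z) *
    \prod_(i < n | i != j) q%:R ^+ (b * N i) by rewrite /D0 (bigD1 j) //= mulrAC.
rewrite (bigD1 j) //=; apply: ler_pM.
- by apply: exprz_ge0; exact: ltW.
- by apply: prodr_ge0 => i _; apply: exprz_ge0; exact: ltW.
- apply: (@le_trans _ _ (q%:R ^ (B%:Z - L%:Z))).
    apply: qle; move: aj (N0 j) BL; rewrite /B; move: (v _) (N j) => s t; clear; nia.
  by rewrite ler_peMl ?exprz_ge0 ?(ltW q0) // exprn_ege1 // ltW.
by apply: ler_prod => i _; rewrite exprz_ge0 ?(ltW q0) //= fac.
Qed.

Lemma level_disjoint (y z : 'rV[int]_n) h : E y h -> E z h -> y = z.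
Proof.
move=> [_ hy] [_ hz]; apply: cum_inj => j.
have [_ e1] := hy j.+1 isT (ltn_ord j); have [_ e2] := hz j.+1 isT (ltn_ord j).
by move: e1; rewrite e2 !levE // => /addIr.
Qed.

Lemma weight_level (y : 'rV[int]_n) h : E y h -> weight h = lweight y.
Proof.
move=> [_ hy]; rewrite /weight ifT; last first.
  by apply/forallP => i; have [] := hy i.+1 isT (ltn_ord i).
by apply: eq_bigr => i _; have [_ ->] := hy i.+1 isT (ltn_ord i).
Qed.

Lemma level_cover h : K h -> weight h != 0 -> exists y : 'rV[int]_n, E y h.
Proof.
move=> Kh; rewrite /weight; case: ifP => [/forallP h0 _|]; last by rewrite eqxx.
have [|y hy] := @cum_surj n (fun j => if j == 0%N then 0 else v (d j h) - cum j (const_mx e : 'rV[int]_n)) => //.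
exists y; split=> // j j0 jn; split.
  by have jn' : (j.-1 < n)%N; [rewrite prednK | have := h0 (Ordinal jn'); rewrite /= prednK].
by rewrite levE // hy // (gtn_eqF j0) subrK.
Qed.

Let step_fun (s : seq 'rV[int]_n) h : R := \sum_(y <- s) lweight y * \1_(E y) h.

Let step_integral s : mu.-integrable (K : set (borel_mx v m)) (EFin \o step_fun s) /\
  \int[mu]_(h in K) step_fun s h = \sum_(y <- s) lweight y * mass mu (E y).
Proof.
elim: s => [|y s [IH1 IH2]].
  have -> : step_fun [::] = cst 0 by apply/funext => h; rewrite /step_fun big_nil.
  by rewrite big_nil; split; [exact: integrable0 | rewrite Rintegral_cst // mul0r].
have eI : mu.-integrable (K : set (borel_mx v m)) (EFin \o (fun h => \1_(E y) h : R)).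
  apply: (@integrableS _ _ _ mu setT) => //.
  by apply: integrable_indic; exact: level_measurable.
have eM : mu.-integrable (K : set (borel_mx v m)) (EFin \o (fun h => lweight y * \1_(E y) h)).
  exact: (integrableZl mK (lweight y) eI).
have -> : step_fun (y :: s) = (fun h => lweight y * \1_(E y) h + step_fun s h).
  by apply/funext => h; rewrite /step_fun big_cons.
split; first exact: (integrableD mK eM IH1).
rewrite RintegralD // IH2 big_cons; congr (_ + _).
rewrite RintegralZl //; congr (_ * _); rewrite /Rintegral integral_indic //; last exact: level_measurable.
by rewrite /mass; congr (fine (mu _)); apply: setIidl => h [].
Qed.

Lemma weight_integrable : mu.-integrable (K : set (borel_mx v m)) (EFin \o weight).
Proof.
have [D [B hD]] := weight_bound.
apply: measurable_bounded_integrable => //.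
- exact: le_lt_trans (probability_le1 mu mK) (ltry 1).
- exact: weight_measurable.
exists D; split=> [|z Dz h Kh]; first exact: num_real.
by rewrite /= ger0_norm ?weight_ge0 // (le_trans (hD h Kh).1) // ltW.
Qed.

(** The sum is the integral of a step function equal to the weight on the levels listed in s.
    Elsewhere the weight is at most D q^(-L), and K has mass 1. *)
Lemma weight_near : exists (D : R) (L0 : nat), forall L (s : seq 'rV[int]_n), (L0 <= L)%N -> uniq s ->
  (forall y, (forall j : 'I_n, `|cum j.+1 y| <= L%:Z) -> y \in s) ->
  `|\sum_(y <- s) lweight y * mass mu (E y) - \int[mu]_(h in K) weight h| <= D * q%:R^-1 ^+ L.
Proof.
have [D [B hD]] := weight_bound; exists D, B => L s BL us hs.
have [i1 <-] := step_integral s.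
have eL : D * q%:R^-1 ^+ L = \int[mu]_(h in K) (cst (D * q%:R^-1 ^+ L) h).
  rewrite (Rintegral_cst mu mK) -[LHS]mulr1; congr (_ * _).
  by rewrite -[LHS]/(fine (1%E : \bar R)); congr fine; exact: (esym Hmu.1).
have iL : mu.-integrable (K : set (borel_mx v m)) (EFin \o cst (D * q%:R^-1 ^+ L : R)).
  apply: (@integrableS _ _ _ mu setT) => //; exact: finite_measure_integrable_cst.
have st h : (exists2 y, y \in s & E y h) \/ step_fun s h = 0.
  have [[y ys Ey]|hn] := pselect (exists2 y, y \in s & E y h); [by left; exists y | right].
  rewrite /step_fun big_seq big1 // => y ys; rewrite indicE memNset ?mulr0 // => Ey.
  by apply: hn; exists y.
have sE y h : y \in s -> E y h -> step_fun s h = weight h.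
  move=> ys Ey; rewrite /step_fun (bigD1_seq y) //= indicE mem_set // mulr1 big1 ?addr0.
    by rewrite (weight_level Ey).
  move=> z zy; rewrite indicE memNset ?mulr0 // => Ez.
  by move: zy; rewrite (level_disjoint Ez Ey) eqxx.
rewrite distrC ger0_norm; last first.
  rewrite subr_ge0; apply: le_Rintegral => // [|h Kh]; first exact: weight_integrable.
  by case: (st h) => [[y ys Ey]|->]; [rewrite (sE y) | exact: weight_ge0].
rewrite lerBlDr addrC eL -RintegralD //; apply: le_Rintegral => //.
- exact: weight_integrable.
- exact: (integrableD mK i1 iL).
move=> h Kh; case: (st h) => [[y ys Ey]|hn].
  rewrite (sE y) // lerDl.
  by rewrite /= mulr_ge0 ?exprn_ge0 ?invr_ge0 ?(ltW q0) // (le_trans (weight_ge0 h)) // (hD h Kh).1.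
have [->|w0] := eqVneq (weight h) 0; first by rewrite hn add0r /= mulr_ge0 ?exprn_ge0 ?invr_ge0 ?(ltW q0) // (le_trans (weight_ge0 h)) // (hD h Kh).1.
have [y Ey] := level_cover Kh w0.
rewrite hn add0r; have [_ hw] := hD h Kh.
have [[j hj]|hj] := pselect (exists j : 'I_n, L%:Z < `|cum j.+1 y|); first exact: (hw L y j).
have ys : y \in s by apply: hs => j; rewrite leNgt; apply/negP => h'; apply: hj; exists j.
by case/negP: w0; rewrite -(sE y) // hn.
Qed.

End ZetaIntegral.

Local Close Scope classical_set_scope.

(** * Powers of q and Laurent polynomials in them *)

Section QPow.
Variables (R : realType) (q : nat).
Hypothesis q1 : (1 < q)%N.
Local Notation C := R[i].
Local Notation qpow := (@qpow R q).

Lemma qpowD x y : qpow (x + y) = qpow x * qpow y.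
Proof.
case: x y => [a b] [c d]; rewrite /Defs.qpow /= !mulrDl expRD cosD sinD; simpc.
by apply/eqP; rewrite eq_complex /=; apply/andP; split; apply/eqP; ring.
Qed.

Lemma qpow0 : qpow 0 = 1.
Proof. by rewrite /Defs.qpow /= mul0r expR0 cos0 sin0 mulr0 mulr1. Qed.

Lemma qpow_neq0 x : qpow x != 0.
Proof.
apply/eqP => h; have := qpow0; rewrite -(subrr x) qpowD h mul0r => /eqP.
by rewrite eq_sym oner_eq0.
Qed.

Lemma qpowN x : qpow (- x) = (qpow x)^-1.
Proof. by apply: (mulfI (qpow_neq0 x)); rewrite -qpowD subrr qpow0 mulfV // qpow_neq0. Qed.

Lemma qpow_sum (J : Type) (s : seq J) (f : J -> C) : qpow (\sum_(i <- s) f i) = \prod_(i <- s) qpow (f i).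
Proof. by elim: s => [|i s IH]; rewrite ?big_nil ?qpow0 // !big_cons qpowD IH. Qed.

Let q0 : (0 : R) < q%:R. Proof. by rewrite ltr0n ltnW. Qed.

Lemma qpow1 : qpow 1 = q%:R.
Proof.
rewrite /Defs.qpow /= mul0r mul1r cos0 sin0 mulr0 mulr1 lnK ?posrE //.
by rewrite -[RHS](rmorph_nat (real_complex R)).
Qed.

Lemma qpowMn x (k : nat) : qpow (k%:R * x) = qpow x ^+ k.
Proof. by elim: k => [|k IH]; rewrite ?mul0r ?qpow0 // -natr1 mulrDl mul1r qpowD IH exprSr. Qed.

Lemma qpowMz x (k : int) : qpow (k%:~R * x) = qpow x ^ k.
Proof.
case: k => k; first by rewrite -pmulrn qpowMn.
by rewrite NegzE mulrNz mulNr qpowN -pmulrn qpowMn -exprnN.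
Qed.

Lemma qpow_int (k : int) : qpow k%:~R = q%:R ^ k.
Proof. by rewrite -[k%:~R]mulr1 qpowMz qpow1. Qed.

Lemma ln_q_neq0 : ln q%:R != 0 :> R.
Proof. by rewrite gt_eqF // ln_gt0 // ltr1n. Qed.

Lemma qpow_pi : qpow (Complex 0 (pi / ln q%:R)) = -1.
Proof.
rewrite /Defs.qpow /= mul0r expR0 divfK ?ln_q_neq0 // cospi sinpi !mul1r.
by apply/eqP; rewrite eq_complex /= oppr0 !eqxx.
Qed.

Lemma pairingD n (a b : 'rV[int]_n) (z : 'rV[C]_n) : pairing (a + b) z = pairing a z + pairing b z.
Proof. by rewrite /pairing -big_split; apply: eq_bigr => i _; rewrite mxE intrD mulrDl. Qed.

Lemma laurentD n (f g : 'rV[C]_n -> C) : laurent q f -> laurent q g -> laurent q (fun z => f z + g z).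
Proof. by move=> [s hs] [t ht]; exists (s ++ t) => z; rewrite big_cat hs ht. Qed.

Lemma laurentM n (f g : 'rV[C]_n -> C) : laurent q f -> laurent q g -> laurent q (fun z => f z * g z).
Proof.
move=> [s hs] [t ht]; exists [seq (a.1 * b.1, a.2 + b.2) | a <- s, b <- t] => z.
rewrite big_allpairs_dep hs ht mulr_suml; apply: eq_bigr => a _.
rewrite mulr_sumr; apply: eq_bigr => b _ /=; rewrite pairingD qpowD; ring.
Qed.

Lemma laurent_mono n c (a : 'rV[int]_n) : laurent q (fun z => c * qpow (pairing a z)).
Proof. by exists [:: (c, a)] => z; rewrite big_seq1. Qed.

Lemma pairing0 n (z : 'rV[C]_n) : pairing 0 z = 0.
Proof. by rewrite /pairing big1 // => i _; rewrite mxE mul0r. Qed.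

Lemma laurent_cst n c : laurent q (fun _ : 'rV[C]_n => c).
Proof. by have [s hs] := laurent_mono c (0 : 'rV[int]_n); exists s => z; rewrite -hs pairing0 qpow0 mulr1. Qed.

Lemma laurent_ext n (f g : 'rV[C]_n -> C) : f =1 g -> laurent q f -> laurent q g.
Proof. by move=> e [s hs]; exists s => z; rewrite -e. Qed.

Lemma laurent_prod n (J : Type) (l : seq J) (f : J -> 'rV[C]_n -> C) : (forall j, laurent q (f j)) ->
  laurent q (fun z => \prod_(j <- l) f j z).
Proof.
move=> h; elim: l => [|j l IH]; first by apply: laurent_ext (laurent_cst n 1) => z; rewrite big_nil.
by apply: laurent_ext (laurentM (h j) IH) => z; rewrite big_cons.
Qed.

Lemma laurent_affine n (f : 'rV[C]_n -> C) (g : 'rV[C]_n -> 'rV[C]_n) :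
  (forall a : 'rV[int]_n, exists (b : 'rV[int]_n) c, forall z, pairing a (g z) = pairing b z + c) ->
  laurent q f -> laurent q (fun z => f (g z)).
Proof.
move=> /choice[b] /choice[c] h [s hs]; exists [seq (t.1 * qpow (c t.2), b t.2) | t <- s] => z.
rewrite hs big_map; apply: eq_bigr => t _ /=; rewrite h qpowD; ring.
Qed.

(** Multiplication by y^M clears the negative exponents and leaves a polynomial that vanishes at all
    q^k with k > 0, more points than its size allows. *)
Lemma int_power_sum_eq0 (s : seq (C * int)) :
  (forall k : nat, (0 < k)%N -> \sum_(t <- s) t.1 * (q%:R ^+ k) ^ t.2 = 0) ->
  forall y, y != 0 -> \sum_(t <- s) t.1 * y ^ t.2 = 0.
Proof.
move=> h; pose M := (\sum_(t <- s) `|t.2|)%N.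
have hM t : t \in s -> exists d : nat, t.2 + M%:Z = d%:Z.
  move=> ts; exists `|(t.2 + M%:Z)%R|%N; have : (`|t.2| <= M)%N by rewrite /M (big_rem t) //= leq_addr.
  by move: M (t.2) => M' a; clear; lia.
pose P : {poly C} := \sum_(t <- s) t.1 *: 'X^`|(t.2 + M%:Z)%R|.
have PE y : y != 0 -> P.[y] = y ^+ M * \sum_(t <- s) t.1 * y ^ t.2.
  move=> y0; rewrite /P horner_sum mulr_sumr big_seq [RHS]big_seq; apply: eq_bigr => t ts.
  have [d hd] := hM t ts; rewrite hornerZ hornerXn hd /= mulrCA; congr (_ * _).
  by rewrite -[y ^+ M]/(y ^ M%:Z) -expfzDr // addrC hd.
have qk0 (k : nat) : (q%:R : C) ^+ k != 0 by rewrite expf_neq0 // pnatr_eq0 -lt0n ltnW.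
have P0 : P = 0.
  apply/eqP/contraT => Pn0.
  have := @max_poly_roots _ P [seq q%:R ^+ k.+1 | k <- iota 0 (size P)] Pn0.
  rewrite size_map size_iota ltnn; apply.
    apply/allP => _ /mapP[k _ ->]; rewrite /root PE // h //.
    by rewrite mulr0.
  rewrite map_inj_uniq ?iota_uniq // => i j /eqP.
  by rewrite -!natrX eqr_nat eqn_exp2l // => /eqP [].
move=> y y0; have := PE y y0; rewrite P0 horner0 => /esym/eqP.
by rewrite mulf_eq0 expf_eq0 (negPf y0) andbF /= => /eqP.
Qed.

(** Coordinates are released from integrality one at a time; in each of them f is a Laurent
    polynomial in a single power of q. *)
Lemma laurent_eq0 n (f : 'rV[C]_n -> C) : laurent q f ->
  (forall s : 'rV[C]_n, (forall j, exists2 k : nat, (0 < k)%N & s 0 j = k%:R) -> f s = 0) ->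
  forall s, f s = 0.
Proof.
move=> [l hl] h; suff key k (s : 'rV[C]_n) : (forall j : 'I_n, (k <= j)%N -> exists2 N : nat, (0 < N)%N & s 0 j = N%:R) -> f s = 0.
  by move=> s; apply: (key n) => j; rewrite leqNgt ltn_ord.
elim: k s => [|k IH] s hs; first by apply: h => j; apply: hs.
have [kn|nk] := ltnP k n; last first.
  by apply: IH => j kj; have := leq_trans nk kj; rewrite leqNgt ltn_ord.
pose i := Ordinal kn; pose u w : 'rV[C]_n := \row_j if j == i then w else s 0 j.
have pu a w : pairing a (u w) = pairing a (u 0) + (a 0 i)%:~R * w.
  rewrite /pairing (bigD1 i) //= [in RHS](bigD1 i) //= !mxE eqxx mulr0 add0r addrC; congr (_ + _).
  by apply: eq_bigr => j ji; rewrite !mxE (negPf ji).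
have fu w : f (u w) = \sum_(t <- [seq (t.1 * qpow (pairing t.2 (u 0)), t.2 0 i) | t <- l]) t.1 * qpow w ^ t.2.
  rewrite hl big_map; apply: eq_bigr => t _ /=.
  by rewrite pu qpowD mulrA qpowMz.
have -> : s = u (s 0 i) by apply/rowP => j; rewrite mxE; case: eqP => [->|].
rewrite fu; apply: int_power_sum_eq0; last exact: qpow_neq0.
move=> N N0; have eN : (q%:R : C) ^+ N = qpow N%:R by rewrite -qpow1 -qpowMn mulr1.
rewrite eN -fu; apply: IH => j kj; rewrite mxE; case: eqP => [_|ji]; first by exists N.
apply: hs; rewrite ltn_neqAle kj andbT; apply: contra_not_neq ji => e.
by apply: val_inj; rewrite /= e.
Qed.

End QPow.

(** * The factor Gamma as a coboundary *)

Section GammaFactor.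
Variables (R : realType) (q : nat) (e : int) (m : nat).
Hypothesis q1 : (1 < q)%N.
Local Notation C := R[i].
Local Notation n := m./2.
Local Notation qp := (@qpow R q).

Lemma pairing_wact (s : signed_perm n) (a : 'rV[int]_n) (z : 'rV[C]_n) :
  pairing (wact s a) (wact s z) = pairing a z.
Proof.
rewrite /pairing [RHS](reindex_inj (@perm_inj _ s.1)); apply: eq_bigr => i _; rewrite !mxE.
by case: (s.2 i); rewrite ?expr1 ?expr0 ?mulN1r ?mul1r // mulrNz mulrNN.
Qed.

Lemma pairingN (a : 'rV[int]_n) (z : 'rV[C]_n) : pairing (- a) z = - pairing a z.
Proof. by rewrite /pairing -sumrN; apply: eq_bigr => i _; rewrite mxE mulrNz mulNr. Qed.

(** Reindexing by the map taking b to whichever of s b and - s b lies in [S]; it is injective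
    because [S] consists of positive roots. *)
Lemma prod_wact_roots (s : signed_perm n) (S : seq 'rV[int]_n) (f : C -> C) (z : 'rV[C]_n) :
  uniq S -> {subset S <= pos_roots n} -> (forall b, b \in S -> (wact s b \in S) || (- wact s b \in S)) ->
  \prod_(a <- S) f (pairing a (wact s z)) =
  \prod_(b <- S) (if wact s b \in S then f (pairing b z) else f (- pairing b z)).
Proof.
move=> uS pS cS; pose g b := if wact s b \in S then wact s b else - wact s b.
have gS b : b \in S -> g b \in S by move=> /cS; rewrite /g; case: ifP.
have sinj : injective (@wact int n s).
  move=> x y h; apply/rowP => i; have := congr1 (fun r : 'rV[int]_n => r 0 (s.1^-1 i)%g) h.
  by rewrite !mxE permKV; case: (s.2 _); rewrite ?expr1 ?expr0 ?mulN1r ?mul1r // => /oppr_inj.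
have gN x y : x \in S -> y \in S -> wact s x = - wact s y -> False.
  move=> xS yS h; have hx : x = - y by apply: sinj; rewrite raddfN.
  by have := pos_rootN (pS _ yS); rewrite -hx pS.
have gi : {in S &, injective g}.
  move=> x y xS yS; rewrite /g; case: ifP => _; case: ifP => _ h.
  - exact: sinj.
  - by case: (gN x y).
  - by case: (gN y x) => //; rewrite -h opprK.
  by apply: sinj; apply: oppr_inj.
have pg : perm_eq [seq g b | b <- S] S.
  have um : uniq (map g S) by rewrite map_inj_in_uniq.
  have sub : {subset map g S <= S} by move=> _ /mapP[b bS ->]; apply: gS.
  have sz : (size S <= size (map g S))%N by rewrite size_map.
  by have [_ h] := uniq_min_size um sub sz; apply: uniq_perm.
rewrite -(perm_big _ pg) big_map /=; apply: eq_bigr => b _; rewrite /g; case: ifP => _.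
  by rewrite pairing_wact.
by rewrite pairingN pairing_wact.
Qed.

Let G_sub : {subset G_roots m <= pos_roots n}.
Proof. by rewrite /G_roots; case: ifP => _ // a ha; rewrite mem_cat ha. Qed.

Let G_uniq : uniq (G_roots m).
Proof. by rewrite /G_roots; case: ifP => _; [exact: pos_roots_uniq | exact: short_roots_uniq]. Qed.

Let G_closed s b : b \in G_roots m -> (wact s b \in G_roots m) || (- wact s b \in G_roots m).
Proof.
rewrite /G_roots; case: ifP => _; last exact: wact_short.
rewrite !mem_cat => /orP[/wact_short-/(_ s)|/wact_long-/(_ s)] /orP[] ->; rewrite ?orbT //.
Qed.

Lemma neg_in_pos s b : b \in G_roots m -> (- wact s b \in pos_roots n) = (wact s b \notin G_roots m).
Proof.
move=> hb; have := G_closed s hb; case: (boolP (wact s b \in G_roots m)) => h /=.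
  by move=> _; apply/negbTE; apply: pos_rootN; apply: G_sub.
by move=> h2; apply: G_sub.
Qed.

(** Each long root 2 e_i made negative by s contributes q^(2 e z_i), and these exponents add up to
    <e>(z) - <e>(s z). *)
Lemma long_gamma_prod (s : signed_perm n) (z : 'rV[C]_n) :
  \prod_(a <- long_roots n | - wact s a \in pos_roots n) qp (e%:~R * pairing a z) =
  qp (ebracket e z) / qp (ebracket e (wact s z)).
Proof.
rewrite -qpowN -qpowD /ebracket big_mkcond big_map big_enum /=.
have hl i : (- wact s (delta_mx 0 i *+ 2) \in pos_roots n) = s.2 ((s.1^-1)%g i).
  have pl j : delta_mx 0 j *+ 2 \in pos_roots n.
    by rewrite mem_cat; apply/orP; right; apply/long_rootP; exists j.
  rewrite raddfMn /= wact_delta; case: (s.2 _); first by rewrite mulNrn opprK pl.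
  by apply/negbTE; apply: pos_rootN.
have pl i : pairing (delta_mx 0 i *+ 2) z = z 0 i *+ 2.
  rewrite /pairing (bigD1 i) //= big1 ?addr0 => [|j ji]; rewrite !mxE ?eqxx /= ?(negPf ji) ?andbF.
    by rewrite mulr_natl.
  by rewrite addr0 mul0r.
transitivity (\prod_(i < n) qp (e%:~R * (if s.2 ((s.1^-1)%g i) then z 0 i *+ 2 else 0))).
  apply: eq_bigr => i _; rewrite hl pl; case: ifP => // _; first by rewrite mulr0 qpow0.
rewrite -qpow_sum -mulr_sumr -mulrBr; congr (qp (_ * _)).
have -> : \sum_i wact s z 0 i = \sum_i (if s.2 ((s.1^-1)%g i) then - z 0 i else z 0 i).
  rewrite [RHS](reindex_inj (@perm_inj _ s.1)); apply: eq_bigr => i _; rewrite mxE permK.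
  by case: (s.2 i); rewrite ?expr1 ?expr0 ?mulN1r ?mul1r.
rewrite -sumrB; apply: eq_bigr => i _; case: ifP => _; last by rewrite subrr.
by rewrite opprK mulr2n.
Qed.

(** The factor of G at b cancels between z and s z unless s b is negative. In that case the quotient
    of its values at - u and u, where u = <b, z>, is the rational part of gamma_b. *)
Lemma Gamma_cocycle (s : signed_perm n) (z : 'rV[C]_n) :
  (forall a, a \in G_roots m ->
     [/\ Gnum q a z != 0, Gden q a z != 0, Gden q a (wact s z) != 0 & gamma_den q a z != 0]) ->
  Gamma q e s z = qp (ebracket e z) / Gfun q z * (Gfun q (wact s z) / qp (ebracket e (wact s z))).
Proof.
move=> hz; pose sh a := (1 - qp (- 1 + pairing a z)) / gamma_den q a z.
have ac (a b c d : C) : a * b * (c * d) = (c * b) * (a * d) by ring.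
rewrite ac.
rewrite -long_gamma_prod.
have -> : Gfun q (wact s z) / Gfun q z = \prod_(a <- G_roots m | - wact s a \in pos_roots n) sh a.
  pose f u := (1 + qp u) / (1 - qp (- 1 + u)).
  rewrite /Gfun (prod_wact_roots f z G_uniq G_sub (@G_closed s)) -prodf_div big_seq [RHS]big_seq_cond.
  rewrite [RHS]big_mkcondr /=; apply: eq_bigr => b hb; rewrite neg_in_pos //.
  have [h1 h2 h3 h4] := hz b hb; case: ifP => _ /=.
    by rewrite divff // mulf_neq0 ?invr_neq0.
  move: h1 h2 h4; rewrite /f /sh /Gnum /Gden /gamma_den; move: (pairing b z) => u.
  rewrite !qpowD !qpowN qpow1 //; have : qp u != 0 by exact: qpow_neq0.
   move: (qp u) => t t0 h1 h2 h4.
  have qn : (q%:R : C) != 0 by rewrite pnatr_eq0 -lt0n ltnW.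
  have h5 : t * q%:R - 1 != 0.
    by apply: contraNneq h4 => h; rewrite -(mulfK qn t) -[in X in _ - X](mul1r q%:R^-1) -mulrBl h mul0r.
  have h6 : q%:R - t != 0.
    by apply: contraNneq h2 => /eqP; rewrite subr_eq0 => /eqP <-; rewrite mulVf ?subrr.
  by field; rewrite ?t0 ?qn ?h5 ?h6 ?h1.
have split (Q : pred 'rV[int]_n) (f : 'rV[int]_n -> C) : \prod_(a <- pos_roots n | Q a) f a =
    (\prod_(a <- short_roots n | Q a) f a) * (\prod_(a <- long_roots n | Q a) f a).
  by rewrite /pos_roots big_cat.
have shortE (Q : pred 'rV[int]_n) : \prod_(a <- short_roots n | Q a) gamma q e a z = \prod_(a <- short_roots n | Q a) sh a.
  by rewrite big_seq_cond [RHS]big_seq_cond; apply: eq_bigr => a /andP[ha _]; rewrite /gamma ha.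
have long_short a : a \in long_roots n -> a \notin short_roots n.
  by have := pos_roots_uniq n; rewrite cat_uniq => /and3P[_ /hasPn h _] /h.
rewrite /Gamma split shortE /G_roots; case: ifP => om.
  rewrite split -mulrA -big_split /=; congr (_ * _).
  rewrite big_seq_cond [RHS]big_seq_cond; apply: eq_bigr => a /andP[/long_short ha _].
  by rewrite /gamma (negPf ha) om mulrC.
congr (_ * _); rewrite big_seq_cond [RHS]big_seq_cond; apply: eq_bigr => a /andP[/long_short ha _].
by rewrite /gamma (negPf ha) om.
Qed.

End GammaFactor.

Local Open Scope classical_set_scope.

(** * Holomorphy of Laurent polynomials in powers of q *)

Section Holomorphic.
Variables (R : realType) (q : nat).
Local Notation C := R[i].

Lemma derive_estimate (f : R -> R) (d : R) : is_derive (0 : R) (1 : R) f d -> forall eps : R, 0 < eps ->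
  exists2 delta : R, 0 < delta & forall u, `|u| < delta -> `|f u - f 0 - d * u| <= eps * `|u|.
Proof.
move=> [df <-] eps eps0.
have := df; rewrite /derivable => /cvg_ex[l hl].
have el : 'D_1 f 0 = l by apply/cvg_lim.
move/cvgrPdist_le : hl => /(_ eps eps0).
rewrite near_withinE => /nbhs_ballP[delta /= d0 h]; exists delta => // u hu.
have [->|u0] := eqVneq u 0; first by rewrite !mulr0 !subr0 subrr normr0 mulr0.
have := h u; rewrite /ball /= sub0r normrN => /(_ hu u0).
rewrite el scaler1 addr0 -[X in _ <= X -> _](mulfK (_ : `|u| != 0)) ?normr_eq0 //.
rewrite ler_pdivlMr ?normr_gt0 // -normrM distrC; congr (_ <= _); congr (`|_|).
by rewrite /GRing.scale /=; field.
Qed.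

(** Complex differentiability at 0, drawn from the real first-order expansions of exp, cos and sin.
    With u and w the real and imaginary parts of h log q, the remainder splits into four terms, each
    containing one of these three errors or the product (exp u - 1) w. *)
Lemma qpow_estimate (eps : R) : 0 < eps -> exists2 delta : R, 0 < delta &
  forall h : C, complex.Re `|h| < delta -> complex.Re `|qpow q h - 1 - (ln q%:R)%:C%C * h| <= eps * complex.Re `|h|.
Proof.
move=> eps0; set a := ln q%:R.
have normE (z : C) : complex.Re `|z| = Num.sqrt (complex.Re z ^+ 2 + complex.Im z ^+ 2) by rewrite normc_def.
have le_re (z : C) : `|complex.Re z| <= complex.Re `|z|.
  by rewrite normE -sqrtr_sqr ler_wsqrtr // lerDl sqr_ge0.
have le_im (z : C) : `|complex.Im z| <= complex.Re `|z|.
  by rewrite normE -sqrtr_sqr ler_wsqrtr // lerDr sqr_ge0.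
have norm_le (z : C) : complex.Re `|z| <= `|complex.Re z| + `|complex.Im z|.
  rewrite normE -[leRHS]ger0_norm ?addr_ge0 // -sqrtr_sqr ler_wsqrtr //.
  rewrite sqrrD !real_normK ?num_real // -addrA lerD2l lerDr mulrn_wge0 // mulr_ge0 //.
pose b := `|a| + 1; have b0 : 0 < b by rewrite ltr_wpDl.
(* The four terms of the remainder are bounded by 1, 3, 3 and 2 times [e1 * b * r], whence the 9. *)
pose e1 := Num.min 1 (eps / (b * 9%:R)).
have e10 : 0 < e1 by rewrite lt_min ltr01 divr_gt0 // mulr_gt0.
have e11 : e1 <= 1 by rewrite ge_min lexx.
have e12 : e1 * b * 9%:R <= eps.
  by rewrite -mulrA -ler_pdivlMr ?mulr_gt0 // ge_min lexx orbT.
clearbody e1.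
have dexp : is_derive (0 : R) (1 : R) expR 1 by have := is_derive_expR (0 : R); rewrite expR0.
have dcos : is_derive (0 : R) (1 : R) cos 0 by have := is_derive_cos (0 : R); rewrite sin0 oppr0.
have dsin : is_derive (0 : R) (1 : R) sin 1 by have := is_derive_sin (0 : R); rewrite cos0.
have [d1 d10 h1] := derive_estimate dexp e10.
have [d2 d20 h2] := derive_estimate dcos e10.
have [d3 d30 h3] := derive_estimate dsin e10.
pose dd := Num.min (Num.min d1 d2) (Num.min d3 e1).
have dd0 : 0 < dd by rewrite !lt_min d10 d20 d30 e10.
exists (dd / b) => [|h hh]; first exact: divr_gt0.
set r := complex.Re `|h| in hh *.
have r0 : 0 <= r by apply: le_trans (le_re h).
pose u := complex.Re h * a; pose w := complex.Im h * a.
have small (y : R) : `|y| <= r -> `|y * a| <= b * r /\ `|y * a| < dd.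
  move=> hy; have h4 : `|y * a| <= b * r.
    by rewrite normrM mulrC; apply: ler_pM => //; rewrite lerDl.
  by split=> //; apply: le_lt_trans h4 _; rewrite mulrC -ltr_pdivlMr.
have [u1 u2] := small _ (le_re h : `|complex.Re h| <= r).
have [w1 w2] := small _ (le_im h : `|complex.Im h| <= r).
rewrite -/u -/w in u1 u2 w1 w2.
move: u2 w2; rewrite !lt_min => /andP[/andP[u3 u4] /andP[u5 u6]] /andP[/andP[w3 w4] /andP[w5 w6]].
have := h1 u u3; have := h2 w w4; have := h3 w w5; rewrite expR0 cos0 sin0 mul0r mul1r subr0 !mul1r subr0.
set X := expR u; set c := cos w; set s := sin w => hs hc hX.
have X3 : `|X| <= 3%:R.
  have -> : X = (X - 1 - u) + u + 1 by ring.
  apply: le_trans (ler_normD _ _) _; apply: le_trans (lerD (ler_normD _ _) (lexx _)) _; rewrite normr1.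
  have u7 : `|u| <= 1 by apply: le_trans (ltW u6) e11.
  have e1u : e1 * `|u| <= 1 by rewrite -[leRHS]mulr1; apply: ler_pM => //; exact: ltW.
  move: hX u7 e1u; lra.
have re_im : qpow q h - 1 - a%:C%C * h = Complex ((X - 1 - u) + X * (c - 1)) (X * (s - w) + (X - 1) * w).
  have -> : a%:C%C * h = Complex u w by rewrite /u /w; case: (h) => hr hi; simpc; congr Complex => /=; ring.
  rewrite /qpow -/a -/u -/w -/X -/c -/s.
  by apply/eqP; rewrite eq_complex /=; apply/andP; split; apply/eqP; ring.
rewrite re_im; apply: le_trans (norm_le _) _ => /=.
have P0 : 0 <= e1 * b * r by rewrite !mulr_ge0 // ltW.
have le1 y : `|y| <= b * r -> e1 * `|y| <= e1 * b * r by move=> hy; rewrite -mulrA ler_wpM2l // ltW.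
have t1 : `|X - 1 - u| <= e1 * b * r by apply: le_trans hX _; apply: le1.
have t2 : `|X * (c - 1)| <= 3%:R * (e1 * b * r).
  by rewrite normrM; apply: ler_pM => //; apply: le_trans hc _; apply: le1.
have t3 : `|X * (s - w)| <= 3%:R * (e1 * b * r).
  by rewrite normrM; apply: ler_pM => //; apply: le_trans hs _; apply: le1.
have t4 : `|(X - 1) * w| <= 2%:R * (e1 * b * r).
  rewrite normrM.
  have X1 : `|X - 1| <= 2%:R * e1.
    have -> : X - 1 = (X - 1 - u) + u by ring.
    apply: le_trans (ler_normD _ _) _; rewrite mulr_natl mulr2n; apply: lerD; last exact: ltW.
    apply: le_trans hX _; rewrite -[leRHS]mulr1; apply: ler_pM => //; first exact: ltW.
    exact: le_trans (ltW u6) e11.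
  by rewrite (_ : 2%:R * (e1 * b * r) = (2%:R * e1) * (b * r)) ?ler_pM //; ring.
have n1 := ler_normD (X - 1 - u) (X * (c - 1)); have n2 := ler_normD (X * (s - w)) ((X - 1) * w).
have fin : 9%:R * (e1 * b * r) <= eps * r.
  by rewrite (_ : 9%:R * (e1 * b * r) = e1 * b * 9%:R * r) ?ler_wpM2r //; ring.
apply: le_trans (lerD n1 n2) _; apply: le_trans _ fin.
apply: le_trans (lerD (lerD t1 t2) (lerD t3 t4)) _.
rewrite (_ : e1 * b * r + 3%:R * (e1 * b * r) + (3%:R * (e1 * b * r) + 2%:R * (e1 * b * r)) =
  9%:R * (e1 * b * r)) //; ring.
Qed.

Hypothesis q1 : (1 < q)%N.

Lemma qpow_derivable (x : C) : derivable (qpow q : C^o -> C^o) x 1.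
Proof.
apply/cvg_ex; exists ((ln q%:R)%:C%C * qpow q x); apply/cvgrPdist_le => /= eps eps0.
have [er e0] : exists er : R, eps = er%:C%C.
  exists (complex.Re eps); move: eps0; case: (eps) => p1 p2; rewrite ltcE /= => /andP[/eqP -> _] //.
have er0 : 0 < er by move: eps0; rewrite e0 ltcR.
have [K hK] : exists K : R, `|qpow q x| = K%:C%C by rewrite normc_def; eexists.
have K0 : 0 <= K by rewrite -lecR -hK normr_ge0.
have K1 : 0 < K + 1 by rewrite ltr_wpDl.
have [delta d0 hd] := qpow_estimate (divr_gt0 er0 K1).
have d0C : 0 < delta%:C%C :> C by rewrite ltcR.
rewrite near_withinE; apply/nbhs_ballP; exists delta%:C%C => //= h; rewrite /ball /= sub0r normrN => hlt h0.
have [rh erh] : exists rh : R, `|h| = rh%:C%C by rewrite normc_def; eexists.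
have [t et] : exists t : R, `|qpow q h - 1 - (ln q%:R)%:C%C * h| = t%:C%C by rewrite normc_def; eexists.
have := hd h; rewrite et erh /= => hd'.
have rlt : rh < delta by move: hlt; rewrite erh ltcR.
have rh0 : 0 < rh by rewrite -ltcR -erh normr_gt0.
have ht := hd' rlt.
have -> : (ln q%:R)%:C%C * qpow q x - h^-1 *: (qpow q (h *: (1 : C^o) + x) - qpow q x) =
   - (qpow q x * (qpow q h - 1 - (ln q%:R)%:C%C * h) / h).
  rewrite [h *: _]mulr1 qpowD /GRing.scale /=; field.
  exact: h0.
rewrite normrN !normrM normfV hK et erh e0 -rmorphM -fmorphV -rmorphM lecR.
rewrite ler_pdivrMr //; apply: (@le_trans _ _ ((K + 1) * t)).
  by rewrite ler_wpM2r ?lerDl // -lecR -et normr_ge0.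
by rewrite -ler_pdivlMl // mulrA [_^-1 * er]mulrC.
Qed.

Lemma laurent_holomorphic n (f : 'rV[C]_n -> C) : laurent q f -> holomorphic f.
Proof.
case=> s hs z.
have -> : f = fun z => \sum_(t <- s) t.1 * qpow q (pairing t.2 z) by apply/funext.
have pairing_diff (a : 'rV[int]_n) : differentiable (pairing a : 'rV[C]_n -> C^o) z.
  rewrite /pairing; have -> : (fun w : 'rV[C]_n => \sum_i (a 0 i)%:~R * w 0 i : C^o) =
     \sum_(i < n) (fun w : 'rV[C]_n => (a 0 i)%:~R *: (w 0 i : C^o)).
    by apply/funext => w; rewrite fct_sumE.
  apply: differentiable_sum => i; apply: differentiableZ; exact: differentiable_coord.
elim: s {hs} => [|t s IH].
  have -> : (fun z : 'rV[C]_n => \sum_(t <- [::]) t.1 * qpow q (pairing t.2 z)) = cst 0.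
    by apply/funext => w; rewrite big_nil.
  exact: differentiable_cst.
have -> : (fun z : 'rV[C]_n => \sum_(t <- t :: s) t.1 * qpow q (pairing t.2 z)) =
   (fun z : 'rV[C]_n => t.1 *: (qpow q (pairing t.2 z) : C^o)) \+ (fun z => \sum_(t <- s) t.1 * qpow q (pairing t.2 z)).
  by apply/funext => w; rewrite big_cons.
apply: differentiableD => //; apply: differentiableZ.
apply: (@differentiable_comp _ _ _ _ (pairing t.2 : 'rV[C]_n -> C^o) (qpow q : C^o -> C^o)) => //.
by apply/derivable1_diffP; exact: qpow_derivable.
Qed.

End Holomorphic.

(** * The change of variables between s and z *)

Section SpectralVariables.
Variables (R : realType) (q m : nat).
Hypothesis q1 : (1 < q)%N.
Local Notation C := R[i].
Local Notation n := m./2.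
Local Notation qp := (@qpow R q).

(** The constant terms of s as an affine function of z. The numbers q^(-kappa_j) are the weights of
    the formal part: - q for j not last, and for the last j a number of square q (m even) or - q^2
    (m odd). *)
Definition kappa (j : 'I_n) : C := svar q (0 : 'rV[C]_n) 0 j.

(** Inverse of the change of variables: the relations s_j = kappa_j - z_j + z_(j+1) telescope when
    summed from j = i on. *)
Definition zvar (s : 'rV[C]_n) : 'rV[C]_n := \row_i \sum_(j < n | (i <= j)%N) (kappa j - s 0 j).

Lemma svarE (z : 'rV[C]_n) (j : 'I_n) :
  svar q z 0 j = kappa j - z 0 j + (if (j.+1 < n)%N then z 0 (ordS j) else 0).
Proof.
rewrite /kappa !mxE; case: ifP => _; first by rewrite oppr0 !add0r; ring.
by case: ifP => _; rewrite oppr0 !add0r addr0; [ring | rewrite addrC].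
Qed.

Lemma qpow_kappa_short (j : 'I_n) : (j.+1 < n)%N -> qp (- kappa j) = - q%:R.
Proof.
move=> h; rewrite /kappa mxE h !mxE oppr0 !add0r opprD opprK qpowD // qpowN // qpow1 // qpow_pi //.
by rewrite invrN1 mulrN1.
Qed.

Lemma qpow_kappa_long (j : 'I_n) : j.+1 = n ->
  qp (- kappa j) ^+ 2 = if odd m then - q%:R ^+ 2 else q%:R.
Proof.
move=> h; rewrite /kappa mxE h ltnn -qpowMn //; case: ifP => _; rewrite mxE oppr0 add0r.
  have -> : 2%:R * - (- 1 + Complex 0 (pi / (2 * ln q%:R))) = 2%:R * 1 - Complex 0 (pi / ln q%:R) :> C.
    rewrite opprD opprK mulrDr mulrN; congr (_ - _); rewrite [2%:R * Complex _ _]mulr_natl mulr2n.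
    apply/eqP; rewrite eq_complex /= addr0 eqxx /=; apply/eqP.
    by have l0 := ln_q_neq0 R q1; field; rewrite ?l0.
  by rewrite qpowD // qpowN // qpow_pi // qpowMn // qpow1 // invrN1 mulrN1.
by rewrite opprK divff ?qpow1 // pnatr_eq0.
Qed.

Lemma pairing_zvar a (s : 'rV[C]_n) : pairing a (zvar s) = \sum_(j < n) (cum j.+1 a)%:~R * (kappa j - s 0 j).
Proof.
rewrite /pairing; transitivity (\sum_(i < n) \sum_(j < n) if (i <= j)%N then (a 0 i)%:~R * (kappa j - s 0 j) else 0).
  by apply: eq_bigr => i _; rewrite mxE mulr_sumr [LHS]big_mkcond.
rewrite exchange_big; apply: eq_bigr => j _ /=; rewrite /cum rmorph_sum mulr_suml [RHS]big_mkcond /=.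
by apply: eq_bigr => i _; rewrite ltnS.
Qed.

Lemma zvarK (z : 'rV[C]_n) : zvar (svar q z) = z.
Proof.
(* Extending z by 0 past its last coordinate lets the last relation telescope like the others. *)
apply/rowP => i; rewrite mxE; pose g (j : nat) : C := if insub j is Some t then z 0 t else 0.
transitivity (\sum_(i <= j < n) ((- g j.+1) - (- g j))).
  rewrite big_geq_mkord; apply: eq_big => [j|j _] //.
  have -> : g j = z 0 j by rewrite /g valK.
  rewrite svarE; case: (boolP (j.+1 < n)%N) => h.
    have -> : g j.+1 = z 0 (ordS j).
      rewrite /g; have -> : insub j.+1 = Some (ordS j) :> option 'I_n => //.
      transitivity (insub (val (ordS j)) : option 'I_n); last exact: valK.
      by congr insub; rewrite /= modn_small.
    by ring.
  have -> : g j.+1 = 0 by rewrite /g insubN.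
  by ring.
rewrite (@telescope_sumr _ _ _ (fun j => - g j)) ?(ltnW (ltn_ord i)) //.
by rewrite /g valK insubN ?ltnn // oppr0 opprK add0r.
Qed.

Lemma laurent_zvar (f : 'rV[C]_n -> C) : laurent q f -> laurent q (fun s => f (zvar s)).
Proof.
apply: laurent_affine => a; exists (\row_j - cum j.+1 a); exists (\sum_(j < n) (cum j.+1 a)%:~R * kappa j) => s.
rewrite pairing_zvar /pairing -big_split; apply: eq_bigr => j _; rewrite mxE mulrNz /=; ring.
Qed.

Lemma ebracketE e (z : 'rV[C]_n) : ebracket e z = pairing (const_mx e) z.
Proof. by rewrite /ebracket mulr_sumr; apply: eq_bigr => i _; rewrite mxE. Qed.

Lemma laurent_Gnum a : laurent q (fun z : 'rV[C]_n => Gnum q a z).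
Proof.
by apply: laurent_ext (laurentD (laurent_cst q _ 1) (laurent_mono q 1 a)) => z; rewrite mul1r.
Qed.

Lemma GdenE a (z : 'rV[C]_n) : Gden q a z = 1 + - q%:R^-1 * qp (pairing a z).
Proof. by rewrite /Gden qpowD // qpowN // qpow1 // mulNr. Qed.

Lemma laurent_Gden a : laurent q (fun z : 'rV[C]_n => Gden q a z).
Proof.
by apply: laurent_ext (laurentD (laurent_cst q _ 1) (laurent_mono q (- q%:R^-1) a)) => z; rewrite GdenE.
Qed.

Lemma laurent_ebracket e : laurent q (fun z : 'rV[C]_n => qp (- ebracket e z)).
Proof.
apply: laurent_ext (laurent_mono q 1 (- const_mx e)) => z.
by rewrite mul1r ebracketE; congr qpow; rewrite /pairing -sumrN; apply: eq_bigr => i _; rewrite !mxE mulrNz mulNr.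
Qed.

Lemma real_qpow_int (k : int) : ((q%:R : R) ^ k)%:C%C = q%:R ^ k :> C.
Proof.
by case: k => k; rewrite ?NegzE -?exprnP -?exprnN ?fmorphV rmorphXn /= rmorph_nat.
Qed.

End SpectralVariables.

(** * From the formal solution to the invariant function *)

Lemma wact_bij (A : pzRingType) n (s : signed_perm n) : bijective (@wact A n s).
Proof.
exists (fun y : 'rV[A]_n => \row_i ((-1) ^+ s.2 ((s.1^-1)%g i) * y 0 ((s.1^-1)%g i)) : 'rV[A]_n) => y; apply/rowP => i; rewrite !mxE.
  by rewrite permKV signrMK.
by rewrite permK signrMK.
Qed.

Lemma sum_support (I : eqType) (F : pzRingType) (f g : I -> F) (l l' : seq I) : uniq l -> uniq l' ->
  (forall y, f y != 0 -> y \in l) -> (forall y, f y != 0 -> y \in l') ->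
  \sum_(y <- l) f y * g y = \sum_(y <- l') f y * g y.
Proof.
move=> ul ul' hl hl'.
have red s : \sum_(y <- s) f y * g y = \sum_(y <- [seq y <- s | f y != 0]) f y * g y.
  rewrite big_filter [RHS]big_mkcond; apply: eq_bigr => y _.
  by case: (eqVneq (f y) 0) => [->|] //=; rewrite mul0r.
rewrite (red l) (red l'); apply: perm_big; apply: uniq_perm; rewrite ?filter_uniq // => y.
by rewrite !mem_filter; case: (eqVneq (f y) 0) => h //=; rewrite hl ?hl'.
Qed.

Section ZetaEvaluation.
Variables (k : fieldType) (k' : fieldExtType k) (conj : {lrmorphism k' -> k'}).
Variables (v : k' -> int) (q : nat) (pi theta : k') (rep : 'I_q -> k').
Hypothesis I : inert conj v pi theta rep.
Variables (R : realType) (m : nat) (mu : probability (borel_mx v m) R).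
Hypothesis Hmu : is_haar conj mu.
Local Notation n := m./2.
Local Notation C := R[i].
Local Notation qp := (@qpow R q).
Variable x : 'M[k']_m.
Local Notation e := (v 2%:R).
Let q1 : (1 < q)%N. Proof. exact: residue_card_gt1 I. Qed.
Let c (j : 'I_n) : C := qp (- kappa R q j).

Section AtIntegers.
Variables (N : 'I_n -> nat) (s : 'rV[C]_n).
Hypothesis N0 : forall i, (0 < N i)%N.
Hypothesis sN : forall j, s 0 j = (N j)%:R.
Let T (y : 'rV[int]_n) : C := qp (pairing y (zvar q s)).

Lemma omega_integrand_weight h :
  omega_integrand conj v q x s h = (weight conj v q R x N h)%:C%C.
Proof.
rewrite /omega_integrand /weight.
have -> : [forall i : 'I_n, dlow i (Defs.act conj h x) != 0] =
    [forall i : 'I_n, lowdet conj i.+1 (Defs.act conj h x) != 0].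
  by apply: eq_forallb => i; rewrite (dlowE conj).
case: ifP => _ //; rewrite rmorph_prod; apply: eq_bigr => i _.
rewrite (dlowE conj) sN /= real_qpow_int -(qpow_int R q1); congr qpow.
by rewrite mulNr mulrNz intrM -pmulrn.
Qed.

Lemma omega_integral_weight : omega_integral conj q mu x s =
  (\int[mu]_(h in unitary_integral conj v m) weight conj v q R x N h)%:C%C.
Proof.
rewrite /omega_integral (_ : omega_integrand conj v q x s = fun h => (weight conj v q R x N h)%:C%C); last first.
  by apply/funext => h; exact: omega_integrand_weight.
congr Complex; rewrite /Rintegral [X in fine X](_ : _ = 0%E) //.
by apply: integral0_eq => h _.
Qed.

(** In the variables z the partial sums of y produce <y, z>, the constants kappa_j go into [wt], and
    the shift by e in [lev] leaves the factor q^(<e>). *)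
Lemma lweightE y : (lweight q R e N y)%:C%C = wt c e y * T y * T (const_mx e).
Proof.
rewrite -mulrA /T -qpowD // -pairingD pairing_zvar qpow_sum // -big_split rmorph_prod.
apply: eq_bigr => j _ /=; rewrite real_qpow_int -(qpow_int R q1) /c -qpowMz // -qpowD //; congr qpow.
by rewrite /lev ltn_ord sN mulrNz intrM -pmulrn; ring.
Qed.

Lemma near_sum_phi : near_sum q T (phi (level_mass conj mu x) c e)
  ((T (const_mx e))^-1 * omega_integral conj q mu x s).
Proof.
have [D [L0 hD]] := weight_near I Hmu x e N0.
exists (`|(T (const_mx e))^-1| * D%:C%C), L0 => L l hL ul hl; have := hD L l hL ul hl.
have Te : T (const_mx e) != 0 by exact: qpow_neq0.
rewrite omega_integral_weight; set W := Rintegral _ _ _; set S := \sum_(y <- l) _; move=> h.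
have -> : \sum_(y <- l) phi (level_mass conj mu x) c e y * T y - (T (const_mx e))^-1 * W%:C%C =
    (T (const_mx e))^-1 * (S - W)%:C%C.
  rewrite rmorphB mulrBr /S rmorph_sum mulr_sumr; congr (_ - _); apply: eq_bigr => y _.
  rewrite rmorphM /= lweightE /phi /level_mass; move: Te; set t := T (const_mx e) => Te.
  by field.
rewrite normrM -mulrA ler_wpM2l // normc_def /= expr0n addr0 sqrtr_sqr.
have -> : D%:C%C * q%:R^-1 ^+ L = (D * q%:R^-1 ^+ L)%:C%C :> C.
  by rewrite rmorphM rmorphXn fmorphV rmorph_nat.
by rewrite lecR.
Qed.

Lemma zeta_at_integers (f : 'rV[int]_n -> C) (M : nat) (l : seq 'rV[int]_n) :
  ops (- q%:R^-1) (G_roots m) f =1 ops 1 (G_roots m) (phi (level_mass conj mu x) c e) ->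
  (forall y, f y != 0 -> forall j : 'I_n, `|cum j.+1 y| <= M%:Z) ->
  uniq l -> (forall y, (y \in l) = [forall j : 'I_n, `|cum j.+1 y| <= M%:Z]) ->
  (\prod_(a <- G_roots m) Gden q a (zvar q s)) * (\sum_(y <- l) f y * qp (pairing y (zvar q s))) =
  (\prod_(a <- G_roots m) Gnum q a (zvar q s)) *
    (qp (- ebracket e (zvar q s)) * omega_integral conj q mu x s).
Proof.
move=> hops hf ul hl.
have TD y y' : T (y + y') = T y * T y' by rewrite /T pairingD qpowD.
have h1 := near_sum_ops q1 TD (- q%:R^-1) (G_roots m) (near_sum_finite q T ul hl hf).
have h2 := near_sum_ops q1 TD 1 (G_roots m) near_sum_phi.
have := near_sum_unique q1 (near_sum_ext hops h1) h2.
have -> : \prod_(a <- G_roots m) (1 + - q%:R^-1 * T a) = \prod_(a <- G_roots m) Gden q a (zvar q s).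
  by apply: eq_bigr => a _; rewrite GdenE.
have -> : \prod_(a <- G_roots m) (1 + 1 * T a) = \prod_(a <- G_roots m) Gnum q a (zvar q s).
  by apply: eq_bigr => a _; rewrite mul1r.
by rewrite qpowN // ebracketE.
Qed.

End AtIntegers.

Lemma zeta_invariant (A B : 'rV[C]_n -> C) : unitary_hermitian conj m x ->
  omega_continuation conj q mu x A B ->
  exists H : 'rV[C]_n -> C,
    [/\ forall z : 'rV[C]_n, B (svar q z) != 0 ->
          (forall a, a \in G_roots m -> Gden q a z != 0) ->
          H z = qp (- ebracket e z) * Gfun q z * (A (svar q z) / B (svar q z)),
        forall s z, H (wact s z) = H z
      & laurent q H].
Proof.
move=> hx [lA lB _ hAB].
have cs (j : 'I_n) : (j.+1 < n)%N -> c j = - q%:R by move=> h; apply: qpow_kappa_short.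
have cl (j : 'I_n) : j.+1 = n -> c j ^+ 2 = if odd m then - q%:R ^+ 2 else q%:R.
  by move=> h; apply: qpow_kappa_long.
have [f [hops hinv [M hM]]] := formal_zeta I Hmu hx cs cl.
have [l [ul hl]] := box_ex n M.
have fl y : f y != 0 -> y \in l by move=> h; rewrite hl; apply/forallP => j; exact: hM.
pose H z := \sum_(y <- l) f y * qp (pairing y z).
have lH : laurent q H by exists [seq (f y, y) | y <- l] => z; rewrite big_map.
exists H; split=> // [z Bz Gz|s z]; last first.
  have [wi wK Kw] := wact_bij int s.
  transitivity (\sum_(y <- map (wact s) l) f y * qp (pairing y (wact s z))).
    apply: sum_support => //; first by rewrite map_inj_uniq //; exact: can_inj wK.
    move=> y fy; rewrite -(Kw y); apply: map_f; apply: fl; rewrite -(hinv s) /= Kw //.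
  by rewrite big_map; apply: eq_bigr => y _; rewrite pairing_wact -[in RHS](hinv s).
pose nu z := \prod_(a <- G_roots m) Gnum q a z : C; pose de z := \prod_(a <- G_roots m) Gden q a z : C.
(* The vanishing of [P] is the wanted identity cleared of denominators. The outer factor B makes [P]
   vanish also at integer points with B = 0, about which the continuation says nothing. *)
pose P s := B s * (B s * (de (zvar q s) * H (zvar q s)) +
  -1 * (nu (zvar q s) * (qp (- ebracket e (zvar q s)) * A s))).
have lP : laurent q P.
  have lnu : laurent q nu by apply: laurent_prod => a; exact: laurent_Gnum.
  have lde : laurent q de by apply: laurent_prod => a; exact: laurent_Gden.
  apply: laurentM => //; apply: laurentD.
    by apply: laurentM => //; apply: laurentM; apply: laurent_zvar.
  apply: laurentM; first exact: laurent_cst.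
  apply: laurentM; first exact: laurent_zvar.
  by apply: laurentM => //; apply: (laurent_zvar (f := fun z => qp (- ebracket e z))); exact: laurent_ebracket.
have P0 : P (svar q z) = 0.
  apply: (laurent_eq0 q1 lP) => s hs.
  have /choice[N hN] : forall j, exists N : nat, (0 < N)%N /\ s 0 j = N%:R.
    by move=> j; have [N h1 h2] := hs j; exists N.
  rewrite /P; have [->|Bs] := eqVneq (B s) 0; first by rewrite mul0r.
  have hz := zeta_at_integers (fun j => (hN j).1) (fun j => (hN j).2) hops hM ul hl.
  rewrite -[de _ * H _]/((\prod_(a <- G_roots m) Gden q a (zvar q s)) *
     (\sum_(y <- l) f y * qp (pairing y (zvar q s)))) hz hAB //; last first.
    by move=> i; rewrite (hN i).2 -(rmorph_nat (real_complex R)) /= ler0n.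
  by rewrite /nu; move: Bs; move: (B s) => b Bs; field.
have de0 : de z != 0 by rewrite prodf_seq_neq0; apply/allP => a /Gz ->.
have -> : Gfun q z = nu z / de z by rewrite /Gfun prodf_div.
move/eqP: P0; rewrite /P zvarK mulf_eq0 (negPf Bz) /= mulN1r subr_eq0 => /eqP h.
apply: (mulfI de0); apply: (mulfI Bz); rewrite h.
move: Bz de0; move: (B _) (de z) => b d Bz de0; field.
by rewrite ?Bz ?de0.
Qed.

End ZetaEvaluation.

Theorem theorem2p10
    (R : realType)
    (p : nat) (Qp : fieldType) (vp : Qp -> int) (HQp : is_Qp p vp)
    (k : fieldExtType Qp) (v : k -> int)
    (Hv : exists r : nat, valuation_over vp v r)
    (q : nat) (Hq : residue_card v q)
    (k' : fieldExtType k) (v' : k' -> int) (Hv' : unramified_quadratic v v')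
    (conj : {lrmorphism k' -> k'}) (Hconj : exists a, conj a != a)
    (m : nat) (Hm : (2 <= m)%N)
    (mu : probability (borel_mx v' m) R) (Hmu : is_haar conj mu)
    (He : odd m -> v 2%:R <= 1) :
  (forall (x : 'M[k']_m) (A B : 'rV[R[i]]_(m./2) -> R[i]),
     unitary_hermitian conj m x ->
     omega_continuation conj q mu x A B ->
     exists H : 'rV[R[i]]_(m./2) -> R[i],
       [/\ forall z : 'rV[R[i]]_(m./2),
             B (svar q z) != 0 ->
             (forall alpha, alpha \in G_roots m -> Gden q alpha z != 0) ->
             H z = qpow q (- ebracket (v 2%:R) z) * Gfun q z
                   * (A (svar q z) / B (svar q z)),
           holomorphic H,
           forall (sigma : signed_perm m./2) (z : 'rV[R[i]]_(m./2)),
             H (wact sigma z) = H z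
         & laurent q H])
  /\
  (forall (sigma : signed_perm m./2) (z : 'rV[R[i]]_(m./2)),
     (forall alpha, alpha \in G_roots m ->
        [/\ Gnum q alpha z != 0, Gden q alpha z != 0,
            Gden q alpha (wact sigma z) != 0 & gamma_den q alpha z != 0]) ->
     Gamma q (v 2%:R) sigma z
     = qpow q (ebracket (v 2%:R) z) / Gfun q z
       * (Gfun q (wact sigma z)
          / qpow q (ebracket (v 2%:R) (wact sigma z)))).

Proof.
have [r over] := Hv; have [dv _ _] := over; have [_ _ nat0 _ cQ] := HQp.
have cv : valuation_complete v := ext_complete cQ over.
have two : 2%:R != 0 :> k.
  by rewrite -(rmorph_nat (in_alg k) 2) fmorph_eq0; have [] := nat0 2%N isT.
have [rep [rep_int repP]] := Hq.
have [pi [theta I]] := inert_exists dv cv rep_int repP two Hv' Hconj.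
have q1 := residue_card_gt1 I.
split=> [x A B hx hAB|sigma z]; last exact: Gamma_cocycle.
(* The ramification index is 1, so e may be computed in k', where all the counts take place. *)
have <- : v' 2%:R = v 2%:R.
  have [_ [_ _ hv']] := Hv'; rewrite -(rmorph_nat (in_alg k') 2) /= -[RHS]mul1r; exact: hv'.
have [H [h1 h2 h3]] := zeta_invariant I Hmu hx hAB.
by exists H; split=> //; exact: laurent_holomorphic h3.
Qed.
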